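(* Let $H_1,\dots,H_q$ be hyperplanes in general position in $\mathbb{P}^n$ with $q>2n$, let $m_i\in\mathbb{Z}_{\ge1}\cup\{\infty\}$ and $\Delta=\sum_{i=1}^q(1-\frac1{m_i})H_i$, with $$\deg\Delta:=\sum_{i=1}^q\Big(1-\frac1{m_i}\Big)>q-\frac qn+1+\frac1n .$$ Then $(\mathbb{P}^n/\Delta)$ is hyperbolic and hyperbolically imbedded in $\mathbb{P}^n$.
   Context: General position: any $n+1$ of the defining linear forms are linearly independent. $\Delta_1$ is the union of the $H_i$ with $m_i=\infty$. With $D$ the unit disc, a holomorphic $h:D\to\mathbb{P}^n$ is an orbifold morphism to $(\mathbb{P}^n/\Delta)$ if $h(D)\not\subset\bigcup H_i$ and the multiplicity of $h^*H_i$ at each point over $H_i$ is $\ge m_i$ (with $h(D)\cap H_i=\emptyset$ if $m_i=\infty$). The orbifold Kobayashi pseudo-distance $d_{(\mathbb{P}^n/\Delta)}$ is the largest pseudo-distance on $\mathbb{P}^n\setminus\Delta_1$ such that $g^*d\le d_P$ for all orbifold morphisms $g:D\to(\mathbb{P}^n/\Delta)$, $d_P$ the Poincaré distance. Hyperbolic: $d_{(\mathbb{P}^n/\Delta)}$ is a distance. Hyperbolically imbedded in $\mathbb{P}^n$: whenever $p_k\to p$, $q_k\to q$ in $\mathbb{P}^n$ with $p_k,q_k\in\mathbb{P}^n\setminus\Delta_1$ and $d_{(\mathbb{P}^n/\Delta)}(p_k,q_k)\to0$, then $p=q$. *)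

(* Defs.v *)
From Stdlib Require Import Reals Lra.
Open Scope R_scope.

Definition Cplx : Type := (R * R)%type.
Definition C0 : Cplx := (0, 0).
Definition C1 : Cplx := (1, 0).
Definition Cadd (z w : Cplx) : Cplx := (fst z + fst w, snd z + snd w).
Definition Copp (z : Cplx) : Cplx := (- fst z, - snd z).
Definition Csub (z w : Cplx) : Cplx := Cadd z (Copp w).
Definition Cmul (z w : Cplx) : Cplx :=
  (fst z * fst w - snd z * snd w, fst z * snd w + snd z * fst w).
Definition Cconj (z : Cplx) : Cplx := (fst z, - snd z).
Definition Cnorm (z : Cplx) : R := sqrt (fst z * fst z + snd z * snd z).
Fixpoint Cpow (z : Cplx) (k : nat) : Cplx :=
  match k with O => C1 | S k' => Cmul z (Cpow z k') end.
Fixpoint Csum (k : nat) (f : nat -> Cplx) : Cplx :=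
  match k with O => C0 | S k' => Cadd (Csum k' f) (f k') end.

Definition inD (z : Cplx) : Prop := Cnorm z < 1.

Definition holo_D (f : Cplx -> Cplx) : Prop :=
  forall z, inD z -> exists l : Cplx, forall eps, eps > 0 -> exists delta, delta > 0 /\
    forall w, inD w -> 0 < Cnorm (Csub w z) < delta ->
      Cnorm (Csub (Csub (f w) (f z)) (Cmul l (Csub w z))) <= eps * Cnorm (Csub w z).

Definition poincare (z w : Cplx) : R :=
  let t := Cnorm (Csub z w) / Cnorm (Csub C1 (Cmul (Cconj w) z)) in
  ln ((1 + t) / (1 - t)).

(** * Projective space P^n via homogeneous coordinates (components 0..n of
    a vector nat -> Cplx; the other components are irrelevant). *)
Definition vec := nat -> Cplx.
Definition nonzero_vec (n : nat) (x : vec) : Prop := exists j, (j <= n)%nat /\ x j <> C0.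
Definition proj_eq (n : nat) (x y : vec) : Prop :=
  exists lam : Cplx, lam <> C0 /\ forall j, (j <= n)%nat -> y j = Cmul lam (x j).
Definition proj_conv (n : nat) (xs : nat -> vec) (x : vec) : Prop :=
  exists lam : nat -> Cplx, forall j, (j <= n)%nat ->
    forall eps, eps > 0 -> exists N, forall k, (k >= N)%nat ->
      Cnorm (Csub (Cmul (lam k) (xs k j)) (x j)) < eps.

(** * Hyperplanes H_i = {L_i = 0}, L_i(x) = sum_j a i j * x j, i < q. *)
Definition lform (n : nat) (a : nat -> nat -> Cplx) (i : nat) (x : vec) : Cplx :=
  Csum (S n) (fun j => Cmul (a i j) (x j)).

Definition general_position (n q : nat) (a : nat -> nat -> Cplx) : Prop :=
  forall idx : nat -> nat,
    (forall k, (k <= n)%nat -> (idx k < q)%nat) ->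
    (forall k l, (k <= n)%nat -> (l <= n)%nat -> idx k = idx l -> k = l) ->
    forall c : nat -> Cplx,
      (forall j, (j <= n)%nat ->
         Csum (S n) (fun k => Cmul (c k) (a (idx k) j)) = C0) ->
      forall k, (k <= n)%nat -> c k = C0.

(** Multiplicities: [m i = Some k] means m_i = k (k >= 1), [None] means infinity. *)
Definition mult := nat -> option nat.

Definition inv_mult (o : option nat) : R :=
  match o with Some k => / INR k | None => 0 end.

Fixpoint Rsum (k : nat) (f : nat -> R) : R :=
  match k with O => 0 | S k' => Rsum k' f + f k' end.

Definition degDelta (q : nat) (m : mult) : R :=
  Rsum q (fun i => 1 - inv_mult (m i)).

Definition vanish_order_ge (f : Cplx -> Cplx) (z0 : Cplx) (k : nat) : Prop :=
  exists u : Cplx -> Cplx, holo_D u /\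
    forall z, inD z -> f z = Cmul (Cpow (Csub z z0) k) (u z).

(** Orbifold morphism D -> (P^n / Delta), given by a reduced representation
    F = (F_0,...,F_n) (holomorphic, without common zeros on D). *)
Definition orbifold_morphism (n q : nat) (a : nat -> nat -> Cplx) (m : mult)
    (F : Cplx -> vec) : Prop :=
  (forall j, (j <= n)%nat -> holo_D (fun z => F z j)) /\
  (forall z, inD z -> nonzero_vec n (F z)) /\
  (exists z, inD z /\ forall i, (i < q)%nat -> lform n a i (F z) <> C0) /\
  (forall i, (i < q)%nat ->
     match m i with
     | None => forall z, inD z -> lform n a i (F z) <> C0
     | Some k => forall z0, inD z0 -> lform n a i (F z0) = C0 ->
                   vanish_order_ge (fun z => lform n a i (F z)) z0 k
     end).

Definition in_S (n q : nat) (a : nat -> nat -> Cplx) (m : mult) (x : vec) : Prop :=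
  nonzero_vec n x /\ forall i, (i < q)%nat -> m i = None -> lform n a i x <> C0.

Definition pseudo_dist (n q : nat) (a : nat -> nat -> Cplx) (m : mult)
    (d : vec -> vec -> R) : Prop :=
  let S := in_S n q a m in
  (forall x y, S x -> S y -> 0 <= d x y) /\
  (forall x, S x -> d x x = 0) /\
  (forall x y, S x -> S y -> d x y = d y x) /\
  (forall x y z, S x -> S y -> S z -> d x z <= d x y + d y z) /\
  (forall x x' y, S x -> S y -> proj_eq n x x' -> d x' y = d x y).

Definition admissible (n q : nat) (a : nat -> nat -> Cplx) (m : mult)
    (d : vec -> vec -> R) : Prop :=
  pseudo_dist n q a m d /\
  forall F, orbifold_morphism n q a m F ->
    forall z w, inD z -> inD w -> d (F z) (F w) <= poincare z w.

Definition is_orbifold_kobayashi (n q : nat) (a : nat -> nat -> Cplx) (m : mult)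
    (d : vec -> vec -> R) : Prop :=
  admissible n q a m d /\
  forall d', admissible n q a m d' ->
    forall x y, in_S n q a m x -> in_S n q a m y -> d' x y <= d x y.

Definition hyperbolic_orb (n q : nat) (a : nat -> nat -> Cplx) (m : mult)
    (d : vec -> vec -> R) : Prop :=
  forall x y, in_S n q a m x -> in_S n q a m y -> ~ proj_eq n x y -> 0 < d x y.

Definition hyperbolically_imbedded (n q : nat) (a : nat -> nat -> Cplx) (m : mult)
    (d : vec -> vec -> R) : Prop :=
  forall (ps qs : nat -> vec) (p p' : vec),
    (forall k, in_S n q a m (ps k)) -> (forall k, in_S n q a m (qs k)) ->
    nonzero_vec n p -> nonzero_vec n p' ->
    proj_conv n ps p -> proj_conv n qs p' ->
    Un_cv (fun k => d (ps k) (qs k)) 0 ->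
    proj_eq n p p'.

(* Main.v *)
(** Let [delta] be the distance of the orthogonal projectors on the lines of [C^(n+1)].  It is enough that orbifold
discs are uniformly Lipschitz at 0 for [delta]: by homogeneity of the disc some [c * delta] is then an admissible
pseudo-distance, so that the Kobayashi pseudo-distance (the supremum of the admissible ones, finite by chains of
explicit discs) dominates it, and [delta] separates the points of projective space and is continuous.

If that failed, Brody's rescaling of discs, followed by a limit along an ultrafilter, would give
a nonconstant entire curve [f] in projective space, covered by normalised representations [F c] on the discs
[D(c, 1/4)].  If a bounded holomorphic [g] on the unit disc has only zeros of multiplicity at least [m], then
[|g^(j)(0)|^m <= K |g(0)|^(m-j)]; this is applied to the discs before the limit, because in the limit a
hyperplane may contain the curve, and the pointwise inequality survives.  Let [k] be the dimension of the span
of [f].  At each point, Nochka's weights select a basis among the forms that are small there, whose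
derivatives bound the Wronskian [W]; with the inequality above this gives
[|W|^M <= K prod |L_i f|^(l_i)] with [M (k+1) < sum l_i], by the hypothesis on the degree.  Completing [W^M] by
components of [f] to a section of the same degree as the product, the quotients are bounded entire functions,
hence constant by Liouville, and the components of [f] are proportional, a contradiction. *)

Require Import Defs.
From Stdlib Require Import Reals.
From Stdlib Require Arith Lra Lia Psatz ClassicalEpsilon Classical Wf_nat.
From HB Require structures.
From mathcomp Require all_boot all_order all_algebra all_fingroup boolp filter Rstruct zify ring lra.
From Coquelicot Require Coquelicot.
Open Scope R_scope.

(** For [n >= 1] the hypothesis on the degree reads [n * sum 1/m_i < q - n - 1]. If some hyperplanes
    contain the limit curve, the number of the others and their index of subgeneral position drop by
    the same amount, so [|Q| - N = q - n] and the inequality is inherited by [Q] and [N]. Nochka's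
    weights have sum [k + 1 + th (|Q| - 2N + k - 1)], and passing from [w_i] to [w_i (1 - k/m_i)]
    costs at most [th k sum 1/m_i]; since [k <= N], what remains still exceeds [k + 1]. This surplus
    is the spare degree that is filled by components of [f]. The rescaling measures discs by charts
    rather than by a derivative: a disc is good when one homogeneous component dominates the others
    up to the factor 2, and quotients by this component are then bounded at once. Along an
    ultrafilter all these quotients, their derivatives and the choice of the dominating component
    converge together, without extraction of subsequences. This requires every constant of the local
    theory to be uniform in the function, which is why the estimates below are explicit. *)

Module Analysis.
Import Arith Lra Lia Psatz ClassicalEpsilon Classical Wf_nat ssreflect ssrfun ssrbool Coquelicot.
Open Scope R_scope.
Open Scope C_scope.

(** * Estimates for the modulus *)

Lemma Cmod_le_split (z : C) : (Cmod z <= Rabs (fst z) + Rabs (snd z))%R.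
Proof.
have X := Rabs_pos (fst z); have Y := Rabs_pos (snd z).
rewrite /Cmod -(sqrt_Rsqr (Rabs (fst z) + Rabs (snd z))); last lra.
apply: sqrt_le_1_alt; have := Rsqr_abs (fst z); have := Rsqr_abs (snd z); rewrite /Rsqr /=; nra.
Qed.

Lemma fst_le_Cmod (z : C) : (Rabs (fst z) <= Cmod z)%R.
Proof. exact: Rle_trans (Rmax_l _ _) (Rmax_Cmod z). Qed.
Lemma snd_le_Cmod (z : C) : (Rabs (snd z) <= Cmod z)%R.
Proof. exact: Rle_trans (Rmax_r _ _) (Rmax_Cmod z). Qed.

Lemma Cmod_sub_sym (z w : C) : Cmod (z - w) = Cmod (w - z).
Proof. by rewrite -Cmod_opp; congr Cmod; ring. Qed.
Lemma Cmod_sub_tri (u v w : C) : (Cmod (u - w) <= Cmod (u - v) + Cmod (v - w))%R.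
Proof. have -> : u - w = (u - v) + (v - w) by ring. by apply: Cmod_triangle. Qed.
Lemma Cmod_triangle_sub (u v : C) : (Cmod (u - v) <= Cmod u + Cmod v)%R.
Proof. by rewrite -(Cmod_opp v); apply: Cmod_triangle. Qed.
Lemma Cmod_rev_triangle (u v : C) : (Cmod u - Cmod v <= Cmod (u - v))%R.
Proof.
have H := Cmod_triangle (u - v) v; have E : (u - v + v)%C = u by ring.
by rewrite E in H; lra.
Qed.

Lemma Cmod_subrr (z : C) : Cmod (z - z) = 0%R.
Proof. have -> : z - z = RtoC 0 by ring. by rewrite Cmod_0. Qed.

(** * Complex derivatives *)

(** The inequality is not strict, so that [w = z] needs no exception. The derivative is a relation
    and nothing is presupposed about its continuity, which Goursat's theorem provides later. *)
Definition cder (f : C -> C) (z l : C) : Prop :=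
  forall eps, (0 < eps)%R -> exists d, (0 < d)%R /\ forall w, (Cmod (w - z) < d)%R ->
    (Cmod (f w - f z - l * (w - z)) <= eps * Cmod (w - z))%R.

Definition ccont (f : C -> C) (z : C) : Prop :=
  forall eps, (0 < eps)%R -> exists d, (0 < d)%R /\ forall w, (Cmod (w - z) < d)%R ->
    (Cmod (f w - f z) < eps)%R.

Definition hol (c : C) (r : R) (f : C -> C) : Prop :=
  forall z, (Cmod (z - c) < r)%R -> exists l, cder f z l.

Lemma cder_ext_loc (f g : C -> C) z l d : (0 < d)%R ->
  (forall w, (Cmod (w - z) < d)%R -> f w = g w) -> cder f z l -> cder g z l.
Proof.
move=> d0 E H e e0; case: (H e e0) => d1 [d10 Hd].
exists (Rmin d d1); split; first exact: Rmin_pos.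
move=> w Hw; have Hw1 := Rlt_le_trans _ _ _ Hw (Rmin_l _ _).
have Hw2 := Rlt_le_trans _ _ _ Hw (Rmin_r _ _).
rewrite -E // -(E z); first exact: Hd.
by rewrite Cmod_subrr.
Qed.

Lemma cder_ext (f g : C -> C) z l : (forall w, f w = g w) -> cder f z l -> cder g z l.
Proof. by move=> E; apply: (cder_ext_loc f g z l 1) => //; lra. Qed.

Lemma cder_const (k z : C) : cder (fun _ => k) z 0.
Proof.
move=> e e0; exists 1%R; split; first lra.
move=> w _; have -> : k - k - 0 * (w - z) = 0 by ring.
rewrite Cmod_0; have := Cmod_ge_0 (w - z); nra.
Qed.

Lemma cder_id (z : C) : cder (fun w => w) z 1.
Proof.
move=> e e0; exists 1%R; split; first lra.
move=> w _; have -> : w - z - 1 * (w - z) = 0 by ring.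
rewrite Cmod_0; have := Cmod_ge_0 (w - z); nra.
Qed.

Lemma cder_lip f z l : cder f z l -> exists d, (0 < d)%R /\ forall w, (Cmod (w - z) < d)%R ->
  (Cmod (f w - f z) <= (Cmod l + 1) * Cmod (w - z))%R.
Proof.
move=> H; case: (H 1%R Rlt_0_1) => d [d0 Hd]; exists d; split=> // w Hw.
have := Hd w Hw; have := Cmod_rev_triangle (f w - f z) (l * (w - z)); rewrite Cmod_mult; lra.
Qed.

Lemma cder_cont f z l : cder f z l -> ccont f z.
Proof.
move=> /cder_lip [d [d0 H]] e e0.
have L := Cmod_ge_0 l.
have P : (0 < e / (Cmod l + 1))%R by apply: Rdiv_lt_0_compat; lra.
exists (Rmin d (e / (Cmod l + 1))); split; first exact: Rmin_pos.
move=> w Hw; have Hw1 := Rlt_le_trans _ _ _ Hw (Rmin_l _ _).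
have Hw2 := Rlt_le_trans _ _ _ Hw (Rmin_r _ _).
apply: Rle_lt_trans (H w Hw1) _.
have -> : e = ((Cmod l + 1) * (e / (Cmod l + 1)))%R by field; lra.
by apply: Rmult_lt_compat_l; lra.
Qed.

Lemma cder_plus f g z l m : cder f z l -> cder g z m -> cder (fun w => f w + g w) z (l + m).
Proof.
move=> Hf Hg e e0.
case: (Hf (e / 2)%R ltac:(lra)) => d1 [d10 H1]; case: (Hg (e / 2)%R ltac:(lra)) => d2 [d20 H2].
exists (Rmin d1 d2); split; first exact: Rmin_pos.
move=> w Hw; have := H1 w (Rlt_le_trans _ _ _ Hw (Rmin_l _ _)).
have := H2 w (Rlt_le_trans _ _ _ Hw (Rmin_r _ _)).
have -> : f w + g w - (f z + g z) - (l + m) * (w - z) =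
  (f w - f z - l * (w - z)) + (g w - g z - m * (w - z)) by ring.
have := Cmod_triangle (f w - f z - l * (w - z)) (g w - g z - m * (w - z)); lra.
Qed.

Lemma cder_mult f g z l m : cder f z l -> cder g z m ->
  cder (fun w => f w * g w) z (l * g z + f z * m).
Proof.
move=> Hf Hg e e0.
have F0 := Cmod_ge_0 (f z); have G0 := Cmod_ge_0 (g z); have L0 := Cmod_ge_0 l.
have M0 := Cmod_ge_0 m.
set K := (Cmod (f z) + Cmod (g z) + 1)%R.
set K2 := ((Cmod l + 1) * (Cmod m + 1))%R.
have K0 : (0 < K)%R by rewrite /K; lra.
have K20 : (0 < K2)%R by rewrite /K2; nra.
have eK : (0 < e / (2 * K))%R by apply: Rdiv_lt_0_compat; lra.
have eK2 : (0 < e / (2 * K2))%R by apply: Rdiv_lt_0_compat; lra.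
case: (Hf _ eK) => d1 [d10 H1]; case: (Hg _ eK) => d2 [d20 H2].
case: (cder_lip _ _ _ Hf) => d3 [d30 H3]; case: (cder_lip _ _ _ Hg) => d4 [d40 H4].
exists (Rmin (Rmin d1 d2) (Rmin (Rmin d3 d4) (e / (2 * K2)))); split.
  by repeat apply: Rmin_pos.
move=> w Hw.
have Ha := Rlt_le_trans _ _ _ Hw (Rmin_l _ _); have Hb := Rlt_le_trans _ _ _ Hw (Rmin_r _ _).
have Hbb := Rlt_le_trans _ _ _ Hb (Rmin_l _ _); have Hc := Rlt_le_trans _ _ _ Hb (Rmin_r _ _).
have {}H1 := H1 w (Rlt_le_trans _ _ _ Ha (Rmin_l _ _)).
have {}H2 := H2 w (Rlt_le_trans _ _ _ Ha (Rmin_r _ _)).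
have {}H3 := H3 w (Rlt_le_trans _ _ _ Hbb (Rmin_l _ _)).
have {}H4 := H4 w (Rlt_le_trans _ _ _ Hbb (Rmin_r _ _)).
have -> : f w * g w - f z * g z - (l * g z + f z * m) * (w - z) =
  (f w - f z - l * (w - z)) * g z + f z * (g w - g z - m * (w - z)) + (f w - f z) * (g w - g z)
  by ring.
apply: Rle_trans (Cmod_triangle _ _) _.
have T1 := Cmod_triangle ((f w - f z - l * (w - z)) * g z) (f z * (g w - g z - m * (w - z))).
rewrite !Cmod_mult in T1 *.
set x := Cmod (w - z) in H1 H2 H3 H4 Hc *.
have x0 : (0 <= x)%R by apply: Cmod_ge_0.
set A := Cmod (f w - f z - l * (w - z)) in H1 T1 *.
set B := Cmod (g w - g z - m * (w - z)) in H2 T1 *.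
have A1 : (A * Cmod (g z) <= e / (2 * K) * x * Cmod (g z))%R by apply: Rmult_le_compat_r.
have B1 : (Cmod (f z) * B <= Cmod (f z) * (e / (2 * K) * x))%R by apply: Rmult_le_compat_l.
have C1 : (Cmod (f w - f z) * Cmod (g w - g z) <= ((Cmod l + 1) * x) * ((Cmod m + 1) * x))%R
  by apply: Rmult_le_compat => //; apply: Cmod_ge_0.
have E1 : (e / (2 * K) * x * Cmod (g z) + Cmod (f z) * (e / (2 * K) * x) <= e / 2 * x)%R.
  have P : (0 <= e / (2 * K) * x)%R by apply: Rmult_le_pos; lra.
  have -> : (e / 2 * x = e / (2 * K) * x * (Cmod (f z) + Cmod (g z) + 1))%R.
    by rewrite -/K; field; lra.
  by move: P; set y := (e / (2 * K) * x)%R => P; lra.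
have E2 : (((Cmod l + 1) * x) * ((Cmod m + 1) * x) <= e / 2 * x)%R.
  have -> : (e / 2 * x = K2 * (e / (2 * K2)) * x)%R by field; lra.
  have -> : (((Cmod l + 1) * x) * ((Cmod m + 1) * x) = K2 * x * x)%R by rewrite /K2; ring.
  apply: Rmult_le_compat_r => //; apply: Rmult_le_compat_l; lra.
lra.
Qed.

Lemma cder_scal f k z l : cder f z l -> cder (fun w => k * f w) z (k * l).
Proof.
move=> H; have := cder_mult _ _ _ _ _ (cder_const k z) H.
by have -> : 0 * f z + k * l = k * l by ring.
Qed.

Lemma cder_opp f z l : cder f z l -> cder (fun w => - f w) z (- l).
Proof.
move=> /(cder_scal _ (-(1))) H; have -> : - l = -(1) * l by ring.
by apply: cder_ext H => w; ring.
Qed.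

Lemma cder_minus f g z l m : cder f z l -> cder g z m -> cder (fun w => f w - g w) z (l - m).
Proof. by move=> Hf Hg; apply: cder_plus Hf _; apply: cder_opp. Qed.

Lemma cder_comp f g z l m : cder g z m -> cder f (g z) l -> cder (fun w => f (g w)) z (l * m).
Proof.
move=> Hg Hf e e0.
have L0 := Cmod_ge_0 l; have M0 := Cmod_ge_0 m.
have e1 : (0 < e / (2 * (Cmod m + 1)))%R by apply: Rdiv_lt_0_compat; lra.
have e2 : (0 < e / (2 * (Cmod l + 1)))%R by apply: Rdiv_lt_0_compat; lra.
case: (Hf _ e1) => d1 [d10 H1]; case: (Hg _ e2) => d2 [d20 H2].
case: (cder_cont _ _ _ Hg _ d10) => d3 [d30 H3].
case: (cder_lip _ _ _ Hg) => d4 [d40 H4].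
exists (Rmin d2 (Rmin d3 d4)); split; first by repeat apply: Rmin_pos.
move=> w Hw.
have Ha := Rlt_le_trans _ _ _ Hw (Rmin_l _ _); have Hb := Rlt_le_trans _ _ _ Hw (Rmin_r _ _).
have {}H2 := H2 w Ha; have {}H3 := H3 w (Rlt_le_trans _ _ _ Hb (Rmin_l _ _)).
have {}H4 := H4 w (Rlt_le_trans _ _ _ Hb (Rmin_r _ _)); have {}H1 := H1 _ H3.
have -> : f (g w) - f (g z) - l * m * (w - z) =
  (f (g w) - f (g z) - l * (g w - g z)) + l * (g w - g z - m * (w - z)) by ring.
apply: Rle_trans (Cmod_triangle _ _) _; rewrite Cmod_mult.
have x0 := Cmod_ge_0 (w - z); set x := Cmod (w - z) in x0 H2 H4 *.
have A : (e / (2 * (Cmod m + 1)) * Cmod (g w - g z) <= e / (2 * (Cmod m + 1)) * ((Cmod m + 1) * x))%R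
  by apply: Rmult_le_compat_l; lra.
have B : (Cmod l * Cmod (g w - g z - m * (w - z)) <= (Cmod l + 1) * (e / (2 * (Cmod l + 1)) * x))%R.
  by apply: Rmult_le_compat; try lra; apply: Cmod_ge_0.
have EA : (e / (2 * (Cmod m + 1)) * ((Cmod m + 1) * x) = e / 2 * x)%R by field; lra.
have EB : ((Cmod l + 1) * (e / (2 * (Cmod l + 1)) * x) = e / 2 * x)%R by field; lra.
lra.
Qed.

Lemma ccont_neq0 f z : ccont f z -> f z <> 0 -> exists d, (0 < d)%R /\
  forall w, (Cmod (w - z) < d)%R -> (Cmod (f z) / 2 < Cmod (f w))%R.
Proof.
move=> H /Cmod_gt_0 N; case: (H (Cmod (f z) / 2)%R ltac:(lra)) => d [d0 Hd].
exists d; split=> // w Hw; have := Hd w Hw; have := Cmod_rev_triangle (f z) (f w).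
by rewrite (Cmod_sub_sym (f z)); lra.
Qed.

Lemma cder_Cinv (z : C) : z <> 0 -> cder (fun w => / w) z (- / (z * z)).
Proof.
move=> z0 e e0; have P := proj1 (Cmod_gt_0 z) z0; set p := Cmod z in P *.
have P3 : (0 < e * (p * p * p) / 2)%R.
  by apply: Rdiv_lt_0_compat; last lra; repeat apply: Rmult_lt_0_compat.
exists (Rmin (p / 2) (e * (p * p * p) / 2)); split; first by apply: Rmin_pos; lra.
move=> w Hw; have Ha := Rlt_le_trans _ _ _ Hw (Rmin_l _ _).
have Hb := Rlt_le_trans _ _ _ Hw (Rmin_r _ _).
have W : (p / 2 < Cmod w)%R.
  by have := Cmod_rev_triangle z w; rewrite (Cmod_sub_sym z) -/p; lra.
have w0 : w <> 0 by apply/Cmod_gt_0; lra.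
have -> : / w - / z - - / (z * z) * (w - z) = (w - z) * (w - z) * / (z * z * w) by field.
have zz : z * z * w <> 0 by repeat apply: Cmult_neq_0.
rewrite !Cmod_mult Cmod_inv // !Cmod_mult -/p.
have x0 := Cmod_ge_0 (w - z); set x := Cmod (w - z) in x0 Ha Hb *.
have Q : (/ (p * p * Cmod w) <= 2 / (p * p * p))%R.
  have -> : (2 / (p * p * p) = / (p * p * (p / 2)))%R by field; lra.
  apply: Rinv_le_contravar; first by repeat apply: Rmult_lt_0_compat; lra.
  by apply: Rmult_le_compat_l; [nra|lra].
have -> : (e * x = (e * (p * p * p) / 2) * x * (2 / (p * p * p)))%R by field; lra.
apply: Rmult_le_compat => //; first nra.
  by apply/Rlt_le/Rinv_0_lt_compat; repeat apply: Rmult_lt_0_compat; lra.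
by apply: Rmult_le_compat_r => //; lra.
Qed.

Lemma cder_inv f z l : cder f z l -> f z <> 0 -> cder (fun w => / f w) z (- / (f z * f z) * l).
Proof. by move=> H N; apply: (cder_comp (fun w => / w) f) => //; apply: cder_Cinv. Qed.

Lemma cder_pow f z l n : cder f z l -> exists l', cder (fun w => f w ^ n) z l'.
Proof.
move=> H; elim: n => [|n [l' IH]]; first by exists 0; apply: cder_const.
by eexists; apply: cder_mult H IH.
Qed.

Lemma cder_unique f z l m : cder f z l -> cder f z m -> l = m.
Proof.
move=> Hl Hm.
case: (Req_dec (Cmod (l - m)) 0) => [/Cmod_eq_0 E|N].
  have -> : l = (l - m) + m by ring. by rewrite E; ring.
have P : (0 < Cmod (l - m))%R by have := Cmod_ge_0 (l - m); lra.
have e0 : (0 < Cmod (l - m) / 4)%R by lra.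
case: (Hl _ e0) => d1 [d10 H1]; case: (Hm _ e0) => d2 [d20 H2].
set d := (Rmin d1 d2 / 2)%R.
have d0 : (0 < d)%R by have := Rmin_pos _ _ d10 d20; rewrite /d; lra.
have Ew : z + RtoC d - z = RtoC d by ring.
have Ed : Cmod (z + RtoC d - z) = d by rewrite Ew Cmod_R Rabs_pos_eq; lra.
have {}H1 := H1 (z + RtoC d); have {}H2 := H2 (z + RtoC d); rewrite Ed in H1 H2.
have {}H1 := H1 ltac:(have := Rmin_l d1 d2; rewrite /d in d0 *; lra).
have {}H2 := H2 ltac:(have := Rmin_r d1 d2; rewrite /d in d0 *; lra).
rewrite Ew in H1 H2.
have := Cmod_triangle_sub (f (z + RtoC d) - f z - m * RtoC d) (f (z + RtoC d) - f z - l * RtoC d).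
have -> : f (z + RtoC d) - f z - m * RtoC d - (f (z + RtoC d) - f z - l * RtoC d) = (l - m) * RtoC d by ring.
rewrite Cmod_mult Cmod_R Rabs_pos_eq; last lra.
nra.
Qed.

(** Choice makes differentiation a total operator; where [f] is not differentiable the value is
    arbitrary, so that iterated derivatives carry information only on discs of holomorphy. *)
Definition D (f : C -> C) (z : C) : C := ClassicalEpsilon.epsilon (inhabits (RtoC 0)) (cder f z).

Lemma D_cder f z l : cder f z l -> cder f z (D f z).
Proof. by move=> H; apply: ClassicalEpsilon.epsilon_spec; exists l. Qed.
Lemma D_eq f z l : cder f z l -> D f z = l.
Proof. by move=> H; apply: cder_unique (D_cder _ _ _ H) H. Qed.
Lemma hol_D c r f z : hol c r f -> (Cmod (z - c) < r)%R -> cder f z (D f z).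
Proof. by move=> H /H [l /D_cder]. Qed.
Lemma hol_cont c r f z : hol c r f -> (Cmod (z - c) < r)%R -> ccont f z.
Proof. by move=> H /H [l /cder_cont]. Qed.

Lemma hol_const c r k : hol c r (fun _ => k).
Proof. by move=> z _; exists 0; apply: cder_const. Qed.
Lemma hol_id c r : hol c r (fun w => w).
Proof. by move=> z _; exists 1; apply: cder_id. Qed.
Lemma hol_plus c r f g : hol c r f -> hol c r g -> hol c r (fun w => f w + g w).
Proof. by move=> Hf Hg z Hz; eexists; apply: cder_plus; apply: hol_D; eauto. Qed.
Lemma hol_minus c r f g : hol c r f -> hol c r g -> hol c r (fun w => f w - g w).
Proof. by move=> Hf Hg z Hz; eexists; apply: cder_minus; apply: hol_D; eauto. Qed.
Lemma hol_mult c r f g : hol c r f -> hol c r g -> hol c r (fun w => f w * g w).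
Proof. by move=> Hf Hg z Hz; eexists; apply: cder_mult; apply: hol_D; eauto. Qed.

Lemma hol_pow c r f n : hol c r f -> hol c r (fun w => f w ^ n).
Proof. by move=> Hf z /Hf [l /(cder_pow _ _ _ n)]. Qed.
Lemma hol_inv c r f : hol c r f -> (forall z, (Cmod (z - c) < r)%R -> f z <> 0) ->
  hol c r (fun w => / f w).
Proof. by move=> Hf N z Hz; eexists; apply: cder_inv; [apply: hol_D; eauto|apply: N]. Qed.
Lemma hol_comp c r c' r' f g : hol c' r' f -> hol c r g ->
  (forall z, (Cmod (z - c) < r)%R -> (Cmod (g z - c') < r')%R) -> hol c r (fun w => f (g w)).
Proof.
by move=> Hf Hg N z Hz; eexists; apply: cder_comp; [apply: hol_D; eauto|apply: (hol_D _ _ _ _ Hf); apply: N].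
Qed.
Lemma hol_sub c r c' r' f : hol c r f -> (forall z, (Cmod (z - c') < r')%R -> (Cmod (z - c) < r)%R) ->
  hol c' r' f.
Proof. by move=> H S z /S /H. Qed.
Lemma hol_ext c r f g : (forall z, (Cmod (z - c) < r)%R -> f z = g z) -> hol c r f -> hol c r g.
Proof.
move=> E H z Hz; exists (D f z); apply: (cder_ext_loc f g z _ (r - Cmod (z - c))); first lra.
  by move=> w Hw; apply: E; have := Cmod_sub_tri w z c; lra.
exact: hol_D H Hz.
Qed.

(** * Integrals of complex-valued functions of a real variable *)

Definition rcont (f : R -> C) (t : R) : Prop :=
  forall eps, (0 < eps)%R -> exists d, (0 < d)%R /\ forall s, (Rabs (s - t) < d)%R ->
    (Cmod (f s - f t) < eps)%R.

Definition rcont_on (a b : R) (f : R -> C) := forall t, (a <= t <= b)%R -> rcont f t.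

Lemma rcont_re f t : rcont f t -> continuous (fun s => fst (f s)) t.
Proof.
move=> H; apply/continuity_pt_filterlim => e e0; case: (H e e0) => d [d0 Hd].
exists d; split=> // s [_ Hs]; apply: Rle_lt_trans (Hd s Hs).
exact: fst_le_Cmod (f s - f t).
Qed.
Lemma rcont_im f t : rcont f t -> continuous (fun s => snd (f s)) t.
Proof.
move=> H; apply/continuity_pt_filterlim => e e0; case: (H e e0) => d [d0 Hd].
exists d; split=> // s [_ Hs]; apply: Rle_lt_trans (Hd s Hs).
exact: snd_le_Cmod (f s - f t).
Qed.

Lemma rcont_comp (f : C -> C) (g : R -> C) t : rcont g t -> ccont f (g t) -> rcont (fun s => f (g s)) t.
Proof.
move=> Hg Hf e e0; case: (Hf e e0) => d [d0 Hd]; case: (Hg d d0) => d' [d'0 Hd'].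
by exists d'; split=> // s /Hd' /Hd.
Qed.

Lemma rcont_const (k : C) t : rcont (fun _ => k) t.
Proof. by move=> e e0; exists 1%R; split; [lra|move=> s _; rewrite Cmod_subrr]. Qed.

Lemma rcont_plus f g t : rcont f t -> rcont g t -> rcont (fun s => f s + g s) t.
Proof.
move=> Hf Hg e e0.
case: (Hf (e / 2)%R ltac:(lra)) => d1 [d10 H1]; case: (Hg (e / 2)%R ltac:(lra)) => d2 [d20 H2].
exists (Rmin d1 d2); split; first exact: Rmin_pos.
move=> s Hs; have := H1 s (Rlt_le_trans _ _ _ Hs (Rmin_l _ _)).
have := H2 s (Rlt_le_trans _ _ _ Hs (Rmin_r _ _)).
have -> : f s + g s - (f t + g t) = (f s - f t) + (g s - g t) by ring.
by have := Cmod_triangle (f s - f t) (g s - g t); lra.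
Qed.

Lemma rcont_scal k f t : rcont f t -> rcont (fun s => k * f s) t.
Proof.
move=> H; apply: (rcont_comp (fun w => k * w)) => //.
by apply: cder_cont (cder_scal _ k _ _ (cder_id _)).
Qed.

Lemma rcont_mult f g t : rcont f t -> rcont g t -> rcont (fun s => f s * g s) t.
Proof.
move=> Hf Hg e e0; have F0 := Cmod_ge_0 (f t); have G0 := Cmod_ge_0 (g t).
set K := (Cmod (f t) + Cmod (g t) + 1)%R; have K0 : (0 < K)%R by rewrite /K; lra.
set e1 := Rmin 1 (e / (2 * K)).
have e10 : (0 < e1)%R by apply: Rmin_pos; [lra|apply: Rdiv_lt_0_compat; lra].
case: (Hf _ e10) => d1 [d10 H1]; case: (Hg _ e10) => d2 [d20 H2].
exists (Rmin d1 d2); split; first exact: Rmin_pos.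
move=> s Hs; have {}H1 := H1 s (Rlt_le_trans _ _ _ Hs (Rmin_l _ _)).
have {}H2 := H2 s (Rlt_le_trans _ _ _ Hs (Rmin_r _ _)).
have -> : f s * g s - f t * g t = (f s - f t) * g t + f t * (g s - g t) + (f s - f t) * (g s - g t) by ring.
apply: Rle_lt_trans (Cmod_triangle _ _) _.
have T1 := Cmod_triangle ((f s - f t) * g t) (f t * (g s - g t)); rewrite !Cmod_mult in T1 *.
have X0 := Cmod_ge_0 (f s - f t); have Y0 := Cmod_ge_0 (g s - g t).
have E1 : (e1 <= 1)%R by apply: Rmin_l.
have E2 : (e1 * (2 * K) <= e)%R.
  have -> : e = (e / (2 * K) * (2 * K))%R by field; lra.
  by apply: Rmult_le_compat_r; [lra|apply: Rmin_r].
rewrite /K in E2; nra.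
Qed.

Definition CI (f : R -> C) (a b : R) : C :=
  (RInt (fun t => fst (f t)) a b, RInt (fun t => snd (f t)) a b).

Lemma rcont_on_ex f a b : (a <= b)%R -> rcont_on a b f ->
  ex_RInt (fun t => fst (f t)) a b /\ ex_RInt (fun t => snd (f t)) a b.
Proof.
move=> ab H; split; apply: ex_RInt_continuous => z; rewrite Rmin_left // Rmax_right // => Hz.
  exact/rcont_re/H.
exact/rcont_im/H.
Qed.

Lemma CI_ext f g a b : (a <= b)%R -> (forall t, (a < t < b)%R -> f t = g t) -> CI f a b = CI g a b.
Proof.
move=> ab E; rewrite /CI; congr pair; apply: RInt_ext => t; rewrite Rmin_left // Rmax_right // => Ht;
by rewrite E.
Qed.

Lemma CI_plus f g a b : (a <= b)%R -> rcont_on a b f -> rcont_on a b g ->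
  CI (fun t => f t + g t) a b = CI f a b + CI g a b.
Proof.
move=> ab /(rcont_on_ex _ _ _ ab) [f1 f2] /(rcont_on_ex _ _ _ ab) [g1 g2].
by rewrite /CI /Cplus /=; congr pair; apply: RInt_plus.
Qed.

Lemma CI_scal k f a b : (a <= b)%R -> rcont_on a b f -> CI (fun t => k * f t) a b = k * CI f a b.
Proof.
move=> ab /(rcont_on_ex _ _ _ ab) [f1 f2].
have S l (h : R -> R) : ex_RInt h a b -> ex_RInt (fun t => l * h t)%R a b.
  exact: (ex_RInt_scal (V := R_NormedModule) h a b l).
have E l (h : R -> R) : ex_RInt h a b -> RInt (fun t => l * h t)%R a b = (l * RInt h a b)%R.
  exact: (RInt_scal (V := R_CompleteNormedModule) h a b l).
rewrite /CI /Cmult /=; congr pair.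
  rewrite -!E //; exact: (RInt_minus (V := R_CompleteNormedModule)
    (fun t => fst k * fst (f t))%R (fun t => snd k * snd (f t))%R _ _ (S _ _ f1) (S _ _ f2)).
rewrite -!E //; exact: (RInt_plus (V := R_CompleteNormedModule)
    (fun t => fst k * snd (f t))%R (fun t => snd k * fst (f t))%R _ _ (S _ _ f2) (S _ _ f1)).
Qed.

Lemma rcont_on_scal a b k f : rcont_on a b f -> rcont_on a b (fun t => k * f t).
Proof. by move=> H t /H; apply: rcont_scal. Qed.

Lemma CI_minus f g a b : (a <= b)%R -> rcont_on a b f -> rcont_on a b g ->
  CI (fun t => f t - g t) a b = CI f a b - CI g a b.
Proof.
move=> ab Hf Hg; have Hg' := rcont_on_scal _ _ (-(1)) _ Hg.
rewrite (CI_ext _ (fun t => f t + -(1) * g t)) //; last by move=> t _; ring.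
by rewrite CI_plus // CI_scal //; ring.
Qed.

Lemma CI_const k a b : CI (fun _ => k) a b = RtoC (b - a) * k.
Proof.
rewrite /CI /= !RInt_const /Cmult /RtoC /scal /= /mult /=; congr pair; ring.
Qed.

Lemma CI_Chasles f a b c : (a <= b <= c)%R -> rcont_on a c f -> CI f a b + CI f b c = CI f a c.
Proof.
move=> [ab bc] H.
have [||f1 f2] := rcont_on_ex f a b; [done|by move=> t Ht; apply: H; lra|].
have [||g1 g2] := rcont_on_ex f b c; [done|by move=> t Ht; apply: H; lra|].
by rewrite /CI /Cplus /=; congr pair; apply: RInt_Chasles.
Qed.

(** The factor 2 comes from bounding the real and imaginary parts separately; it reappears in the
    constants of the Cauchy estimates. *)
Lemma CI_bound f a b M : (a <= b)%R -> rcont_on a b f ->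
  (forall t, (a <= t <= b)%R -> (Cmod (f t) <= M)%R) -> (Cmod (CI f a b) <= 2 * (b - a) * M)%R.
Proof.
move=> ab /(rcont_on_ex _ _ _ ab) [f1 f2] H.
apply: Rle_trans (Cmod_le_split _) _; rewrite /CI /=.
have := abs_RInt_le_const _ _ _ M ab f1 (fun t Ht => Rle_trans _ _ _ (fst_le_Cmod _) (H t Ht)).
have := abs_RInt_le_const _ _ _ M ab f2 (fun t Ht => Rle_trans _ _ _ (snd_le_Cmod _) (H t Ht)).
lra.
Qed.

Lemma is_RInt_id a b : RInt (fun t : R => t) a b = ((b * b - a * a) / 2)%R.
Proof.
apply: is_RInt_unique.
have -> : ((b * b - a * a) / 2)%R = minus (b * b / 2)%R (a * a / 2)%R by rewrite /minus /plus /opp /=; field.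
apply: (is_RInt_derive (fun t : R => t * t / 2)%R) => t _.
  by auto_derive => //; field.
exact: continuous_id.
Qed.

Lemma rcont_RtoC t : rcont (fun s => RtoC s) t.
Proof.
move=> e e0; exists e; split=> // s Hs; have -> : RtoC s - RtoC t = RtoC (s - t).
  by rewrite RtoC_minus.
by rewrite Cmod_R.
Qed.

Lemma CI_id a b : CI (fun t => RtoC t) a b = RtoC ((b * b - a * a) / 2).
Proof. by rewrite /CI /= is_RInt_id RInt_const /RtoC /scal /= /mult /= Rmult_0_r. Qed.

(** * Goursat's theorem for rectangles *)

Definition rect_int (g : C -> C) (x1 x2 y1 y2 : R) : C :=
  CI (fun x => g (x, y1)) x1 x2 + Ci * CI (fun y => g (x2, y)) y1 y2
  - CI (fun x => g (x, y2)) x1 x2 - Ci * CI (fun y => g (x1, y)) y1 y2.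

Lemma rcont_horiz (g : C -> C) y x : ccont g (x, y) -> rcont (fun x => g (x, y)) x.
Proof.
move=> H; apply: (rcont_comp g (fun x => (x, y))) H => e e0; exists e; split=> // s Hs.
have -> : (s, y) - (x, y) = RtoC (s - x) by rewrite /Cminus /Cplus /Copp /RtoC /=; congr pair; ring.
by rewrite Cmod_R.
Qed.
Lemma rcont_vert (g : C -> C) x y : ccont g (x, y) -> rcont (fun y => g (x, y)) y.
Proof.
move=> H; apply: (rcont_comp g (fun y => (x, y))) H => e e0; exists e; split=> // s Hs.
have -> : (x, s) - (x, y) = Ci * RtoC (s - y).
  by rewrite /Ci /Cmult /Cminus /Cplus /Copp /RtoC /=; congr pair; ring.
by rewrite Cmod_mult Cmod_Ci Cmod_R Rmult_1_l.
Qed.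

Definition rect_cont (g : C -> C) (x1 x2 y1 y2 : R) : Prop :=
  forall x y, (x1 <= x <= x2)%R -> (y1 <= y <= y2)%R -> ccont g (x, y).

Lemma rect_int_split (g : C -> C) x1 xm x2 y1 ym y2 :
  (x1 <= xm <= x2)%R -> (y1 <= ym <= y2)%R -> rect_cont g x1 x2 y1 y2 ->
  rect_int g x1 x2 y1 y2 = rect_int g x1 xm y1 ym + rect_int g xm x2 y1 ym
    + rect_int g x1 xm ym y2 + rect_int g xm x2 ym y2.
Proof.
move=> Hx Hy H.
have h y : (y1 <= y <= y2)%R -> rcont_on x1 x2 (fun x => g (x, y)).
  by move=> Ht x Hxx; apply: rcont_horiz; apply: H.
have v x : (x1 <= x <= x2)%R -> rcont_on y1 y2 (fun y => g (x, y)).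
  by move=> Ht y Hyy; apply: rcont_vert; apply: H.
rewrite /rect_int.
rewrite -(CI_Chasles (fun x => g (x, y1)) x1 xm x2) //; last by apply: h; lra.
rewrite -(CI_Chasles (fun x => g (x, y2)) x1 xm x2) //; last by apply: h; lra.
rewrite -(CI_Chasles (fun y => g (x1, y)) y1 ym y2) //; last by apply: v; lra.
rewrite -(CI_Chasles (fun y => g (x2, y)) y1 ym y2) //; last by apply: v; lra.
ring.
Qed.

Lemma rect_int_affine (A B : C) x1 x2 y1 y2 : (x1 <= x2)%R -> (y1 <= y2)%R ->
  rect_int (fun s => A + B * s) x1 x2 y1 y2 = 0.
Proof.
move=> Hx Hy.
have rc u v a b : rcont_on a b (fun t => u + v * RtoC t).
  by move=> t _; apply: rcont_plus; [apply: rcont_const|apply/rcont_scal/rcont_RtoC].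
have I u v a b : (a <= b)%R -> CI (fun t => u + v * RtoC t) a b =
   RtoC (b - a) * u + v * RtoC ((b * b - a * a) / 2).
  move=> ab; rewrite CI_plus //.
  - by rewrite CI_const CI_scal ?CI_id // => t _; apply: rcont_RtoC.
  - by move=> t _; apply: rcont_const.
  - by move=> t _; apply/rcont_scal/rcont_RtoC.
have Eh y a b : (a <= b)%R -> CI (fun x => A + B * (x, y)) a b =
   RtoC (b - a) * (A + B * (0%R, y)) + B * RtoC ((b * b - a * a) / 2).
  move=> ab; rewrite -I //; apply: CI_ext => // t _.
  have -> : ((t, y) : C) = (0%R, y) + RtoC t by rewrite /Cplus /RtoC /=; congr pair; ring.
  ring.
have Ev x a b : (a <= b)%R -> CI (fun y => A + B * (x, y)) a b =
   RtoC (b - a) * (A + B * RtoC x) + B * Ci * RtoC ((b * b - a * a) / 2).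
  move=> ab; rewrite -I //; apply: CI_ext => // t _.
  have -> : ((x, t) : C) = RtoC x + Ci * RtoC t by rewrite /Ci /Cmult /Cplus /RtoC /=; congr pair; ring.
  ring.
rewrite /rect_int !Eh // !Ev //.
clear Eh Ev I rc; case: A => [a1 a2]; case: B => [b1 b2].
by rewrite /Ci /Cminus /Cmult /Cplus /Copp /RtoC /=; congr pair; field.
Qed.

Lemma rect_int_minus g h x1 x2 y1 y2 : (x1 <= x2)%R -> (y1 <= y2)%R ->
  rect_cont g x1 x2 y1 y2 -> rect_cont h x1 x2 y1 y2 ->
  rect_int (fun s => g s - h s) x1 x2 y1 y2 = rect_int g x1 x2 y1 y2 - rect_int h x1 x2 y1 y2.
Proof.
move=> Hx Hy Hg Hh; rewrite /rect_int !CI_minus //; try by (move=> t Ht; apply: rcont_vert; (apply: Hg || apply: Hh); lra).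
  ring.
all: by move=> t Ht; apply: rcont_horiz; (apply: Hg || apply: Hh); lra.
Qed.

Lemma rect_int_bound g x1 x2 y1 y2 M : (x1 <= x2)%R -> (y1 <= y2)%R -> rect_cont g x1 x2 y1 y2 ->
  (forall x y, (x1 <= x <= x2)%R -> (y1 <= y <= y2)%R -> (Cmod (g (x, y)) <= M)%R) ->
  (Cmod (rect_int g x1 x2 y1 y2) <= 4 * (x2 - x1 + (y2 - y1)) * M)%R.
Proof.
move=> Hx Hy Hg HM; rewrite /rect_int.
have B1 y : (y1 <= y <= y2)%R -> (Cmod (CI (fun x => g (x, y)) x1 x2) <= 2 * (x2 - x1) * M)%R.
  by move=> Ht; apply: CI_bound => // t T; [apply/rcont_horiz/Hg|apply: HM].
have B2 x : (x1 <= x <= x2)%R -> (Cmod (Ci * CI (fun y => g (x, y)) y1 y2) <= 2 * (y2 - y1) * M)%R.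
  move=> Ht; rewrite Cmod_mult Cmod_Ci Rmult_1_l.
  by apply: CI_bound => // t T; [apply/rcont_vert/Hg|apply: HM].
have := B1 y1 ltac:(lra); have := B1 y2 ltac:(lra); have := B2 x1 ltac:(lra); have := B2 x2 ltac:(lra).
move: (CI (fun x => g (x, y1)) x1 x2) (CI (fun x => g (x, y2)) x1 x2)
  (Ci * CI (fun y => g (x1, y)) y1 y2) (Ci * CI (fun y => g (x2, y)) y1 y2) => a c d b h1 h2 h3 h4.
have T1 := Cmod_triangle_sub (a + b - c) d; have T2 := Cmod_triangle_sub (a + b) c.
have T3 := Cmod_triangle a b; lra.
Qed.

(** Quadrisection: one of the four quarters keeps at least a quarter of the integral. Near the
    common point of the nested rectangles [g] differs from an affine function, whose integral is 0,
    by at most [e] times the distance to that point, and this is too little for the integral that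
    must survive. *)
Lemma goursat (g : C -> C) x y h k : (0 < h)%R -> (0 < k)%R ->
  (forall s t, (x <= s <= x + h)%R -> (y <= t <= y + k)%R -> exists l, cder g (s, t) l) ->
  rect_int g x (x + h) y (y + k) = 0.
Proof.
move=> h0 k0 H; case: (Req_dec (Cmod (rect_int g x (x + h) y (y + k))) 0) => [/Cmod_eq_0 //|N].
have {N} eta0 : (0 < Cmod (rect_int g x (x + h) y (y + k)))%R.
  by have := Cmod_ge_0 (rect_int g x (x + h) y (y + k)); lra.
set eta := Cmod _ in eta0.
have HC s1 s2 t1 t2 : (x <= s1)%R -> (s2 <= x + h)%R -> (y <= t1)%R -> (t2 <= y + k)%R ->
   rect_cont g s1 s2 t1 t2.
  by move=> a1 a2 a3 a4 s t Hs Ht; have [||l /cder_cont //] := H s t; lra.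
pose hn n := (h / 2 ^ n)%R; pose kn n := (k / 2 ^ n)%R.
pose J n (p : C) := Cmod (rect_int g (fst p) (fst p + hn n)%R (snd p) (snd p + kn n)%R).
pose inr n (p : C) := (x <= fst p)%R /\ (fst p + hn n <= x + h)%R /\ (y <= snd p)%R /\ (snd p + kn n <= y + k)%R.
pose next n (p p' : C) := (fst p <= fst p')%R /\ (fst p' + hn (S n) <= fst p + hn n)%R /\
  (snd p <= snd p')%R /\ (snd p' + kn (S n) <= snd p + kn n)%R /\ (J n p <= 4 * J (S n) p')%R.
have P2 n : (0 < 2 ^ n)%R by apply: pow_lt; lra.
have hS n : hn n = (2 * hn (S n))%R by rewrite /hn /=; field; have := P2 n; lra.
have kS n : kn n = (2 * kn (S n))%R by rewrite /kn /=; field; have := P2 n; lra.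
have hp n : (0 < hn n)%R by apply: Rdiv_lt_0_compat.
have kp n : (0 < kn n)%R by apply: Rdiv_lt_0_compat.
have step n p : inr n p -> exists p', next n p p'.
  case: p => [s t] [/= I1 [I2 [I3 I4]]].
  have hh := hp (S n); have kk := kp (S n); have hE := hS n; have kE := kS n.
  have E := rect_int_split g s (s + hn (S n)) (s + hn n) t (t + kn (S n)) (t + kn n)
    ltac:(lra) ltac:(lra) (HC _ _ _ _ I1 I2 I3 I4).
  have E1 : (s + hn n = s + hn (S n) + hn (S n))%R by lra.
  have E2 : (t + kn n = t + kn (S n) + kn (S n))%R by lra.
  have T := f_equal Cmod E.
  have JE : J n (s, t) = Cmod (rect_int g s (s + hn n) t (t + kn n)) by [].
  rewrite -JE E1 E2 in T.
  set a := rect_int g s (s + hn (S n)) t _ in T; set b := rect_int g _ _ t _ in T.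
  set c := rect_int g s _ (t + kn (S n)) _ in T; set d := rect_int g (s + hn (S n)) _ (t + kn (S n)) _ in T.
  have T1 := Cmod_triangle (a + b + c) d; have T2 := Cmod_triangle (a + b) c.
  have T3 := Cmod_triangle a b.
  have [Q|Q] := Rle_lt_dec (J n (s, t)) (4 * Cmod a).
    by exists (s, t); rewrite /next /=; do 4 (split; first lra).
  have [Q1|Q1] := Rle_lt_dec (J n (s, t)) (4 * Cmod b).
    by exists ((s + hn (S n))%R, t); rewrite /next /=; do 4 (split; first lra).
  have [Q2|Q2] := Rle_lt_dec (J n (s, t)) (4 * Cmod c).
    by exists (s, (t + kn (S n))%R); rewrite /next /=; do 4 (split; first lra).
  have [Q3|Q3] := Rle_lt_dec (J n (s, t)) (4 * Cmod d).
    by exists ((s + hn (S n))%R, (t + kn (S n))%R); rewrite /next /=; do 4 (split; first lra).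
  lra.
pose nx n p := ClassicalEpsilon.epsilon (inhabits p) (next n p).
pose fix sq n : C := match n with O => (x, y) | S n' => nx n' (sq n') end.
have inv n : inr n (sq n) /\ next n (sq n) (sq (S n)).
  elim: n => [|n [I Nn]].
    have I0 : inr 0%nat (sq 0%nat).
      by rewrite /inr /hn /kn /= /Rdiv Rinv_1; lra.
    by split=> //=; apply: ClassicalEpsilon.epsilon_spec; apply: step.
  have I1 : inr (S n) (sq (S n)) by move: I Nn; rewrite /inr /next; lra.
  by split=> //; apply: ClassicalEpsilon.epsilon_spec; apply: step.
have mono m n : (fst (sq m) <= fst (sq (m + n)%nat))%R /\ (snd (sq m) <= snd (sq (m + n)%nat))%R /\
   (fst (sq (m + n)%nat) + hn (m + n)%nat <= fst (sq m) + hn m)%R /\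
   (snd (sq (m + n)%nat) + kn (m + n)%nat <= snd (sq m) + kn m)%R.
  elim: n => [|n IH]; first by rewrite Nat.add_0_r; lra.
  rewrite Nat.add_succ_r; have [_ Nn] := inv (m + n)%nat; move: Nn; rewrite /next; lra.
(* The nested intervals [[u n, u n + w n]] share the supremum of their left ends. *)
have le2 (u : nat -> R) w : (forall n, 0 < w n)%R -> (forall m n, u m <= u (m + n)%nat /\ u (m + n)%nat + w (m + n)%nat <= u m + w m)%R ->
   exists l, forall n, (u n <= l <= u n + w n)%R.
  move=> w0 Hu; have [||l [L1 L2]] := completeness (fun r => exists n, r = u n).
  - exists (u O + w O)%R => r [n ->]; have := Hu O n; have := w0 (0 + n)%nat; rewrite Nat.add_0_l; lra.
  - by exists (u O), O.
  exists l => n; split; first by apply: L1; exists n.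
  apply: L2 => r [m ->]; have A := Hu n m; have B := Hu m n; rewrite Nat.add_comm in B.
  have := w0 (n + m)%nat; lra.
have [|sx Hsx] := le2 (fun n => fst (sq n)) hn hp; first by move=> m n; have := mono m n; lra.
have [|sy Hsy] := le2 (fun n => snd (sq n)) kn kp; first by move=> m n; have := mono m n; lra.
have [||l Hl] := H sx sy.
- by have := Hsx O; rewrite /= /hn /= /Rdiv Rinv_1 Rmult_1_r; lra.
- by have := Hsy O; rewrite /= /kn /= /Rdiv Rinv_1 Rmult_1_r; lra.
(* With this [e] the bound [4 (hn n + kn n) * e (hn n + kn n)] is half of [eta / 4^n]. *)
set e := (eta / (8 * (h + k) * (h + k)))%R.
have e0 : (0 < e)%R by apply: Rdiv_lt_0_compat => //; repeat apply: Rmult_lt_0_compat; lra.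
have [d [d0 Hd]] := Hl e e0.
have [n Hn] : exists n, ((h + k) / 2 ^ n < d)%R.
  have [n Hn] := pow_lt_1_zero (/2) ltac:(rewrite Rabs_pos_eq; lra) (d / (h + k)) ltac:(apply: Rdiv_lt_0_compat; lra).
  exists n; have := Hn n (le_n n); rewrite Rabs_pos_eq; last by apply: pow_le; lra.
  rewrite pow_inv => Q; have -> : d = (d / (h + k) * (h + k))%R by field; lra.
  by rewrite /Rdiv Rmult_comm; apply: Rmult_lt_compat_r; [lra|].
have Jn m : (eta <= 4 ^ m * J m (sq m))%R.
  elim: m => [|m IH].
    by rewrite /= Rmult_1_l /J /= /hn /kn /= /Rdiv Rinv_1 !Rmult_1_r; apply: Rle_refl.
  have [_ [_ [_ [_ [_ Nn]]]]] := inv m; have P : (0 < 4 ^ m)%R by apply: pow_lt; lra.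
  apply: Rle_trans IH _; rewrite [(4 ^ S m)%R]/=.
  have -> : (4 * 4 ^ m * J (S m) (sq (S m)) = 4 ^ m * (4 * J (S m) (sq (S m))))%R by ring.
  apply: Rmult_le_compat_l => //; exact: Rlt_le.
have {}Jn := Jn n; have [[I1 [I2 [I3 I4]]] _] := inv n.
set s := fst (sq n) in I1 I2 Jn; set t := snd (sq n) in I3 I4 Jn.
have hh := hp n; have kk := kp n.
pose aff w := (g (sx, sy) - l * (sx, sy)) + l * w.
have cA : rect_cont aff s (s + hn n) t (t + kn n).
  move=> a b _ _; apply: (cder_cont _ _ (0 + l * 1)).
  by apply: cder_plus; [apply: cder_const|apply/cder_scal/cder_id].
have cG := HC _ _ _ _ I1 I2 I3 I4.
have E : rect_int g s (s + hn n) t (t + kn n) = rect_int (fun w => g w - aff w) s (s + hn n) t (t + kn n).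
  rewrite rect_int_minus //; try lra.
  by rewrite (rect_int_affine _ l) //; try lra; ring.
have Hx1 := Hsx n; have Hy1 := Hsy n; rewrite -/s -/t in Hx1 Hy1.
have B : (Cmod (rect_int g s (s + hn n) t (t + kn n)) <= 4 * (hn n + kn n) * (e * (hn n + kn n)))%R.
  rewrite E; have -> : (hn n + kn n = s + hn n - s + (t + kn n - t))%R by ring.
  apply: rect_int_bound; try lra.
    move=> a b Ha Hb e' e'0; have [l1 h1] := H a b ltac:(lra) ltac:(lra).
    apply: (cder_cont (fun w => g w - aff w) (a, b) (l1 - (0 + l * 1))) => //.
    apply: cder_minus h1 _; apply: cder_plus; [apply: cder_const|apply/cder_scal/cder_id].
  move=> a b Ha Hb.
  have Q : (Cmod ((a, b) - (sx, sy)) <= hn n + kn n)%R.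
    apply: Rle_trans (Cmod_le_split _) _; rewrite /=.
    by apply: Rplus_le_compat; apply: Rabs_le; lra.
  have -> : g (a, b) - aff (a, b) = g (a, b) - g (sx, sy) - l * ((a, b) - (sx, sy)) by rewrite /aff; ring.
  have -> : (s + hn n - s + (t + kn n - t) = hn n + kn n)%R by ring.
  have Qd : (hn n + kn n < d)%R by move: Hn; rewrite /hn /kn; lra.
  apply: Rle_trans (Hd _ (Rle_lt_trans _ _ _ Q Qd)) _.
  by apply: Rmult_le_compat_l; lra.
have P4 : (4 ^ n = 2 ^ n * 2 ^ n)%R by rewrite -Rpow_mult_distr; congr pow; ring.
have P2n := P2 n.
have B2 : (4 * (hn n + kn n) * (e * (hn n + kn n)) = eta / 2 / 4 ^ n)%R.
  by rewrite P4 /hn /kn /e; field; lra.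
have : (4 ^ n * J n (sq n) <= eta / 2)%R.
  have -> : (eta / 2 = 4 ^ n * (eta / 2 / 4 ^ n))%R by rewrite P4; field; lra.
  apply: Rmult_le_compat_l; first by rewrite P4; nra.
  by rewrite -B2.
lra.
Qed.

(** * The complex exponential *)

Definition Cexp (z : C) : C := (exp (fst z) * cos (snd z), exp (fst z) * sin (snd z))%R.

Lemma Cexp_plus z w : Cexp (z + w) = Cexp z * Cexp w.
Proof.
rewrite /Cexp /Cmult /Cplus /= exp_plus cos_plus sin_plus; congr pair; ring.
Qed.
Lemma Cexp_0 : Cexp 0 = 1.
Proof. by rewrite /Cexp /= exp_0 cos_0 sin_0 !Rmult_1_l. Qed.
Lemma Cmod_Cexp z : Cmod (Cexp z) = exp (fst z).
Proof.
rewrite /Cmod /Cexp /=; have -> : (exp (fst z) * cos (snd z) * (exp (fst z) * cos (snd z) * 1) +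
  exp (fst z) * sin (snd z) * (exp (fst z) * sin (snd z) * 1) = Rsqr (exp (fst z)) *
  (Rsqr (sin (snd z)) + Rsqr (cos (snd z))))%R by rewrite /Rsqr; ring.
rewrite sin2_cos2 Rmult_1_r sqrt_Rsqr //; exact/Rlt_le/exp_pos.
Qed.

Lemma derive0 (f : R -> R) l : derivable_pt_lim f 0 l -> forall e, (0 < e)%R -> exists d, (0 < d)%R /\
  forall h, (Rabs h < d)%R -> (Rabs (f h - f 0 - l * h) <= e * Rabs h)%R.
Proof.
move=> H e e0; case: (H e e0) => d Hd; exists d; split; first exact: cond_pos.
move=> h hd; case: (Req_dec h 0) => [->|h0].
  have -> : (f 0 - f 0 - l * 0 = 0)%R by ring.
  by rewrite Rabs_R0; lra.
have := Hd h h0 hd; rewrite Rplus_0_l => Q.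
have -> : (f h - f 0 - l * h = ((f h - f 0) / h - l) * h)%R by field.
by rewrite Rabs_mult; apply: Rmult_le_compat_r; [apply: Rabs_pos|lra].
Qed.

Lemma cder_Cexp0 : cder Cexp 0 1.
Proof.
move=> e e0.
have e1 : (0 < e / 8)%R by lra.
have e2 : (0 < Rmin (e / 8) 1)%R by apply: Rmin_pos; lra.
case: (derive0 exp 1 ltac:(have := derivable_pt_lim_exp 0; rewrite exp_0; done) _ e2) => d1 [d10 H1].
case: (derive0 cos 0 ltac:(have := derivable_pt_lim_cos 0; rewrite sin_0 Ropp_0; done) _ e1) => d2 [d20 H2].
case: (derive0 sin 1 ltac:(have := derivable_pt_lim_sin 0; rewrite cos_0; done) _ e2) => d3 [d30 H3].
have [d4 [d40 H4]] : exists d4, (0 < d4)%R /\ forall h, (Rabs h < d4 -> 0 < 1 + h <= 2 /\ Rabs h < e / 8)%R.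
  exists (Rmin 1 (e / 8)); split; first by apply: Rmin_pos; lra.
  move=> h hh; have := Rmin_l 1 (e / 8); have := Rmin_r 1 (e / 8); split; last lra.
  by split; case: (Rabs_def2 h 1) => *; lra.
exists (Rmin (Rmin d1 d2) (Rmin d3 d4)); split; first by repeat apply: Rmin_pos.
move=> w; have -> : w - 0 = w by ring. move=> Hw.
have Ha := Rlt_le_trans _ _ _ Hw (Rmin_l _ _); have Hb := Rlt_le_trans _ _ _ Hw (Rmin_r _ _).
have X := fst_le_Cmod w; have Y := snd_le_Cmod w.
have L1 := Rmin_l d1 d2; have L2 := Rmin_r d1 d2; have L3 := Rmin_l d3 d4; have L4 := Rmin_r d3 d4.
have {}H1 := H1 (fst w) ltac:(lra); have {}H2 := H2 (snd w) ltac:(lra).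
have {}H3 := H3 (snd w) ltac:(lra); have [H4a H4b] := H4 (fst w) ltac:(lra).
have [_ H4c] := H4 (snd w) ltac:(lra).
rewrite exp_0 Rmult_1_l in H1; rewrite cos_0 Rmult_0_l Rminus_0_r in H2; rewrite sin_0 Rmult_1_l Rminus_0_r in H3.
have m1 := Rmin_l (e / 8) 1; have m2 := Rmin_r (e / 8) 1.
set m := Rmin (e / 8) 1 in H1 H3 m1 m2 e2.
move: H1 H2 H3 H4a H4b H4c X Y; rewrite Cexp_0.
have -> : Cexp w - 1 - 1 * w = (exp (fst w) * cos (snd w) - 1 - fst w, exp (fst w) * sin (snd w) - snd w)%R.
  by case: w {Hw Ha Hb} => a b; rewrite /Cexp /Cminus /Cplus /Copp /Cmult /RtoC /=; congr pair; ring.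
set x := fst w; set y := snd w; set N := Cmod w => H1 H2 H3 H4a H4b H4c X Y.
apply: Rle_trans (Cmod_le_split _) _; rewrite [fst _]/= [snd _]/=.
set E := exp x in H1 *; set c := cos y in H2 *; set s := sin y in H3 *.
have N0 : (0 <= N)%R by apply: Cmod_ge_0.
have X0 := Rabs_pos x; have Y0 := Rabs_pos y.
have H1' : (Rabs (E - 1 - x) <= m * N)%R by apply: Rle_trans H1 _; apply: Rmult_le_compat_l; lra.
have H2' : (Rabs (c - 1) <= e / 8 * N)%R by apply: Rle_trans H2 _; apply: Rmult_le_compat_l; lra.
have H3' : (Rabs (s - y) <= m * N)%R by apply: Rle_trans H3 _; apply: Rmult_le_compat_l; lra.
have C1 : (Rabs c <= 1)%R by apply: Rabs_le; have := COS_bound y; rewrite -/c; lra.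
have S1 : (Rabs s <= 1)%R by apply: Rabs_le; have := SIN_bound y; rewrite -/s; lra.
have A1 : (Rabs (E * c - 1 - x) <= e / 8 * N + e / 4 * N)%R.
  have -> : (E * c - 1 - x = (E - 1 - x) * c + (1 + x) * (c - 1))%R by ring.
  apply: Rle_trans (Rabs_triang _ _) _; rewrite !Rabs_mult; apply: Rplus_le_compat.
    apply: (Rle_trans _ (Rabs (E - 1 - x) * 1)%R); last nra.
    by apply: Rmult_le_compat_l; [apply: Rabs_pos|].
  rewrite (Rabs_pos_eq (1 + x)); last lra.
  apply: (Rle_trans _ (2 * (e / 8 * N))%R); last nra.
  by apply: Rmult_le_compat; try lra; apply: Rabs_pos.
have A2 : (Rabs (E * s - y) <= e / 8 * N + e / 4 * N + e / 8 * N)%R.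
  have -> : (E * s - y = (E - 1 - x) * s + x * s + (s - y))%R by ring.
  apply: Rle_trans (Rabs_triang _ _) _; apply: Rplus_le_compat; last nra.
  apply: Rle_trans (Rabs_triang _ _) _; rewrite !Rabs_mult; apply: Rplus_le_compat.
    apply: (Rle_trans _ (Rabs (E - 1 - x) * 1)%R); last nra.
    by apply: Rmult_le_compat_l; [apply: Rabs_pos|].
  have SS : (Rabs s <= 2 * N)%R.
    have -> : s = ((s - y) + y)%R by ring.
    by apply: Rle_trans (Rabs_triang _ _) _; nra.
  apply: (Rle_trans _ (e / 8 * (2 * N))%R); last lra.
  by apply: Rmult_le_compat; try lra; apply: Rabs_pos.
nra.
Qed.

Lemma cder_Cexp z : cder Cexp z (Cexp z).
Proof.
have H : cder (fun w => Cexp z * Cexp (w - z)) z (Cexp z * (1 * (1 - 0))).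
  apply: cder_scal; apply: (cder_comp Cexp (fun w => w - z)).
    by apply: cder_minus; [apply: cder_id|apply: cder_const].
  have -> : z - z = 0 by ring. exact: cder_Cexp0.
have E : Cexp z * (1 * (1 - 0)) = Cexp z by ring.
rewrite E in H; apply: cder_ext H => w; rewrite -Cexp_plus; congr Cexp; ring.
Qed.

Lemma exp_le_exp x y : (x <= y)%R -> (exp x <= exp y)%R.
Proof. by case=> [/exp_increasing/Rlt_le|->] //; apply: Rle_refl. Qed.

(** * Circle means *)

Definition circ (r t : R) : C := (r * cos t, r * sin t)%R.

Lemma Cmod_circ r t : Cmod (circ r t) = Rabs r.
Proof.
rewrite /Cmod /circ /=; have -> : (r * cos t * (r * cos t * 1) + r * sin t * (r * sin t * 1) =
  Rsqr r * (Rsqr (sin t) + Rsqr (cos t)))%R by rewrite /Rsqr; ring.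
by rewrite sin2_cos2 Rmult_1_r sqrt_Rsqr_abs.
Qed.

Lemma cos_sin_lip x y : (Rabs (cos x - cos y) <= Rabs (x - y))%R /\ (Rabs (sin x - sin y) <= Rabs (x - y))%R.
Proof.
have L (f f' : R -> R) : (forall t, derivable_pt_lim f t (f' t)) -> (forall t, Rabs (f' t) <= 1)%R ->
    (Rabs (f x - f y) <= Rabs (x - y))%R.
  move=> Hd Hb; have [c [_ ->]] := MVT_gen f y x f' (fun t _ => proj2 (is_derive_Reals f t (f' t)) (Hd t) : is_derive f t (f' t))
    (fun t _ => derivable_continuous_pt _ _ (exist _ (f' t) (Hd t))).
  rewrite Rabs_mult -{2}(Rmult_1_l (Rabs (x - y))); apply: Rmult_le_compat_r => //; exact: Rabs_pos.
split.
  apply: (L _ (fun t => - sin t)%R); first exact: derivable_pt_lim_cos.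
  by move=> t; rewrite Rabs_Ropp; apply: Rabs_le; have := SIN_bound t; lra.
apply: (L _ cos); first exact: derivable_pt_lim_sin.
by move=> t; apply: Rabs_le; have := COS_bound t; lra.
Qed.

Lemma circ_dist r s x y : (Cmod (circ r x - circ s y) <= Rabs (r - s) + 2 * Rabs s * Rabs (x - y))%R.
Proof.
have -> : circ r x - circ s y = circ (r - s) x + RtoC s * (cos x - cos y, sin x - sin y)%R.
  by rewrite /circ /Cminus /Cplus /Copp /Cmult /RtoC /=; congr pair; ring.
apply: Rle_trans (Cmod_triangle _ _) _; rewrite Cmod_circ Cmod_mult Cmod_R.
have := Cmod_le_split (cos x - cos y, sin x - sin y)%R; have [/= A B] := cos_sin_lip x y => Q.
have := Rabs_pos s; nra.
Qed.

Lemma rcont_circ r t : rcont (circ r) t.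
Proof.
move=> e e0; have P := Rabs_pos r.
exists (e / (2 * Rabs r + 1))%R; split; first by apply: Rdiv_lt_0_compat; lra.
move=> s Hs; apply: Rle_lt_trans (circ_dist _ _ _ _) _.
rewrite Rminus_diag Rabs_R0 Rplus_0_l.
apply: (Rle_lt_trans _ ((2 * Rabs r + 1) * Rabs (s - t))%R); first by have := Rabs_pos (s - t); nra.
have -> : e = ((2 * Rabs r + 1) * (e / (2 * Rabs r + 1)))%R by field; lra.
apply: Rmult_lt_compat_l => //; lra.
Qed.

(** An average in the angle instead of a contour integral: since [dw = i w dt], the Cauchy kernel
    becomes [w / (w - z)]. *)
Definition cmean (f : C -> C) (r : R) : C := RtoC (/ (2 * PI)) * CI (fun t => f (circ r t)) 0 (2 * PI).

Definition ccircle (f : C -> C) (r : R) := forall z, Cmod z = r -> ccont f z.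

Lemma twopi_pos : (0 < 2 * PI)%R.
Proof. by have := PI_RGT_0; lra. Qed.

Lemma ccircle_rcont f r : (0 <= r)%R -> ccircle f r -> rcont_on 0 (2 * PI) (fun t => f (circ r t)).
Proof.
move=> r0 H t _; apply: (rcont_comp f); first exact: rcont_circ.
by apply: H; rewrite Cmod_circ Rabs_pos_eq.
Qed.

Lemma cmean_ext f g r : (0 <= r)%R -> (forall z, Cmod z = r -> f z = g z) -> cmean f r = cmean g r.
Proof.
move=> r0 E; rewrite /cmean; congr Cmult; apply: CI_ext => [|t _]; first exact/Rlt_le/twopi_pos.
by apply: E; rewrite Cmod_circ Rabs_pos_eq.
Qed.

Lemma cmean_plus f g r : (0 <= r)%R -> ccircle f r -> ccircle g r ->
  cmean (fun z => f z + g z) r = cmean f r + cmean g r.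
Proof.
move=> r0 Hf Hg; rewrite /cmean CI_plus; first ring.
- exact/Rlt_le/twopi_pos.
- exact: ccircle_rcont.
- exact: ccircle_rcont.
Qed.

Lemma cmean_scal k f r : (0 <= r)%R -> ccircle f r -> cmean (fun z => k * f z) r = k * cmean f r.
Proof.
move=> r0 Hf; rewrite /cmean CI_scal; first ring.
- exact/Rlt_le/twopi_pos.
- exact: ccircle_rcont.
Qed.

Lemma ccircle_scal k f r : ccircle f r -> ccircle (fun z => k * f z) r.
Proof.
move=> H z /H Hz e e0; have K := Cmod_ge_0 k.
have P : (0 < e / (Cmod k + 1))%R by apply: Rdiv_lt_0_compat; lra.
case: (Hz _ P) => d [d0 Hd]; exists d; split=> // w /Hd Hw.
have -> : k * f w - k * f z = k * (f w - f z) by ring.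
rewrite Cmod_mult; have -> : e = ((Cmod k + 1) * (e / (Cmod k + 1)))%R by field; lra.
apply: (Rle_lt_trans _ ((Cmod k + 1) * Cmod (f w - f z))%R).
  by apply: Rmult_le_compat_r; [apply: Cmod_ge_0|lra].
by apply: Rmult_lt_compat_l; lra.
Qed.

Lemma cmean_minus f g r : (0 <= r)%R -> ccircle f r -> ccircle g r ->
  cmean (fun z => f z - g z) r = cmean f r - cmean g r.
Proof.
move=> r0 Hf Hg; rewrite (cmean_ext _ (fun z => f z + -(1) * g z)) //; last by move=> z _; ring.
rewrite cmean_plus // ?cmean_scal //; first ring.
exact: ccircle_scal.
Qed.

Lemma cmean_const k r : cmean (fun _ => k) r = k.
Proof.
rewrite /cmean CI_const Rminus_0_r Cmult_assoc -RtoC_mult Rinv_l ?Cmult_1_l //.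
by have := twopi_pos; lra.
Qed.

Lemma cmean_bound f r B : (0 <= r)%R -> ccircle f r -> (forall z, Cmod z = r -> (Cmod (f z) <= B)%R) ->
  (Cmod (cmean f r) <= 2 * B)%R.
Proof.
move=> r0 Hf HB; have P := twopi_pos.
have := CI_bound (fun t => f (circ r t)) 0 (2 * PI) B ltac:(lra) (ccircle_rcont f r r0 Hf)
  (fun t _ => HB (circ r t) (eq_trans (Cmod_circ r t) (Rabs_pos_eq r r0))).
rewrite /cmean Cmod_mult Cmod_R Rabs_pos_eq; last by apply/Rlt_le/Rinv_0_lt_compat.
move=> Q; apply: (Rle_trans _ (/ (2 * PI) * (2 * (2 * PI - 0) * B))%R).
  by apply: Rmult_le_compat_l => //; apply/Rlt_le/Rinv_0_lt_compat.
by right; field; apply: PI_neq0.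
Qed.

(** The exponential maps the rectangle [[ln a, ln b] x [0, 2 PI]] onto an annulus. In Goursat's
    identity the horizontal sides cancel by periodicity, and the vertical sides are the two circle
    means. *)
Lemma cmean_annulus f r1 r2 r s : (0 <= r1)%R -> (r1 < r < r2)%R -> (r1 < s < r2)%R ->
  (forall z, (r1 < Cmod z < r2)%R -> exists l, cder f z l) -> cmean f r = cmean f s.
Proof.
move=> r10 Hr Hs H.
suff W a b : (r1 < a < r2)%R -> (r1 < b < r2)%R -> (a < b)%R -> cmean f a = cmean f b.
  by case: (Rtotal_order r s) => [|[->|]] //; [apply: W|move=> L; symmetry; apply: W].
clear r s Hr Hs => Ha Hb ab.
have la : (ln a < ln b)%R by apply: ln_increasing; lra.
have P := twopi_pos.
have G := goursat (fun w => f (Cexp w)) (ln a) 0 (ln b - ln a) (2 * PI) ltac:(lra) P.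
have {}G : rect_int (fun w => f (Cexp w)) (ln a) (ln b) 0 (2 * PI) = 0.
  have -> : ln b = (ln a + (ln b - ln a))%R by ring.
  have -> : (2 * PI = 0 + 2 * PI)%R by ring.
  apply: G => x t Hx Ht.
  have [|l Hl] := H (Cexp (x, t)).
    rewrite Cmod_Cexp /=; split; first (apply: (Rlt_le_trans _ a); first lra).
      by rewrite -{1}(exp_ln a); [apply: exp_le_exp; lra|lra].
    apply: (Rle_lt_trans _ b); last lra.
    by rewrite -(exp_ln b); [apply: exp_le_exp; lra|lra].
  by exists (l * Cexp (x, t)); apply: (cder_comp f Cexp); [apply: cder_Cexp|].
move: G; rewrite /rect_int.
rewrite (CI_ext (fun x => f (Cexp (x, (2 * PI)%R))) (fun x => f (Cexp (x, 0%R))) (ln a) (ln b)); first last.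
- by move=> t _; rewrite /Cexp /= cos_2PI sin_2PI cos_0 sin_0.
- lra.
have E c : (0 < c)%R -> (fun y => f (Cexp (ln c, y))) = (fun t => f (circ c t)).
  by move=> c0; rewrite -{2}(exp_ln c).
rewrite !E; try lra; move=> G.
rewrite /cmean; congr Cmult.
move: G; move: (CI _ _ _) (CI _ _ _) (CI _ _ _) => u v w G.
have : Ci * (u - v) = 0 by rewrite -Copp_0 -G; ring.
move/(f_equal (Cmult (- Ci))); rewrite Cmult_0_r.
have -> : - Ci * (Ci * (u - v)) = u - v.
  have CC : Ci * Ci = - (1) by rewrite /Ci /Cmult /Copp /RtoC /=; congr pair; ring.
  have -> : - Ci * (Ci * (u - v)) = - (Ci * Ci) * (u - v) by ring.
  by rewrite CC; ring.
move=> Q; have -> : u = v + (u - v) by ring. by rewrite Q; ring.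
Qed.

(** * Cauchy's formula *)

(** Compactness of the interval of angles makes continuity at the points of the circle uniform, also
    towards circles of nearby radius. *)
Lemma circ_compact (g : C -> C) r : (0 <= r)%R -> ccircle g r -> forall e, (0 < e)%R ->
  exists d, (0 < d)%R /\ forall t s, (0 <= t <= 2 * PI)%R -> (Rabs (s - r) < d)%R ->
    (Cmod (g (circ s t) - g (circ r t)) < e)%R.
Proof.
move=> r0 Hg e e0.
have H t : exists d : posreal, forall w, (Cmod (w - circ r t) < (2 + 2 * r) * d)%R -> (Cmod (g w - g (circ r t)) < e / 2)%R.
  have [|d [d0 Hd]] := Hg (circ r t) _ (e / 2)%R ltac:(lra); first by rewrite Cmod_circ Rabs_pos_eq.
  have P : (0 < d / (2 + 2 * r))%R by apply: Rdiv_lt_0_compat; lra.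
  exists (mkposreal _ P) => w /= Hw; apply: Hd.
  by have E : ((2 + 2 * r) * (d / (2 + 2 * r)) = d)%R; [field; lra|lra].
pose dl t := ClassicalEpsilon.epsilon (inhabits (mkposreal 1 Rlt_0_1)) (fun d : posreal => forall w,
  (Cmod (w - circ r t) < (2 + 2 * r) * d)%R -> (Cmod (g w - g (circ r t)) < e / 2)%R).
have Hdl t : forall w, (Cmod (w - circ r t) < (2 + 2 * r) * dl t)%R -> (Cmod (g w - g (circ r t)) < e / 2)%R.
  exact: ClassicalEpsilon.epsilon_spec (H t).
have [d Hd] := compactness_value_1d 0 (2 * PI) dl.
exists d; split; first exact: cond_pos.
move=> x s Hx Hs.
apply: NNPP => M; apply: (Hd x Hx) => [[t [Ht [H1 H2]]]]; apply: M.
have T0 := cond_pos (dl t).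
have A : (Cmod (circ s x - circ r t) < (2 + 2 * r) * dl t)%R.
  apply: Rle_lt_trans (circ_dist _ _ _ _) _; rewrite (Rabs_pos_eq r) //.
  have : (2 * r * Rabs (x - t) <= 2 * r * dl t)%R by apply: Rmult_le_compat_l; lra.
  by have := Rabs_pos (s - r); lra.
have B : (Cmod (circ r x - circ r t) < (2 + 2 * r) * dl t)%R.
  apply: Rle_lt_trans (circ_dist _ _ _ _) _; rewrite (Rabs_pos_eq r) // Rminus_diag Rabs_R0.
  have : (2 * r * Rabs (x - t) <= 2 * r * dl t)%R by apply: Rmult_le_compat_l; lra.
  lra.
have := Hdl t _ A; have := Hdl t _ B.
have -> : g (circ s x) - g (circ r x) = (g (circ s x) - g (circ r t)) - (g (circ r x) - g (circ r t)) by ring.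
have := Cmod_triangle_sub (g (circ s x) - g (circ r t)) (g (circ r x) - g (circ r t)); lra.
Qed.

Lemma cmean_bound_t f r B : (0 <= r)%R -> ccircle f r ->
  (forall t, (0 <= t <= 2 * PI)%R -> (Cmod (f (circ r t)) <= B)%R) -> (Cmod (cmean f r) <= 2 * B)%R.
Proof.
move=> r0 Hf HB; have P := twopi_pos.
have := CI_bound (fun t => f (circ r t)) 0 (2 * PI) B ltac:(lra) (ccircle_rcont f r r0 Hf) HB.
rewrite /cmean Cmod_mult Cmod_R Rabs_pos_eq; last by apply/Rlt_le/Rinv_0_lt_compat.
move=> Q; apply: (Rle_trans _ (/ (2 * PI) * (2 * (2 * PI - 0) * B))%R).
  by apply: Rmult_le_compat_l => //; apply/Rlt_le/Rinv_0_lt_compat.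
by right; field; apply: PI_neq0.
Qed.

Lemma circ_bounded f r : (0 <= r)%R -> ccircle f r -> exists B, (0 < B)%R /\
  forall t, (0 <= t <= 2 * PI)%R -> (Cmod (f (circ r t)) <= B)%R.
Proof.
move=> r0 Hf; have Hc t : continuity_pt (fun t => Cmod (f (circ r t))) t.
  move=> e e0.
  have Q : rcont (fun t => f (circ r t)) t.
    by apply: rcont_comp; [apply: rcont_circ|apply: Hf; rewrite Cmod_circ Rabs_pos_eq].
  case: (Q e e0) => d [d0 Hd]; exists d; split=> // s [_ Hs]; apply: Rle_lt_trans (Hd s Hs).
  have A := Cmod_rev_triangle (f (circ r s)) (f (circ r t)).
  have B := Cmod_rev_triangle (f (circ r t)) (f (circ r s)); rewrite Cmod_sub_sym in B.
  rewrite /= /R_dist; apply: Rabs_le; lra.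
have [t [Ht _]] := continuity_ab_maj (fun t => Cmod (f (circ r t))) 0 (2 * PI) (Rlt_le _ _ twopi_pos) (fun t _ => Hc t).
exists (Cmod (f (circ r t)) + 1)%R; split; first by have := Cmod_ge_0 (f (circ r t)); lra.
by move=> s Hs; have := Ht s Hs; lra.
Qed.

Lemma cmean_cont g r : (0 <= r)%R -> (exists d0, (0 < d0)%R /\ forall z, (r - d0 < Cmod z < r + d0)%R -> ccont g z) ->
  forall e, (0 < e)%R -> exists d, (0 < d)%R /\ forall s, (0 <= s)%R -> (Rabs (s - r) < d)%R ->
    (Cmod (cmean g s - cmean g r) <= e)%R.
Proof.
move=> r0 [d0 [d00 Hc]] e e0.
have Hr : ccircle g r by move=> z Hz; apply: Hc; lra.
case: (circ_compact g r r0 Hr (e / 2)%R ltac:(lra)) => d [dp Hd].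
exists (Rmin d d0); split; first exact: Rmin_pos.
move=> s s0 Hs; have Hs1 := Rlt_le_trans _ _ _ Hs (Rmin_l _ _).
have Hs2 := Rlt_le_trans _ _ _ Hs (Rmin_r _ _).
have [Q1 Q2] := Rabs_def2 _ _ Hs2.
have Hsc : ccircle g s by move=> z Hz; apply: Hc; lra.
have P := twopi_pos.
rewrite /cmean; have -> : RtoC (/ (2 * PI)) * CI (fun t => g (circ s t)) 0 (2 * PI) -
  RtoC (/ (2 * PI)) * CI (fun t => g (circ r t)) 0 (2 * PI) =
  RtoC (/ (2 * PI)) * CI (fun t => g (circ s t) - g (circ r t)) 0 (2 * PI).
  rewrite CI_minus; [ring|lra|exact: ccircle_rcont|exact: ccircle_rcont].
have := CI_bound (fun t => g (circ s t) - g (circ r t)) 0 (2 * PI) (e / 2)%R ltac:(lra).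
move=> /(_ _ _) Q.
rewrite Cmod_mult Cmod_R Rabs_pos_eq; last by apply/Rlt_le/Rinv_0_lt_compat.
apply: (Rle_trans _ (/ (2 * PI) * (2 * (2 * PI - 0) * (e / 2)))%R); last by right; field; apply: PI_neq0.
apply: Rmult_le_compat_l; first by apply/Rlt_le/Rinv_0_lt_compat.
apply: Q.
  move=> t Ht e' e'0.
  have A := ccircle_rcont g s s0 Hsc t Ht; have B := ccircle_rcont g r r0 Hr t Ht.
  have B' := rcont_scal (-(1)) _ _ B.
  case: (rcont_plus _ _ _ A B' e' e'0) => dd [dd0 Hdd]; exists dd; split=> // x /Hdd.
  by congr (Cmod _ < _)%R; ring.
by move=> t Ht; apply/Rlt_le/Hd.
Qed.

Lemma cmean_limit g r l : (forall e, (0 < e)%R -> (Cmod (cmean g r - l) <= e)%R) -> cmean g r = l.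
Proof.
move=> H; have : Cmod (cmean g r - l) = 0%R.
  apply: Rle_antisym; last exact: Cmod_ge_0.
  by apply: le_epsilon => e e0; rewrite Rplus_0_l; apply: H.
by move/Cmod_eq_0 => E; have -> : cmean g r = (cmean g r - l) + l; [ring|rewrite E; ring].
Qed.

(** The mean is constant on the radii below [|z|] and on those above. Its continuity in the radius
    joins the two ranges across [|z|] and extends the inner one to radius 0. *)
Lemma cmean_punctured (g : C -> C) z R0 : (Cmod z < R0)%R ->
  (forall w, (Cmod w < R0)%R -> ccont g w) ->
  (forall w, (Cmod w < R0)%R -> w <> z -> exists l, cder g w l) ->
  forall r, (Cmod z < r < R0)%R -> cmean g r = g 0.
Proof.
move=> zR Hc Hd r Hr; have z0 := Cmod_ge_0 z.
have at0 : cmean g 0 = g 0.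
  rewrite -(cmean_const (g 0) 0); apply: cmean_ext; first exact: Rle_refl.
  by move=> w /Cmod_eq_0 ->.
have cont s : (0 <= s < R0)%R -> forall e, (0 < e)%R -> exists d, (0 < d)%R /\
   forall s', (0 <= s')%R -> (Rabs (s' - s) < d)%R -> (Cmod (cmean g s' - cmean g s) <= e)%R.
  move=> Hs; apply: cmean_cont; first lra.
  by exists (R0 - s)%R; split; [lra|move=> w Hw; apply: Hc; lra].
have ann a b s t : (0 <= a)%R -> (b <= R0)%R -> (Cmod z <= a \/ b <= Cmod z)%R -> (a < s < b)%R -> (a < t < b)%R -> cmean g s = cmean g t.
  move=> a0 bR Hab Hs Ht; apply: (cmean_annulus g a b) => // w Hw.
  by apply: Hd; [lra|move=> E; rewrite E in Hw; lra].
have inner s : (0 <= s <= Cmod z)%R -> cmean g s = g 0.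
  move=> [s0 s1].
  have A t : (0 <= t < Cmod z)%R -> cmean g t = g 0.
    move=> [[t0|<-//] t1]; apply: cmean_limit => e e0.
    case: (cont 0%R ltac:(lra) e e0) => d [d0 Q]; rewrite at0 in Q.
    pose u := (Rmin d t / 2)%R; have U := Rmin_pos _ _ d0 t0.
    have := Rmin_l d t; have := Rmin_r d t => L1 L2.
    rewrite -(ann 0%R (Cmod z) u t) /u; try lra.
    by apply: Q; [lra|rewrite Rabs_pos_eq; lra].
  case: s1 => [s1|E]; first exact: A.
  case: s0 => [s0|<-//]; apply: cmean_limit => e e0.
  case: (cont s ltac:(lra) e e0) => d [d0 Q].
  pose u := (s - Rmin d s / 2)%R; have U := Rmin_pos _ _ d0 s0.
  have := Rmin_l d s; have := Rmin_r d s => L1 L2.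
  rewrite -(A u) /u; last lra.
  by rewrite Cmod_sub_sym; apply: Q; [lra|rewrite Rabs_left; lra].
apply: cmean_limit => e e0; rewrite -(inner (Cmod z)); last lra.
case: (cont (Cmod z) ltac:(lra) e e0) => d [d0 Q].
pose u := (Cmod z + Rmin d (r - Cmod z) / 2)%R; have U := Rmin_pos d (r - Cmod z) d0 ltac:(lra).
have := Rmin_l d (r - Cmod z); have := Rmin_r d (r - Cmod z) => L1 L2.
rewrite -(ann (Cmod z) R0 u r) /u; try lra.
by apply: Q; [lra|rewrite Rabs_pos_eq; lra].
Qed.

Lemma Csub_neq0 (z w : C) : (Cmod w < Cmod z)%R -> z - w <> 0.
Proof.
move=> H E; have := Cmod_rev_triangle z w; rewrite E Cmod_0; lra.
Qed.

(** The mean does not depend on the radius above [|z|], and the kernel tends to 1 at infinity. *)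
Lemma cmean_kernel z r : (Cmod z < r)%R -> cmean (fun w => w / (w - z)) r = 1.
Proof.
move=> zr; have z0 := Cmod_ge_0 z.
have hd w : (Cmod z < Cmod w)%R -> exists l, cder (fun w => w / (w - z)) w l.
  move=> Hw; eexists; apply: cder_mult; first exact: cder_id.
  apply: cder_inv; first by apply: cder_minus; [apply: cder_id|apply: cder_const].
  exact: Csub_neq0.
apply: cmean_limit => e e0.
(* The term [2 |z| / e] forces [|z / (w - z)| <= e / 2] on the circle; the others put [s] beyond [r]
   and [|z|]. *)
pose s := (r + 1 + 2 * Cmod z / e + Cmod z)%R.
have Q : (0 <= 2 * Cmod z / e)%R by apply: Rdiv_le_0_compat; lra.
rewrite (cmean_annulus _ (Cmod z) (s + 1) r s) /s; try lra; last by move=> w [Hw _]; apply: hd.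
rewrite -/s -(cmean_const 1 s).
have s0 : (0 <= s)%R by rewrite /s; lra.
have cs k : ccircle (fun _ => k) s by move=> w _; apply: cder_cont (cder_const _ _).
have ck : ccircle (fun w => w / (w - z)) s.
  by move=> w Hw; have [|l /cder_cont //] := hd w; rewrite Hw /s; lra.
rewrite -cmean_minus //.
have -> : e = (2 * (e / 2))%R by field.
apply: cmean_bound => //.
  move=> w Hw e' e'0; have [|l Hl] := hd w; first by rewrite Hw /s; lra.
  exact: (cder_cont _ _ _ (cder_minus _ _ _ _ _ Hl (cder_const 1 w))).
move=> w Hw.
have N : w - z <> 0 by apply: Csub_neq0; rewrite Hw /s; lra.
have -> : w / (w - z) - 1 = z / (w - z) by field.
rewrite Cmod_div //.
have B : (2 * Cmod z / e < Cmod (w - z))%R by have := Cmod_rev_triangle w z; rewrite Hw /s; lra.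
have P := proj1 (Cmod_gt_0 _) N.
apply: (Rmult_le_reg_r (Cmod (w - z))) => //.
rewrite /Rdiv Rmult_assoc Rinv_l; last lra.
have E : (2 * Cmod z / e * (e / 2) = Cmod z)%R by field; lra.
by have : (2 * Cmod z / e * (e / 2) <= Cmod (w - z) * (e / 2))%R; [apply: Rmult_le_compat_r; lra|lra].
Qed.

(** The difference quotient at [z] multiplied by [w], completed at [z] by means of the derivative,
    is continuous at [z] and differentiable elsewhere. Its mean is therefore its value at 0, which
    is 0 thanks to the factor [w]. *)
Lemma cauchy_formula f r R0 z : hol 0 R0 f -> (Cmod z < r < R0)%R ->
  f z = cmean (fun w => f w * (w / (w - z))) r.
Proof.
move=> Hf Hr; have z0 := Cmod_ge_0 z.
have H0 w : (Cmod w < R0)%R -> exists l, cder f w l by move=> Hw; apply: Hf; rewrite /Cminus Copp_0 Cplus_0_r.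
have [l Hl] := H0 z ltac:(lra).
pose g w := if excluded_middle_informative (w = z) then l * z else (f w - f z) * (w / (w - z)).
have gE w : w <> z -> g w = (f w - f z) * (w / (w - z)).
  by rewrite /g; case: excluded_middle_informative.
have gz : g z = l * z by rewrite /g; case: excluded_middle_informative.
have gd w : (Cmod w < R0)%R -> w <> z -> exists l, cder g w l.
  move=> Hw N; have [m Hm] := H0 w Hw.
  have Nz : w - z <> 0 by move=> E; apply: N; have -> : w = (w - z) + z; [ring|rewrite E; ring].
  eexists; apply: (cder_ext_loc (fun w => (f w - f z) * (w / (w - z))) g w _ (Cmod (w - z))).
  - exact/Cmod_gt_0.
  - by move=> u Hu; rewrite gE // => E; rewrite E Cmod_sub_sym in Hu; lra.
  - apply: cder_mult; first by apply: cder_minus; [exact: Hm|apply: cder_const].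
    apply: cder_mult; first exact: cder_id.
    by apply: cder_inv => //; apply: cder_minus; [apply: cder_id|apply: cder_const].
have gc w : (Cmod w < R0)%R -> ccont g w.
  move=> Hw; have [->|N] := classic (w = z); last by have [m /cder_cont] := gd w Hw N.
  move=> e e0.
  set K := (Cmod l + Cmod z + 1)%R; have L0 := Cmod_ge_0 l; have K0 : (0 < K)%R by rewrite /K; lra.
  pose e1 := Rmin 1 (e / (2 * K)).
  have e1p : (0 < e1)%R by apply: Rmin_pos; [lra|apply: Rdiv_lt_0_compat; lra].
  case: (Hl _ e1p) => d [d0 Hd].
  exists (Rmin d e1); split; first exact: Rmin_pos.
  move=> u Hu; have Hu1 := Rlt_le_trans _ _ _ Hu (Rmin_l _ _); have Hu2 := Rlt_le_trans _ _ _ Hu (Rmin_r _ _).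
  have [->|Nu] := classic (u = z); first by rewrite Cmod_subrr.
  have Nz : u - z <> 0 by move=> E; apply: Nu; have -> : u = (u - z) + z; [ring|rewrite E; ring].
  have P := proj1 (Cmod_gt_0 _) Nz.
  have -> : g u - g z = ((f u - f z - l * (u - z)) / (u - z)) * u + l * (u - z).
    by rewrite gE // gz; field.
  apply: Rle_lt_trans (Cmod_triangle _ _) _; rewrite Cmod_mult Cmod_div // Cmod_mult.
  have A : (Cmod (f u - f z - l * (u - z)) / Cmod (u - z) <= e1)%R.
    apply: (Rmult_le_reg_r (Cmod (u - z))) => //; rewrite /Rdiv Rmult_assoc Rinv_l; last lra.
    by rewrite Rmult_1_r; apply: Hd.
  have U : (Cmod u <= Cmod z + 1)%R.
    have := Cmod_rev_triangle u z; have : (e1 <= 1)%R by apply: Rmin_l.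
    lra.
  have A2 : (Cmod (f u - f z - l * (u - z)) / Cmod (u - z) * Cmod u <= e1 * (Cmod z + 1))%R.
    by apply: Rmult_le_compat => //; [apply: Rdiv_le_0_compat => //; apply: Cmod_ge_0|apply: Cmod_ge_0].
  have A3 : (e1 * (2 * K) <= e)%R.
    have -> : e = (e / (2 * K) * (2 * K))%R by field; lra.
    by apply: Rmult_le_compat_r; [lra|apply: Rmin_r].
  by rewrite /K in A3; nra.
have G := cmean_punctured g z R0 ltac:(lra) gc gd r Hr.
have g0 : g 0 = 0.
  have [E|N] := classic ((0 : C) = z); first by rewrite {1}E gz -E; ring.
  by rewrite gE // /Cdiv Cmult_0_l Cmult_0_r.
have ck : ccircle (fun w => w / (w - z)) r.
  move=> w Hw; eapply cder_cont, cder_mult; first exact: cder_id.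
  apply: cder_inv; first by apply: cder_minus; [apply: cder_id|apply: cder_const].
  by apply: Csub_neq0; lra.
have ck2 : ccircle (fun w => f w * (w / (w - z))) r.
  move=> w Hw; have [m Hm] := H0 w ltac:(lra); eapply cder_cont, cder_mult; first exact: Hm.
  apply: cder_mult; first exact: cder_id.
  apply: cder_inv; first by apply: cder_minus; [apply: cder_id|apply: cder_const].
  by apply: Csub_neq0; lra.
have : cmean (fun w => f w * (w / (w - z)) - f z * (w / (w - z))) r = 0.
  rewrite -g0 -G; apply: cmean_ext; first lra.
  move=> w Hw; rewrite gE; first ring.
  by move=> E; rewrite E in Hw; lra.
rewrite cmean_minus //; try lra; last exact: ccircle_scal.
rewrite cmean_scal //; try lra; rewrite cmean_kernel; last lra.

rewrite Cmult_1_r; set a := cmean _ r => Q; have -> : a = (a - f z) + f z by ring.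
by rewrite Q; ring.
Qed.

Lemma cder_shift f c z l : cder f (c + z) l <-> cder (fun w => f (c + w)) z l.
Proof.
split=> H e e0; case: (H e e0) => d [d0 Hd]; exists d; split=> // w Hw.
  by have E : c + w - (c + z) = w - z; [ring|have := Hd (c + w); rewrite E; apply].
have E : c + (w - c) = w by ring. have E2 : w - c - z = w - (c + z) by ring.
by have := Hd (w - c); rewrite E E2; apply.
Qed.

Lemma D_shift f c z l : cder f (c + z) l -> D (fun w => f (c + w)) z = D f (c + z).
Proof. by move=> H; rewrite (D_eq _ _ _ H); apply/D_eq/cder_shift. Qed.

Lemma hol_shift c R0 f : hol c R0 f -> hol 0 R0 (fun w => f (c + w)).
Proof.
move=> H z; have -> : z - 0 = z by ring. move=> Hz.
have [|l Hl] := H (c + z); first by have -> : c + z - c = z by ring.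
by exists l; apply/cder_shift.
Qed.

Definition dcircle (g : C -> C) r := forall w, Cmod w = r -> exists l, cder g w l.

Lemma dcircle_ccircle g r : dcircle g r -> ccircle g r.
Proof. by move=> H w /H [l /cder_cont]. Qed.
Lemma dcircle_mult f g r : dcircle f r -> dcircle g r -> dcircle (fun w => f w * g w) r.
Proof. by move=> Hf Hg w Hw; have [l Hl] := Hf w Hw; have [m Hm] := Hg w Hw; eexists; apply: cder_mult; eauto. Qed.
Lemma dcircle_inv f r : dcircle f r -> (forall w, Cmod w = r -> f w <> 0) -> dcircle (fun w => / f w) r.
Proof. by move=> Hf Hn w Hw; have [l Hl] := Hf w Hw; eexists; apply: cder_inv; eauto. Qed.
Lemma dcircle_const k r : dcircle (fun _ => k) r.
Proof. by move=> w _; eexists; apply: cder_const. Qed.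
Lemma dcircle_id r : dcircle (fun w => w) r.
Proof. by move=> w _; eexists; apply: cder_id. Qed.
Lemma dcircle_subz z r : dcircle (fun w => w - z) r.
Proof. by move=> w _; eexists; apply: cder_minus; [apply: cder_id|apply: cder_const]. Qed.
Lemma dcircle_pow f n r : dcircle f r -> dcircle (fun w => f w ^ n) r.
Proof. by move=> Hf w /Hf [l /(cder_pow _ _ _ n)]. Qed.
Lemma hol_dcircle f r R0 : hol 0 R0 f -> (r < R0)%R -> dcircle f r.
Proof. by move=> H Hr w Hw; apply: H; have -> : w - 0 = w; [ring|lra]. Qed.

(** Differentiation under the integral sign: a second order bound that is uniform on the circle
    keeps the error of the mean quadratic. *)
Lemma cmean_cder (k : C -> C -> C) (k' : C -> C) z r K d : (0 <= r)%R -> (0 < d)%R ->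
  (forall u, (Cmod (u - z) < d)%R -> dcircle (fun w => k w u) r) -> dcircle k' r ->
  (forall w u, (exists t, (0 <= t <= 2 * PI)%R /\ w = circ r t) -> (Cmod (u - z) < d)%R ->
    (Cmod (k w u - k w z - k' w * (u - z)) <= K * (Cmod (u - z) * Cmod (u - z)))%R) ->
  cder (fun u => cmean (fun w => k w u) r) z (cmean k' r).
Proof.
move=> r0 d0 Hk Hk' HK e e0.
have K1 := Rabs_pos K.
have P : (0 < e / (2 * Rabs K + 1))%R by apply: Rdiv_lt_0_compat; lra.
exists (Rmin d (e / (2 * Rabs K + 1))); split; first exact: Rmin_pos.
move=> u Hu; have Hu1 := Rlt_le_trans _ _ _ Hu (Rmin_l _ _); have Hu2 := Rlt_le_trans _ _ _ Hu (Rmin_r _ _).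
have Hz : (Cmod (z - z) < d)%R by rewrite Cmod_subrr.
have dm : dcircle (fun w => - (u - z) * k' w) r by apply: dcircle_mult => //; apply: dcircle_const.
have E : cmean (fun w => k w u) r - cmean (fun w => k w z) r - cmean k' r * (u - z) =
   cmean (fun w => (k w u - k w z) + - (u - z) * k' w) r.
  rewrite cmean_plus // ?cmean_scal ?cmean_minus //; try (by apply/dcircle_ccircle; auto); try ring.
  move=> w Hw; have [l Hl] := Hk u Hu1 w Hw; have [m Hm] := Hk z Hz w Hw.
  exact: (cder_cont _ _ _ (cder_minus _ _ _ _ _ Hl Hm)).
rewrite E; have X0 := Cmod_ge_0 (u - z); set x := Cmod (u - z) in X0 Hu1 Hu2 *.
apply: (Rle_trans _ (2 * (Rabs K * (x * x)))%R).
  apply: cmean_bound_t => //.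
    move=> w Hw; have [l Hl] := Hk u Hu1 w Hw; have [m Hm] := Hk z Hz w Hw; have [m' Hm'] := dm w Hw.
    exact: (cder_cont _ _ _ (cder_plus _ _ _ _ _ (cder_minus _ _ _ _ _ Hl Hm) Hm')).
  move=> t Ht; have := HK (circ r t) u ltac:(by exists t) Hu1; rewrite -/x => Q.
  have -> : k (circ r t) u - k (circ r t) z + - (u - z) * k' (circ r t) =
     k (circ r t) u - k (circ r t) z - k' (circ r t) * (u - z) by ring.
  apply: Rle_trans Q _; apply: Rmult_le_compat_r; [nra|exact: Rle_abs].
have : ((2 * Rabs K + 1) * x <= (2 * Rabs K + 1) * (e / (2 * Rabs K + 1)))%R by apply: Rmult_le_compat_l; lra.
have -> : ((2 * Rabs K + 1) * (e / (2 * Rabs K + 1)) = e)%R by field; lra.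
nra.
Qed.

Lemma Rinv_mono a b : (0 < a)%R -> (a <= b)%R -> (/ b <= / a)%R.
Proof. by move=> *; apply: Rinv_le_contravar. Qed.

Lemma kernel1 g r z : (Cmod z < r)%R -> dcircle g r ->
  cder (fun u => cmean (fun w => g w * / (w - u)) r) z (cmean (fun w => g w * / ((w - z) * (w - z))) r).
Proof.
move=> zr Hg; have z0 := Cmod_ge_0 z; have r0 : (0 <= r)%R by lra.
have [B [B0 HB]] := circ_bounded g r r0 (dcircle_ccircle _ _ Hg).
set rho := (r - Cmod z)%R; have rho0 : (0 < rho)%R by rewrite /rho; lra.
have far u w : (Cmod (u - z) < rho / 2)%R -> Cmod w = r -> (rho / 2 < Cmod (w - u))%R.
  move=> Hu Hw; have A := Cmod_rev_triangle w u; have A2 := Cmod_rev_triangle u z.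
  by move: A A2; rewrite Hw /rho in Hu *; rewrite /rho in Hu; lra.
have nz u w : (Cmod (u - z) < rho / 2)%R -> Cmod w = r -> w - u <> 0.
  by move=> Hu Hw; apply/Cmod_gt_0; have := far u w Hu Hw; lra.
have Hz : (Cmod (z - z) < rho / 2)%R by rewrite Cmod_subrr; lra.
apply: (cmean_cder (fun w u => g w * / (w - u)) _ z r (B * (8 / (rho * rho * rho))) (rho / 2)) => //; try lra.
- move=> u Hu; apply: dcircle_mult => //; apply: dcircle_inv; first exact: dcircle_subz.
  by move=> w; apply: nz.
- apply: dcircle_mult => //; apply: dcircle_inv; first by apply: dcircle_mult; apply: dcircle_subz.
  by move=> w Hw; apply: Cmult_neq_0; apply: nz.
- move=> w u [t [Ht wE]] Hu; have Hw : Cmod w = r by rewrite wE Cmod_circ Rabs_pos_eq.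
  have N1 := nz u w Hu Hw; have N2 := nz z w Hz Hw.
  have -> : g w * / (w - u) - g w * / (w - z) - g w * / ((w - z) * (w - z)) * (u - z) =
    g w * (/ ((w - z) * (w - z) * (w - u)) * ((u - z) * (u - z))) by field.
  have N3 : (w - z) * (w - z) * (w - u) <> 0 by repeat apply: Cmult_neq_0.
  rewrite !Cmod_mult Cmod_inv // !Cmod_mult.
  have F1 := far u w Hu Hw; have F2 := far z w Hz Hw.
  have Q : (/ (Cmod (w - z) * Cmod (w - z) * Cmod (w - u)) <= 8 / (rho * rho * rho))%R.
    have -> : (8 / (rho * rho * rho) = / (rho / 2 * (rho / 2) * (rho / 2)))%R by field; lra.
    apply: Rinv_mono; first by repeat apply: Rmult_lt_0_compat; lra.
    by repeat apply: Rmult_le_compat; try lra; nra.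
  rewrite -Rmult_assoc; apply: Rmult_le_compat_r; first by have := Cmod_ge_0 (u - z); nra.
  apply: Rmult_le_compat => //; first exact: Cmod_ge_0.
    by apply/Rlt_le/Rinv_0_lt_compat; repeat apply: Rmult_lt_0_compat; lra.
  by rewrite wE; apply: HB.
Qed.

Lemma kernel2 g r z : (Cmod z < r)%R -> dcircle g r ->
  exists l, cder (fun u => cmean (fun w => g w * / ((w - u) * (w - u))) r) z l.
Proof.
move=> zr Hg; have z0 := Cmod_ge_0 z; have r0 : (0 <= r)%R by lra.
have [B [B0 HB]] := circ_bounded g r r0 (dcircle_ccircle _ _ Hg).
set rho := (r - Cmod z)%R; have rho0 : (0 < rho)%R by rewrite /rho; lra.
have far u w : (Cmod (u - z) < rho / 2)%R -> Cmod w = r -> (rho / 2 < Cmod (w - u))%R.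
  move=> Hu Hw; have A := Cmod_rev_triangle w u; have A2 := Cmod_rev_triangle u z.
  by move: A A2; rewrite Hw /rho in Hu *; rewrite /rho in Hu; lra.
have nz u w : (Cmod (u - z) < rho / 2)%R -> Cmod w = r -> w - u <> 0.
  by move=> Hu Hw; apply/Cmod_gt_0; have := far u w Hu Hw; lra.
have Hz : (Cmod (z - z) < rho / 2)%R by rewrite Cmod_subrr; lra.
exists (cmean (fun w => g w * (RtoC 2 * / ((w - z) * (w - z) * (w - z)))) r).
apply: (cmean_cder (fun w u => g w * / ((w - u) * (w - u))) _ z r (B * (7 * r * (32 / (rho * rho * rho * rho * rho)))) (rho / 2)) => //; try lra.
- move=> u Hu; apply: dcircle_mult => //; apply: dcircle_inv; first by apply: dcircle_mult; apply: dcircle_subz.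
  by move=> w Hw; apply: Cmult_neq_0; apply: nz.
- apply: dcircle_mult => //; apply: dcircle_mult; first exact: dcircle_const.
  apply: dcircle_inv; first by repeat apply: dcircle_mult; apply: dcircle_subz.
  by move=> w Hw; repeat apply: Cmult_neq_0; apply: nz.
- move=> w u [t [Ht wE]] Hu; have Hw : Cmod w = r by rewrite wE Cmod_circ Rabs_pos_eq.
  have N1 := nz u w Hu Hw; have N2 := nz z w Hz Hw.
  have -> : g w * / ((w - u) * (w - u)) - g w * / ((w - z) * (w - z)) - g w * (RtoC 2 * / ((w - z) * (w - z) * (w - z))) * (u - z) =
    g w * ((RtoC 3 * (w - z) - RtoC 2 * (u - z)) * / ((w - z) * (w - z) * (w - z) * (w - u) * (w - u)) * ((u - z) * (u - z))) by field.
  have N3 : (w - z) * (w - z) * (w - z) * (w - u) * (w - u) <> 0 by repeat apply: Cmult_neq_0.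
  have F1 := far u w Hu Hw; have F2 := far z w Hz Hw.
  have S : (Cmod (RtoC 3 * (w - z) - RtoC 2 * (u - z)) <= 7 * r)%R.
    apply: Rle_trans (Cmod_triangle_sub _ _) _; rewrite !Cmod_mult !Cmod_R !Rabs_pos_eq; try lra.
    have := Cmod_triangle_sub w z; rewrite Hw; rewrite /rho in Hu; lra.
  rewrite !Cmod_mult Cmod_inv // !Cmod_mult.
  have Q : (/ (Cmod (w - z) * Cmod (w - z) * Cmod (w - z) * Cmod (w - u) * Cmod (w - u)) <= 32 / (rho * rho * rho * rho * rho))%R.
    have -> : (32 / (rho * rho * rho * rho * rho) = / (rho / 2 * (rho / 2) * (rho / 2) * (rho / 2) * (rho / 2)))%R by field; lra.
    apply: Rinv_mono; first by repeat apply: Rmult_lt_0_compat; lra.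
    by repeat (apply: Rmult_le_compat; try lra); repeat apply: Rmult_le_pos; lra.
  rewrite -Rmult_assoc; apply: Rmult_le_compat_r; first by have := Cmod_ge_0 (u - z); nra.
  have I0 : (0 <= / (Cmod (w - z) * Cmod (w - z) * Cmod (w - z) * Cmod (w - u) * Cmod (w - u)))%R.
    by apply/Rlt_le/Rinv_0_lt_compat; repeat apply: Rmult_lt_0_compat; lra.
  apply: Rmult_le_compat; [exact: Cmod_ge_0| |by rewrite wE; apply: HB|].
    by apply: Rmult_le_pos => //; apply: Cmod_ge_0.
  by apply: Rmult_le_compat => //; apply: Cmod_ge_0.
Qed.

(** * Holomorphy of derivatives and Cauchy estimates *)

Lemma cauchy_D0 f r R0 z : hol 0 R0 f -> (Cmod z < r < R0)%R ->
  cder f z (cmean (fun w => f w * w * / ((w - z) * (w - z))) r).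
Proof.
move=> Hf Hr; have z0 := Cmod_ge_0 z.
apply: (cder_ext_loc (fun u => cmean (fun w => f w * w * / (w - u)) r) f z _ (r - Cmod z)); first lra.
  move=> u Hu; have A := Cmod_rev_triangle u z.
  rewrite (cauchy_formula f r R0 u) //; last lra.
  by apply: cmean_ext; [lra|move=> w _; rewrite /Cdiv; ring].
apply: kernel1; first lra.
apply: dcircle_mult; last exact: dcircle_id.
by apply: (hol_dcircle f r R0); [|lra].
Qed.

Lemma hol_deriv0 R0 f : hol 0 R0 f -> hol 0 R0 (D f).
Proof.
move=> Hf z; have -> : z - 0 = z by ring. move=> Hz; have z0 := Cmod_ge_0 z.
pose r := ((Cmod z + R0) / 2)%R.
have Hr : (Cmod z < r < R0)%R by rewrite /r; lra.
have dg : dcircle (fun w => f w * w) r.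
  apply: dcircle_mult; last exact: dcircle_id.
  by apply: (hol_dcircle f r R0); [|lra].
have [l Hl] := kernel2 (fun w => f w * w) r z ltac:(lra) dg.
exists l; apply: (cder_ext_loc _ _ _ _ (r - Cmod z)) Hl; first lra.
move=> u Hu; have A := Cmod_rev_triangle u z.
by symmetry; apply: D_eq; apply: (cauchy_D0 f r R0); [|lra].
Qed.

Lemma Cmod_shift_lt c z R0 : (Cmod (z - c) < R0)%R -> (Cmod (z - c - 0) < R0)%R.
Proof. by have -> : z - c - 0 = z - c by ring. Qed.

Lemma hol_deriv c R0 f : hol c R0 f -> hol c R0 (D f).
Proof.
move=> H z Hz; have H0 := hol_deriv0 _ _ (hol_shift _ _ _ H).
have [l Hl] := H0 (z - c) (Cmod_shift_lt _ _ _ Hz).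
have E : c + (z - c) = z by ring.
exists l; rewrite -E; apply/cder_shift.
apply: (cder_ext_loc _ _ _ _ (R0 - Cmod (z - c))) Hl; first lra.
move=> u Hu; have [|m Hm] := H (c + u).
  have -> : c + u - c = (u - (z - c)) + (z - c) by ring.
  by have := Cmod_triangle (u - (z - c)) (z - c); lra.
exact: D_shift Hm.
Qed.

Fixpoint Dn (n : nat) (f : C -> C) : C -> C := match n with O => f | S n' => D (Dn n' f) end.

Lemma hol_Dn n c R0 f : hol c R0 f -> hol c R0 (Dn n f).
Proof. by move=> H; elim: n => [//|n IH]; apply: hol_deriv. Qed.

Lemma Dn_succ_r n f : Dn (S n) f = Dn n (D f).
Proof. by elim: n => [//|n IH] /=; rewrite -IH. Qed.

(** The bounds depend on [B] and [R0] only. This uniformity gives equicontinuity of bounded families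
    and lets derivatives pass to limits along an ultrafilter. *)
Lemma taylor2 c R0 B f : (0 < R0)%R -> hol c R0 f -> (forall z, (Cmod (z - c) < R0)%R -> (Cmod (f z) <= B)%R) ->
  (Cmod (D f c) <= 4 * B / R0)%R /\
  forall w, (Cmod (w - c) <= R0 / 4)%R ->
    (Cmod (f w - f c - D f c * (w - c)) <= 16 * B / (R0 * R0) * (Cmod (w - c) * Cmod (w - c)))%R.
Proof.
move=> R00 Hf HB; pose g w := f (c + w); pose r := (R0 / 2)%R.
have Hg : hol 0 R0 g by apply: hol_shift.
have r0 : (0 < r)%R by rewrite /r; lra.
have dg : dcircle g r by apply: (hol_dcircle g r R0) => //; rewrite /r; lra.
have gB w : Cmod w = r -> (Cmod (g w) <= B)%R.
  by move=> Hw; apply: HB; have -> : c + w - c = w; [ring|rewrite Hw /r; lra].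
have B0 : (0 <= B)%R.
  by apply: Rle_trans (Cmod_ge_0 (g (RtoC r))) (gB _ _); rewrite Cmod_R Rabs_pos_eq; lra.
have c0 : Cmod 0 = 0%R by apply: Cmod_0.
have nz w : Cmod w = r -> w <> 0 by move=> Hw; apply/Cmod_gt_0; lra.
have E0 : c + 0 = c by ring.
have DE : D f c = cmean (fun w => g w * / w) r.
  have Q := cauchy_D0 g r R0 0 Hg ltac:(rewrite c0 /r; lra).
  have Q' := proj2 (cder_shift f c 0 _) Q.
  rewrite -{1}E0 (D_eq _ _ _ Q'); apply: cmean_ext; first lra.
  by move=> w Hw; have -> : w - 0 = w; [ring|field; exact: nz].
have dk : dcircle (fun w => g w * / w) r.
  by apply: dcircle_mult => //; apply: dcircle_inv; [apply: dcircle_id|exact: nz].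
split.
  rewrite DE; have -> : (4 * B / R0 = 2 * (B / r))%R by rewrite /r; field; lra.
  apply: cmean_bound; [lra|exact: dcircle_ccircle|].
  move=> w Hw; rewrite Cmod_mult Cmod_inv ?Hw; last exact: nz.
  by apply: Rmult_le_compat_r; [apply/Rlt_le/Rinv_0_lt_compat|exact: gB].
move=> w Hw; set h := w - c in Hw *.
have wE : w = c + h by rewrite /h; ring.
have Fh := cauchy_formula g r R0 h Hg ltac:(rewrite /r; lra).
have F0 := cauchy_formula g r R0 0 Hg ltac:(rewrite c0 /r; lra).
have nzh u : Cmod u = r -> u - h <> 0 by move=> Hu; apply: Csub_neq0; rewrite Hu /r; lra.
have nz0 u : Cmod u = r -> u - 0 <> 0 by move=> Hu; have -> : u - 0 = u; [ring|exact: nz].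
have d1 : dcircle (fun u => g u * (u / (u - h))) r.
  apply: dcircle_mult => //; apply: dcircle_mult; first exact: dcircle_id.
  by apply: dcircle_inv => //; apply: dcircle_subz.
have d2 : dcircle (fun u => g u * (u / (u - 0))) r.
  apply: dcircle_mult => //; apply: dcircle_mult; first exact: dcircle_id.
  by apply: dcircle_inv => //; apply: dcircle_subz.
have d4 : dcircle (fun u => - h * (g u * / u)) r by apply: dcircle_mult => //; apply: dcircle_const.
have cc a b : dcircle a r -> dcircle b r -> ccircle (fun u => a u - b u) r.
  by move=> Ha Hb u Hu; have [l Hl] := Ha u Hu; have [m Hm] := Hb u Hu; apply: cder_cont (cder_minus _ _ _ _ _ Hl Hm).
have -> : f w - f c - D f c * h = (h * h) * cmean (fun u => g u * (/ u * / (u - h))) r.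
  have dd : dcircle (fun u => g u * (/ u * / (u - h))) r.
    apply: dcircle_mult => //; apply: dcircle_mult; apply: dcircle_inv => //; try exact: nz; try exact: dcircle_id.
    exact: dcircle_subz.
  rewrite -cmean_scal; [|lra|exact: dcircle_ccircle].
  have -> : f w = g h by rewrite wE.
  have -> : f c = g 0 by rewrite /g E0.
  rewrite Fh F0 DE.
  have -> : cmean (fun u => g u * (u / (u - h))) r - cmean (fun u => g u * (u / (u - 0))) r - cmean (fun u => g u * / u) r * h =
    cmean (fun u => (g u * (u / (u - h)) - g u * (u / (u - 0))) + - h * (g u * / u)) r.
    rewrite cmean_plus ?cmean_minus ?cmean_scal; try ring; try lra; try exact: dcircle_ccircle.
    exact: cc.
  apply: cmean_ext; first lra.
  move=> u Hu; have -> : u - 0 = u by ring.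
  by have N1 := nz u Hu; have N2 := nzh u Hu; field.
rewrite Cmod_mult Cmod_mult Rmult_comm; apply: Rmult_le_compat_r; first by have := Cmod_ge_0 h; nra.
have -> : (16 * B / (R0 * R0) = 2 * (B * (/ r * / (R0 / 4))))%R by rewrite /r; field; lra.
apply: cmean_bound; first lra.
  apply: dcircle_ccircle; apply: dcircle_mult => //; apply: dcircle_mult; apply: dcircle_inv => //; try exact: nz; try exact: dcircle_id.
  exact: dcircle_subz.
move=> u Hu; rewrite !Cmod_mult !Cmod_inv ?Hu; [|exact: nzh|exact: nz].
apply: Rmult_le_compat; [exact: Cmod_ge_0| |exact: gB|].
  apply: Rmult_le_pos; first by apply/Rlt_le/Rinv_0_lt_compat.
  by apply/Rlt_le/Rinv_0_lt_compat/Cmod_gt_0/nzh.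
apply: Rmult_le_compat_l; first by apply/Rlt_le/Rinv_0_lt_compat.
apply: Rinv_mono; first lra.
by have := Cmod_rev_triangle u h; rewrite Hu /r; lra.
Qed.

(** The first derivative is bounded by [8 B / R0] on the disc of half the radius; applying the [n]
    remaining ones on that disc costs another [2^n]. *)
Fixpoint cauchyK (n : nat) : R := match n with O => 1%R | S n' => (cauchyK n' * (8 * 2 ^ n'))%R end.

Lemma cauchyK_pos n : (0 < cauchyK n)%R.
Proof. by elim: n => [|n IH] /=; [lra|apply: Rmult_lt_0_compat => //; have := pow_lt 2 n; lra]. Qed.

Lemma cauchy_estimate n c R0 B f : (0 < R0)%R -> hol c R0 f ->
  (forall z, (Cmod (z - c) < R0)%R -> (Cmod (f z) <= B)%R) -> (Cmod (Dn n f c) <= cauchyK n * B / R0 ^ n)%R.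
Proof.
elim: n c R0 B f => [|n IH] c R0 B f R00 Hf HB.
  have -> : (cauchyK 0 * B / R0 ^ 0 = B)%R by rewrite /=; field.
  by apply: HB; rewrite Cmod_subrr.
rewrite Dn_succ_r.
have -> : (cauchyK (S n) * B / R0 ^ S n = cauchyK n * (8 * B / R0) / (R0 / 2) ^ n)%R.
  rewrite /Rdiv Rpow_mult_distr pow_inv /=; field.
  by repeat split; first [lra|apply: pow_nonzero; lra].
apply: IH; first lra.
  by apply: (hol_sub c R0); [exact: hol_deriv|move=> z; lra].
move=> z Hz; have -> : (8 * B / R0 = 4 * B / (R0 / 2))%R by field; lra.
have S u : (Cmod (u - z) < R0 / 2)%R -> (Cmod (u - c) < R0)%R.
  by move=> Hu; have := Cmod_sub_tri u z c; lra.
apply: (proj1 (taylor2 z (R0 / 2) B f _ _ _)); [lra|exact: hol_sub Hf S|by move=> u /S /HB].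
Qed.

(** * Zeros of holomorphic functions *)

Lemma Cmult_integral (a b : C) : a * b = 0 -> a = 0 \/ b = 0.
Proof.
move=> E; have [|A] := classic (a = 0); [by left|right]; apply: NNPP => B.
exact: Cmult_neq_0 A B E.
Qed.

Lemma Rle_eps0 (x : R) K : (0 <= x)%R -> (forall e, (0 < e <= 1)%R -> (x <= K * e)%R) -> x = 0%R.
Proof.
move=> x0 H; apply: Rle_antisym => //; apply: le_epsilon => e e0; rewrite Rplus_0_l.
have K0 := Rabs_pos K.
pose d := Rmin 1 (e / (Rabs K + 1)).
have d0 : (0 < d)%R by apply: Rmin_pos; [lra|apply: Rdiv_lt_0_compat; lra].
have d1 : (d <= 1)%R by apply: Rmin_l.
have d2 : (d <= e / (Rabs K + 1))%R by apply: Rmin_r.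
apply: Rle_trans (H d _) _; first lra.
apply: (Rle_trans _ ((Rabs K + 1) * d)%R).
  by apply: Rmult_le_compat_r; [lra|have := Rle_abs K; lra].
have -> : e = ((Rabs K + 1) * (e / (Rabs K + 1)))%R by field; lra.
by apply: Rmult_le_compat_l; lra.
Qed.

Lemma Cpow_continuous_lim (x : R) n : (0 <= x < 1)%R -> forall e, (0 < e)%R -> exists N, (x ^ (N + n) < e)%R.
Proof.
move=> Hx e e0; have [N HN] := pow_lt_1_zero x ltac:(rewrite Rabs_pos_eq; lra) e e0.
exists N; have := HN (N + n)%nat ltac:(lia); rewrite Rabs_pos_eq //; apply: pow_le; lra.
Qed.

(** For [f] holomorphic beyond the circle this is [f] minus its Taylor polynomial of degree less
    than [n], divided by [z^n], in integral form; its value at 0 is the Taylor coefficient of index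
    [n]. *)
Definition taylor_rem (f : C -> C) (r : R) (n : nat) (z : C) : C :=
  cmean (fun w => f w * w * / w ^ n * / (w - z)) r.

Section Factor0.
Variables (f : C -> C) (R0 : R).
Hypothesis Hf : hol 0 R0 f.

Lemma taylor_rem_dcircle r n : (0 < r < R0)%R -> dcircle (fun w => f w * w * / w ^ n) r.
Proof.
move=> Hr; apply: dcircle_mult.
  by apply: dcircle_mult; [apply: (hol_dcircle f r R0) => //; lra|apply: dcircle_id].
apply: dcircle_inv; first by apply: dcircle_pow; apply: dcircle_id.
by move=> w Hw; apply: Cpow_nz; apply/Cmod_gt_0; lra.
Qed.

Lemma taylor_rem_dcircle' r n z : (Cmod z < r < R0)%R -> dcircle (fun w => f w * w * / w ^ n * / (w - z)) r.
Proof.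
move=> Hr; have z0 := Cmod_ge_0 z; apply: dcircle_mult; first by apply: taylor_rem_dcircle; lra.
apply: dcircle_inv; first exact: dcircle_subz.
by move=> w Hw; apply: Csub_neq0; lra.
Qed.

Lemma taylor_rem_hol r n : (0 < r < R0)%R -> hol 0 r (taylor_rem f r n).
Proof.
move=> Hr z; have -> : z - 0 = z by ring. move=> Hz.
by eexists; apply: kernel1 => //; apply: taylor_rem_dcircle.
Qed.

Lemma taylor_rem_step r n z : (Cmod z < r < R0)%R ->
  taylor_rem f r n z = taylor_rem f r n 0 + z * taylor_rem f r (S n) z.
Proof.
move=> Hr; have z0 := Cmod_ge_0 z.
have H0 : (Cmod 0 < r < R0)%R by rewrite Cmod_0; lra.
rewrite /taylor_rem -cmean_scal; [|lra|exact/dcircle_ccircle/taylor_rem_dcircle'].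
rewrite -cmean_plus; [|lra|exact/dcircle_ccircle/taylor_rem_dcircle'|].
  apply: cmean_ext; first lra.
  move=> w Hw; have N1 : w <> 0 by apply/Cmod_gt_0; lra.
  have N2 : w - z <> 0 by apply: Csub_neq0; lra.
  have N3 := Cpow_nz w n N1.
  have -> : w - 0 = w by ring.
  by rewrite Cpow_S; field.
by apply/dcircle_ccircle/dcircle_mult; [apply: dcircle_const|apply: taylor_rem_dcircle'].
Qed.

Lemma taylor_rem_zero r n z : (Cmod z < r < R0)%R -> (forall k, (k < n)%nat -> taylor_rem f r k 0 = 0) ->
  f z = z ^ n * taylor_rem f r n z.
Proof.
move=> Hr H; elim: n H => [|n IH] H.
  rewrite /= (cauchy_formula f r R0 z) // Cmult_1_l; apply: cmean_ext.
    by have := Cmod_ge_0 z; lra.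
  move=> w Hw; have N2 : w - z <> 0 by apply: Csub_neq0; lra.
  by rewrite /=; field.
rewrite IH; last by move=> k Hk; apply: H; lia.
by rewrite taylor_rem_step // H; [rewrite Cpow_S; ring|lia].
Qed.

Lemma taylor_rem_bound r z : (Cmod z < r < R0)%R -> exists K, forall n, (Cmod (taylor_rem f r n z) <= K / r ^ n)%R.
Proof.
move=> Hr; have z0 := Cmod_ge_0 z.
have [B [B0 HB]] := circ_bounded f r ltac:(lra) (dcircle_ccircle _ _ (hol_dcircle f r R0 Hf ltac:(lra))).
exists (2 * (B * r * / (r - Cmod z)))%R => n.
have P : (0 < r ^ n)%R by apply: pow_lt; lra.
have -> : (2 * (B * r * / (r - Cmod z)) / r ^ n = 2 * (B * r * / r ^ n * / (r - Cmod z)))%R by field; lra.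
apply: cmean_bound_t; first lra.
  exact/dcircle_ccircle/taylor_rem_dcircle'.
move=> t Ht; set w := circ r t; have Hw : Cmod w = r by rewrite Cmod_circ Rabs_pos_eq; lra.
have N1 : w <> 0 by apply/Cmod_gt_0; lra.
have N2 : w - z <> 0 by apply: Csub_neq0; lra.
rewrite !Cmod_mult !Cmod_inv //; last exact: Cpow_nz.
rewrite Cmod_pow Hw; apply: Rmult_le_compat.
- apply: Rmult_le_pos; last exact/Rlt_le/Rinv_0_lt_compat.
  by apply: Rmult_le_pos; [apply: Cmod_ge_0|lra].
- by apply/Rlt_le/Rinv_0_lt_compat/Cmod_gt_0.
- apply: Rmult_le_compat_r; first exact/Rlt_le/Rinv_0_lt_compat.
  by apply: Rmult_le_compat_r; [lra|apply: HB].
- by apply: Rinv_mono; [lra|have := Cmod_rev_triangle w z; lra].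
Qed.

Lemma taylor_rem_radius r s n : (0 < r < R0)%R -> (0 < s < R0)%R -> taylor_rem f r n 0 = taylor_rem f s n 0.
Proof.
move=> Hr Hs; apply: (cmean_annulus _ 0 R0) => //; try lra.
move=> w Hw; have N1 : w <> 0 by apply/Cmod_gt_0; lra.
have [|l Hl] := Hf w; first by have -> : w - 0 = w; [ring|lra].
have [m Hm] := cder_pow _ _ _ n (cder_id w).
eexists; apply: cder_mult.
  apply: cder_mult; first by apply: cder_mult; [exact: Hl|exact: cder_id].
  by apply: cder_inv; [exact: Hm|exact: Cpow_nz].
apply: cder_inv; first by apply: cder_minus; [apply: cder_id|apply: cder_const].
by have -> : w - 0 = w; [ring|].
Qed.

(** If all Taylor coefficients vanish, then [|f z| <= K (|z| / s)^n] for every [n]. Otherwise the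
    first coefficient that does not vanish gives the order, and the remainder of that index is the
    other factor. *)
Lemma factor0 : (0 < R0)%R -> (forall z, (Cmod z < R0)%R -> f z = 0) \/
  exists n u, hol 0 R0 u /\ u 0 <> 0 /\ forall z, (Cmod z < R0)%R -> f z = z ^ n * u z.
Proof.
move=> R00; pose r := (R0 / 2)%R; have Hr : (0 < r < R0)%R by rewrite /r; lra.
have [A|A] := classic (forall n, taylor_rem f r n 0 = 0).
  left=> z Hz; have z0 := Cmod_ge_0 z.
  pose s := ((Cmod z + R0) / 2)%R; have Hs : (Cmod z < s < R0)%R by rewrite /s; lra.
  have As n : taylor_rem f s n 0 = 0 by rewrite -(taylor_rem_radius r) //; lra.
  have [K HK] := taylor_rem_bound s z Hs.
  apply: Cmod_eq_0; apply: (Rle_eps0 _ K); first exact: Cmod_ge_0.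
  move=> e He; have [n Hn] := Cpow_continuous_lim (Cmod z / s) 0 ltac:(split; [apply: Rdiv_le_0_compat; lra|
    apply: (Rmult_lt_reg_r s); [lra|rewrite /Rdiv Rmult_assoc Rinv_l; lra]]) e ltac:(lra).
  rewrite Nat.add_0_r in Hn.
  rewrite (taylor_rem_zero s n z Hs) // Cmod_mult Cmod_pow.
  have P : (0 < s ^ n)%R by apply: pow_lt; lra.
  have K0 : (0 <= K)%R.
    have := HK 0%nat; have := Cmod_ge_0 (taylor_rem f s 0 z); rewrite /= /Rdiv Rinv_1; lra.
  apply: (Rle_trans _ (Cmod z ^ n * (K / s ^ n))%R).
    by apply: Rmult_le_compat_l => //; apply: pow_le.
  have -> : (Cmod z ^ n * (K / s ^ n) = K * (Cmod z / s) ^ n)%R.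
    by rewrite /Rdiv Rpow_mult_distr pow_inv; field; lra.
  by apply: Rmult_le_compat_l => //; lra.
right; have [n [Hn Hmin]] : exists n, taylor_rem f r n 0 <> 0 /\ forall k, (k < n)%nat -> taylor_rem f r k 0 = 0.
  have [n Hn] := not_all_ex_not _ _ A.
  have [m [[M1 M2] _]] := dec_inh_nat_subset_has_unique_least_element (fun n => taylor_rem f r n 0 <> 0)
    (fun n => classic _) (ex_intro _ n Hn).
  exists m; split=> // k Hk; apply: NNPP => N; have := M2 k N; lia.
(* Near 0 this agrees with [taylor_rem f r n]; the quotient defines it on the rest of the disc. *)
pose u (z : C) : C := if excluded_middle_informative (z = 0) then taylor_rem f r n 0 else f z * / z ^ n.
have uE z : (Cmod z < r)%R -> u z = taylor_rem f r n z.
  move=> Hz; rewrite /u; case: excluded_middle_informative => [E|N] /=; first by rewrite E.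
  by rewrite (taylor_rem_zero r n z) //; [field; apply: Cpow_nz|lra].
have u0 : u 0 = taylor_rem f r n 0 by rewrite uE // Cmod_0; lra.
exists n, u; split; last split.
- move=> z; have -> : z - 0 = z by ring. move=> Hz.
  have [Hz1|Hz1] := Rlt_le_dec (Cmod z) r.
    have [|l Hl] := taylor_rem_hol r n Hr z; first by have -> : z - 0 = z by ring.
    exists l; apply: (cder_ext_loc _ _ _ _ (r - Cmod z)) Hl; first lra.
    by move=> w Hw; rewrite uE //; have := Cmod_rev_triangle w z; lra.
  have N : z <> 0 by apply/Cmod_gt_0; lra.
  have [|l Hl] := Hf z; first by have -> : z - 0 = z; [ring|].
  have [m Hm] := cder_pow _ _ _ n (cder_id z).
  eexists; apply: (cder_ext_loc (fun z => f z * / z ^ n) _ _ _ (Cmod z)).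
  + exact/Cmod_gt_0.
  + move=> w Hw; rewrite /u; case: excluded_middle_informative => [E|//].
    have := Hw; rewrite {1}E Cmod_sub_sym; have -> : z - 0 = z by ring.
    by move/Rlt_irrefl.
  + by apply: cder_mult Hl _; apply: cder_inv Hm _; apply: Cpow_nz.
- by rewrite u0.
- move=> z Hz; rewrite /u; case: excluded_middle_informative => [E|N] /=.
    by rewrite E; apply: taylor_rem_zero => //; rewrite Cmod_0.
  by field; apply: Cpow_nz.
Qed.
End Factor0.

Lemma factor_zero c R0 f : (0 < R0)%R -> hol c R0 f -> (forall z, (Cmod (z - c) < R0)%R -> f z = 0) \/
  exists n u, hol c R0 u /\ u c <> 0 /\ forall z, (Cmod (z - c) < R0)%R -> f z = (z - c) ^ n * u z.
Proof.
move=> R00 Hf; have E z : c + (z - c) = z by ring.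
case: (factor0 (fun w => f (c + w)) R0 (hol_shift _ _ _ Hf) R00) => [H|[n [u [Hu [Hu0 H]]]]].
  by left=> z Hz; have := H _ Hz; rewrite E.
right; exists n, (fun z => u (z - c)); split; last split.
- apply: hol_comp Hu _ _; first by apply: hol_minus; [apply: hol_id|apply: hol_const].
  by move=> z Hz; have -> : z - c - 0 = z - c by ring.
- by have -> : c - c = 0 by ring.
- by move=> z Hz; have := H _ Hz; rewrite E.
Qed.

Lemma hol_near_neq0 c r u : (0 < r)%R -> hol c r u -> u c <> 0 -> exists d, (0 < d <= r)%R /\
  forall w, (Cmod (w - c) < d)%R -> u w <> 0.
Proof.
move=> r0 Hu N; have Hc : ccont u c by apply: hol_cont Hu _; rewrite Cmod_subrr.
have [d [d0 Hd]] := ccont_neq0 u c Hc N.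
exists (Rmin d r); split; first by split; [exact: Rmin_pos|exact: Rmin_r].
move=> w Hw; apply/Cmod_gt_0; have := Hd w (Rlt_le_trans _ _ _ Hw (Rmin_l _ _)).
by have := Cmod_ge_0 (u c); lra.
Qed.

Lemma point_near (c : C) d : (0 < d)%R -> exists w, w <> c /\ (Cmod (w - c) = d)%R.
Proof.
move=> d0; exists (c + RtoC d); have E : c + RtoC d - c = RtoC d by ring.
rewrite E Cmod_R Rabs_pos_eq; last lra.
split=> // Q; have : Cmod (c + RtoC d - c) = 0%R by rewrite Q Cmod_subrr.
by rewrite E Cmod_R Rabs_pos_eq; lra.
Qed.

Lemma Csub_nz (w c : C) : w <> c -> w - c <> 0.
Proof. by move=> N E; apply: N; have -> : w = (w - c) + c; [ring|rewrite E; ring]. Qed.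

Lemma identity_center c r s f : (0 < s)%R -> hol c r f -> (forall z, (Cmod (z - c) < s)%R -> f z = 0) ->
  forall z, (Cmod (z - c) < r)%R -> f z = 0.
Proof.
move=> s0 Hf H z Hz; have r0 : (0 < r)%R by have := Cmod_ge_0 (z - c); lra.
case: (factor_zero c r f r0 Hf) => [|[n [u [Hu [Hu0 E]]]]]; first by apply.
have [d [Hd Hn]] := hol_near_neq0 c r u r0 Hu Hu0.
have [w [wc Hw]] := point_near c (Rmin d s / 2) ltac:(have := Rmin_pos d s ltac:(lra) s0; lra).
have m1 := Rmin_l d s; have m2 := Rmin_r d s; have m3 := Rmin_pos d s ltac:(lra) s0.
have := H w ltac:(lra); rewrite E; last lra.
by move/Cmult_integral => [/(Cpow_nz _ n (Csub_nz _ _ wc)) //|]; move/(Hn w ltac:(lra)).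
Qed.

Lemma mult_eq0 c r f g : (0 < r)%R -> hol c r f -> hol c r g ->
  (forall z, (Cmod (z - c) < r)%R -> f z * g z = 0) ->
  (forall z, (Cmod (z - c) < r)%R -> f z = 0) \/ (forall z, (Cmod (z - c) < r)%R -> g z = 0).
Proof.
move=> r0 Hf Hg H.
case: (factor_zero c r f r0 Hf) => [|[n [u [Hu [Hu0 Eu]]]]]; first by left.
case: (factor_zero c r g r0 Hg) => [|[m [v [Hv [Hv0 Ev]]]]]; first by right.
have [d [Hd Hn]] := hol_near_neq0 c r u r0 Hu Hu0; have [d' [Hd' Hn']] := hol_near_neq0 c r v r0 Hv Hv0.
have m3 := Rmin_pos d d' ltac:(lra) ltac:(lra).
have [w [wc Hw]] := point_near c (Rmin d d' / 2) ltac:(lra).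
have m1 := Rmin_l d d'; have m2 := Rmin_r d d'; have N := Csub_nz _ _ wc.
have := H w ltac:(lra); rewrite Eu ?Ev; try lra.
move/Cmult_integral => [] /Cmult_integral [].
- by move/(Cpow_nz _ n N).
- by move/(Hn w ltac:(lra)).
- by move/(Cpow_nz _ m N).
- by move/(Hn' w ltac:(lra)).
Qed.

(** Vanishing spreads along the segment from [w] to [c] through discs of the common radius [rho],
    each centred within [rho / 2] of the previous one. *)
Lemma identity_disc c r f w s : hol c r f -> (Cmod (w - c) < r)%R -> (0 < s)%R ->
  (forall z, (Cmod (z - w) < s)%R -> f z = 0) -> forall z, (Cmod (z - c) < r)%R -> f z = 0.
Proof.
move=> Hf Hw s0 H.
have a0 := Cmod_ge_0 (w - c); set rho := (r - Cmod (w - c))%R; have rho0 : (0 < rho)%R by rewrite /rho; lra.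
have [N HN] : exists N, (Cmod (w - c) < INR N * (rho / 2))%R.
  have [N HN] := INR_unbounded (Cmod (w - c) / (rho / 2)).
  exists N; have -> : Cmod (w - c) = (Cmod (w - c) / (rho / 2) * (rho / 2))%R by field; lra.
  by apply: Rmult_lt_compat_r; lra.
have N0 : (0 < INR N)%R.
  have : (0 < INR N * (rho / 2))%R by lra.
  by move=> Q; apply: (Rmult_lt_reg_r (rho / 2)); lra.
pose p (j : nat) := w + RtoC (INR j / INR N) * (c - w).
have pc j : (j <= N)%nat -> (Cmod (p j - c) <= Cmod (w - c))%R.
  move=> Hj; have -> : p j - c = RtoC (1 - INR j / INR N) * (w - c) by rewrite /p RtoC_minus; ring.
  rewrite Cmod_mult Cmod_R -{2}(Rmult_1_l (Cmod (w - c))); apply: Rmult_le_compat_r => //.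
  have J := le_INR _ _ Hj; have J0 := pos_INR j.
  have A : (0 <= INR j / INR N)%R by apply: Rdiv_le_0_compat.
  have B : (INR j / INR N <= 1)%R.
    by apply: (Rmult_le_reg_r (INR N)) => //; rewrite /Rdiv Rmult_assoc Rinv_l; lra.
  by apply: Rabs_le; lra.
have pstep j : (Cmod (p (S j) - p j) < rho / 2)%R.
  have -> : p (S j) - p j = RtoC (/ INR N) * (c - w).
    rewrite /p S_INR; have -> : ((INR j + 1) / INR N = INR j / INR N + / INR N)%R by field; lra.
    by rewrite RtoC_plus; ring.
  rewrite Cmod_mult Cmod_R Rabs_pos_eq; last by apply/Rlt_le/Rinv_0_lt_compat.
  rewrite Cmod_sub_sym; apply: (Rmult_lt_reg_l (INR N)) => //.
  by rewrite -Rmult_assoc Rinv_r; lra.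
have sub j : (j <= N)%nat -> hol (p j) rho f.
  move=> Hj; apply: hol_sub Hf _ => z Hz.
  by have := Cmod_sub_tri z (p j) c; have := pc j Hj; rewrite /rho in Hz; lra.
have Z j : (j <= N)%nat -> forall z, (Cmod (z - p j) < rho)%R -> f z = 0.
  elim: j => [|j IH] Hj.
    apply: (identity_center _ _ s) => //; first exact: sub.
    have -> : p 0%nat = w by rewrite /p /= /Rdiv Rmult_0_l; ring.
    exact: H.
  apply: (identity_center _ _ (rho / 2)); [lra|exact: sub|].
  move=> z Hz; apply: IH; first lia.
  by have := Cmod_sub_tri z (p (S j)) (p j); have := pstep j; lra.
apply: (identity_center c r rho) => //.
have -> : c = p N by rewrite /p /Rdiv Rinv_r; [ring|lra].
exact: Z.
Qed.

(** * Removable singularities and Liouville's theorem *)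

(** Compare the orders [a] of [A] and [b] of [B] at [c]: the inequality excludes [a < b], and
    otherwise the quotient is [(z - c)^(a - b) A1 / B1]. At [c] itself the bound follows by
    continuity. *)
Lemma bounded_quotient c r K A B : (0 < r)%R -> hol c r A -> hol c r B ->
  ~ (forall z, (Cmod (z - c) < r)%R -> B z = 0) ->
  (forall z, (Cmod (z - c) < r)%R -> B z <> 0 -> (Cmod (A z) <= K * Cmod (B z))%R) ->
  exists d H, (0 < d <= r)%R /\ hol c d H /\
    forall z, (Cmod (z - c) < d)%R -> A z = H z * B z /\ (Cmod (H z) <= K)%R.
Proof.
move=> r0 HA HB NB HK.
case: (factor_zero c r B r0 HB) => [//|[b [B1 [hB1 [nB1 EB]]]]].
have [d [Hd Hn]] := hol_near_neq0 c r B1 r0 hB1 nB1.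
have Bn z : (Cmod (z - c) < d)%R -> z <> c -> B z <> 0.
  move=> Hz N; rewrite EB; last lra.
  by apply: Cmult_neq_0; [apply/Cpow_nz/Csub_nz|apply: Hn].
suff [H [hH EH]] : exists H, hol c d H /\ forall z, (Cmod (z - c) < d)%R -> A z = H z * B z.
  exists d, H; split=> //; split=> // z Hz; split; first exact: EH.
  have Q w : (Cmod (w - c) < d)%R -> w <> c -> (Cmod (H w) <= K)%R.
    move=> Hw N; have Nb := Bn w Hw N; have P := proj1 (Cmod_gt_0 _) Nb.
    apply: (Rmult_le_reg_r (Cmod (B w))) => //; rewrite -Cmod_mult -EH //.
    by apply: HK => //; lra.
  have [E|N] := classic (z = c); last exact: Q.
  rewrite E; apply: le_epsilon => e e0.
  have Hc : ccont H c by apply: hol_cont hH _; rewrite Cmod_subrr; lra.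
  have [d' [d'0 Hd']] := Hc e e0.
  have m3 := Rmin_pos d d' ltac:(lra) d'0; have m1 := Rmin_l d d'; have m2 := Rmin_r d d'.
  have [w [wc Hw]] := point_near c (Rmin d d' / 2) ltac:(lra).
  have := Hd' w ltac:(lra); have := Q w ltac:(lra) wc.
  by have := Cmod_rev_triangle (H c) (H w); rewrite Cmod_sub_sym; lra.
have hI : hol c d (fun z => / B1 z) by apply: hol_inv => //; apply: hol_sub hB1 _ => z; lra.
case: (factor_zero c r A r0 HA) => [A0|[a [A1 [hA1 [nA1 EA]]]]].
  by exists (fun _ => 0); split; [apply: hol_const|move=> z Hz; rewrite A0; [ring|lra]].
have [L|L] := PeanoNat.Nat.le_gt_cases b a.
  exists (fun z => (z - c) ^ (a - b) * A1 z * / B1 z); split.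
    apply: hol_mult hI; apply: hol_mult; last by apply: hol_sub hA1 _ => z; lra.
    by apply: hol_pow; apply: hol_minus; [apply: hol_id|apply: hol_const].
  move=> z Hz; rewrite EA ?EB; try lra.
  have -> : (a = (a - b) + b)%nat by lia.
  have -> : (a - b + b - b)%nat = (a - b)%nat by lia.
  rewrite Cpow_add_r; field; exact: Hn.
exfalso; apply: nA1.
have Hc1 : ccont A1 c by apply: hol_cont hA1 _; rewrite Cmod_subrr; lra.
have Hc2 : ccont B1 c by apply: hol_cont hB1 _; rewrite Cmod_subrr; lra.
apply: Cmod_eq_0; apply: (Rle_eps0 _ (1 + Rabs K * (Cmod (B1 c) + 1))); first exact: Cmod_ge_0.
move=> e He.
have [d1 [d10 Hd1]] := Hc1 e ltac:(lra); have [d2 [d20 Hd2]] := Hc2 1%R Rlt_0_1.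
pose s := Rmin (Rmin d1 d2) (Rmin d e).
have s0 : (0 < s)%R by repeat apply: Rmin_pos; lra.
have s1 : (s <= d1)%R by apply: Rle_trans (Rmin_l _ _) (Rmin_l _ _).
have s2 : (s <= d2)%R by apply: Rle_trans (Rmin_l _ _) (Rmin_r _ _).
have s3 : (s <= d)%R by apply: Rle_trans (Rmin_r _ _) (Rmin_l _ _).
have s4 : (s <= e)%R by apply: Rle_trans (Rmin_r _ _) (Rmin_r _ _).
have [w [wc Hw]] := point_near c (s / 2) ltac:(lra).
have Nw := Csub_nz _ _ wc.
have := HK w ltac:(lra) (Bn w ltac:(lra) wc); rewrite EA ?EB; try lra.
rewrite !Cmod_mult !Cmod_pow Hw.
have -> : (b = a + (S (b - a - 1)))%nat by lia.
rewrite pow_add => Q.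
have Pa : (0 < (s / 2) ^ a)%R by apply: pow_lt; lra.
have {}Q : (Cmod (A1 w) <= Rabs K * ((s / 2) ^ S (b - a - 1) * Cmod (B1 w)))%R.
  apply: (Rmult_le_reg_l ((s / 2) ^ a)) => //; apply: Rle_trans Q _.
  have -> : ((s / 2) ^ a * (Rabs K * ((s / 2) ^ S (b - a - 1) * Cmod (B1 w))) =
    Rabs K * ((s / 2) ^ a * (s / 2) ^ S (b - a - 1) * Cmod (B1 w)))%R by ring.
  apply: Rmult_le_compat_r; last exact: Rle_abs.
  apply: Rmult_le_pos; last exact: Cmod_ge_0.
  by apply: Rmult_le_pos; apply: pow_le; lra.
have P1 : ((s / 2) ^ S (b - a - 1) <= e)%R.
  rewrite /=; apply: (Rle_trans _ (s / 2 * 1)%R); last lra.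
  by apply: Rmult_le_compat_l; [lra|rewrite -(pow1 (b - a - 1)); apply: pow_incr; lra].
have := Hd1 w ltac:(lra); have := Hd2 w ltac:(lra).
have T1 := Cmod_rev_triangle (A1 c) (A1 w); have T2 := Cmod_rev_triangle (B1 w) (B1 c).
rewrite (Cmod_sub_sym (A1 c)) in T1.
have Q2 : ((s / 2) ^ S (b - a - 1) * Cmod (B1 w) <= e * Cmod (B1 w))%R by apply: Rmult_le_compat_r => //; apply: Cmod_ge_0.
have Q3 : (Rabs K * ((s / 2) ^ S (b - a - 1) * Cmod (B1 w)) <= Rabs K * (e * Cmod (B1 w)))%R.
  by apply: Rmult_le_compat_l => //; apply: Rabs_pos.
move=> X Y.
have Q4 : (Rabs K * (e * Cmod (B1 w)) <= Rabs K * (e * (Cmod (B1 c) + 1)))%R.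
  apply: Rmult_le_compat_l; first exact: Rabs_pos.
  by apply: Rmult_le_compat_l; lra.
nra.
Qed.

Lemma liouville K H : (forall z, exists l, cder H z l) -> (forall z, (Cmod (H z) <= K)%R) -> forall z, H z = H 0.
Proof.
move=> hH HK z.
have z0 := Cmod_ge_0 z; have K0 : (0 <= K)%R by apply: Rle_trans (Cmod_ge_0 (H 0)) (HK _).
have hh r : hol 0 r H by move=> w _; apply: hH.
suff /Cmod_eq_0 E : Cmod (H z - H 0) = 0%R by have -> : H z = (H z - H 0) + H 0; [ring|rewrite E; ring].
apply: (Rle_eps0 _ (4 * K * Cmod z + 16 * K * (Cmod z * Cmod z))); first exact: Cmod_ge_0.
move=> e He.
pose r := (/ e + 4 * Cmod z)%R; have e1 : (0 < / e)%R by apply: Rinv_0_lt_compat; lra.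
have r0 : (0 < r)%R by rewrite /r; lra.
have [T1 T2] := taylor2 0 r K H r0 (hh r) (fun w _ => HK w).
have E0 : z - 0 = z by ring.
have {}T2 := T2 z; rewrite E0 in T2; have {}T2 := T2 ltac:(rewrite /r; lra).
have -> : H z - H 0 = (H z - H 0 - D H 0 * z) + D H 0 * z by ring.
apply: Rle_trans (Cmod_triangle _ _) _; rewrite Cmod_mult.
have re : (/ r <= e)%R.
  by rewrite -(Rinv_inv e); apply: Rinv_mono => //; rewrite /r; lra.
have ir : (0 < / r)%R by apply: Rinv_0_lt_compat.
have A : (Cmod (D H 0) * Cmod z <= 4 * K * e * Cmod z)%R.
  apply: Rmult_le_compat_r => //; apply: Rle_trans T1 _; rewrite /Rdiv.
  by apply: Rmult_le_compat_l; lra.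
have B : (16 * K / (r * r) * (Cmod z * Cmod z) <= 16 * K * e * (Cmod z * Cmod z))%R.
  apply: Rmult_le_compat_r; first nra.
  rewrite /Rdiv; apply: Rmult_le_compat_l; first lra.
  by rewrite Rinv_mult; nra.
nra.
Qed.

Lemma hol_bounded R0 r f : hol 0 R0 f -> (0 < r < R0)%R -> exists B, forall z, (Cmod z < r)%R -> (Cmod (f z) <= B)%R.
Proof.
move=> Hf Hr; pose s := ((r + R0) / 2)%R; have Hs : (r < s < R0)%R by rewrite /s; lra.
have ds : dcircle f s by apply: (hol_dcircle f s R0) => //; lra.
have [B [B0 HB]] := circ_bounded f s ltac:(lra) (dcircle_ccircle _ _ ds).
exists (2 * (B * (s * / (s - r))))%R => z Hz; have z0 := Cmod_ge_0 z.
have nz w : Cmod w = s -> w - z <> 0 by move=> Hw; apply: Csub_neq0; lra.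
rewrite (cauchy_formula f s R0 z) //; last lra.
apply: cmean_bound_t; first lra.
  apply: dcircle_ccircle; apply: dcircle_mult => //; apply: dcircle_mult; first exact: dcircle_id.
  by apply: dcircle_inv => //; apply: dcircle_subz.
move=> t Ht; set w := circ s t; have Hw : Cmod w = s by rewrite Cmod_circ Rabs_pos_eq; lra.
rewrite Cmod_mult Cmod_div; last exact: nz.
apply: Rmult_le_compat; [exact: Cmod_ge_0| |exact: HB|].
  by apply: Rdiv_le_0_compat; [apply: Cmod_ge_0|apply/Cmod_gt_0/nz].
rewrite Hw; apply: Rmult_le_compat_l; first lra.
by apply: Rinv_mono; [lra|have := Cmod_rev_triangle w z; lra].
Qed.

(** * Primitives and logarithms *)

Lemma cder_real_re G t l : cder G (RtoC t) l -> is_derive (fun s => fst (G (RtoC s))) t (fst l).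
Proof.
move=> H; apply/is_derive_Reals => e e0; case: (H (e / 2)%R ltac:(lra)) => d [d0 Hd].
exists (mkposreal d d0) => h h0 /= hd.
have E : RtoC (t + h) - RtoC t = RtoC h by rewrite RtoC_plus; ring.
have := Hd (RtoC (t + h)); rewrite E Cmod_R => /(_ hd) Q.
have := Rle_trans _ _ _ (fst_le_Cmod _) Q.
set a := G _; set b := G _; have -> : fst (a - b - l * RtoC h) = (((fst a - fst b) / h - fst l) * h)%R.
  by rewrite /= ; field.
rewrite Rabs_mult => Q2; have hp := Rabs_pos_lt h h0.
by have := Rmult_le_reg_r _ _ _ hp Q2; lra.
Qed.

Lemma cder_real_im G t l : cder G (RtoC t) l -> is_derive (fun s => snd (G (RtoC s))) t (snd l).
Proof.
move=> /(cder_scal _ (- Ci)) /cder_real_re H.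
have -> : snd l = fst (- Ci * l) by rewrite /=; ring.
by apply: is_derive_ext H => s /=; ring.
Qed.

Lemma CI_deriv (G G' : C -> C) a b : (a <= b)%R ->
  (forall t, (a <= t <= b)%R -> cder G (RtoC t) (G' (RtoC t)) /\ ccont G' (RtoC t)) ->
  CI (fun t => G' (RtoC t)) a b = G (RtoC b) - G (RtoC a).
Proof.
move=> ab H; have rc t : (a <= t <= b)%R -> rcont (fun t => G' (RtoC t)) t.
  by move=> Ht; apply: rcont_comp (rcont_RtoC t) _; case: (H t Ht).
rewrite /CI /Cminus /Cplus /Copp /=; congr pair; apply: is_RInt_unique.
  apply: (is_RInt_derive (fun t => fst (G (RtoC t))) (fun t => fst (G' (RtoC t)))) => t;
  rewrite Rmin_left // Rmax_right // => Ht.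
    by apply: cder_real_re; case: (H t Ht).
  exact/rcont_re/rc.
apply: (is_RInt_derive (fun t => snd (G (RtoC t))) (fun t => snd (G' (RtoC t)))) => t;
rewrite Rmin_left // Rmax_right // => Ht.
  by apply: cder_real_im; case: (H t Ht).
exact/rcont_im/rc.
Qed.

Lemma scale_lt t z r : (0 <= t <= 1)%R -> (Cmod z < r)%R -> (Cmod (RtoC t * z) < r)%R.
Proof. by move=> Ht Hz; rewrite Cmod_mult Cmod_R Rabs_pos_eq; [have := Cmod_ge_0 z; nra|lra]. Qed.

Lemma hol0_D R0 f z : hol 0 R0 f -> (Cmod z < R0)%R -> cder f z (D f z).
Proof. by move=> H Hz; apply: hol_D H _; have -> : z - 0 = z by ring. Qed.

(** The primitive is an integral along the radius; [taylor2] expands the integrand to second order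
    uniformly in [t], which allows differentiation under the integral. *)
Lemma primitive0 R0 f : (0 < R0)%R -> hol 0 R0 f -> exists P : C -> C, P 0 = 0 /\ forall z, (Cmod z < R0)%R -> cder P z (f z).
Proof.
move=> R00 Hf; pose P (z : C) := CI (fun t => z * f (RtoC t * z)) 0 1.
have psid t z : (0 <= t <= 1)%R -> (Cmod z < R0)%R ->
  cder (fun u => u * f (RtoC t * u)) z (f (RtoC t * z) + z * (D f (RtoC t * z) * RtoC t)).
  move=> Ht Hz; have E : f (RtoC t * z) + z * (D f (RtoC t * z) * RtoC t) =
    1 * f (RtoC t * z) + z * (D f (RtoC t * z) * (RtoC t * 1)) by ring.
  rewrite E; apply: cder_mult; first exact: cder_id.
  apply: (cder_comp f (fun u => RtoC t * u)); first by apply/cder_scal/cder_id.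
  by apply: hol0_D Hf _; apply: scale_lt.
have rc (g : C -> C) z t : (0 <= t <= 1)%R -> (Cmod z < R0)%R -> (forall w, (Cmod w < R0)%R -> ccont g w) -> rcont (fun t => g (RtoC t * z)) t.
  move=> Ht Hz Hg; apply: (rcont_comp g (fun t => RtoC t * z)); last by apply: Hg; apply: scale_lt.
  apply: (rcont_comp (fun w => w * z) RtoC); first exact: rcont_RtoC.
  by apply: cder_cont (cder_mult _ _ _ _ _ (cder_id _) (cder_const _ _)).
have cf w : (Cmod w < R0)%R -> ccont f w by move=> Hw; apply: cder_cont (hol0_D _ _ _ Hf Hw).
have cDf w : (Cmod w < R0)%R -> ccont (D f) w by move=> Hw; apply: cder_cont (hol0_D _ _ _ (hol_deriv _ _ _ Hf) Hw).
exists P; split.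
  rewrite /P (CI_ext _ (fun _ => 0)); [|lra|by move=> t _; rewrite Cmult_0_l].
  by rewrite CI_const Cmult_0_r.
move=> z Hz; have z0 := Cmod_ge_0 z.
have rp u : (Cmod u < R0)%R -> rcont_on 0 1 (fun t => u * f (RtoC t * u)).
  by move=> Hu t Ht; apply: rcont_scal; apply: rc.
(* The integrand is the derivative of [t f(t z)] with respect to [t]. *)
have FT : CI (fun t => f (RtoC t * z) + z * (D f (RtoC t * z) * RtoC t)) 0 1 = f z.
  have := CI_deriv (fun w => w * f (w * z)) (fun w => f (w * z) + z * (D f (w * z) * w)) 0 1 ltac:(lra).
  move=> -> //; first by rewrite !Cmult_1_l; ring.
  move=> t Ht; split.
    have E : f (RtoC t * z) + z * (D f (RtoC t * z) * RtoC t) =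
      1 * f (RtoC t * z) + RtoC t * (D f (RtoC t * z) * (1 * z + RtoC t * 0)) by ring.
    rewrite E; apply: cder_mult; first exact: cder_id.
    apply: (cder_comp f (fun u => u * z)); first by apply: cder_mult; [apply: cder_id|apply: cder_const].
    by apply: hol0_D Hf _; apply: scale_lt.
  have Hs := scale_lt t z R0 Ht Hz.
  eapply cder_cont, cder_plus.
    apply: (cder_comp f (fun u => u * z)); first by apply: cder_mult; [apply: cder_id|apply: cder_const].
    exact: hol0_D Hf Hs.
  apply: cder_scal; apply: cder_mult; last exact: cder_id.
  apply: (cder_comp (D f) (fun u => u * z)); first by apply: cder_mult; [apply: cder_id|apply: cder_const].
  exact: hol0_D (hol_deriv _ _ _ Hf) Hs.
pose s := ((R0 - Cmod z) / 2)%R; have s0 : (0 < s)%R by rewrite /s; lra.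
have [B HB] := hol_bounded R0 (Cmod z + s) f Hf ltac:(rewrite /s; lra).
have B0 : (0 <= B)%R by apply: Rle_trans (Cmod_ge_0 (f z)) (HB z _); lra.
pose K := (16 * ((Cmod z + s) * B) / (s * s))%R.
have K0 : (0 <= K)%R by apply: Rdiv_le_0_compat; nra.
have second t (u : C) : (0 <= t <= 1)%R -> (Cmod (u - z) <= s / 4)%R ->
   (Cmod (u * f (RtoC t * u) - z * f (RtoC t * z) - (f (RtoC t * z) + z * (D f (RtoC t * z) * RtoC t)) * (u - z))%C <= K * (Cmod (u - z) * Cmod (u - z)))%R.
  move=> Ht Hu; rewrite -(D_eq _ _ _ (psid t z Ht Hz)).
  apply: (proj2 (taylor2 z s ((Cmod z + s) * B) (fun u => u * f (RtoC t * u)) s0 _ _)) Hu.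
    move=> w Hw; eexists; apply: psid => //.
    by have := Cmod_rev_triangle w z; rewrite /s in Hw; lra.
  move=> w Hw; have Q : (Cmod w < Cmod z + s)%R by have := Cmod_rev_triangle w z; lra.
  rewrite Cmod_mult; apply: Rmult_le_compat; try exact: Cmod_ge_0; first lra.
  by apply: HB; apply: scale_lt.
move=> e e0.
exists (Rmin (s / 4) (e / (2 * K + 1))); split; first by apply: Rmin_pos; [lra|apply: Rdiv_lt_0_compat; lra].
move=> u Hu; have Hu1 := Rlt_le_trans _ _ _ Hu (Rmin_l _ _); have Hu2 := Rlt_le_trans _ _ _ Hu (Rmin_r _ _).
have uR : (Cmod u < R0)%R by have := Cmod_rev_triangle u z; rewrite /s in Hu1; lra.
have rD : rcont_on 0 1 (fun t => f (RtoC t * z) + z * (D f (RtoC t * z) * RtoC t)).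
  move=> t Ht; apply: rcont_plus; first exact: rc.
  by apply: rcont_scal; apply: rcont_mult; [exact: rc|exact: rcont_RtoC].
have rpu := rp u uR; have rpz := rp z Hz.
have rm : rcont_on 0 1 (fun t => u * f (RtoC t * u) + -(1) * (z * f (RtoC t * z))).
  by move=> t Ht; apply: rcont_plus; [apply: rpu|apply/rcont_scal/rpz].
have rD' : rcont_on 0 1 (fun t => - (u - z) * (f (RtoC t * z) + z * (D f (RtoC t * z) * RtoC t))).
  by move=> t Ht; apply/rcont_scal/rD.
have -> : P u - P z - f z * (u - z) =
  CI (fun t => (u * f (RtoC t * u) + -(1) * (z * f (RtoC t * z))) + - (u - z) * (f (RtoC t * z) + z * (D f (RtoC t * z) * RtoC t))) 0 1.
  rewrite CI_plus //; last lra.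
  rewrite CI_plus //; [|lra|by move=> t Ht; apply/rcont_scal/rpz].
  rewrite (CI_scal (-(1)) (fun t => z * f (RtoC t * z))) //; last lra.
  rewrite (CI_scal (- (u - z))) //; last lra.
  by rewrite FT /P; ring.
apply: (Rle_trans _ (2 * (1 - 0) * (K * (Cmod (u - z) * Cmod (u - z))))%R).
  apply: CI_bound; first lra.
    by move=> t Ht; apply: rcont_plus; [apply: rm|apply: rD'].
  move=> t Ht; apply: Rle_trans (second t u Ht ltac:(lra)); right; congr Cmod; ring.
have x0 := Cmod_ge_0 (u - z); set x := Cmod (u - z) in x0 Hu2 *.
have : ((2 * K + 1) * x <= (2 * K + 1) * (e / (2 * K + 1)))%R by apply: Rmult_le_compat_l; lra.
have -> : ((2 * K + 1) * (e / (2 * K + 1)) = e)%R by field; lra.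
nra.
Qed.

Lemma cder0_const R0 f : (forall z, (Cmod z < R0)%R -> cder f z 0) -> forall z, (Cmod z < R0)%R -> f z = f 0.
Proof.
move=> H z Hz.
have := CI_deriv (fun w => f (w * z)) (fun _ => 0) 0 1 ltac:(lra).
rewrite CI_const Cmult_0_r Cmult_1_l Cmult_0_l => Q.
have {}Q : RtoC 0 = f z - f 0.
  apply: Q => t Ht; split; last exact: cder_cont (cder_const _ _).
  have E : RtoC 0 = 0 * (1 * z + RtoC t * 0) by ring.
  rewrite E; apply: (cder_comp f (fun u => u * z)); first by apply: cder_mult; [apply: cder_id|apply: cder_const].
  by apply: H; apply: scale_lt.
have -> : f z = (f z - f 0) + f 0 by ring.
by rewrite -Q; ring.
Qed.

(** If [P] is a primitive of [g' / g], then [g exp(- P)] has derivative 0. *)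
Lemma hol_log R0 g : (0 < R0)%R -> hol 0 R0 g -> (forall z, (Cmod z < R0)%R -> g z <> 0) ->
  exists P, hol 0 R0 P /\ P 0 = 0 /\ forall z, (Cmod z < R0)%R -> g z = g 0 * Cexp (P z).
Proof.
move=> R00 Hg N.
have Nz z : (Cmod (z - 0) < R0)%R -> g z <> 0 by have -> : z - 0 = z; [ring|exact: N].
have [P [P0 HP]] := primitive0 R0 (fun z => D g z * / g z) R00 (hol_mult _ _ _ _ (hol_deriv _ _ _ Hg) (hol_inv _ _ _ Hg Nz)).
exists P; split; last split => //.
  by move=> z; have -> : z - 0 = z; [ring|move=> Hz; eexists; apply: HP].
move=> z Hz.
have := cder0_const R0 (fun z => g z * Cexp (- P z)).
move=> /(_ _ z Hz) Q.
have {}Q : g z * Cexp (- P z) = g 0.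
  rewrite Q ?P0; first by rewrite Copp_0 Cexp_0 Cmult_1_r.
  move=> w Hw.
  have H := cder_mult g (fun w => Cexp (- P w)) w (D g w) _ (hol0_D _ _ _ Hg Hw)
    (cder_comp Cexp (fun w => - P w) w _ _ (cder_opp _ _ _ (HP w Hw)) (cder_Cexp _)).
  have E : D g w * Cexp (- P w) + g w * (Cexp (- P w) * - (D g w * / g w)) = 0 by field; exact: N.
  by rewrite E in H.
rewrite -Q -Cmult_assoc -Cexp_plus; have -> : - P z + P z = 0 by ring.
by rewrite Cexp_0 Cmult_1_r.
Qed.

(** * Schwarz lemma with multiplicity and the Borel-Caratheodory inequality *)

(** Cauchy's formula for [u] on the circle of radius [R0 / 2] takes the place of the maximum
    principle, at the price of the factor 4, of the ratio [2 |z - c| / R0] and of the restriction to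
    radius [R0 / 4]. *)
Lemma schwarz_mult c R0 B m f u : (0 < R0)%R -> hol c R0 u ->
  (forall z, (Cmod (z - c) < R0)%R -> f z = (z - c) ^ m * u z) ->
  (forall z, (Cmod (z - c) < R0)%R -> (Cmod (f z) <= B)%R) ->
  forall z, (Cmod (z - c) <= R0 / 4)%R -> (Cmod (f z) <= 4 * B * (2 * Cmod (z - c) / R0) ^ m)%R.
Proof.
move=> R00 Hu Ef HB z Hz; pose v w := u (c + w); have Hv : hol 0 R0 v by apply: hol_shift.
pose r := (R0 / 2)%R; have Hr : (0 < r < R0)%R by rewrite /r; lra.
have Pm : (0 < r ^ m)%R by apply: pow_lt; lra.
have vB w : Cmod w = r -> (Cmod (v w) <= B / r ^ m)%R.
  move=> Hw; have E : c + w - c = w by ring.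
  have := HB (c + w); rewrite Ef E ?Hw; try lra.
  rewrite Cmod_mult Cmod_pow Hw => /(_ ltac:(lra)) Q.
  apply: (Rmult_le_reg_l (r ^ m)) => //; rewrite /v.
  have -> : (r ^ m * (B / r ^ m) = B)%R by field; lra.
  exact: Q.
set h := z - c in Hz *; have zE : z = c + h by rewrite /h; ring.
have h0 := Cmod_ge_0 h.
have nzh w : Cmod w = r -> w - h <> 0 by move=> Hw; apply: Csub_neq0; rewrite Hw /r; lra.
have V : (Cmod (u z) <= 2 * (B / r ^ m * 2))%R.
  rewrite zE -/(v h) (cauchy_formula v r R0 h Hv); last by rewrite /r; lra.
  apply: cmean_bound; first lra.
    apply: dcircle_ccircle; apply: dcircle_mult; first by apply: (hol_dcircle v r R0); [|lra].
    by apply: dcircle_mult; [apply: dcircle_id|apply: dcircle_inv => //; apply: dcircle_subz].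
  move=> w Hw; rewrite Cmod_mult Cmod_div; last exact: nzh.
  have P := proj1 (Cmod_gt_0 _) (nzh w Hw).
  apply: Rmult_le_compat; [exact: Cmod_ge_0|by apply: Rdiv_le_0_compat => //; apply: Cmod_ge_0|exact: vB|].
  apply: (Rmult_le_reg_r (Cmod (w - h))) => //; rewrite /Rdiv Rmult_assoc Rinv_l; last lra.
  by have := Cmod_rev_triangle w h; rewrite Hw /r; lra.
rewrite Ef; last by rewrite -/h; lra.
rewrite -/h Cmod_mult Cmod_pow.
have -> : (4 * B * (2 * Cmod h / R0) ^ m = Cmod h ^ m * (2 * (B / r ^ m * 2)))%R.
  have -> : (2 * Cmod h / R0 = Cmod h * / r)%R by rewrite /r; field; lra.
  by rewrite Rpow_mult_distr pow_inv; field; lra.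
by apply: Rmult_le_compat_l => //; apply: pow_le.
Qed.

Lemma schwarz0 R0 B f : (0 < R0)%R -> hol 0 R0 f -> f 0 = 0 ->
  (forall z, (Cmod z < R0)%R -> (Cmod (f z) <= B)%R) ->
  forall z, (Cmod z <= R0 / 4)%R -> (Cmod (f z) <= 8 * B * (Cmod z / R0))%R.
Proof.
move=> R00 Hf f0 HB z Hz; have E w : w - 0 = w by ring.
have B0 : (0 <= B)%R by rewrite -Cmod_0 -f0; apply: HB; rewrite Cmod_0.
have z0 := Cmod_ge_0 z; have q0 : (0 <= Cmod z / R0)%R by apply: Rdiv_le_0_compat.
case: (factor_zero 0 R0 f R00 Hf) => [Z|[n [u [Hu [nu Eu]]]]].
  by rewrite Z ?E ?Cmod_0; nra.
case: n Eu => [|n] Eu.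
  exfalso; apply: nu; have := Eu 0; rewrite E Cmod_0 f0 => /(_ R00).
  by rewrite /= Cmult_1_l => <-.
have := schwarz_mult 0 R0 B 1 f (fun z => (z - 0) ^ n * u z) R00.
move=> /(_ _ _ _ z); rewrite E pow_1.
have -> : (4 * B * (2 * Cmod z / R0) = 8 * B * (Cmod z / R0))%R by field; lra.
apply=> //.
- by apply: hol_mult => //; apply: hol_pow; apply: hol_minus; [apply: hol_id|apply: hol_const].
- by move=> w Hw; rewrite Eu // Cpow_S /=; ring.
- by move=> w; rewrite E; apply: HB.
Qed.

(* Borel-Caratheodory for [log (g / g 0)]. *)
Lemma zerofree_growth R0 M A g : (0 < R0)%R -> hol 0 R0 g -> (forall z, (Cmod z < R0)%R -> g z <> 0) ->
  (forall z, (Cmod z < R0)%R -> (Cmod (g z) <= M)%R) -> (0 < A)%R -> (M <= Cmod (g 0) * exp A)%R ->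
  forall z, (Cmod z <= R0 / 32)%R -> (Cmod (g z) <= Cmod (g 0) * exp (24 * A * (Cmod z / R0)))%R.
Proof.
move=> R00 Hg N HM A0 HA z Hz.
have g0 : (0 < Cmod (g 0))%R by apply/Cmod_gt_0/N; rewrite Cmod_0.
have [P [HP [P0 E]]] := hol_log R0 g R00 Hg N.
have ReP w : (Cmod w < R0)%R -> (fst (P w) <= A)%R.
  move=> Hw; have := HM w Hw; rewrite E // Cmod_mult Cmod_Cexp => Q.
  have : (exp (fst (P w)) <= exp A)%R by apply: (Rmult_le_reg_l (Cmod (g 0))) => //; lra.
  by case=> [/exp_lt_inv|/exp_inv ->]; lra.
have den w : (Cmod w < R0)%R -> (0 < Cmod (RtoC (2 * A) - P w))%R /\ (Cmod (P w) <= Cmod (RtoC (2 * A) - P w))%R.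
  move=> Hw; have R := ReP w Hw; split.
    apply/Cmod_gt_0 => Q; have := f_equal fst Q; rewrite /=; lra.
  by rewrite /Cmod; apply: sqrt_le_1_alt; rewrite /=; nra.
(* This Möbius map sends the half plane of real part at most [A] into the closed unit disc and fixes
   0, so that the Schwarz lemma applies to [F]. *)
pose F w := P w * / (RtoC (2 * A) - P w).
have FB w : (Cmod w < R0)%R -> (Cmod (F w) <= 1)%R.
  move=> /den [d1 d2]; rewrite /F Cmod_mult Cmod_inv; last by apply/Cmod_gt_0.
  by apply: (Rmult_le_reg_r (Cmod (RtoC (2 * A) - P w))) => //; rewrite Rmult_assoc Rinv_l; lra.
have hF : hol 0 R0 F.
  apply: (hol_mult _ _ _ _ HP); apply: hol_inv; first exact: hol_minus (hol_const _ _ _) HP.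
  by move=> w; have -> : w - 0 = w; [ring|move=> /den [d1 _]; apply/Cmod_gt_0].
have F0 : F 0 = 0 by rewrite /F P0 Cmult_0_l.
have S := schwarz0 R0 1 F R00 hF F0 FB z ltac:(lra).
have zR : (Cmod z < R0)%R by lra.
have z0 := Cmod_ge_0 z; have q0 : (0 <= Cmod z / R0)%R by apply: Rdiv_le_0_compat.
have q1 : (Cmod z / R0 <= / 32)%R.
  by apply: (Rmult_le_reg_r R0) => //; rewrite /Rdiv Rmult_assoc Rinv_l; lra.
have [d1 d2] := den z zR; have Nd := proj2 (Cmod_gt_0 _) d1.
(* Solving for [P]; since [|F z| <= 1/4], the term [F z * P z] is absorbed by the left side. *)
have PE : P z = RtoC (2 * A) * F z - F z * P z by rewrite /F; field.
have : (Cmod (P z) <= 2 * A * Cmod (F z) + Cmod (F z) * Cmod (P z))%R.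
  rewrite {1}PE; apply: Rle_trans (Cmod_triangle_sub _ _) _; rewrite !Cmod_mult Cmod_R Rabs_pos_eq; lra.
have p0 := Cmod_ge_0 (P z); have f0 := Cmod_ge_0 (F z) => Q.
have Q2 : (Cmod (P z) <= 24 * A * (Cmod z / R0))%R.
  have : (Cmod (F z) * Cmod (P z) <= / 4 * Cmod (P z))%R by apply: Rmult_le_compat_r; lra.
  have : (2 * A * Cmod (F z) <= 2 * A * (8 * (Cmod z / R0)))%R by apply: Rmult_le_compat_l; lra.
  have : (0 <= A * (Cmod z / R0))%R by apply: Rmult_le_pos; lra.
  nra.
rewrite E // Cmod_mult Cmod_Cexp; apply: Rmult_le_compat_l; first lra.
by apply: exp_le_exp; have := fst_le_Cmod (P z); have := Rle_abs (fst (P z)); lra.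
Qed.

(** * Derivatives of functions with highly multiple zeros *)

Lemma root_exists (x : R) m : (0 < x)%R -> (1 <= m)%nat -> exists t, (0 < t)%R /\ (t ^ m = x)%R.
Proof.
move=> x0 Hm; exists (Rpower x (/ INR m)); split; first exact: exp_pos.
have Nm : INR m <> 0%R by apply: not_0_INR; lia.
rewrite -Rpower_pow; last exact: exp_pos.
by rewrite Rpower_mult Rinv_l // Rpower_1.
Qed.

Lemma pow_lt_compat (a b : R) m : (0 <= a < b)%R -> (a ^ S m < b ^ S m)%R.
Proof.
move=> H; elim: m => [|m IH]; first by rewrite !pow_1; lra.
rewrite -!(tech_pow_Rmult _ (S m)); have A : (0 <= a ^ S m)%R by apply: pow_le; lra.
by apply: Rmult_le_0_lt_compat; lra.
Qed.

Lemma pow_le_inv (a b : R) m : (0 <= b)%R -> (1 <= m)%nat -> (a ^ m <= b ^ m)%R -> (a <= b)%R.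
Proof.
case: m => [|m] b0 Hm H; first lia.
by apply: Rnot_lt_le => L; have := pow_lt_compat b a m (conj b0 L); lra.
Qed.

(** Multiplicity is expressed by a factorisation on the whole disc, with [u] depending on the zero.
    A function without zeros satisfies the condition for every [m]. *)
Definition zeros_mult (m : nat) (c : C) (r : R) (g : C -> C) : Prop :=
  forall a, (Cmod (a - c) < r)%R -> g a = 0 ->
    exists u, hol c r u /\ forall z, (Cmod (z - c) < r)%R -> g z = (z - a) ^ m * u z.

Lemma nearest_zero (g : C -> C) : ccont g 0 -> g 0 <> 0 -> exists rho, (0 < rho <= / 64)%R /\
  (forall z, (Cmod z < rho)%R -> g z <> 0) /\
  (rho = (/ 64)%R \/ exists a, g a = 0 /\ (Cmod a < 2 * rho)%R /\ (2 * rho <= / 64)%R).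
Proof.
move=> Hc N; pose rh k := (/ 64 * / 2 ^ k)%R.
have rh0 k : (0 < rh k)%R by apply: Rmult_lt_0_compat; [lra|apply/Rinv_0_lt_compat/pow_lt; lra].
have rhS k : rh k = (2 * rh (S k))%R.
  by rewrite /rh /=; field; apply: pow_nonzero; lra.
have rhle k : (rh k <= / 64)%R by elim: k => [|k IH]; [rewrite /rh /=; lra|have := rhS k; have := rh0 (S k); lra].
pose free k := forall z, (Cmod z < rh k)%R -> g z <> 0.
have [k0 Hk0] : exists k, free k.
  have [d [d0 Hd]] := ccont_neq0 g 0 Hc N.
  have [k Hk] := pow_lt_1_zero (/ 2) ltac:(rewrite Rabs_pos_eq; lra) d d0.
  exists k => z Hz; apply/Cmod_gt_0.
  have := Hk k (le_n k); rewrite Rabs_pos_eq; last by apply: pow_le; lra.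
  rewrite pow_inv => Q.
  have Q2 : (rh k < d)%R.
    rewrite /rh; have : (0 < / 2 ^ k)%R by apply/Rinv_0_lt_compat/pow_lt; lra.
    lra.
  have := Hd z; have -> : z - 0 = z by ring.
  by move=> /(_ ltac:(lra)); have := Cmod_ge_0 (g 0); lra.
have [k [[K1 K2] _]] := dec_inh_nat_subset_has_unique_least_element free (fun n => classic _) (ex_intro _ k0 Hk0).
exists (rh k); split; first by split.
split=> //; case: k K1 K2 => [|k] K1 K2; first by left; rewrite /rh /=; field.
right; have [a Ha] : exists a, ~ (((Cmod a < rh k)%R) -> g a <> 0).
  by apply: not_all_ex_not => F; have := K2 k F; lia.
exists a; rewrite -rhS; split; first by apply: NNPP => Q; apply: Ha.
by split; [apply: NNPP => Q; apply: Ha|].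
Qed.

(* With [t^m = |g 0|]: the zero of [g] nearest to 0, if any, lies at distance at least of order [t] by the
   Schwarz lemma, and on the zero-free disc [g] varies by a bounded factor at the scale [t]. *)
Lemma deriv_bound_zeros m j : (1 <= m)%nat -> exists K, (0 <= K)%R /\ forall g,
  hol 0 1 g -> (forall z, (Cmod z < 1)%R -> (Cmod (g z) <= 1)%R) -> zeros_mult m 0 1 g ->
  (Cmod (Dn j g 0) ^ m <= K * Cmod (g 0) ^ (m - j))%R.
Proof.
move=> Hm; have Em (w : C) : w - 0 = w by ring.
pose K1 := (cauchyK j * exp (INR m) * 4096 ^ j)%R.
have cK := cauchyK_pos j.
have p4 : (1 <= 4096 ^ j)%R by apply: pow_R1_Rle; lra.
have ex1 : (1 <= exp (INR m))%R by rewrite -exp_0; apply: exp_le_exp; apply: pos_INR.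
have K10 : (cauchyK j <= K1)%R by rewrite /K1; have : (1 * 1 <= exp (INR m) * 4096 ^ j)%R; [apply: Rmult_le_compat; lra|nra].
exists (K1 ^ m)%R; split; first by apply: pow_le; lra.
move=> g Hg HB Hz.
have HB' z : (Cmod (z - 0) < 1)%R -> (Cmod (g z) <= 1)%R by rewrite Em; apply: HB.
(* Here the truncated exponent [m - j] is 0 and the claim is Cauchy's estimate. *)
have triv : (m <= j)%nat -> (Cmod (Dn j g 0) ^ m <= K1 ^ m * Cmod (g 0) ^ (m - j))%R.
  move=> mj; have -> : (m - j = 0)%nat by lia.
  rewrite Rmult_1_r; apply: pow_incr; split; first exact: Cmod_ge_0.
  have := cauchy_estimate j 0 1 1 g Rlt_0_1 Hg HB'; rewrite pow1; lra.
case: (PeanoNat.Nat.le_gt_cases m j) => [/triv //|jm].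
(* At a zero of order at least [m > j] the derivative vanishes, by Cauchy's estimate on discs
   shrinking to 0. *)
have [g0|g0] := classic (g 0 = 0).
  have [|u [Hu Eu]] := Hz 0 _ g0; first by rewrite Em Cmod_0; lra.
  have S := schwarz_mult 0 1 1 m g u Rlt_0_1 Hu Eu HB'.
  have hB0 : (Cmod (Dn j g 0) <= 0)%R; last first.
    have -> : Cmod (Dn j g 0) = 0%R by have := Cmod_ge_0 (Dn j g 0); lra.
    by rewrite g0 Cmod_0 !pow_i; [lra|lia|lia].
  right; apply: (Rle_eps0 _ (cauchyK j * 4 * 2 ^ j)%R); first exact: Cmod_ge_0.
  move=> e He; pose r := (e / 4)%R; have r0 : (0 < r)%R by rewrite /r; lra.
  have hs : hol 0 r g by apply: (hol_sub _ _ _ _ _ Hg) => z; rewrite /r; lra.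
  apply: Rle_trans (cauchy_estimate j 0 r (4 * (2 * r) ^ m) g r0 hs _) _.
    move=> z; rewrite Em => Hzz; have := S z; rewrite Em => /(_ ltac:(rewrite /r in Hzz; lra)) Q.
    apply: Rle_trans Q _; rewrite Rmult_1_r; apply: Rmult_le_compat_l; first lra.
    by apply: pow_incr; rewrite Rdiv_1_r; have := Cmod_ge_0 z; lra.
  have Pj : (0 < r ^ j)%R by apply: pow_lt.
  have [k km] : exists k, m = (j + Datatypes.S k)%nat by exists (m - j - 1)%nat; lia.
  rewrite km pow_add (Rpow_mult_distr 2 r j).
  have -> : (cauchyK j * (4 * (2 ^ j * r ^ j * (2 * r) ^ Datatypes.S k)) / r ^ j = cauchyK j * 4 * 2 ^ j * (2 * r) ^ Datatypes.S k)%R by field; lra.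
  apply: Rmult_le_compat_l.
    by have : (0 < 2 ^ j)%R; [apply: pow_lt; lra|move=> ?; repeat apply: Rmult_le_pos; lra].
  rewrite /=; apply: (Rle_trans _ (2 * r * 1)%R); last by rewrite /r; lra.
  apply: Rmult_le_compat_l; first lra.
  by rewrite -(pow1 k); apply: pow_incr; rewrite /r; lra.
have gp : (0 < Cmod (g 0))%R by apply/Cmod_gt_0.
have [t [t0 tm]] := root_exists _ m gp Hm.
have g1 : (Cmod (g 0) <= 1)%R by apply: HB; rewrite Cmod_0; lra.
have gc : ccont g 0 by apply: (hol_cont 0 1) => //; rewrite Em Cmod_0; lra.
have [rho [Hr [Hfree Hcase]]] := nearest_zero g gc g0.
have pf (x : R) : (0 <= x -> 4 * x ^ m <= (4 * x) ^ m)%R.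
  move=> x0; rewrite Rpow_mult_distr; apply: Rmult_le_compat_r; first exact: pow_le.
  by rewrite -{1}(pow_1 4); apply: Rle_pow; [lra|lia].
(* Either [64 rho = 1] and the bound by 1 suffices, or the Schwarz lemma around the zero [a] gives
   [|g z| <= (16 |z - a|)^m]; evaluated at 0 the latter bounds [t] by a multiple of [rho]. *)
have [HM Ht] : (forall z, (Cmod z < rho)%R -> (Cmod (g z) <= (64 * rho) ^ m)%R) /\ (t <= 64 * rho)%R.
  case: Hcase => [E|[a [ga [al al2]]]].
    have -> : (64 * rho = 1)%R by rewrite E; field.
    rewrite pow1; split; first by move=> z Hzz; apply: HB; lra.
    by apply: (pow_le_inv _ _ m); [lra|exact: Hm|rewrite pow1 tm].
  have a0 := Cmod_ge_0 a.
  have [|u [Hu Eu]] := Hz a _ ga; first by rewrite Em; lra.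
  have sub z : (Cmod (z - a) < / 2)%R -> (Cmod (z - 0) < 1)%R.
    by rewrite Em => Q; have := Cmod_rev_triangle z a; lra.
  have S z : (Cmod (z - a) <= / 2 / 4)%R -> (Cmod (g z) <= (16 * Cmod (z - a)) ^ m)%R.
    move=> Q; have S := schwarz_mult a (/ 2) 1 m g u ltac:(lra) (hol_sub _ _ _ _ _ Hu sub)
      (fun w Hw => Eu w (sub w Hw)) (fun w Hw => HB' w (sub w Hw)) z Q.
    apply: Rle_trans S _; rewrite Rmult_1_r; apply: Rle_trans (pf _ _) _.
      by have := Cmod_ge_0 (z - a); lra.
    right; congr pow; field.
  split.
    move=> z Hzz; have T := Cmod_triangle_sub z a.
    apply: Rle_trans (S z _) _; first lra.
    by apply: pow_incr; have := Cmod_ge_0 (z - a); lra.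
  have T := S 0; have E : 0 - a = - a by ring.
  rewrite E Cmod_opp in T; have {}T := T ltac:(lra).
  apply: (Rle_trans _ (16 * Cmod a)%R); last lra.
  by apply: (pow_le_inv _ _ m) => //; [lra|rewrite tm].
(* So [exp A] is [(128 rho / t)^m], which exceeds the growth [(64 rho / t)^m] of [g]; the extra
   factor 2 keeps the logarithm positive. *)
pose A := (INR m * ln (128 * rho / t))%R.
have q2 : (2 <= 128 * rho / t)%R.
  by apply: (Rmult_le_reg_r t) => //; rewrite /Rdiv Rmult_assoc Rinv_l; lra.
have mp : (1 <= INR m)%R by have := le_INR 1 m Hm.
have A0 : (0 < A)%R by apply: Rmult_lt_0_compat; [lra|rewrite -ln_1; apply: ln_increasing; lra].
have Al : (A <= INR m * (128 * rho / t))%R.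
  apply: Rmult_le_compat_l; first lra.
  have := exp_ineq1_le (ln (128 * rho / t)); rewrite exp_ln; lra.
have MA : ((64 * rho) ^ m <= Cmod (g 0) * exp A)%R.
  have -> : exp A = ((128 * rho / t) ^ m)%R.
    by rewrite -Rpower_pow; [rewrite /Rpower /A|lra].
  rewrite -tm -Rpow_mult_distr; apply: pow_incr; split; first lra.
  have -> : (t * (128 * rho / t) = 128 * rho)%R by field; lra.
  lra.
have hgr : hol 0 rho g by apply: (hol_sub _ _ _ _ _ Hg) => z; lra.
(* Since [24 * 128 / 4096 = 3/4], the growth exponent on this disc is at most [m]; and [t <= 64 rho]
   puts [s] below [rho / 32]. *)
pose s := (t / 4096)%R; have s0 : (0 < s)%R by rewrite /s; lra.
have G z : (Cmod z < s)%R -> (Cmod (g z) <= Cmod (g 0) * exp (INR m))%R.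
  move=> Hzz; have z0 := Cmod_ge_0 z.
  apply: Rle_trans (zerofree_growth rho _ A g ltac:(lra) hgr Hfree HM A0 MA z _) _; first by rewrite /s in Hzz; lra.
  apply: Rmult_le_compat_l; first lra.
  apply: exp_le_exp.
  apply: (Rle_trans _ (24 * (INR m * (128 * rho / t)) * (s / rho))%R).
    apply: Rmult_le_compat; [lra|by apply: Rdiv_le_0_compat; lra|lra|].
    by apply: Rmult_le_compat_r; [apply/Rlt_le/Rinv_0_lt_compat; lra|lra].
  have -> : (24 * (INR m * (128 * rho / t)) * (s / rho) = INR m * (3 / 4))%R by rewrite /s; field; lra.
  lra.
have hgs : hol 0 s g by apply: (hol_sub _ _ _ _ _ Hg) => z; rewrite /s; have : (t <= 1)%R; [lra|lra].
have CE : (Cmod (Dn j g 0) <= cauchyK j * (Cmod (g 0) * exp (INR m)) / s ^ j)%R.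
  by apply: cauchy_estimate => // z; rewrite Em; apply: G.
have tj : (0 < t ^ j)%R by apply: pow_lt.
have CE2 : (Cmod (Dn j g 0) <= K1 * t ^ (m - j))%R.
  apply: Rle_trans CE _; right; rewrite -tm.
  have -> : (t ^ m = t ^ j * t ^ (m - j))%R by rewrite -pow_add; congr pow; lia.
  rewrite /s /K1 /Rdiv Rpow_mult_distr pow_inv; field; split; first by apply: pow_nonzero; lra.
  by apply: pow_nonzero; lra.
have -> : (K1 ^ m * Cmod (g 0) ^ (m - j) = (K1 * t ^ (m - j)) ^ m)%R.
  by rewrite Rpow_mult_distr -tm -!pow_mult Nat.mul_comm.
by apply: pow_incr; split; [apply: Cmod_ge_0|].
Qed.

(** * Limits along an ultrafilter *)

Record ultra (U : (nat -> Prop) -> Prop) : Prop := Ultra {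
  ultra_and : forall P Q, U P -> U Q -> U (fun n => P n /\ Q n);
  ultra_mono : forall P Q : nat -> Prop, (forall n, P n -> Q n) -> U P -> U Q;
  ultra_or : forall P, U P \/ U (fun n => ~ P n);
  ultra_tail : forall N, U (fun n => (N <= n)%nat);
  ultra_false : ~ U (fun _ => False) }.

Lemma ultra_exists : exists U, ultra U.
Proof.
have [G [UG sub]] := filter.ultraFilterLemma filter.eventually_filter.
exists G; split.
- by move=> P Q HP HQ; apply: filter.filterI.
- by move=> P Q H HP; apply: filter.filterS HP.
- by move=> P; case: (filter.in_ultra_setVsetC P UG) => H; [left|right].
- by move=> N; apply: sub; exists N => // n /= /ssrnat.leP.
- exact: filter.filter_not_empty.
Qed.

Section Ultra.
Variable U : (nat -> Prop) -> Prop.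
Hypothesis HU : ultra U.

Lemma ultra_all (P : nat -> Prop) : (forall n, P n) -> U P.
Proof. by move=> H; apply: (ultra_mono _ HU _ _ _ (ultra_tail _ HU 0)). Qed.

Lemma ultra_ex (P : nat -> Prop) : U P -> exists n, P n.
Proof.
move=> HP; apply: NNPP => N; apply: (ultra_false _ HU); apply: (ultra_mono _ HU _ _ _ HP) => n Pn.
by apply: N; exists n.
Qed.

Definition is_ulim (x : nat -> C) (l : C) := forall e, (0 < e)%R -> U (fun n => (Cmod (x n - l) < e)%R).
Definition ulim (x : nat -> C) : C := ClassicalEpsilon.epsilon (inhabits (RtoC 0)) (is_ulim x).

Lemma is_ulim_ext x y l : U (fun n => x n = y n) -> is_ulim x l -> is_ulim y l.
Proof.
move=> E H e e0; apply: (ultra_mono _ HU _ _ _ (ultra_and _ HU _ _ E (H e e0))).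
by move=> n [-> ].
Qed.

Lemma is_ulim_const k : is_ulim (fun _ => k) k.
Proof. by move=> e e0; apply: ultra_all => n; rewrite Cmod_subrr. Qed.

Lemma is_ulim_le x y l m K : (0 <= K)%R -> is_ulim x l -> is_ulim y m ->
  U (fun n => (Cmod (x n) <= K * Cmod (y n))%R) -> (Cmod l <= K * Cmod m)%R.
Proof.
move=> K0 Hx Hy H; apply: Rnot_lt_le => L.
pose e := ((Cmod l - K * Cmod m) / (2 * (1 + K)))%R.
have e0 : (0 < e)%R by apply: Rdiv_lt_0_compat; lra.
have ee : ((1 + K) * e = (Cmod l - K * Cmod m) / 2)%R by rewrite /e; field; lra.
have [n [[H1 H2] H3]] := ultra_ex _ (ultra_and _ HU _ _ (ultra_and _ HU _ _ (Hx e e0) (Hy e e0)) H).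
have := Cmod_rev_triangle l (x n); rewrite Cmod_sub_sym => A1.
have A2 := Cmod_rev_triangle (y n) m.
have A3 : (K * Cmod (y n) <= K * (Cmod m + e))%R by apply: Rmult_le_compat_l; lra.
lra.
Qed.

Lemma is_ulim_bound x l K : (0 <= K)%R -> is_ulim x l -> U (fun n => (Cmod (x n) <= K)%R) -> (Cmod l <= K)%R.
Proof.
move=> K0 Hx H; have := is_ulim_le x (fun _ => RtoC 1) l (RtoC 1) K K0 Hx (is_ulim_const _).
by rewrite Cmod_1 Rmult_1_r; apply.
Qed.

Lemma is_ulim_plus x y l m : is_ulim x l -> is_ulim y m -> is_ulim (fun n => x n + y n) (l + m).
Proof.
move=> Hx Hy e e0.
have := ultra_and _ HU _ _ (Hx (e / 2)%R ltac:(lra)) (Hy (e / 2)%R ltac:(lra)).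
apply: (ultra_mono _ HU) => n [H1 H2].
have -> : x n + y n - (l + m) = (x n - l) + (y n - m) by ring.
by have := Cmod_triangle (x n - l) (y n - m); lra.
Qed.

Lemma is_ulim_scal x l k : is_ulim x l -> is_ulim (fun n => k * x n) (k * l).
Proof.
move=> Hx e e0; have k0 := Cmod_ge_0 k.
have := Hx (e / (1 + Cmod k))%R ltac:(apply: Rdiv_lt_0_compat; lra).
apply: (ultra_mono _ HU) => n H.
have -> : k * x n - k * l = k * (x n - l) by ring.
rewrite Cmod_mult; have x0 := Cmod_ge_0 (x n - l).
apply: (Rle_lt_trans _ ((1 + Cmod k) * Cmod (x n - l))%R); first lra.
have := Rmult_lt_compat_l (1 + Cmod k)%R _ _ ltac:(lra) H.
have -> : ((1 + Cmod k) * (e / (1 + Cmod k)) = e)%R by field; lra.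
by [].
Qed.

Lemma is_ulim_mult x y l m : is_ulim x l -> is_ulim y m -> is_ulim (fun n => x n * y n) (l * m).
Proof.
move=> Hx Hy.
have Hz : is_ulim (fun n => (x n - l) * (y n - m)) 0.
  move=> e e0; have s0 : (0 < sqrt e)%R by apply: sqrt_lt_R0.
  apply: (ultra_mono _ HU _ _ _ (ultra_and _ HU _ _ (Hx _ s0) (Hy _ s0))) => n [H1 H2].
  have -> : (x n - l) * (y n - m) - 0 = (x n - l) * (y n - m) by ring.
  rewrite Cmod_mult -(sqrt_sqrt e); last lra.
  by apply: Rmult_le_0_lt_compat => //; apply: Cmod_ge_0.
have -> : l * m = 0 + (m * l + (l * m + - (l * m))) by ring.
apply: (is_ulim_ext (fun n => (x n - l) * (y n - m) + (m * x n + (l * y n + - (l * m))))).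
  by apply: ultra_all => n; ring.
apply: is_ulim_plus => //; apply: is_ulim_plus; first exact: is_ulim_scal.
by apply: is_ulim_plus; [apply: is_ulim_scal|apply: is_ulim_const].
Qed.

Lemma is_ulim_pow x l k : is_ulim x l -> is_ulim (fun n => x n ^ k) (l ^ k).
Proof. by move=> H; elim: k => [|k IH] /=; [apply: is_ulim_const|apply: is_ulim_mult]. Qed.

Lemma is_ulim_unique x l m : is_ulim x l -> is_ulim x m -> l = m.
Proof.
move=> Hl Hm; have H : (Cmod (l - m) <= 0)%R.
  apply: (is_ulim_bound (fun n => x n + -1 * x n)); first lra.
    have -> : l - m = l + -1 * m by ring.
    by apply: is_ulim_plus => //; apply: is_ulim_scal.
  apply: ultra_all => n; have -> : x n + -1 * x n = RtoC 0 by ring.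
  by rewrite Cmod_0; lra.
have E : l - m = RtoC 0 by apply: Cmod_eq_0; have := Cmod_ge_0 (l - m); lra.
have -> : l = (l - m) + m by ring. by rewrite E; ring.
Qed.

(** The limit is the supremum of the [t] that lie below [x n] for almost all [n]; the dichotomy
    [ultra_or] gives the estimate from above. *)
Lemma ulim_real (x : nat -> R) B : U (fun n => (Rabs (x n) <= B)%R) ->
  exists l, forall e, (0 < e)%R -> U (fun n => (Rabs (x n - l) < e)%R).
Proof.
move=> HB; pose E t := U (fun n => (t < x n)%R).
have [||l [Hl1 Hl2]] := completeness E.
- exists B => t Ht; apply: Rnot_lt_le => L.
  have [n [H1 H2]] := ultra_ex _ (ultra_and _ HU _ _ Ht HB).
  by have := Rle_abs (x n); lra.
- exists (- B - 1)%R; apply: (ultra_mono _ HU _ _ _ HB) => n H.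
  by have := Rle_abs (- x n); rewrite Rabs_Ropp; lra.
exists l => e e0.
have A : U (fun n => (l - e < x n)%R).
  apply: NNPP => N; have : is_upper_bound E (l - e).
    move=> t Ht; apply: Rnot_lt_le => L; apply: N; apply: (ultra_mono _ HU _ _ _ Ht) => n; lra.
  by move=> /Hl2; lra.
have A2 : U (fun n => ~ (l + e / 2 < x n)%R).
  by case: (ultra_or _ HU (fun n => (l + e / 2 < x n)%R)) => // /Hl1; lra.
apply: (ultra_mono _ HU _ _ _ (ultra_and _ HU _ _ A A2)) => n [H1 H2].
by apply: Rabs_def1; lra.
Qed.

Lemma ulimP x B : U (fun n => (Cmod (x n) <= B)%R) -> is_ulim x (ulim x).
Proof.
move=> HB; apply: ClassicalEpsilon.epsilon_spec.
have [l1 H1] : exists l, forall e, (0 < e)%R -> U (fun n => (Rabs (fst (x n) - l) < e)%R).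
  by apply: (ulim_real _ B); apply: (ultra_mono _ HU _ _ _ HB) => n; have := fst_le_Cmod (x n); lra.
have [l2 H2] : exists l, forall e, (0 < e)%R -> U (fun n => (Rabs (snd (x n) - l) < e)%R).
  by apply: (ulim_real _ B); apply: (ultra_mono _ HU _ _ _ HB) => n; have := snd_le_Cmod (x n); lra.
exists (l1, l2) => e e0.
have := ultra_and _ HU _ _ (H1 (e / 2)%R ltac:(lra)) (H2 (e / 2)%R ltac:(lra)).
apply: (ultra_mono _ HU) => n [A1 A2].
by have := Cmod_le_split (x n - (l1, l2)); rewrite /= /Rminus in A1 A2 *; lra.
Qed.

Lemma ulim_eq x l : is_ulim x l -> ulim x = l.
Proof. by move=> H; apply: (is_ulim_unique _ _ _ _ H); apply: ClassicalEpsilon.epsilon_spec; exists l. Qed.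

Section LimFun.
Variables (f : nat -> C -> C).

(** The quadratic remainder in [taylor2] has a constant independent of [n], so it survives the limit
    and makes the limit function differentiable. *)
Lemma ulim_cder c r B z : (forall w, (Cmod (w - c) < r)%R -> is_ulim (fun n => f n w) (ulim (fun n => f n w))) ->
  U (fun n => hol c r (f n)) -> U (fun n => forall w, (Cmod (w - c) < r)%R -> (Cmod (f n w) <= B)%R) ->
  (Cmod (z - c) < r)%R ->
  cder (fun w => ulim (fun n => f n w)) z (ulim (fun n => D (f n) z)) /\
  is_ulim (fun n => D (f n) z) (ulim (fun n => D (f n) z)).
Proof.
move=> HF Hh HB Hz; set F := (fun w => ulim (fun n => f n w)); pose s := (r - Cmod (z - c))%R.
have s0 : (0 < s)%R by rewrite /s; lra.
have sub w : (Cmod (w - z) < s)%R -> (Cmod (w - c) < r)%R by have := Cmod_sub_tri w z c; rewrite /s; lra.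
pose T n := (Cmod (D (f n) z) <= 4 * B / s)%R /\ forall w, (Cmod (w - z) <= s / 4)%R ->
    (Cmod (f n w - f n z - D (f n) z * (w - z)) <= 16 * B / (s * s) * (Cmod (w - z) * Cmod (w - z)))%R.
have HT : U T.
  apply: (ultra_mono _ HU _ _ _ (ultra_and _ HU _ _ Hh HB)) => n [h1 h2].
  apply: taylor2 => //; first by apply: hol_sub h1 sub.
  by move=> w /sub /h2.
have HD : is_ulim (fun n => D (f n) z) (ulim (fun n => D (f n) z)).
  by apply: (ulimP _ (4 * B / s)%R); apply: (ultra_mono _ HU _ _ _ HT) => n [].
split=> // e e0.
have B0 : (0 <= B)%R.
  by have [n /(_ z Hz)] := ultra_ex _ HB; have := Cmod_ge_0 (f n z); lra.
pose K := (16 * B / (s * s))%R.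
have K0 : (0 <= K)%R by apply: Rmult_le_pos; [lra|apply/Rlt_le/Rinv_0_lt_compat/Rmult_lt_0_compat].
have m0 : (0 < Rmin (s / 4) (e / (K + 1)))%R.
  by apply: Rmin_pos; [lra|apply: Rdiv_lt_0_compat; lra].
exists (Rmin (s / 4) (e / (K + 1))); split=> // w Hw.
have w1 := Rlt_le_trans _ _ _ Hw (Rmin_l _ _); have w2 := Rlt_le_trans _ _ _ Hw (Rmin_r _ _).
have w0 := Cmod_ge_0 (w - z).
apply: (Rle_trans _ (K * (Cmod (w - z) * Cmod (w - z)))%R).
  apply: (is_ulim_bound (fun n => f n w + -1 * f n z + - (w - z) * D (f n) z)).
  - by apply: Rmult_le_pos => //; apply: Rmult_le_pos.
  - have -> : F w - F z - ulim (fun n => D (f n) z) * (w - z) =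
       F w + -1 * F z + - (w - z) * ulim (fun n => D (f n) z) by ring.
    apply: is_ulim_plus; last exact: is_ulim_scal.
    by apply: is_ulim_plus; [apply: HF; apply: sub; lra|apply: is_ulim_scal; apply: HF].
  - apply: (ultra_mono _ HU _ _ _ HT) => n [_ /(_ w ltac:(lra))].
    by have -> : f n w + -1 * f n z + - (w - z) * D (f n) z = f n w - f n z - D (f n) z * (w - z) by ring.
rewrite -Rmult_assoc; apply: Rmult_le_compat_r => //.
have : (Cmod (w - z) * (K + 1) <= e)%R.
  have := Rmult_le_compat_r (K + 1)%R _ _ ltac:(lra) (Rlt_le _ _ w2).
  by have -> : (e / (K + 1) * (K + 1) = e)%R by field; lra.
by rewrite -/K; lra.
Qed.
End LimFun.

Definition flim (f : nat -> C -> C) (z : C) : C := ulim (fun n => f n z).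

Lemma flim_hol f c r B : U (fun n => hol c r (f n)) ->
  U (fun n => forall w, (Cmod (w - c) < r)%R -> (Cmod (f n w) <= B)%R) -> hol c r (flim f).
Proof.
move=> Hh HB z Hz; exists (ulim (fun n => D (f n) z)).
apply: (proj1 (ulim_cder f c r B z _ Hh HB Hz)) => w Hw.
by apply: (ulimP _ B); apply: (ultra_mono _ HU _ _ _ HB) => n; apply.
Qed.

Lemma Dn_ext_hol l c r f g : hol c r f -> (forall z, (Cmod (z - c) < r)%R -> f z = g z) ->
  forall z, (Cmod (z - c) < r)%R -> Dn l g z = Dn l f z.
Proof.
move=> Hf E; elim: l => [|l IH] z Hz /=; first by rewrite E.
apply: D_eq; apply: (cder_ext_loc (Dn l f) _ _ _ (r - Cmod (z - c))); first lra.
  by move=> w Hw; rewrite IH //; have := Cmod_sub_tri w z c; lra.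
exact: (hol_D _ _ _ _ (hol_Dn _ _ _ _ Hf)).
Qed.

(** Induction through the sequence of first derivatives, which is again uniformly bounded on a
    smaller disc around [z]. *)
Lemma flim_Dn l f c r B z : U (fun n => hol c r (f n)) ->
  U (fun n => forall w, (Cmod (w - c) < r)%R -> (Cmod (f n w) <= B)%R) ->
  (Cmod (z - c) < r)%R -> is_ulim (fun n => Dn l (f n) z) (Dn l (flim f) z).
Proof.
elim: l f c r B z => [|l IH] f c r B z Hh HB Hz.
  by apply: (ulimP _ B); apply: (ultra_mono _ HU _ _ _ HB) => n; apply.
have lim w : (Cmod (w - c) < r)%R -> is_ulim (fun n => f n w) (ulim (fun n => f n w)).
  by move=> Hw; apply: (ulimP _ B); apply: (ultra_mono _ HU _ _ _ HB) => n; apply.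
pose s := ((r - Cmod (z - c)) / 2)%R; have s0 : (0 < s)%R by rewrite /s; lra.
have sub w : (Cmod (w - z) < s)%R -> (Cmod (w - c) < r - s)%R by have := Cmod_sub_tri w z c; rewrite /s; lra.
have zz : (Cmod (z - z) < s)%R by rewrite Cmod_subrr.
have h1 : U (fun n => hol z s (D (f n))).
  apply: (ultra_mono _ HU _ _ _ Hh) => n Hn; apply: hol_sub (hol_deriv _ _ _ Hn) _ => w /sub; lra.
have h2 : U (fun n => forall w, (Cmod (w - z) < s)%R -> (Cmod (D (f n) w) <= 4 * B / s)%R).
  apply: (ultra_mono _ HU _ _ _ (ultra_and _ HU _ _ Hh HB)) => n [Hn Hb] w /sub Hw.
  apply: (proj1 (taylor2 w s B (f n) s0 _ _)).
    by apply: hol_sub Hn _ => u; have := Cmod_sub_tri u w c; lra.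
  by move=> u Hu; apply: Hb; have := Cmod_sub_tri u w c; lra.
have := IH (fun n => D (f n)) z s _ z h1 h2 zz.
have E : Dn l (flim (fun n => D (f n))) z = Dn (S l) (flim f) z.
  rewrite Dn_succ_r; apply: (Dn_ext_hol _ z s) => //.
    apply: hol_sub (hol_deriv _ _ _ (flim_hol f c r B Hh HB)) _ => w /sub; lra.
  by move=> w /sub Hw; apply: D_eq; apply: (proj1 (ulim_cder f c r B w lim Hh HB _)); lra.
rewrite E; apply: is_ulim_ext; apply: ultra_all => n; by rewrite Dn_succ_r.
Qed.

(* Equicontinuity lets the evaluation point move with the index. *)
Lemma flim_moving f c r B z : (0 < r)%R -> U (fun n => hol c r (f n)) ->
  U (fun n => forall w, (Cmod (w - c) < r)%R -> (Cmod (f n w) <= B)%R) ->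
  is_ulim z c -> is_ulim (fun n => f n (z n)) (flim f c).
Proof.
move=> r0 Hh HB Hz.
have cc : (Cmod (c - c) < r)%R by rewrite Cmod_subrr.
have B0 : (0 <= B)%R by have [n /(_ c cc)] := ultra_ex _ HB; have := Cmod_ge_0 (f n c); lra.
have lim := flim_Dn 0 f c r B c Hh HB cc.
have K0 : (0 <= 4 * B / r + 4 * B / r)%R.
  suff : (0 <= 4 * B / r)%R by lra.
  by apply: Rmult_le_pos; [lra|apply/Rlt_le/Rinv_0_lt_compat].
set K := (4 * B / r + 4 * B / r)%R in K0.
move=> e e0.
have d0 : (0 < Rmin (r / 4) (e / 2 / (K + 1)))%R.
  by apply: Rmin_pos; [lra|apply: Rdiv_lt_0_compat; lra].
have := ultra_and _ HU _ _ (ultra_and _ HU _ _ Hh HB) (ultra_and _ HU _ _ (Hz _ d0) (lim (e / 2)%R ltac:(lra))).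
apply: (ultra_mono _ HU) => n [[h1 h2] [h3 h4]].
have w1 := Rlt_le_trans _ _ _ h3 (Rmin_l _ _); have w2 := Rlt_le_trans _ _ _ h3 (Rmin_r _ _).
have w0 := Cmod_ge_0 (z n - c).
have [t1 /(_ (z n) ltac:(lra)) t2] := taylor2 c r B (f n) r0 h1 h2.
have A : (Cmod (f n (z n) - f n c) <= K * Cmod (z n - c))%R.
  have -> : f n (z n) - f n c = (f n (z n) - f n c - D (f n) c * (z n - c)) + D (f n) c * (z n - c) by ring.
  apply: (Rle_trans _ _ _ (Cmod_triangle _ _)); rewrite Cmod_mult.
  have t3 : (16 * B / (r * r) * (Cmod (z n - c) * Cmod (z n - c)) <= 4 * B / r * Cmod (z n - c))%R.
    rewrite -Rmult_assoc; apply: Rmult_le_compat_r => //.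
    have -> : (4 * B / r = 16 * B / (r * r) * (r / 4))%R by field; lra.
    apply: Rmult_le_compat_l; last lra.
    by apply: Rmult_le_pos; [lra|apply/Rlt_le/Rinv_0_lt_compat/Rmult_lt_0_compat].
  have := Rmult_le_compat_r _ _ _ w0 t1; rewrite /K; lra.
have A2 : (K * Cmod (z n - c) <= e / 2)%R.
  have := Rmult_le_compat_r (K + 1)%R _ _ ltac:(lra) (Rlt_le _ _ w2).
  have -> : (e / 2 / (K + 1) * (K + 1) = e / 2)%R by field; lra.
  lra.
by have := Cmod_sub_tri (f n (z n)) (f n c) (flim f c); rewrite /= in h4; lra.
Qed.
End Ultra.

(** * Affine changes of variable and rescaled estimates *)

Lemma hol_affine c r g (z s : C) R0 : hol c r g -> (forall w, (Cmod w < R0)%R -> (Cmod (z + s * w - c) < r)%R) ->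
  hol 0 R0 (fun w => g (z + s * w)).
Proof.
move=> Hg Hs; apply: (hol_comp 0 R0 c r g (fun w => z + s * w)) => //.
  by apply: hol_plus; [apply: hol_const|apply: hol_mult; [apply: hol_const|apply: hol_id]].
by move=> w Hw; apply: Hs; have <- : w - 0 = w by ring.
Qed.

Lemma Dn_affine l (k z s : C) g r R0 : hol z r g -> (forall w, (Cmod w < R0)%R -> (Cmod (s * w) < r)%R) ->
  forall w, (Cmod w < R0)%R -> Dn l (fun w => k * g (z + s * w)) w = k * (s ^ l * Dn l g (z + s * w)).
Proof.
move=> Hg Hs; elim: l => [|l IH] w Hw /=; first by ring.
apply: D_eq; apply: (cder_ext_loc (fun w => k * (s ^ l * Dn l g (z + s * w))) _ _ _ (R0 - Cmod w)); first lra.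
  move=> u Hu; rewrite IH //; have := Cmod_rev_triangle u w; lra.
have -> : k * (s * s ^ l * D (Dn l g) (z + s * w)) = k * (s ^ l * (D (Dn l g) (z + s * w) * s)) by ring.
apply/cder_scal/cder_scal/(cder_comp (Dn l g) (fun w => z + s * w)).
  have {2}-> : s = 0 + s * 1 by ring.
  by apply: cder_plus; [apply: cder_const|apply/cder_scal/cder_id].
apply: (hol_D _ _ _ _ (hol_Dn l _ _ _ Hg)).
have -> : z + s * w - z = s * w by ring.
exact: Hs.
Qed.

Lemma zeros_mult_affine m c r g (k z s : C) R0 : zeros_mult m c r g -> s <> 0 -> k <> 0 ->
  (forall w, (Cmod w < R0)%R -> (Cmod (z + s * w - c) < r)%R) ->
  zeros_mult m 0 R0 (fun w => k * g (z + s * w)).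
Proof.
move=> Hg s0 k0 Hs a; have E w : w - 0 = w by ring.
rewrite E => Ha Z; have ga : g (z + s * a) = 0.
  have -> : g (z + s * a) = / k * (k * g (z + s * a)) by field.
  by rewrite Z; ring.
have [u [hu Hu]] := Hg _ (Hs _ Ha) ga.
exists (fun w => k * s ^ m * u (z + s * w)); split.
  by apply: hol_mult; [apply: hol_const|apply: hol_affine hu Hs].
move=> w; rewrite E => Hw; rewrite Hu; last exact: Hs.
have -> : z + s * w - (z + s * a) = s * (w - a) by ring.
by rewrite Cpow_mult_l; ring.
Qed.

Lemma zeros_mult_sub m c r c' r' g : zeros_mult m c r g ->
  (forall z, (Cmod (z - c') < r')%R -> (Cmod (z - c) < r)%R) -> zeros_mult m c' r' g.
Proof.
move=> H S a /S Ha Z; have [u [hu Hu]] := H a Ha Z.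
by exists u; split; [apply: hol_sub hu S|move=> z /S /Hu].
Qed.

Lemma zeros_mult_div m c r g h : zeros_mult m c r g -> hol c r h ->
  (forall z, (Cmod (z - c) < r)%R -> h z <> 0) -> zeros_mult m c r (fun z => g z * / h z).
Proof.
move=> H Hh N a Ha Z; have ga : g a = 0.
  have -> : g a = (g a * / h a) * h a by field; apply: N.
  by rewrite Z; ring.
have [u [hu Hu]] := H a Ha ga.
exists (fun z => u z * / h z); split; first by apply: hol_mult => //; apply: hol_inv.
by move=> z Hz; rewrite Hu //; ring.
Qed.

(** [deriv_bound_zeros] after rescaling the disc and the function. The constant precedes the centre
    and the function in the quantifiers, as one constant has to serve a whole sequence of discs. *)
Lemma deriv_bound m j r B : (1 <= m)%nat -> (0 < r)%R -> (0 < B)%R -> exists K, (0 <= K)%R /\ forall z g,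
  hol z r g -> (forall w, (Cmod (w - z) < r)%R -> (Cmod (g w) <= B)%R) -> zeros_mult m z r g ->
  (Cmod (Dn j g z) ^ m <= K * Cmod (g z) ^ (m - j))%R.
Proof.
move=> Hm r0 B0; have [K [K0 HK]] := deriv_bound_zeros m j Hm.
have iB : (0 < / B)%R by apply: Rinv_0_lt_compat.
have rj : (0 < r ^ j)%R by apply: pow_lt.
have brj : (0 < B * / r ^ j)%R by apply: Rmult_lt_0_compat => //; apply: Rinv_0_lt_compat.
exists ((B * / r ^ j) ^ m * K * (/ B) ^ (m - j))%R; split.
  by apply: Rmult_le_pos; [apply: Rmult_le_pos => //|]; apply: pow_le; lra.
move=> z g hg Hb zg.
have in1 w : (Cmod w < 1)%R -> (Cmod (RtoC r * w) < r)%R.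
  by move=> Hw; rewrite Cmod_mult Cmod_R Rabs_pos_eq; [have := Rmult_lt_compat_l r _ _ r0 Hw; lra|lra].
have in2 w : (Cmod w < 1)%R -> (Cmod (z + RtoC r * w - z) < r)%R.
  have -> : z + RtoC r * w - z = RtoC r * w by ring.
  exact: in1.
have rC : RtoC r <> 0 by move=> /RtoC_inj; lra.
have bC : RtoC (/ B) <> 0 by move=> /RtoC_inj; lra.
have := HK (fun w => RtoC (/ B) * g (z + RtoC r * w)) _ _ (zeros_mult_affine _ _ _ _ _ _ _ _ zg rC bC in2).
rewrite (Dn_affine j _ _ _ _ r 1 hg in1); last by rewrite Cmod_0; lra.
have -> : z + RtoC r * 0 = z by ring.
move=> H; have {}H : ((/ B * (r ^ j * Cmod (Dn j g z))) ^ m <= K * (/ B * Cmod (g z)) ^ (m - j))%R.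
  have -> : (/ B * (r ^ j * Cmod (Dn j g z)) = Cmod (RtoC (/ B) * (RtoC r ^ j * Dn j g z)))%R.
    by rewrite !Cmod_mult Cmod_pow !Cmod_R !Rabs_pos_eq //; lra.
  have -> : (/ B * Cmod (g z) = Cmod (RtoC (/ B) * g z))%R.
    by rewrite Cmod_mult Cmod_R Rabs_pos_eq //; lra.
  apply: H; first by apply: hol_mult; [apply: hol_const|apply: hol_affine hg in2].
  move=> w /in2 Hw; rewrite Cmod_mult Cmod_R Rabs_pos_eq; last lra.
  have := Rmult_le_compat_l _ _ _ (Rlt_le _ _ iB) (Hb _ Hw).
  by have -> : (/ B * B = 1)%R by field; lra.
have E : (Cmod (Dn j g z) = (B * / r ^ j) * (/ B * (r ^ j * Cmod (Dn j g z))))%R by field; lra.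
rewrite E Rpow_mult_distr.
apply: (Rle_trans _ _ _ (Rmult_le_compat_l _ _ _ _ H)); first by apply: pow_le; lra.
by rewrite (Rpow_mult_distr (/ B)); lra.
Qed.

(* The doubling argument: a point where the scale of [Bad] is almost minimal among its neighbours. *)
Lemma zoom_point (Bad : C -> R -> Prop) (R0 : R) : (1 <= R0)%R ->
  (forall z r z' r', Bad z' r' -> (forall w, (Cmod (w - z') < r')%R -> (Cmod (w - z) < r)%R) -> Bad z r) ->
  (forall z, (Cmod z < 1)%R -> exists rho, (0 < rho)%R /\ ~ Bad z rho) ->
  Bad 0 (2 * / (8 * R0))%R ->
  exists z l, (0 < l)%R /\ (Cmod z + 2 * R0 * l <= / 4)%R /\ Bad z (2 * l)%R /\
    forall z', (Cmod (z' - z) < R0 * l)%R -> ~ Bad z' (l / 4)%R.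
Proof.
move=> R1 mono loc B0; apply: NNPP => N.
(* The reserve [2 R0 l] in the invariant pays for all later displacements, so that the search never
   leaves the disc of radius 1/4. *)
pose P (s : C * R) := (0 < snd s)%R /\ (Cmod (fst s) + 2 * R0 * snd s <= / 4)%R /\ Bad (fst s) (2 * snd s)%R.
have ex s : exists z', P s -> (Cmod (z' - fst s) < R0 * snd s)%R /\ Bad z' (snd s / 4)%R.
  apply: NNPP => N2; apply: N; exists (fst s), (snd s).
  have Ps : P s by apply: NNPP => nP; apply: N2; exists 0 => /nP.
  case: (Ps) => p1 [p2 p3]; split=> //; split=> //; split=> // z' Hz' Bz.
  by apply: N2; exists z'.
pose nx s := proj1_sig (constructive_indefinite_description _ (ex s)).
have Hnx s : P s -> (Cmod (nx s - fst s) < R0 * snd s)%R /\ Bad (nx s) (snd s / 4)%R.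
  exact: (proj2_sig (constructive_indefinite_description _ (ex s))).
pose l0 := (/ (8 * R0))%R.
have l00 : (0 < l0)%R by apply: Rinv_0_lt_compat; lra.
have l0E : (R0 * l0 = / 8)%R by rewrite /l0; field; lra.
(* A bad disc of radius [l / 4] has the form [2 (l / 8)]: the scale drops by the factor 8 and the
   displacements [R0 l] have a convergent sum. *)
pose sq := fix sq k := match k with O => (RtoC 0, l0) | S k => (nx (sq k), (snd (sq k) / 8)%R) end.
pose z k := fst (sq k); pose l k := snd (sq k).
have PS k : P (sq k).
  elim: k => [|k IH].
    by split=> //=; split; [rewrite Cmod_0; lra|].
  have [h1 h2] := Hnx _ IH; case: (IH) => p1 [p2 p3].
  split=> /=; first lra; split.
    have Rl : (0 <= R0 * snd (sq k))%R by apply: Rmult_le_pos; lra.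
    have := Cmod_rev_triangle (nx (sq k)) (fst (sq k)); lra.
  by have -> : (2 * (snd (sq k) / 8) = snd (sq k) / 4)%R by field.
have tele k i : (Cmod (z (k + i)%nat - z k) + 2 * R0 * l (k + i)%nat <= 2 * R0 * l k)%R.
  elim: i => [|i IH]; first by rewrite Nat.add_0_r Cmod_subrr; lra.
  rewrite Nat.add_succ_r; have [h1 _] := Hnx _ (PS (k + i)%nat); rewrite -/(z _) -/(l _) in h1.
  have e1 : z (S (k + i)) = nx (sq (k + i)%nat) by [].
  have e2 : l (S (k + i)) = (l (k + i)%nat / 8)%R by [].
  have Rl : (0 <= R0 * l (k + i)%nat)%R by apply: Rmult_le_pos; [lra|apply/Rlt_le; case: (PS (k + i)%nat)].
  have := Cmod_sub_tri (z (S (k + i))) (z (k + i)%nat) (z k); rewrite e2 {2}e1; lra.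
have lpos k : (0 < l k)%R by case: (PS k).
have [U HU] := ultra_exists.
have zb k : (Cmod (z k) <= / 4)%R.
  case: (PS k) => p1 [p2 _]; rewrite /z; have Rl : (0 <= R0 * snd (sq k))%R by apply: Rmult_le_pos; lra.
  lra.
have lim := ulimP U HU z (/ 4)%R (ultra_all U HU _ zb).
set Z := ulim U z in lim.
have Zb : (Cmod Z < 1)%R.
  by have := is_ulim_bound U HU z Z (/ 4)%R ltac:(lra) lim (ultra_all U HU _ zb); lra.
(* Some disc around the limit point is good, but it contains the bad discs from some index on. *)
have [rho [r0 Hr]] := loc Z Zb; apply: Hr.
have [k Hk] : exists k, (l k * (2 * R0 + 2) < rho)%R.
  have e0 : (0 < rho / (2 * R0 + 2))%R by apply: Rdiv_lt_0_compat; lra.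
  have [k Hk] := pow_lt_1_zero (/ 8) ltac:(rewrite Rabs_pos_eq; lra) _ e0.
  exists k; have {}Hk := Rle_lt_trans _ _ _ (Rle_abs _) (Hk k (le_n k)).
  have lE i : (l i = l0 * (/ 8) ^ i)%R.
    by elim: i => [|i IH]; rewrite /l /=; [ring|rewrite -/(l i) IH; field].
  have p8 : (0 < (/ 8) ^ k)%R by apply: pow_lt; lra.
  have l01 : (l0 <= 1)%R by nra.
  have : ((/ 8) ^ k * (2 * R0 + 2) < rho)%R.
    have := Rmult_lt_compat_r (2 * R0 + 2)%R _ _ ltac:(lra) Hk.
    by have -> : (rho / (2 * R0 + 2) * (2 * R0 + 2) = rho)%R by field; lra.
  by rewrite lE; nra.
have near : (Cmod (Z - z k) <= 2 * R0 * l k)%R.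
  apply: (is_ulim_bound U HU (fun i => z i + - z k)).
  - by have := lpos k; nra.
  - by apply: is_ulim_plus => //; apply: is_ulim_const.
  - apply: (ultra_mono U HU _ _ _ (ultra_tail U HU k)) => i Hi.
    have := tele k (i - k)%nat; have -> : (k + (i - k) = i)%nat by lia.
    by move=> T; have := lpos i; rewrite -/(Cminus _ _); nra.
apply: (mono _ _ (z k) (2 * l k)%R); first by case: (PS k) => _ [].
move=> w Hw; have := Cmod_sub_tri w (z k) Z; rewrite (Cmod_sub_sym (z k) Z); lra.
Qed.

(** * Automorphisms of the disc *)

Lemma Cmod_sq (z : C) : (Cmod z * Cmod z = fst z * fst z + snd z * snd z)%R.
Proof. by rewrite /Cmod sqrt_sqrt /=; [ring|have := Rle_0_sqr (fst z); have := Rle_0_sqr (snd z); rewrite /Rsqr; lra]. Qed.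

Lemma Cmod_lt_sq (z w : C) : (Cmod z * Cmod z < Cmod w * Cmod w)%R -> (Cmod z < Cmod w)%R.
Proof. by have := Cmod_ge_0 z; have := Cmod_ge_0 w; nra. Qed.

(** The automorphism of the disc that carries 0 to [z]; its inverse is [mob (- z)]. *)
Definition mob (z w : C) : C := (w + z) * / (1 + Cconj z * w).

(** For [z] and [w] in the disc the right side is positive, which yields at the same time that the
    denominator of [mob] does not vanish and that [|mob z w| < 1]. *)
Lemma mob_ident z w : (Cmod (1 + Cconj z * w) * Cmod (1 + Cconj z * w) - Cmod (w + z) * Cmod (w + z) =
  (1 - Cmod z * Cmod z) * (1 - Cmod w * Cmod w))%R.
Proof. by rewrite !Cmod_sq; case: z w => [a b] [c d] /=; ring. Qed.

Lemma mob_num_lt z w : (Cmod z < 1)%R -> (Cmod w < 1)%R -> (Cmod (w + z) < Cmod (1 + Cconj z * w))%R.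
Proof.
move=> Hz Hw; apply: Cmod_lt_sq; have := mob_ident z w.
have z0 := Cmod_ge_0 z; have w0 := Cmod_ge_0 w.
have : (0 < (1 - Cmod z * Cmod z) * (1 - Cmod w * Cmod w))%R by apply: Rmult_lt_0_compat; nra.
lra.
Qed.

Lemma mob_den z w : (Cmod z < 1)%R -> (Cmod w < 1)%R -> 1 + Cconj z * w <> 0.
Proof.
move=> Hz Hw E; have := mob_num_lt z w Hz Hw; rewrite E Cmod_0; have := Cmod_ge_0 (w + z); lra.
Qed.

Lemma mob_lt z w : (Cmod z < 1)%R -> (Cmod w < 1)%R -> (Cmod (mob z w) < 1)%R.
Proof.
move=> Hz Hw; have N := mob_den z w Hz Hw; have P := proj1 (Cmod_gt_0 _) N.
rewrite /mob Cmod_mult Cmod_inv //.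
by have := Rmult_lt_compat_r _ _ _ (Rinv_0_lt_compat _ P) (mob_num_lt z w Hz Hw); rewrite Rinv_r; lra.
Qed.

Lemma mob_hol z : (Cmod z < 1)%R -> hol 0 1 (mob z).
Proof.
move=> Hz; apply: hol_mult; first by apply: hol_plus; [apply: hol_id|apply: hol_const].
apply: hol_inv.
  by apply: hol_plus; [apply: hol_const|apply: hol_mult; [apply: hol_const|apply: hol_id]].
by move=> w; have -> : w - 0 = w by [ring]; apply: mob_den.
Qed.

Lemma mob0 z : mob z 0 = z.
Proof. by rewrite /mob; field; rewrite Cmult_0_r Cplus_0_r; apply: C1_nz. Qed.

Lemma mob_opp_den z w : (Cmod z < 1)%R -> (Cmod w < 1)%R -> 1 - Cconj z * w <> 0.
Proof.
move=> Hz Hw; have -> : 1 - Cconj z * w = 1 + Cconj (- z) * w by rewrite Copp_conj; ring.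
by apply: mob_den => //; rewrite Cmod_opp.
Qed.

Lemma mob_inv z w : (Cmod z < 1)%R -> (Cmod w < 1)%R -> mob z (mob (- z) w) = w.
Proof.
move=> Hz Hw; have zo : (Cmod (- z) < 1)%R by rewrite Cmod_opp.
have N1 := mob_opp_den z w Hz Hw; have N3 := mob_den z _ Hz (mob_lt _ _ zo Hw); have N4 := mob_opp_den z z Hz Hz.
rewrite /mob Copp_conj in N3 *.
have E1 : 1 + - Cconj z * w = 1 - Cconj z * w by ring. rewrite E1 in N3 *.
have E2 : 1 + Cconj z * ((w + - z) * / (1 - Cconj z * w)) = (1 - Cconj z * z) * / (1 - Cconj z * w) by field.
have E3 : (w + - z) * / (1 - Cconj z * w) + z = w * (1 - Cconj z * z) * / (1 - Cconj z * w) by field.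
by rewrite E2 E3; field.
Qed.

(** The right side is the pseudo-hyperbolic distance from which [poincare] is built. *)
Lemma Cmod_mob_opp z w : (Cmod z < 1)%R -> (Cmod w < 1)%R ->
  Cmod (mob (- z) w) = (Cmod (z - w) / Cmod (1 - Cconj w * z))%R.
Proof.
move=> Hz Hw; have N1 := mob_opp_den z w Hz Hw.
rewrite /mob Copp_conj; have -> : 1 + - Cconj z * w = 1 - Cconj z * w by ring.
rewrite Cmod_mult Cmod_inv // (Cmod_sub_sym z w) /Rdiv; congr (_ * / _)%R.
by rewrite -(Cmod_conj (1 - Cconj z * w)) Cplus_conj Copp_conj Cmult_conj Cconj_conj /Cminus; congr Cmod; rewrite /Cconj /=;
  case: z w {Hz Hw N1} => [a b] [c d]; rewrite /Cplus /Copp /Cmult /=; congr pair; ring.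
Qed.

Lemma zeros_mult_mob m g z : (Cmod z < 1)%R -> zeros_mult m 0 1 g -> zeros_mult m 0 1 (fun w => g (mob z w)).
Proof.
move=> Hz Hg a; have E w : w - 0 = w by ring.
rewrite E => Ha Z; have [|u [hu Hu]] := Hg _ _ Z; first by rewrite E; apply: mob_lt.
have Nd w : (Cmod (w - 0) < 1)%R -> 1 + Cconj z * w <> 0 by rewrite E; apply: mob_den.
have hm : hol 0 1 (fun w => u (mob z w)).
  apply: (hol_comp 0 1 0 1) => //; first exact: mob_hol.
  by move=> w; rewrite !E; apply: mob_lt.
(* From [mob z w - mob z a = (1 - |z|^2) (w - a) / ((1 + conj z a) (1 + conj z w))]. *)
exists (fun w => ((1 - Cconj z * z) * / (1 + Cconj z * a) * / (1 + Cconj z * w)) ^ m * u (mob z w)); split.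
  apply: hol_mult => //; apply: hol_pow; apply: hol_mult; first exact: hol_const.
  apply: hol_inv => //; apply: hol_plus; first exact: hol_const.
  by apply: hol_mult; [apply: hol_const|apply: hol_id].
move=> w Hw; rewrite Hu; last by rewrite E; apply: mob_lt => //; rewrite -(E w).
rewrite Cmult_assoc -Cpow_mult_l; congr (_ ^ m * _).
by rewrite /mob; field; split; [apply: Nd|apply: mob_den].
Qed.

(* [ring] must see the type [C] in place of the convertible [Cplx]. *)
Ltac cring := lazymatch goal with |- @eq _ ?x ?y => change (@eq C x y); ring end.

(** * The definitions of the statement in terms of the analytic ones *)

Lemma Cnorm_Cmod (z : C) : Cnorm z = Cmod z.
Proof. by rewrite /Cnorm /Cmod; congr sqrt; ring. Qed.

Lemma Csub_Cminus (z w : C) : Csub z w = z - w. Proof. by []. Qed.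
Lemma Cmul_Cmult (z w : C) : Cmul z w = z * w. Proof. by []. Qed.
Lemma Defs_Cpow (z : C) k : Defs.Cpow z k = z ^ k.
Proof. by elim: k => [//|k IH] /=; rewrite IH. Qed.

Lemma inD_Cmod (z : C) : inD z <-> (Cmod z < 1)%R. Proof. by rewrite /inD Cnorm_Cmod. Qed.

Lemma holo_hol (f : C -> C) : holo_D f <-> hol 0 1 f.
Proof.
have E w : w - 0 = w by ring.
split=> H z.
  rewrite E => Hz; have [l Hl] := H z (proj2 (inD_Cmod z) Hz); exists l => e e0.
  have [d [d0 Hd]] := Hl e e0; exists (Rmin d (1 - Cmod z)); split; first by apply: Rmin_pos => //; lra.
  move=> w Hw; have w1 := Rlt_le_trans _ _ _ Hw (Rmin_l _ _); have w2 := Rlt_le_trans _ _ _ Hw (Rmin_r _ _).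
  case: (Req_dec (Cmod (w - z)) 0) => [/Cmod_eq_0 Z|N].
    have -> : w = (w - z) + z by ring.
    by rewrite Z Cplus_0_l; have -> : f z - f z - l * (z - z) = 0 by [ring]; rewrite Cmod_0 Cmod_subrr; lra.
  have wp : (0 < Cmod (w - z))%R by case: (Rle_lt_or_eq_dec _ _ (Cmod_ge_0 (w - z))) => // Q; case: N.
  have := Hd w; rewrite /inD !Cnorm_Cmod; apply; last by split=> //; lra.
  by have := Cmod_rev_triangle w z; lra.
move=> /inD_Cmod Hz; have [|l Hl] := H z; first by rewrite E.
exists l => e e0; have [d [d0 Hd]] := Hl e e0; exists d; split=> // w _; rewrite !Cnorm_Cmod => -[_ Hw].
exact: Hd.
Qed.

(** * Existence of the Kobayashi pseudo-distance *)

Section Kobayashi.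
Variables (n q : nat) (a : nat -> nat -> Cplx) (m : Defs.mult).
Hypothesis nq : (n < q)%nat.
Hypothesis gp : general_position n q a.
Notation L := (lform n a).
Notation admi := (admissible n q a m).
Notation inS := (in_S n q a m).

Lemma lform_ext i (x y : vec) : (forall j, (j <= n)%nat -> x j = y j) -> L i x = L i y.
Proof.
rewrite /lform => H; have : forall k, (k <= S n)%nat ->
    Csum k (fun j => Cmul (a i j) (x j)) = Csum k (fun j => Cmul (a i j) (y j)).
  by elim=> [//|k IH] Hk /=; rewrite IH ?H //; lia.
by apply.
Qed.

Lemma lform_lin i (x y : nat -> C) (s t : C) :
  L i (fun j => s * x j + t * y j) = s * L i x + t * L i y.
Proof.
rewrite /lform; elim: (S n) => [|k IH]; first by rewrite -![Csum 0 _]/(RtoC 0); cring.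
rewrite -![Csum (S k) _]/(Cplus (Csum k _) (Cmult (a i k) _)) IH; cring.
Qed.

Lemma lform0 i (x : nat -> C) : (forall j, (j <= n)%nat -> x j = RtoC 0) -> L i x = RtoC 0.
Proof.
move=> H; rewrite (lform_ext i x (fun j => 0 * x j + 0 * x j)) ?lform_lin; first by cring.
by move=> j Hj; rewrite H //; cring.
Qed.

Lemma inS_proj x y : inS x -> proj_eq n x y -> inS y.
Proof.
move=> [[j [Hj xj]] Hx] [lam [l0 E]]; split.
  by exists j; split=> //; rewrite E // => Z; case: (Cmult_neq_0 _ _ l0 xj).
move=> i Hi mi; have -> : L i y = lam * L i x; last by apply: Cmult_neq_0 => //; apply: Hx.
rewrite (lform_ext i y (fun k => lam * x k + 0 * x k)) ?lform_lin; first by cring.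
by move=> k Hk; rewrite E // Cmul_Cmult; cring.
Qed.

Lemma orb_inS F z : orbifold_morphism n q a m F -> inD z -> inS (F z).
Proof.
move=> [_ [h2 [_ h4]]] Hz; split; first exact: h2.
by move=> i Hi mi; have := h4 i Hi; rewrite mi; apply.
Qed.

(** The bound is uniform in [d], as a finite supremum over all admissible [d] demands. *)
Definition linked (x y : vec) : Prop := exists B : R, forall d, admi d -> d x y <= B.

Lemma linked_sym x y : inS x -> inS y -> linked x y -> linked y x.
Proof. by move=> Sx Sy [B HB]; exists B => d Hd; case: (Hd) => -[_ [_ [sym _]]] _; rewrite sym //; apply: HB. Qed.

Lemma linked_trans x y z : inS x -> inS y -> inS z -> linked x y -> linked y z -> linked x z.
Proof.
move=> Sx Sy Sz [B1 H1] [B2 H2]; exists (B1 + B2)%R => d Hd; case: (Hd) => -[_ [_ [_ [tri _]]]] _.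
by have := tri x y z Sx Sy Sz; have := H1 d Hd; have := H2 d Hd; lra.
Qed.

Lemma linked_proj x y : inS x -> proj_eq n x y -> linked x y.
Proof.
move=> Sx P; have Sy := inS_proj x y Sx P; exists 0%R => d; case=> -[_ [h0 [_ [_ hp]]]] _.
by rewrite -(hp x y y Sx Sy P) h0 //; lra.
Qed.

Lemma linked_disc F z w : orbifold_morphism n q a m F -> inD z -> inD w -> linked (F z) (F w).
Proof. by move=> HF Hz Hw; exists (poincare z w) => d [_ Hd]; apply: Hd. Qed.

Definition generic (x : vec) := forall i, (i < q)%nat -> L i x <> RtoC 0.

Lemma generic_inS x : generic x -> inS x.
Proof.
move=> Hx; split; last by move=> i Hi _; apply: Hx.
apply: NNPP => N; apply: (Hx 0%nat); first lia.
by apply: lform0 => j Hj; apply: NNPP => Z; apply: N; exists j.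
Qed.

Lemma small_perturb k (A B : nat -> C) : (forall i, (i < k)%nat -> A i <> 0) ->
  exists e, (0 < e)%R /\ forall t, (Cmod t <= e)%R -> forall i, (i < k)%nat -> A i + t * B i <> RtoC 0.
Proof.
elim: k => [|k IH] H; first by exists 1%R; split; [lra|move=> t _ i; lia].
have [e [e0 He]] := IH (fun i Hi => H i ltac:(lia)).
have Ak := proj1 (Cmod_gt_0 _) (H k ltac:(lia)); have Bk := Cmod_ge_0 (B k).
have m0 : (0 < Rmin e (Cmod (A k) / (2 * (1 + Cmod (B k)))))%R.
  by apply: Rmin_pos => //; apply: Rdiv_lt_0_compat; lra.
eexists; split; first exact: m0.
move=> t Ht i Hi; have t1 := Rle_trans _ _ _ Ht (Rmin_l _ _); have t2 := Rle_trans _ _ _ Ht (Rmin_r _ _).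
case: (Nat.eq_dec i k) => [->|ne]; last by apply: He => //; lia.
move=> Z; have t0 := Cmod_ge_0 t.
have E : A k = - (t * B k) by have -> : A k = (A k + t * B k) - t * B k by [cring]; rewrite Z; cring.
have : (Cmod (A k) <= Cmod t * (1 + Cmod (B k)))%R by rewrite {1}E Cmod_opp Cmod_mult; nra.
have := Rmult_le_compat_r (1 + Cmod (B k))%R _ _ ltac:(lra) t2.
have -> : (Cmod (A k) / (2 * (1 + Cmod (B k))) * (1 + Cmod (B k)) = Cmod (A k) / 2)%R by field; lra.
lra.
Qed.

Lemma row_nonzero i : (i < q)%nat -> exists e : vec, L i e <> RtoC 0.
Proof.
move=> Hi; apply: NNPP => N.
(* General position speaks of [n + 1] distinct indices; [i] is completed cyclically, without
   repetition because [n < q]. *)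
pose idx k := ((i + k) mod q)%nat.
have idxE k : (k <= n)%nat -> idx k = (i + k)%nat \/ idx k = (i + k - q)%nat /\ (q <= i + k)%nat.
  move=> Hk; rewrite /idx; case: (Nat.lt_ge_cases (i + k) q) => H; first by left; apply: Nat.mod_small.
  by right; split=> //; rewrite -{1}(Nat.sub_add _ _ H) -{2}(Nat.mul_1_l q) Nat.Div0.mod_add Nat.mod_small //; lia.
have := gp idx _ _ (fun k => match k with O => RtoC 1 | _ => RtoC 0 end) _ 0%nat ltac:(lia).
move=> H; apply: C1_nz; apply: H.
- by move=> k Hk; apply: Nat.mod_upper_bound; lia.
- by move=> k l Hk Hl; have := idxE k Hk; have := idxE l Hl; lia.
move=> j Hj; have aj : a i j = RtoC 0.
  apply: NNPP => aj; apply: N; exists (fun k => if Nat.eq_dec k j then RtoC 1 else RtoC 0).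
  have : forall k, Csum k (fun l => Cmul (a i l) (if Nat.eq_dec l j then RtoC 1 else RtoC 0)) =
     if lt_dec j k then a i j else RtoC 0.
    elim=> [//|k IH]; rewrite -[Csum (S k) _]/(Cplus (Csum k _) (Cmult (a i k) _)) IH.
    case: (Nat.eq_dec k j) => h0; case: (lt_dec j _) => h1; case: (lt_dec j _) => h2; try lia; try subst k; rewrite /=; cring.
  by rewrite /lform => ->; case: (lt_dec j (S n)) => // h; lia.
have i0 : idx 0%nat = i by rewrite /idx Nat.add_0_r Nat.mod_small.
have : forall k, Csum (S k) (fun l => Cmul (match l with O => RtoC 1 | _ => RtoC 0 end) (a (idx l) j)) = RtoC 0.
  elim=> [|k IH].
    rewrite -[LHS]/(Cplus (RtoC 0) (Cmult (RtoC 1) (a (idx 0%nat) j))) i0 aj; cring.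
  rewrite -[LHS]/(Cplus (Csum (S k) _) (Cmult (RtoC 0) (a (idx (S k)) j))) IH; cring.
by apply.
Qed.

(** One hyperplane at a time: a small multiple of a vector off the next hyperplane repairs that form
    without making the previous ones vanish. *)
Lemma generic_exists : exists y, generic y.
Proof.
suff : forall k, (k <= q)%nat -> exists y : vec, forall i, (i < k)%nat -> L i y <> RtoC 0 by move=> H; apply: (H q).
elim=> [|k IH] Hk; first by exists (fun _ => RtoC 0) => i; lia.
have [y Hy] := IH ltac:(lia); have [e He] := row_nonzero k ltac:(lia).
have [eps [e0 Heps]] := small_perturb k (fun i => L i y) (fun i => L i e) Hy.
have key (t : C) : (Cmod t <= eps)%R -> L k y + t * L k e <> RtoC 0 ->
    exists y : vec, forall i, (i < S k)%nat -> L i y <> RtoC 0.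
  move=> Ht Hk'; exists (fun j => RtoC 1 * y j + t * e j) => i Hi; rewrite lform_lin Cmult_1_l.
  by case: (Nat.eq_dec i k) => [->//|ne]; apply: Heps => //; lia.
case: (classic (L k y = RtoC 0)) => Z.
  apply: (key (RtoC eps)); first by rewrite Cmod_R Rabs_pos_eq; lra.
  by rewrite Z Cplus_0_l; apply: Cmult_neq_0 => // /RtoC_inj; lra.
by apply: (key 0); rewrite ?Cmod_0 ?Cmult_0_l ?Cplus_0_r //; lra.
Qed.

Lemma mult_bound k : exists M, (1 <= M)%nat /\ forall i p, (i < k)%nat -> m i = Some p -> (p <= M)%nat.
Proof.
elim: k => [|k [M [M1 HM]]]; first by exists 1%nat; split=> // i p; lia.
exists (M + match m k with Some p => p | None => 0 end)%nat; split; first lia.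
move=> i p Hi mi; case: (Nat.eq_dec i k) => [E|ne]; first by rewrite -E mi; lia.
by have := HM i p ltac:(lia) mi; lia.
Qed.

(* [z |-> x + e z^M y] is tangent to order [M] at [x] to every hyperplane through [x], and meets no other hyperplane. *)
Lemma linked_generic x y : inS x -> generic y -> exists x', generic x' /\ linked x x'.
Proof.
move=> Sx Hy; have [M [M1 HM]] := mult_bound q.
(* For a hyperplane through [x] the constant 1 replaces the form, so that [small_perturb] applies
   and controls the other hyperplanes only. *)
pose A i : C := if excluded_middle_informative (L i x = RtoC 0) then RtoC 1 else L i x.
pose B i : C := if excluded_middle_informative (L i x = RtoC 0) then RtoC 0 else L i y.
have A0 i : (i < q)%nat -> A i <> 0.
  by move=> _; rewrite /A; case: (excluded_middle_informative _) => //= _; apply: C1_nz.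
have [e [e0 He]] := small_perturb q A B A0.
pose F (z : C) : vec := fun j => RtoC 1 * x j + RtoC e * z ^ M * y j.
have LF i z : L i (F z) = L i x + RtoC e * z ^ M * L i y by rewrite /F lform_lin Cmult_1_l.
have eC : RtoC e <> 0 by move=> /RtoC_inj; lra.
have zM z : (Cmod z < 1)%R -> (Cmod (RtoC e * z ^ M) <= e)%R.
  move=> Hz; rewrite Cmod_mult Cmod_R Rabs_pos_eq; last lra.
  have := pow_incr (Cmod z) 1 M (conj (Cmod_ge_0 z) (Rlt_le _ _ Hz)).
  by rewrite pow1 -Cmod_pow => H; have := Rmult_le_compat_l e _ _ (Rlt_le _ _ e0) H; lra.
have nz i z : (i < q)%nat -> (Cmod z < 1)%R -> L i x <> RtoC 0 -> L i (F z) <> RtoC 0.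
  move=> Hi Hz N; have := He _ (zM z Hz) i Hi; rewrite LF /A /B; case: (excluded_middle_informative _) => //=.
have nz0 i z : (i < q)%nat -> (Cmod z < 1)%R -> z <> 0 -> L i (F z) <> RtoC 0.
  move=> Hi Hz Nz; case: (classic (L i x = RtoC 0)) => [Z|]; last exact: nz.
  rewrite LF Z Cplus_0_l; apply: Cmult_neq_0; last exact: Hy.
  by apply: Cmult_neq_0 => //; apply: Cpow_nz.
have h2 : (Cmod (RtoC (/ 2)) < 1)%R by rewrite Cmod_R Rabs_pos_eq; lra.
have hh : RtoC (/ 2) <> 0 by move=> /RtoC_inj; lra.
have F0 : F (RtoC 0) = fun j => RtoC 1 * x j + 0 * y j.
  have z0M : RtoC 0 ^ M = RtoC 0 by case: (M) M1 => [|k] Hk; [lia|rewrite /=; ring].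
  by rewrite /F z0M Cmult_0_r.
have orb : orbifold_morphism n q a m F.
  split.
    move=> j Hj; apply/holo_hol; apply: hol_plus; first exact: hol_const.
    apply: hol_mult; last exact: hol_const.
    by apply: hol_mult; [apply: hol_const|apply: hol_pow; apply: hol_id].
  split.
    move=> z /inD_Cmod Hz; case: (classic (z = RtoC 0)) => [->|Nz].
      rewrite F0; case: Sx => -[j [Hj xj]] _; exists j; split=> //.
      by have -> : RtoC 1 * x j + 0 * y j = x j by cring.
    apply: NNPP => N; apply: (nz0 0%nat z ltac:(lia) Hz Nz); apply: lform0 => j Hj.
    by apply: NNPP => Fj; apply: N; exists j.
  split; first by exists (RtoC (/ 2)); split; [apply/inD_Cmod|move=> i Hi; apply: nz0].
  move=> i Hi; case Emi : (m i) => [k|]; last first.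
    by move=> z /inD_Cmod Hz; apply: nz => //; case: Sx => _; apply.
  move=> z0 /inD_Cmod Hz0 Z.
  have Z0 : z0 = RtoC 0 by apply: NNPP => /(nz0 i z0 Hi Hz0); apply.
  have Lx : L i x = RtoC 0 by apply: NNPP => /(nz i z0 Hi Hz0); apply.
  exists (fun z => RtoC e * z ^ (M - k) * L i y); split.
    apply/holo_hol; apply: hol_mult; last exact: hol_const.
    by apply: hol_mult; [apply: hol_const|apply: hol_pow; apply: hol_id].
  move=> z _; rewrite LF Lx Z0 Defs_Cpow Csub_Cminus Cmul_Cmult.
  have -> : z - 0 = z by cring.
  have {1}-> : M = (k + (M - k))%nat by have := HM i k Hi Emi; lia.
  by rewrite Cpow_add_r; cring.
have D0 : inD (RtoC 0) by apply/inD_Cmod; rewrite Cmod_0; lra.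
have Dh : inD (RtoC (/ 2)) by apply/inD_Cmod.
exists (F (RtoC (/ 2))); split; first by move=> i Hi; apply: nz0.
apply: (linked_trans _ (F (RtoC 0))) => //; try by apply: orb_inS.
  apply: linked_proj => //; exists (RtoC 1); split; first exact: C1_nz.
  by move=> j Hj; rewrite F0 Cmul_Cmult; cring.
exact: linked_disc.
Qed.

Lemma fin_pos k (P : nat -> R -> Prop) : (forall i r r', P i r -> (0 < r' <= r)%R -> P i r') ->
  (forall i, (i < k)%nat -> exists r, (0 < r)%R /\ P i r) -> exists r, (0 < r)%R /\ forall i, (i < k)%nat -> P i r.
Proof.
move=> mono; elim: k => [|k IH] H; first by exists 1%R; split; [lra|move=> i; lia].
have [r [r0 Hr]] := IH (fun i Hi => H i ltac:(lia)); have [s [s0 Hs]] := H k ltac:(lia).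
have m0 : (0 < Rmin r s)%R by apply: Rmin_pos.
exists (Rmin r s); split=> // i Hi; case: (Nat.eq_dec i k) => [->|ne].
  by apply: mono Hs _; split=> //; apply: Rmin_r.
by apply: (mono _ r); [apply: Hr; lia|split=> //; apply: Rmin_l].
Qed.

(** For [u = 1 + i t] each condition excludes at most one value of [t], so that every large [t]
    works. *)
Lemma avoid_real k (b : nat -> C) : (forall i, (i < k)%nat -> b i <> RtoC 0) ->
  exists u, u <> RtoC 0 /\ forall i, (i < k)%nat -> snd (u * b i) <> 0%R.
Proof.
move=> Hb; suff [T HT] : exists T, forall t, (T < t)%R -> forall i, (i < k)%nat -> snd (((1, t) : C) * b i) <> 0%R.
  exists (1, T + 1)%R; split; first by move=> /(f_equal fst) /=; lra.
  by apply: HT; lra.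
elim: k Hb => [|k IH] Hb; first by exists 0%R => t _ i; lia.
have [T HT] := IH (fun i Hi => Hb i ltac:(lia)).
exists (Rmax T (- snd (b k) / fst (b k)))%R => t Ht i Hi.
have t1 := Rle_lt_trans _ _ _ (Rmax_l _ _) Ht; have t2 := Rle_lt_trans _ _ _ (Rmax_r _ _) Ht.
case: (Nat.eq_dec i k) => [->|ne]; last by apply: HT => //; lia.
rewrite /= => Z; case: (Req_dec (fst (b k)) 0) => f0.
  apply: (Hb k); first lia.
  by rewrite f0 in Z; apply: injective_projections => //=; lra.
have E : (- snd (b k) / fst (b k) = t)%R by have -> : snd (b k) = (- t * fst (b k))%R by [lra]; field.
lra.
Qed.

Lemma Cinv_neq0 (z : C) : z <> 0 -> / z <> 0.
Proof. by move=> N Z; apply: C1_nz; rewrite -(Cinv_r z) // Z Cmult_0_r. Qed.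

(* If [(1 - w) A + w B = 0] then [w = 1 / (1 - B/A)], which is not real. *)
Lemma segment_safe (A B : C) : A <> RtoC 0 -> snd (B * / A) <> 0%R -> exists r, (0 < r)%R /\
  forall (s : R) t, (Cmod t <= r)%R -> (1 - (s + t)) * A + (s + t) * B <> RtoC 0.
Proof.
move=> A0 Hb; set b := B * / A in Hb; have Bb : B = b * A by rewrite /b; field.
clearbody b.
have N1 : 1 - b <> 0 by move=> /(f_equal snd) /= H; lra.
have iw : snd (/ (1 - b)) <> 0%R.
  move=> Z; have E : b = 1 - / / (1 - b) by field.
  apply: Hb; have -> : snd b = snd (1 - / / (1 - b)) by rewrite -E.
  have -> : / (1 - b) = RtoC (fst (/ (1 - b))) by apply: injective_projections.
  rewrite -RtoC_inv; first by rewrite -[RtoC 1]/(RtoC 1) /= Ropp_0 Rplus_0_r.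
  by move=> f0; apply: (Cinv_neq0 _ N1); apply: injective_projections.
have p0 := Rabs_pos_lt _ iw.
exists (Rabs (snd (/ (1 - b))%C) / 2)%R; split; first lra.
move=> s t Ht Z.
have E : (s + t) * (1 - b) = 1.
  have E1 : (1 - (s + t) * (1 - b)) * A = 0 by rewrite -Z Bb; ring.
  have E2 : 1 - (s + t) * (1 - b) = 0 by apply: NNPP => N; apply: (Cmult_neq_0 _ _ N A0).
  by have -> : (s + t) * (1 - b) = 1 - (1 - (s + t) * (1 - b)) by [ring]; rewrite E2; ring.
have E3 : t = / (1 - b) - s.
  have -> : / (1 - b) = ((s + t) * (1 - b)) * / (1 - b) by rewrite E; ring.
  by field.
have := snd_le_Cmod t; rewrite {1}E3.
have -> : snd (/ (1 - b) - s) = snd (/ (1 - b)) by rewrite /=; lra.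
lra.
Qed.

(** After multiplication of [y] by a suitable [u], the line [g] through the two points meets no
    hyperplane at parameters in a strip around the real axis. Finitely many discs of radius [r] lead
    through this strip from 0 to 1. *)
Lemma linked_generics x y : generic x -> generic y -> linked x y.
Proof.
move=> Gx Gy.
have bn i : (i < q)%nat -> L i y * / L i x <> RtoC 0.
  by move=> Hi; apply: Cmult_neq_0; [apply: Gy|apply: Cinv_neq0; apply: Gx].
have [u [u0 Hu]] := avoid_real q _ bn.
pose P i r := forall (s : R) t, (Cmod t <= r)%R -> (1 - (s + t)) * L i x + (s + t) * (u * L i y) <> RtoC 0.
have [r [r0 Hr]] : exists r, (0 < r)%R /\ forall i, (i < q)%nat -> P i r.
  apply: fin_pos; first by move=> i r r' H Hr' s t Ht; apply: H; lra.
  move=> i Hi; apply: segment_safe; first exact: Gx.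
  by have -> : u * L i y * / L i x = u * (L i y * / L i x) by [cring]; apply: Hu.
pose g (w : C) : vec := fun j => (1 - w) * x j + (w * u) * y j.
have Lg i w : L i (g w) = (1 - w) * L i x + w * (u * L i y) by rewrite /g lform_lin; cring.
have Gg (s : R) t : (Cmod t <= r)%R -> generic (g (s + t)) by move=> Ht i Hi; rewrite Lg; apply: Hr.
have orb (s : R) : orbifold_morphism n q a m (fun z => g (s + RtoC r * z)).
  have Gz z : inD z -> generic (g (s + RtoC r * z)).
    move=> /inD_Cmod Hz; apply: Gg; rewrite Cmod_mult Cmod_R Rabs_pos_eq; last lra.
    by have := Rmult_le_compat_l r _ _ (Rlt_le _ _ r0) (Rlt_le _ _ Hz); lra.
  split.
    move=> j Hj; apply/holo_hol.
    have hw : hol 0 1 (fun z => s + RtoC r * z).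
      by apply: hol_plus; [apply: hol_const|apply: hol_mult; [apply: hol_const|apply: hol_id]].
    apply: hol_plus; apply: hol_mult; try exact: hol_const.
      by apply: hol_minus => //; apply: hol_const.
    by apply: hol_mult => //; apply: hol_const.
  split; first by move=> z /Gz /generic_inS [].
  have D0 : inD (RtoC 0) by apply/inD_Cmod; rewrite Cmod_0; lra.
  split; first by exists (RtoC 0); split=> // i; apply: Gz.
  move=> i Hi; case: (m i) => [k|]; last by move=> z Hz; apply: Gz.
  by move=> z Hz Z; case: (Gz z Hz i Hi).
have S0 (s : R) : inS (g s).
  by have -> : g s = g (s + 0) by [congr g; cring]; apply: generic_inS; apply: Gg; rewrite Cmod_0; lra.
have step (s : R) (e : R) : (0 <= e < r)%R -> linked (g s) (g (s + e)%R).
  move=> He; have -> : g s = g (s + RtoC r * 0) by congr g; cring.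
  have -> : g (s + e)%R = g (s + RtoC r * RtoC (e / r)).
    by congr g; rewrite -RtoC_mult -RtoC_plus; congr RtoC; field; lra.
  apply: (linked_disc _ _ _ (orb s)); apply/inD_Cmod; first by rewrite Cmod_0; lra.
  rewrite Cmod_R Rabs_pos_eq; last by apply: Rmult_le_pos; [lra|apply/Rlt_le/Rinv_0_lt_compat].
  by have := Rmult_lt_compat_r (/ r) _ _ (Rinv_0_lt_compat _ r0) (proj2 He); rewrite Rinv_r; lra.
have [N HN] := INR_unbounded (/ r).
have N0 : (0 < INR N)%R by have := Rinv_0_lt_compat _ r0; lra.
have iN : (0 <= / INR N < r)%R.
  split; first exact/Rlt_le/Rinv_0_lt_compat.
  rewrite -(Rinv_inv r); apply: Rinv_lt_contravar => //.
  by apply: Rmult_lt_0_compat => //; apply: Rinv_0_lt_compat.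
have walk k : linked (g (RtoC 0)) (g (INR k * / INR N)%R).
  elim: k => [|k IH].
    by rewrite Rmult_0_l; apply: linked_proj => //; exists (RtoC 1); split; [apply: C1_nz|move=> j _; rewrite Cmul_Cmult Cmult_1_l].
  apply: (linked_trans _ (g (INR k * / INR N)%R)) => //.
  have -> : (INR (S k) * / INR N = INR k * / INR N + / INR N)%R by rewrite S_INR; lra.
  exact: step.
have Sx := generic_inS x Gx; have Sy := generic_inS y Gy.
apply: (linked_trans _ (g (RtoC 0))) => //.
  apply: linked_proj => //; exists (RtoC 1); split; first exact: C1_nz.
  by move=> j _; rewrite /g Cmul_Cmult; cring.
apply: (linked_trans _ (g (RtoC 1))) => //.
  by have := walk N; rewrite Rinv_r //; lra.
apply: linked_sym => //; apply: linked_proj => //; exists u; split=> //.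
by move=> j _; rewrite /g Cmul_Cmult; cring.
Qed.

Lemma linked_all x y : inS x -> inS y -> linked x y.
Proof.
move=> Sx Sy; have [g Gg] := generic_exists.
have [x' [Gx' Lx]] := linked_generic x g Sx Gg; have [y' [Gy' Ly]] := linked_generic y g Sy Gg.
have Sx' := generic_inS _ Gx'; have Sy' := generic_inS _ Gy'.
apply: (linked_trans _ x') => //; apply: (linked_trans _ y') => //; first exact: linked_generics.
exact: linked_sym.
Qed.

(** All the axioms pass to a pointwise supremum; [d0] makes the sets of values nonempty and
    [linked_all] makes them bounded. *)
Lemma kobayashi_exists d0 : admi d0 -> exists d, is_orbifold_kobayashi n q a m d.
Proof.
move=> A0; pose E x y r := exists d, admi d /\ r = d x y.
(* The value is arbitrary unless both points satisfy [inS], the only case in which the axioms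
   constrain it. *)
have ex x y : exists s, inS x -> inS y -> is_lub (E x y) s.
  case: (classic (inS x /\ inS y)) => [[Sx Sy]|N]; last by exists 0%R => Sx Sy; case: N.
  have [B HB] := linked_all x y Sx Sy.
  have [||s Hs] := completeness (E x y); last by exists s.
    by exists B => r [d [Ad ->]]; apply: HB.
  by exists (d0 x y); exists d0.
pose K x y := proj1_sig (constructive_indefinite_description _ (ex x y)).
have HK x y : inS x -> inS y -> is_lub (E x y) (K x y).
  exact: (proj2_sig (constructive_indefinite_description _ (ex x y))).
have ub x y d : inS x -> inS y -> admi d -> (d x y <= K x y)%R.
  by move=> Sx Sy Ad; apply: (proj1 (HK x y Sx Sy)); exists d.
have lb x y r : inS x -> inS y -> (forall d, admi d -> (d x y <= r)%R) -> (K x y <= r)%R.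
  by move=> Sx Sy H; apply: (proj2 (HK x y Sx Sy)) => _ [d [Ad ->]]; apply: H.
exists K; split; last by move=> d Ad x y Sx Sy; apply: ub.
split; last first.
  move=> F HF z w Hz Hw; apply: lb; try exact: orb_inS HF _.
  by move=> d [_]; apply.
split; first by move=> x y Sx Sy; case: (A0) => -[nn _] _; apply: Rle_trans (ub x y d0 Sx Sy A0); apply: nn.
split.
  move=> x Sx; apply: Rle_antisym.
    by apply: lb => // d [[_ [h _]] _]; rewrite h //; lra.
  by case: (A0) => -[_ [h _]] _; rewrite -(h x Sx); apply: ub.
split.
  move=> x y Sx Sy; apply: Rle_antisym; apply: lb => // d Ad; case: (Ad) => -[_ [_ [h _]]] _; rewrite h //; exact: ub.
split.
  move=> x y z Sx Sy Sz; apply: lb => // d Ad; case: (Ad) => -[_ [_ [_ [h _]]]] _.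
  by have := h x y z Sx Sy Sz; have := ub x y d Sx Sy Ad; have := ub y z d Sy Sz Ad; lra.
move=> x x' y Sx Sy P; have Sx' := inS_proj x x' Sx P.
apply: Rle_antisym; apply: lb => // d Ad; case: (Ad) => -[_ [_ [_ [_ h]]]] _.
  by rewrite (h x x' y) //; apply: ub.
by rewrite -(h x x' y) //; apply: ub.
Qed.
End Kobayashi.
End Analysis.

Module Matroid.
Import all_boot all_order all_algebra zify ring lra.
Import Order.TTheory GRing.Theory Num.Theory.
Set Implicit Arguments. Unset Strict Implicit. Unset Printing Implicit Defensive.
Local Open Scope ring_scope.

Lemma mulr_shuffle (R : comNzRingType) (x w x2 u h v : R) :
  x * w * (x2 * u * (h * v)) = x * (h * x2) * (w * (u * v)).
Proof. ring. Qed.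

(** The hypothesis on [u] gives [th <= 1] and [th m <= u (1 - th) <= t (1 - th)]; adding [th t]
    concludes. This is the case of [nochka_weights] in which a union of sets is too large for
    extremality to apply. *)
Lemma nochka_arith (F : realFieldType) (th u t r m : F) : 0 < th -> 0 < u -> 0 <= m -> u <= t ->
  r <= t + m -> th * (m + u) <= u -> th * r <= t.
Proof.
move=> th0 u0 m0 ut rtm key.
have th1 : th <= 1.
  have : th * u <= 1 * u by rewrite mul1r; apply: le_trans key; rewrite ler_pM2l // lerDr.
  by rewrite ler_pM2r.
have a1 : th * r <= th * (t + m) by rewrite ler_pM2l.
have a2 : 0 <= (t - u) * (1 - th) by apply: mulr_ge0; rewrite subr_ge0.
by move: key a1 a2; clear; lra.
Qed.

(** * Nochka weights for a matroid rank function *)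

Section Nochka.
Variables (T : finType) (F : archiRealFieldType).

Lemma card_unionD (A B : {set T}) : #|A :|: B| = (#|B| + #|A :\: B|)%N.
Proof. by rewrite cardsU -(cardsID B A); lia. Qed.

(* A vertex of the base polytope, by the greedy algorithm. *)
Lemma polymatroid_base (g : {set T} -> F) :
  g set0 = 0 -> (forall A B : {set T}, g (A :|: B) + g (A :&: B) <= g A + g B) ->
  (forall A B : {set T}, A \subset B -> g A <= g B) ->
  forall X : {set T}, exists w : T -> F,
  [/\ forall i, 0 <= w i, forall S : {set T}, S \subset X -> \sum_(i in S) w i <= g S & \sum_(i in X) w i = g X].
Proof.
move=> g0 gsub gmono X; move: {2}#|X| (erefl #|X|) => n; elim: n X => [|n IH] X cX.
  move/cards0_eq: cX => ->; exists (fun=> 0); split=> // [S|].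
    by rewrite subset0 => /eqP ->; rewrite big_set0 g0.
  by rewrite big_set0.
have [e eX] : exists e, e \in X by apply/card_gt0P; rewrite cX.
have [|w [w0 wS wX]] := IH (X :\ e); first by move: cX; rewrite (cardsD1 e X) eX; lia.
pose w' i := if i == e then g X - g (X :\ e) else w i.
have w'w S : e \notin S -> \sum_(i in S) w' i = \sum_(i in S) w i.
  move=> eS; apply: eq_bigr => i iS; rewrite /w'; case: eqP => // E; by rewrite -E iS in eS.
have XE : \sum_(i in X) w' i = g X.
  rewrite (big_setD1 e eX) /= w'w ?wX ?setD11 // {1}/w' eqxx; ring.
exists w'; split=> // [i|S SX].
  by rewrite /w'; case: eqP => // _; rewrite subr_ge0; apply: gmono; apply: subsetDl.
have [eS|eS] := boolP (e \in S); last first.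
  by rewrite w'w //; apply: wS; rewrite subsetD1 SX.
rewrite (big_setD1 e eS) /= w'w ?setD11 // {1}/w' eqxx.
have := wS (S :\ e) (setSD _ SX).
have := gsub S (X :\ e).
have -> : S :|: (X :\ e) = X.
  apply/setP => i; rewrite !inE; have := subsetP SX i; case: eqP => [->|_] /=; first by rewrite eS eX.
  by case: (i \in S) => // ->.
have -> : S :&: (X :\ e) = S :\ e.
  apply/setP => i; rewrite !inE; have := subsetP SX i; case: eqP => //= _; first by rewrite andbF.
  by case: (i \in S) => // ->.
lra.
Qed.

Variable rk : {set T} -> nat.
Hypothesis rk0 : rk set0 = 0%N.
Hypothesis rk1 : forall i, (rk [set i] <= 1)%N.
Hypothesis rkmono : forall A B : {set T}, A \subset B -> (rk A <= rk B)%N.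
Hypothesis rksub : forall A B : {set T}, (rk (A :|: B) + rk (A :&: B) <= rk A + rk B)%N.

Lemma rk_step i (A : {set T}) : (rk (i |: A) <= rk A + 1)%N.
Proof. by have := rksub [set i] A; have := rk1 i; lia. Qed.

Lemma rk_card (A : {set T}) : (rk A <= #|A|)%N.
Proof.
move: {2}#|A| (erefl #|A|) => n; elim: n A => [|n IH] A cA; first by move/cards0_eq: cA => ->; rewrite rk0.
have [e eA] : exists e, e \in A by apply/card_gt0P; rewrite cA.
have cA' : #|A :\ e| = n by move: cA; rewrite (cardsD1 e A) eA; lia.
by have := rk_step e (A :\ e); rewrite setD1K //; have := IH _ cA'; lia.
Qed.

(** Subtract the least value [E e] everywhere and remove [e]: the left side loses at most
    [E e * rk X] by the hypothesis on [w], the right side exactly this amount because a basis has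
    [rk X] elements. The element [e] joins the basis when its removal lowers the rank. *)
Lemma greedy_basis (X : {set T}) (w E : T -> F) :
  (forall i, i \in X -> 0 <= E i) -> (forall S : {set T}, S \subset X -> \sum_(i in S) w i <= (rk S)%:R) ->
  exists B : {set T}, [/\ B \subset X, #|B| = rk X, rk B = rk X & \sum_(i in X) w i * E i <= \sum_(i in B) E i].
Proof.
move: {2}#|X| (erefl #|X|) => n; elim: n X E => [|n IH] X E cX E0 wS.
  by move/cards0_eq: cX => ->; exists set0; rewrite cards0 rk0 !big_set0.
have [e0 e0X] : exists e, e \in X by apply/card_gt0P; rewrite cX.
case: (@arg_minP _ F T e0 (mem X) E e0X) => e eX0 emin; have eX : e \in X by [].
have [|i iX|S SX|B [BX cB rB sB]] := IH (X :\ e) (fun i => E i - E e).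
- by move: cX; rewrite (cardsD1 e X) eX; lia.
- by rewrite subr_ge0; apply: emin; move: iX; rewrite inE => /andP[].
- by apply: wS; apply: subset_trans SX (subsetDl _ _).
have eB : e \notin B by apply/negP => /(subsetP BX); rewrite setD11.
have BX' : B \subset X by apply: subset_trans BX (subsetDl _ _).
have S1 : \sum_(i in X) w i * E i = \sum_(i in X :\ e) w i * (E i - E e) + E e * \sum_(i in X) w i.
  rewrite !(big_setD1 e eX) /= mulrDr mulr_sumr.
  rewrite [X in _ = X + _](eq_bigr (fun i => w i * E i - E e * w i)); last by move=> i _; ring.
  rewrite sumrB; ring.
have S2 : \sum_(i in B) (E i - E e) = \sum_(i in B) E i - E e * (#|B|)%:R.
  by rewrite sumrB sumr_const mulr_natr.
have wX := wS X (subxx _); have Ee0 := E0 e eX.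
have P : E e * \sum_(i in X) w i <= E e * (rk X)%:R by apply: ler_wpM2l.
have stp := rk_step e (X :\ e); rewrite setD1K // in stp.
have := rkmono (subsetDl X [set e]) => mo.
have [E1|N1] := eqVneq (rk X) (rk (X :\ e)).
  exists B; split=> //; [by rewrite E1|by rewrite E1|].
  rewrite S1; rewrite S2 cB -E1 in sB; lra.
have E1 : rk X = (rk (X :\ e)).+1 by move/eqP: N1 stp mo; clear - F rk0 rk1 rkmono rksub; lia.
exists (e |: B); split.
- by rewrite subUset sub1set eX.
- by rewrite cardsU1 eB cB E1.
- apply/eqP; rewrite eqn_leq rkmono ?subUset ?sub1set ?eX //=.
  have := rksub (X :\ e) (e |: B).
  have -> : (X :\ e) :|: (e |: B) = X.
    apply/setP => i; rewrite !inE; have := subsetP BX' i; case: eqP => [->|_] /=; first by rewrite eX.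
    by case: (i \in B) => // [->//|]; rewrite orbF.
  have -> : (X :\ e) :&: (e |: B) = B.
    apply/setP => i; rewrite !inE; have := subsetP BX' i; case: eqP => [->|_] /=; first by rewrite (negbTE eB).
    by case: (i \in B) => // [->//|]; rewrite andbF.
  rewrite rB; clear - F rk0 rk1 rkmono rksub; lia.
- rewrite big_setU1 //= S1; rewrite S2 cB in sB; rewrite E1 -natr1 in P; lra.
Qed.

Lemma rk_closure (A B : {set T}) : (forall i, i \in A -> rk (i |: B) = rk B) -> rk (A :|: B) = rk B.
Proof.
move: {2}#|A| (erefl #|A|) => n; elim: n A => [|n IH] A cA H.
  by move/cards0_eq: cA => ->; rewrite set0U.
have [e eA] : exists e, e \in A by apply/card_gt0P; rewrite cA.
have I : rk ((A :\ e) :|: B) = rk B.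
  apply: IH => [|i]; first by move: cA; rewrite (cardsD1 e A) eA; lia.
  by rewrite inE => /andP[_ iA]; apply: H.
apply/eqP; rewrite eqn_leq (rkmono (subsetUr A B)) andbT.
have := rksub ((A :\ e) :|: B) (e |: B); rewrite I H //.
have -> : (A :\ e) :|: B :|: (e |: B) = A :|: B.
  apply/setP => i; rewrite !inE; case: eqP => [->|_] /=; first by rewrite eA orbT.
  by case: (i \in A) => //=; case: (i \in B).
have := rkmono (_ : B \subset ((A :\ e) :|: B) :&: (e |: B)); rewrite subsetI subsetUr subsetUr => /(_ isT); lia.
Qed.

Lemma extend_basis (Q B : {set T}) : B \subset Q -> #|B| = rk B ->
  exists B' : {set T}, [/\ B \subset B', B' \subset Q, #|B'| = rk B' & rk B' = rk Q].
Proof.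
move: {2}(rk Q - rk B)%N (erefl (rk Q - rk B)%N) => n; elim: n B => [|n IH] B en BQ cB.
  by exists B; split=> //; have := rkmono BQ; lia.
have [/existsP[e /andP[eQ ne]]|/existsPn N] := boolP [exists e, (e \in Q) && (rk (e |: B) != rk B)].
  have st := rk_step e B; have mo := rkmono (subsetUr [set e] B).
  have re : rk (e |: B) = (rk B).+1 by move/eqP: ne; lia.
  have eB : e \notin B by apply/negP => eB; move: ne; rewrite (setUidPr _) ?eqxx // sub1set.
  have [|||B' [B1 B2 B3 B4]] := IH (e |: B).
  - by rewrite re; lia.
  - by rewrite subUset sub1set eQ.
  - by rewrite cardsU1 eB cB re.
  by exists B'; split=> //; apply: subset_trans (subsetUr _ _) B1.
have : rk (Q :|: B) = rk B.
  by apply: rk_closure => i iQ; have := N i; rewrite iQ /= negbK => /eqP.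
by rewrite (setUidPl BQ); lia.
Qed.

(* The set [Ts] is extremal for the slope [(k + 1 - rk R) / (2N + 1 - k - |R|)] and [th] is its slope.  The weight is
   [th] off [Ts]; on [Ts] it is a base of the polymatroid of the truncated rank
   [S |-> min_(U <= S) (rk U + th |S - U|)], which agrees with [rk] at [Ts]. *)
Lemma nochka_weights (Q : {set T}) (N k : nat) :
  (k <= N)%N -> (2 * N < #|Q|)%N -> (forall R : {set T}, R \subset Q -> (N < #|R|)%N -> rk R = k.+1) ->
  exists (th : F) (w : T -> F), [/\ 0 < th, forall i, 0 <= w i <= th,
    forall R : {set T}, R \subset Q -> (#|R| <= N)%N -> \sum_(i in R) w i <= (rk R)%:R &
    \sum_(i in Q) w i = k%:R + 1 + th * (#|Q|%:R - 2 * N%:R + k%:R - 1)].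
Proof.
move=> kN NQ full.
(* Induction downwards from the sets of [N + 1] elements, which have rank [k + 1]: adding an element
   raises the rank by at most 1. *)
have low (R : {set T}) : R \subset Q -> (#|R| <= N.+1)%N -> (#|R| + k <= rk R + N)%N.
  move: {2}(N.+1 - #|R|)%N (erefl (N.+1 - #|R|)%N) => n; elim: n R => [|n IH] R en RQ cR.
    by rewrite full //; lia.
  have [e /setDP[eQ eR]] : exists e, e \in Q :\: R.
    by apply/card_gt0P; rewrite cardsD; have := subset_leq_card (subsetIr Q R); lia.
  have := IH (e |: R); rewrite cardsU1 eR => /(_ _ _ _).
  have := rk_step e R; rewrite subUset sub1set eQ RQ /=; lia.
have rkle (R : {set T}) : R \subset Q -> (rk R <= k.+1)%N.
  by move=> RQ; rewrite -(full Q) ?rkmono //; lia.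
pose d (R : {set T}) : F := 2 * N%:R + 1 - k%:R - #|R|%:R.
pose P := [pred R : {set T} | (R \subset Q) && (#|R| <= N)%N].
have kNF : k%:R <= N%:R :> F by rewrite ler_nat.
have d1 (R : {set T}) : P R -> 1 <= d R.
  by move=> /andP[_ cR]; have : #|R|%:R <= N%:R :> F; [rewrite ler_nat|move: kNF; rewrite /d; clear - F rk0 rk1 rkmono rksub; lra].
have P0 : P set0 by rewrite /= sub0set cards0.
case: (@arg_maxP _ F _ set0 P (fun R => (k%:R + 1 - (rk R)%:R) / d R) P0) => Ts PTs tmax.
set th := (_ / _) in tmax.
have dTs := d1 _ PTs.
have dp : 0 < d Ts := lt_le_trans ltr01 dTs.
have eqT : k%:R + 1 - (rk Ts)%:R = th * d Ts by rewrite /th divfK // gt_eqF.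
have leT (R : {set T}) : P R -> k%:R + 1 - (rk R)%:R <= th * d R.
  by move=> PR; have dR := lt_le_trans ltr01 (d1 _ PR); rewrite -ler_pdivrMr; [exact: tmax|].
have th0 : 0 < th.
  apply: lt_le_trans (tmax _ P0); rewrite rk0 subr0 divr_gt0 ?(lt_le_trans ltr01 (d1 _ P0)) //.
  by rewrite natr1 ltr0n.
have /andP[TsQ cTs] := PTs.
(* The elements of [U] are charged by their rank and the others [th] each; [am S] is a cheapest
   choice of [U] and [f S] its cost. *)
pose h (S U : {set T}) : F := (rk U)%:R + th * #|S :\: U|%:R.
pose am (S : {set T}) : {set T} := [arg min_(U < set0 | U \subset S) h S U]%O.
pose f (S : {set T}) := h S (am S).
have amP (S : {set T}) : am S \subset S /\ forall U : {set T}, U \subset S -> f S <= h S U.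
  by rewrite /f /am; case: arg_minP => [|U US Umin]; [apply: sub0set|].
have fle (S : {set T}) : f S <= (rk S)%:R.
  by apply: le_trans ((amP S).2 S (subxx _)) _; rewrite /h setDv cards0 mulr0 addr0.
have cD (S U : {set T}) : U \subset S -> #|S :\: U|%:R = #|S|%:R - #|U|%:R :> F.
  by move=> US; rewrite cardsD (setIidPr US) natrB // subset_leq_card.
have f0 : f set0 = 0.
  rewrite /f; have [/[!subset0]/eqP -> _] := amP set0.
  by rewrite /h rk0 setDv cards0 mulr0 addr0.
have fsub (A B : {set T}) : f (A :|: B) + f (A :&: B) <= f A + f B.
  have [UA _] := amP A; have [UB _] := amP B; rewrite {3 4}/f.
  set U := am A in UA *; set V := am B in UB *.
  have h1 := (amP (A :|: B)).2 (U :|: V) (setUSS UA UB).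
  have h2 := (amP (A :&: B)).2 (U :&: V) (setISS UA UB).
  apply: le_trans (lerD h1 h2) _; rewrite /h !cD ?setUSS ?setISS //.
  have r : (rk (U :|: V))%:R + (rk (U :&: V))%:R <= (rk U)%:R + (rk V)%:R :> F by rewrite -!natrD ler_nat.
  have c1 : #|A :|: B|%:R + #|A :&: B|%:R = #|A|%:R + #|B|%:R :> F by rewrite -!natrD cardsUI.
  have c2 : #|U :|: V|%:R + #|U :&: V|%:R = #|U|%:R + #|V|%:R :> F by rewrite -!natrD cardsUI.
  have -> : #|A :|: B|%:R = #|A|%:R + #|B|%:R - #|A :&: B|%:R :> F by rewrite -c1; ring.
  have -> : #|U :|: V|%:R = #|U|%:R + #|V|%:R - #|U :&: V|%:R :> F by rewrite -c2; ring.
  set a := #|A|%:R; set b := #|B|%:R; set c := #|_ :&: _|%:R; set u := #|U|%:R; set v := #|V|%:R; set z := #|_ :&: _|%:R.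
  have -> : (rk (U :|: V))%:R + th * (a + b - c - (u + v - z)) + ((rk (U :&: V))%:R + th * (c - z)) =
    ((rk (U :|: V))%:R + (rk (U :&: V))%:R) + th * (a + b - u - v) by ring.
  have -> : (rk U)%:R + th * (a - u) + ((rk V)%:R + th * (b - v)) = ((rk U)%:R + (rk V)%:R) + th * (a + b - u - v) by ring.
  by rewrite lerD2r.
have fmono (A B : {set T}) : A \subset B -> f A <= f B.
  move=> AB; have [UB _] := amP B; set U := am B in UB.
  apply: le_trans ((amP A).2 (U :&: A) (subsetIr _ _)) _; rewrite /f -/U /h lerD //.
    by rewrite ler_nat rkmono // subsetIl.
  rewrite ler_pM2l // ler_nat; apply: subset_leq_card; apply/subsetP => i; rewrite !inE.
  by have := subsetP AB i; case: (i \in U); case: (i \in A) => //= ->.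
have fTs : f Ts = (rk Ts)%:R.
  apply/eqP; rewrite eq_le fle /=; have [UT _] := amP Ts; rewrite /f; set U := am Ts in UT *.
  have PU : P U.
    by rewrite /= (subset_trans UT) //= (leq_trans (subset_leq_card UT)).
  rewrite /h cD //; have := leT U PU; move: eqT; rewrite /d; clear - F rk0 rk1 rkmono rksub; lra.
have [w0 [w00 w0S w0T]] := polymatroid_base f0 fsub fmono Ts.
rewrite fTs in w0T.
have w0th i : i \in Ts -> w0 i <= th.
  move=> iT; have := w0S [set i]; rewrite sub1set iT big_set1 => /(_ isT) h1; apply: le_trans h1 _.
  apply: le_trans ((amP [set i]).2 set0 (sub0set _)) _.
  by rewrite /h rk0 setD0 cards1 mulr1 add0r.
pose w i := if i \in Ts then w0 i else th.
have wsum (R : {set T}) : \sum_(i in R) w i = \sum_(i in R :&: Ts) w0 i + th * #|R :\: Ts|%:R.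
  rewrite (big_setID Ts) /=; congr (_ + _).
    by apply: eq_bigr => i; rewrite inE /w => /andP[_ ->].
  rewrite (eq_bigr (fun=> th)); first by rewrite sumr_const mulr_natr.
  by move=> i; rewrite inE /w => /andP[/negbTE ->].
exists th, w; split=> //.
- by move=> i; rewrite /w; case: ifP => [iT|_]; [rewrite w00 w0th|rewrite ltW /=].
- move=> R RQ cR; rewrite wsum.
  have h1 : \sum_(i in R :&: Ts) w0 i <= (rk (R :&: Ts))%:R.
    by apply: le_trans (w0S _ (subsetIr _ _)) (fle _).
  have sb : (rk (R :|: Ts))%:R + (rk (R :&: Ts))%:R <= (rk R)%:R + (rk Ts)%:R :> F by rewrite -!natrD ler_nat.
  have cU : #|R :|: Ts|%:R = #|Ts|%:R + #|R :\: Ts|%:R :> F.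
    by rewrite -natrD card_unionD.
  have RTQ : R :|: Ts \subset Q by rewrite subUset RQ TsQ.
  (* If the union is small, extremality of [Ts] bounds [th |R - Ts|] by the growth of the rank from
     [Ts] to the union, and submodularity concludes. If it is large, its rank is [k + 1] and
     [nochka_arith] applies. *)
  have [cs|cb] := leqP #|R :|: Ts| N.
    have := leT (R :|: Ts); rewrite /= RTQ cs /= => /(_ isT).
    move: eqT h1 sb; rewrite /d cU; clear - F rk0 rk1 rkmono rksub; lra.
  have fu := full _ RTQ cb.
  have lR := low R RQ (leqW cR); have lT := low Ts TsQ (leqW cTs).
  rewrite fu -natr1 in sb.
  have cI := rk_card (R :&: Ts).
  have cR' : (#|R :&: Ts| + #|R :\: Ts| = #|R|)%N by rewrite cardsID.
  have [t et] : {t | t = (rk R)%:R - (rk (R :&: Ts))%:R :> F} by eexists.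
  have [u eu] : {u | u = k%:R + 1 - (rk Ts)%:R :> F} by eexists.
  have u0 : 0 < u by rewrite eu eqT mulr_gt0.
  have tu : u <= t by rewrite et eu; move: sb; clear - F rk0 rk1 rkmono rksub; lra.
  have lR' : #|R :\: Ts|%:R <= t + (N%:R - k%:R).
    have : (#|R :\: Ts| + rk (R :&: Ts) + k <= rk R + N)%N by move: cR' lR cI; clear - F rk0 rk1 rkmono rksub; lia.
    by rewrite -(ler_nat F) !natrD et; clear - F rk0 rk1 rkmono rksub; lra.
  have lT' : N%:R - k%:R + u <= d Ts.
    by move: lT; rewrite -(ler_nat F) !natrD /d eu; clear - F rk0 rk1 rkmono rksub; lra.
  have key : th * (N%:R - k%:R + u) <= u by rewrite [leRHS]eu eqT ler_pM2l.
  have m0 : 0 <= N%:R - k%:R :> F by rewrite subr_ge0.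
  have fin := nochka_arith th0 u0 m0 tu lR' key.
  by move: fin h1; rewrite et; clear - F rk0 rk1 rkmono rksub; lra.
rewrite wsum (setIidPr TsQ) w0T cD //; move: eqT; rewrite /d; clear - F rk0 rk1 rkmono rksub; lra.
Qed.

(* [X i] stands for [- ln |L_i f|] at a point, where at most [N] of the forms are small; the integers [l i] are
   roundings of [M w_i (mu_i - k)^+ / mu_i], with [w] the Nochka weights. *)
Lemma weighted_basis (Q : {set T}) (N k : nat) (mu : T -> nat) :
  (0 < k <= N)%N -> (2 * N < #|Q|)%N ->
  (forall R : {set T}, R \subset Q -> (N < #|R|)%N -> rk R = k.+1) ->
  (forall i, i \in Q -> (0 < mu i)%N) ->
  N%:R * (\sum_(i in Q) ((mu i)%:R : F)^-1) < #|Q|%:R - N%:R - 1 ->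
  exists (l : T -> nat) (M : nat), (M * k.+1 < \sum_(i in Q) l i)%N /\
  exists K : F, 0 <= K /\ forall (X : T -> F) (c : F), (forall i, i \in Q -> 0 <= X i) -> 0 <= c ->
    (#|[set i in Q | (c < X i)%R]| <= N)%N ->
    exists B : {set T}, [/\ B \subset Q, #|B| = k.+1, rk B = k.+1 &
      \sum_(i in Q) (l i)%:R * X i <= M%:R * (\sum_(i in B) (mu i - k)%N%:R / (mu i)%:R * X i) + K * c].
Proof.
move=> /andP[k0 kN] NQ full mu0 Hsum.
have [th [w [th0 wth wR wQ]]] := nochka_weights kN NQ full.
have kNF : k%:R <= N%:R :> F by rewrite ler_nat.
have k0F : 0 < k%:R :> F by rewrite ltr0n.
have NQF : 2 * N%:R + 1 <= #|Q|%:R :> F by rewrite -natrM natr1 ler_nat.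
pose e i : F := (mu i - k)%N%:R / (mu i)%:R.
have e0 i : 0 <= e i by rewrite divr_ge0 ?ler0n.
have e1 i : i \in Q -> e i <= 1 by move=> iQ; rewrite ler_pdivrMr ?ltr0n ?mu0 // mul1r ler_nat leq_subr.
have elow i : i \in Q -> 1 - k%:R / (mu i)%:R <= e i.
  move=> iQ; have m0 : 0 < (mu i)%:R :> F by rewrite ltr0n mu0.
  rewrite -(ler_pM2r m0) mulrBl mul1r !divfK ?gt_eqF //.
  have [km|mk] := leqP k (mu i); first by rewrite natrB.
  by apply: le_trans (ler0n _ _); rewrite subr_le0 ler_nat ltnW.
set S := \sum_(i in Q) (mu i)%:R^-1 in Hsum.
pose lam i := w i * e i.
have lam0 i : 0 <= lam i by rewrite mulr_ge0 //; case/andP: (wth i).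
(* The surplus is at least [th (|Q| - 2N + k - 1 - k S)]. It is positive because
   [N k S < k (|Q| - N - 1)] and [N (|Q| - 2N + k - 1) - k (|Q| - N - 1) = (N - k) (|Q| - 2N -
   1)]. *)
have big : k%:R + 1 < \sum_(i in Q) lam i.
  have h1 : \sum_(i in Q) (w i - th * k%:R * (mu i)%:R^-1) <= \sum_(i in Q) lam i.
    apply: ler_sum => i iQ; have /andP[w0 w1] := wth i.
    apply: le_trans (ler_wpM2l w0 (elow i iQ)); rewrite mulrBr mulr1 lerD2l lerN2.
    by rewrite mulrA ler_wpM2r ?invr_ge0 ?ler0n // ler_wpM2r // ltW.
  rewrite sumrB -mulr_sumr -/S wQ in h1; apply: lt_le_trans h1.
  have N0 : 0 < N%:R :> F by apply: lt_le_trans kNF.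
  have : k%:R * S < #|Q|%:R - 2 * N%:R + k%:R - 1.
    rewrite -(ltr_pM2l N0).
    have a1 : k%:R * (N%:R * S) < k%:R * (#|Q|%:R - N%:R - 1) by rewrite ltr_pM2l.
    have a2 : 0 <= (N%:R - k%:R) * (#|Q|%:R - 2 * N%:R - 1) :> F by apply: mulr_ge0; lra.
    nra.
  by rewrite -(ltr_pM2l th0); lra.
(* Rounding down each [M lam i] loses at most [|Q|] in total; this [M] makes [M] times the surplus
   exceed that loss. *)
have [M HM] : exists M : nat, (#|Q|%:R + 1) / (\sum_(i in Q) lam i - (k%:R + 1)) < M%:R :> F.
  exists (Num.Def.archi_bound ((#|Q|%:R + 1) / (\sum_(i in Q) lam i - (k%:R + 1)))).
  by apply: archi_boundP; apply: divr_ge0; [have := ler0n F #|Q|; lra|lra].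
pose l i := Num.truncn (M%:R * lam i).
have Ml0 i : 0 <= M%:R * lam i by rewrite mulr_ge0 ?ler0n.
have lP i : (l i)%:R <= M%:R * lam i < (l i).+1%:R by apply: truncn_itv.
exists l, M; split.
  have h : (\sum_(i in Q) (M%:R * lam i - 1)) <= (\sum_(i in Q) l i)%N%:R.
    rewrite natr_sum; apply: ler_sum => i _; have /andP[_ h] := lP i.
    by rewrite lerBlDr natr1 ltW.
  rewrite sumrB -mulr_sumr sumr_const in h.
  rewrite -(ltr_nat F); apply: lt_le_trans h.
  rewrite ltr_pdivrMr in HM; last lra.
  rewrite natrM -natr1; nra.
exists (M%:R * \sum_(i in Q) th); split.
  by rewrite mulr_ge0 ?ler0n // sumr_ge0 // => i _; rewrite ltW.
move=> X c X0 c0 card; set R := [set i in Q | c < X i] in card.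
have RQ : R \subset Q by apply/subsetP => i; rewrite inE => /andP[].
have E0 i : i \in R -> 0 <= e i * X i.
  by move=> /(subsetP RQ) iQ; rewrite mulr_ge0 ?X0.
have [|B0 [B0R cB0 rB0 sB0]] := greedy_basis (w := w) E0.
  move=> S' S'R; apply: wR; first exact: subset_trans S'R RQ.
  exact: leq_trans (subset_leq_card S'R) card.
(* A greedy basis of the set [R] of small forms is completed inside [Q]; the added terms are
   nonnegative and only enlarge the right side. Indices off [R] satisfy [X i <= c] and go into the
   term [K * c]. *)
have [|B [B0B BQ cB rB]] := extend_basis (Q := Q) (B := B0) (subset_trans B0R RQ).
  by rewrite cB0 rB0.
have NQ1 : (N < #|Q|)%N by apply: leq_ltn_trans NQ; rewrite leq_pmull.
rewrite (full Q (subxx _) NQ1) in rB.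
exists B; split=> //; first by rewrite cB.
have s1 : \sum_(i in Q) (l i)%:R * X i <= M%:R * \sum_(i in Q) lam i * X i.
  rewrite mulr_sumr; apply: ler_sum => i iQ; rewrite mulrA ler_wpM2r ?X0 //.
  by have /andP[] := lP i.
apply: le_trans s1 _; rewrite -mulrA -mulrDr ler_wpM2l ?ler0n //.
rewrite (big_setID R) /= (setIidPr RQ); apply: lerD.
  apply: (@le_trans _ _ (\sum_(i in B0) e i * X i)).
    by apply: le_trans sB0; apply: ler_sum => i _; rewrite mulrA.
  rewrite [leRHS](big_setID B0) /= (setIidPr B0B) lerDl sumr_ge0 // => i.
  by rewrite inE => /andP[_ /(subsetP BQ) iQ]; exact: mulr_ge0 (e0 i) (X0 i iQ).
rewrite mulr_suml [leRHS](big_setID R) /= (setIidPr RQ).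
have p : 0 <= \sum_(i in R) th * c by apply: sumr_ge0 => i _; rewrite mulr_ge0 // ltW.
apply: le_trans (_ : \sum_(i in Q :\: R) th * c <= _); last by rewrite lerDr.
apply: ler_sum => i; rewrite !inE => /andP[nR iQ]; rewrite iQ /= -leNgt in nR.
apply: ler_pM => //; first exact: X0.
have /andP[w0 w1] := wth i; rewrite /lam.
by apply: le_trans (_ : th * 1 <= _); [apply: ler_pM => //; apply: e1|rewrite mulr1].
Qed.
End Nochka.
End Matroid.

Module Wronskian.
Import Lra Classical structures all_boot all_order all_algebra Coquelicot Analysis.
Import GRing.Theory.
Set Implicit Arguments. Unset Strict Implicit. Unset Printing Implicit Defensive.
Delimit Scope R_scope with coqR.
Local Open Scope ring_scope.

(** * The complex numbers as a field *)

(** An alias that carries the field structure used by matrices and big operators; being convertible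
    to the original type, it leaves the analytic lemmas applicable. *)
Definition CC : Type := Complex.C.

HB.instance Definition _ := boolp.gen_eqMixin CC.
HB.instance Definition _ := boolp.gen_choiceMixin CC.

Lemma CC_addA : associative (Cplus : CC -> CC -> CC). Proof. by move=> x y z; apply: Cplus_assoc. Qed.
Lemma CC_addC : commutative (Cplus : CC -> CC -> CC). Proof. by move=> x y; apply: Cplus_comm. Qed.
Lemma CC_add0 : left_id (RtoC 0 : CC) Cplus. Proof. by move=> x; apply: Cplus_0_l. Qed.
Lemma CC_addN : left_inverse (RtoC 0 : CC) Copp Cplus.
Proof. by move=> x; rewrite [LHS]Cplus_comm; apply: Cplus_opp_r. Qed.
HB.instance Definition _ := GRing.isZmodule.Build CC CC_addA CC_addC CC_add0 CC_addN.

Lemma CC_mulA : associative (Cmult : CC -> CC -> CC). Proof. by move=> x y z; apply: Cmult_assoc. Qed.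
Lemma CC_mulC : commutative (Cmult : CC -> CC -> CC). Proof. by move=> x y; apply: Cmult_comm. Qed.
Lemma CC_mul1 : left_id (RtoC 1 : CC) Cmult. Proof. by move=> x; apply: Cmult_1_l. Qed.
Lemma CC_mulD : left_distributive (Cmult : CC -> CC -> CC) (GRing.add : CC -> CC -> CC).
Proof. by move=> x y z; apply: Cmult_plus_distr_r. Qed.
Lemma CC_neq10 : (RtoC 1 : CC) != 0.
Proof. by apply/eqP => H; have := f_equal fst H => /= Q; case: R1_neq_R0. Qed.
HB.instance Definition _ := GRing.Zmodule_isComNzRing.Build CC CC_mulA CC_mulC CC_mul1 CC_mulD CC_neq10.

Lemma CC_mulV (x : CC) : x != 0 -> (Cinv x : CC) * x = 1.
Proof. by move=> /eqP N; apply: Cinv_l. Qed.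
Lemma CC_inv0 : (Cinv (0 : CC) : CC) = 0.
Proof. by rewrite /Cinv /=; congr pair; rewrite /Rdiv ?Ropp_0 Rmult_0_l. Qed.
HB.instance Definition _ := GRing.ComNzRing_isField.Build CC CC_mulV CC_inv0.

Lemma CC_mulE (x y : CC) : x * y = Cmult x y. Proof. by []. Qed.
Lemma CC_expE (x : CC) n : x ^+ n = Cpow x n.
Proof. by elim: n => [//|n IH]; rewrite exprS IH. Qed.

(** * Holomorphy and derivatives of finite sums, products and determinants *)

Section HolBig.
Variables (c : Complex.C) (r : R).
Implicit Types f : Complex.C -> CC.

Lemma hol_add f g : hol c r f -> hol c r g -> hol c r (fun z => f z + g z).
Proof. exact: hol_plus. Qed.
Lemma hol_mul f g : hol c r f -> hol c r g -> hol c r (fun z => f z * g z).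
Proof. exact: hol_mult. Qed.
Lemma hol_cst (k : CC) : hol c r (fun=> k).
Proof. exact: hol_const. Qed.
Lemma hol_sum (I : Type) (s : seq I) (P : pred I) (f : I -> Complex.C -> CC) :
  (forall i, P i -> hol c r (f i)) -> hol c r (fun z => \sum_(i <- s | P i) f i z).
Proof.
move=> H; elim: s => [|i s IH].
  by apply: hol_ext (hol_cst 0) => z _; rewrite big_nil.
have [Pi|Pi] := boolP (P i).
  by apply: hol_ext (hol_add (H i Pi) IH) => z _; rewrite big_cons Pi.
by apply: hol_ext IH => z _; rewrite big_cons (negbTE Pi).
Qed.
Lemma hol_prod (I : Type) (s : seq I) (P : pred I) (f : I -> Complex.C -> CC) :
  (forall i, P i -> hol c r (f i)) -> hol c r (fun z => \prod_(i <- s | P i) f i z).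
Proof.
move=> H; elim: s => [|i s IH].
  by apply: hol_ext (hol_cst 1) => z _; rewrite big_nil.
have [Pi|Pi] := boolP (P i).
  by apply: hol_ext (hol_mul (H i Pi) IH) => z _; rewrite big_cons Pi.
by apply: hol_ext IH => z _; rewrite big_cons (negbTE Pi).
Qed.
Lemma hol_exp f n : hol c r f -> hol c r (fun z => f z ^+ n).
Proof. by move=> H; apply: hol_ext (hol_pow _ _ _ n H) => z _; rewrite CC_expE. Qed.
Lemma hol_det n (M : Complex.C -> 'M[CC]_n) :
  (forall i j, hol c r (fun z => M z i j)) -> hol c r (fun z => \det (M z)).
Proof.
move=> H; apply: hol_sum => s _; apply: hol_mul; first exact: hol_cst.
by apply: hol_prod => i _; apply: H.
Qed.
End HolBig.

Lemma hol_sub_disc c (r : R) c' (s : R) f : (Cmod (Cminus c' c) + s <= r)%coqR -> hol c r f -> hol c' s f.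
Proof.
move=> H Hf; apply: (hol_sub _ _ _ _ _ Hf) => z Hz.
by have := Cmod_sub_tri z c' c; lra.
Qed.

Lemma D_ext_loc f g z d : (0 < d)%coqR -> (forall w, (Cmod (Cminus w z) < d)%coqR -> f w = g w) ->
  (exists l, cder f z l) -> D g z = D f z.
Proof. by move=> d0 E [l Hl]; rewrite (D_eq _ _ _ Hl); apply/D_eq/(cder_ext_loc _ _ _ _ _ d0 E). Qed.

Lemma D_ext_disc c r f g : hol c r f -> (forall z, (Cmod (Cminus z c) < r)%coqR -> f z = g z) ->
  forall z, (Cmod (Cminus z c) < r)%coqR -> D g z = D f z.
Proof.
move=> Hf E z Hz; apply: (@D_ext_loc _ _ _ (r - Cmod (Cminus z c))%coqR); first lra.
  by move=> w Hw; apply: E; have := Cmod_sub_tri w z c; lra.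
exact: Hf.
Qed.

Lemma D_add c r (f g : Complex.C -> CC) z : hol c r f -> hol c r g -> (Cmod (Cminus z c) < r)%coqR ->
  D (fun w => f w + g w) z = (D f z : CC) + D g z.
Proof. by move=> Hf Hg Hz; apply: D_eq; apply: cder_plus; apply: hol_D Hz. Qed.
Lemma D_mul c r (f g : Complex.C -> CC) z : hol c r f -> hol c r g -> (Cmod (Cminus z c) < r)%coqR ->
  D (fun w => f w * g w) z = (D f z : CC) * g z + f z * D g z.
Proof. by move=> Hf Hg Hz; apply: D_eq; apply: cder_mult; apply: hol_D Hz. Qed.
Lemma D_cst (k : CC) z : D (fun=> k) z = (0 : CC).
Proof. by apply: D_eq; apply: cder_const. Qed.
Lemma D_sum c r (I : Type) (s : seq I) (P : pred I) (f : I -> Complex.C -> CC) z :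
  (forall i, P i -> hol c r (f i)) -> (Cmod (Cminus z c) < r)%coqR ->
  D (fun w => \sum_(i <- s | P i) f i w) z = \sum_(i <- s | P i) (D (f i) z : CC).
Proof.
move=> H Hz; elim: s => [|i s IH].
  by rewrite big_nil -[RHS](D_cst 0 z); congr (D _ z); apply: boolp.funext => w; rewrite big_nil.
rewrite big_cons -IH; have [Pi|Pi] := boolP (P i).
  rewrite -(D_add (H i Pi) (hol_sum s H) Hz); congr (D _ z); apply: boolp.funext => w.
  by rewrite big_cons Pi.
by congr (D _ z); apply: boolp.funext => w; rewrite big_cons (negbTE Pi).
Qed.

Lemma Dn_lin c r (I : finType) (p : I -> CC) (y : I -> Complex.C -> CC) l z :
  (forall i, hol c r (y i)) -> (Cmod (Cminus z c) < r)%coqR ->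
  Dn l (fun w => \sum_i p i * y i w) z = \sum_i p i * (Dn l (y i) z : CC).
Proof.
move=> H; elim: l z => [//|l IH] z Hz /=.
have hs : hol c r (fun w => \sum_i p i * (Dn l (y i) w : CC)).
  by apply: hol_sum => i _; apply: hol_mul; [apply: hol_cst|apply: hol_Dn].
rewrite (D_ext_disc hs (fun w Hw => esym (IH w Hw)) Hz).
rewrite (D_sum (c := c) (r := r)) //; last first.
  by move=> i _; apply: hol_mul; [apply: hol_cst|apply: hol_Dn].
apply: eq_bigr => i _; rewrite (D_mul (@hol_cst c r (p i)) (hol_Dn l _ _ _ (H i)) Hz).
by rewrite D_cst mul0r add0r.
Qed.

(** * Wronskians *)

Definition wronsk_mx (m : nat) (y : nat -> Complex.C -> CC) (z : Complex.C) : 'M[CC]_m :=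
  \matrix_(i < m, l < m) (Dn l (y i) z : CC).
Definition wronsk m y z : CC := \det (wronsk_mx m y z).

Lemma hol_wronsk c r m y : (forall i, (i < m)%N -> hol c r (y i)) -> hol c r (wronsk m y).
Proof.
move=> H; apply: hol_det => i j; apply: hol_ext (hol_Dn j _ _ _ (H i (ltn_ord i))) => z _.
by rewrite mxE.
Qed.

(** The coefficient of the derivative of order [s] of [y] in the derivative of order [l] of [h y],
    that is a binomial coefficient times the derivative of order [l - s] of [h]. The recursion
    avoids binomials, and triangularity with diagonal [h] follows by induction. *)
Fixpoint leibniz_coef (h : Complex.C -> CC) (l s : nat) : Complex.C -> CC :=
  match l with
  | 0 => if s is 0 then h else fun=> 0
  | l'.+1 => fun z => (D (leibniz_coef h l' s) z : CC) + (if s is s'.+1 then leibniz_coef h l' s' z else 0)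
  end.

Lemma leibniz_coef_hol c r h l s : hol c r h -> hol c r (leibniz_coef h l s).
Proof.
move=> H; elim: l s => [|l IH] [|s] //=; try exact: hol_cst.
  by apply: hol_add; [apply: hol_deriv|apply: hol_cst].
by apply: hol_add; [apply: hol_deriv|].
Qed.

Lemma leibniz_coef_gt c r h l s z : hol c r h -> (Cmod (Cminus z c) < r)%coqR -> (l < s)%N ->
  leibniz_coef h l s z = 0.
Proof.
move=> H; elim: l s z => [|l IH] [|s] z Hz //= ls.
rewrite IH // addr0 (D_ext_disc (f := fun=> (0 : CC)) (@hol_cst c r 0) _ Hz) ?D_cst // => w Hw.
by rewrite IH // ltnW.
Qed.

Lemma leibniz_coef_diag c r h l z : hol c r h -> (Cmod (Cminus z c) < r)%coqR -> leibniz_coef h l l z = h z.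
Proof.
move=> H; elim: l z => [//|l IH] z Hz /=.
rewrite IH // (D_ext_disc (f := fun=> (0 : CC)) (@hol_cst c r 0) _ Hz) ?D_cst ?add0r // => w Hw.
by rewrite (leibniz_coef_gt H).
Qed.

Lemma leibniz c r (h y : Complex.C -> CC) l m z : hol c r h -> hol c r y -> (Cmod (Cminus z c) < r)%coqR -> (l < m)%N ->
  Dn l (fun w => h w * y w) z = \sum_(s < m) leibniz_coef h l s z * (Dn s y z : CC).
Proof.
move=> Hh Hy; elim: l z => [|l IH] z Hz lm.
  by case: m lm => // m _; rewrite big_ord_recl /= big1 ?addr0 // => i _; rewrite mul0r.
have hs i : hol c r (fun w => leibniz_coef h l i w * (Dn i y w : CC)).
  by apply: hol_mul; [apply: leibniz_coef_hol|apply: hol_Dn].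
rewrite /= (D_ext_disc (hol_sum (P := xpredT) (index_enum 'I_m) (fun i _ => hs i)) (fun w Hw => esym (IH w Hw (ltnW lm))) Hz).
rewrite (D_sum (c := c) (r := r)) //.
have E i : D (fun w => leibniz_coef h l i w * (Dn i y w : CC)) z = _ := D_mul (leibniz_coef_hol l i Hh) (hol_Dn i _ _ _ Hy) Hz.
under [LHS]eq_bigr => i _ do rewrite E.
under [RHS]eq_bigr => i _ do rewrite mulrDl.
rewrite !big_split /=; apply: (f_equal2 (fun a b : CC => a + b)) => //.
clear IH; case: m lm => // m lm.
rewrite big_ord_recr big_ord_recl /= mul0r add0r (leibniz_coef_gt Hh) ?mul0r ?addr0 //.
Qed.

(** By Leibniz's rule the matrix is multiplied by a triangular one with [h] on the diagonal. So
    under a change of homogeneous representation the Wronskian behaves as an expression of degree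
    [m]. *)
Lemma wronsk_scale c r m (h : Complex.C -> CC) (y y' : nat -> Complex.C -> CC) z : hol c r h -> (forall i, (i < m)%N -> hol c r (y' i)) ->
  (forall i w, (i < m)%N -> (Cmod (Cminus w c) < r)%coqR -> y i w = h w * y' i w) ->
  (Cmod (Cminus z c) < r)%coqR -> wronsk m y z = h z ^+ m * wronsk m y' z.
Proof.
move=> Hh Hy E Hz.
pose L : 'M[CC]_m := \matrix_(s, l) leibniz_coef h l s z.
have -> : wronsk m y z = \det (wronsk_mx m y' z *m L).
  congr (\det _); apply/matrixP => i l; rewrite !mxE.
  have hyi := hol_mul Hh (Hy i (ltn_ord i)).
  rewrite (Dn_ext_hol l _ _ _ _ hyi (fun w Hw => esym (E i w (ltn_ord i) Hw)) _ Hz).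
  rewrite (leibniz Hh (Hy i (ltn_ord i)) Hz (ltn_ord l)).
  by apply: eq_bigr => s _; rewrite !mxE mulrC.
rewrite det_mulmx mulrC; congr (_ * _).
rewrite -det_tr det_trig; last first.
  by apply/is_trig_mxP => i j ij; rewrite !mxE (leibniz_coef_gt Hh Hz ij).
under eq_bigr => i _ do rewrite !mxE (leibniz_coef_diag _ Hh Hz).
by rewrite prodr_const card_ord.
Qed.

Lemma wronsk_lin c r m (P : 'M[CC]_m) (g y : nat -> Complex.C -> CC) z : (forall i, (i < m)%N -> hol c r (y i)) ->
  (forall (i : 'I_m) w, (Cmod (Cminus w c) < r)%coqR -> g i w = \sum_(j < m) P i j * y j w) ->
  (Cmod (Cminus z c) < r)%coqR -> wronsk m g z = \det P * wronsk m y z.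
Proof.
move=> Hy E Hz; rewrite -det_mulmx; congr (\det _); apply/matrixP => i l; rewrite !mxE.
have hs : hol c r (fun w => \sum_(j < m) P i j * y j w).
  by apply: hol_sum => j _; apply: hol_mul; [apply: hol_cst|apply: Hy].
rewrite (Dn_ext_hol l _ _ _ _ hs (fun w Hw => esym (E i w Hw)) _ Hz).
rewrite (Dn_lin (P i) (y := fun j : 'I_m => y j) l (fun j => Hy j (ltn_ord j)) Hz).
by apply: eq_bigr => j _; rewrite !mxE.
Qed.

Lemma D0_const c r f : hol c r f -> (forall z, (Cmod (Cminus z c) < r)%coqR -> D f z = RtoC 0) ->
  forall z, (Cmod (Cminus z c) < r)%coqR -> f z = f c.
Proof.
move=> Hf H z Hz.
have E (w : Complex.C) : Cminus (Cplus c w) c = w by ring.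
have := cder0_const r (fun w => f (Cplus c w)) _ (Cminus z c) Hz.
have -> : Cplus c (Cminus z c) = z by ring.
have -> : Cplus c (RtoC 0) = c by ring.
apply=> w Hw; apply/cder_shift; rewrite -(H (Cplus c w)) ?E //.
by apply: (hol_D c r) => //; rewrite E.
Qed.

Lemma widen_lift m (i : 'I_m) : widen_ord (leqnSn m) i = lift ord_max i.
Proof. by apply: val_inj; rewrite /= /bump leqNgt ltn_ord. Qed.

(** Induction on the number of functions. Where the smaller Wronskian has no zero, the last function
    is a combination of the others with holomorphic coefficients, compatibly with derivatives;
    differentiating shows that the coefficients are constant, and the identity theorem extends the
    relation to the disc. *)
Lemma wronsk_nonzero c r m (y : nat -> Complex.C -> CC) : (0 < r)%coqR -> (forall i, (i < m)%N -> hol c r (y i)) ->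
  (forall z, (Cmod (Cminus z c) < r)%coqR -> wronsk m y z = 0) ->
  exists p : 'rV[CC]_m, p != 0 /\ forall z, (Cmod (Cminus z c) < r)%coqR -> \sum_(i < m) p 0 i * y i z = 0.
Proof.
move=> r0; elim: m => [|m IH] Hy W0.
  have := W0 c; rewrite /wronsk det_mx00 Cmod_subrr => /(_ r0) /eqP; by rewrite oner_eq0.
have Hy' i : (i < m)%N -> hol c r (y i) by move=> im; apply: Hy; apply: ltnW.
have [Z|NZ] := classic (forall z, (Cmod (Cminus z c) < r)%coqR -> wronsk m y z = 0).
  have [p [p0 Hp]] := IH Hy' Z.
  exists (\row_(i < m.+1) (if unlift ord_max i is Some j then p 0 j else 0)); split.
    apply: contra_neq p0 => /rowP E; apply/rowP => j.
    by have := E (lift ord_max j); rewrite !mxE liftK.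
  move=> z Hz; rewrite big_ord_recr /= mxE unlift_none mul0r addr0 -[RHS](Hp z Hz).
  apply: eq_bigr => i _; rewrite mxE.
  by rewrite widen_lift liftK.
have {NZ} [z1 [Hz1 Nz1]] : exists z1, (Cmod (Cminus z1 c) < r)%coqR /\ wronsk m y z1 <> 0.
  by apply: NNPP => N; apply: NZ => z Hz; apply: NNPP => Q; apply: N; exists z.
have hW := hol_wronsk Hy'.
have [s [[s0 sr] Hs]] : exists s, (0 < s <= r - Cmod (Cminus z1 c))%coqR /\ forall w, (Cmod (Cminus w z1) < s)%coqR -> wronsk m y w <> 0.
  apply: hol_near_neq0 => //; first lra.
  by apply: hol_sub_disc hW; lra.
have sub w : (Cmod (Cminus w z1) < s)%coqR -> (Cmod (Cminus w c) < r)%coqR.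
  by move=> Hw; have := Cmod_sub_tri w z1 c; lra.
have hy i : (i < m.+1)%N -> hol z1 s (y i) by move=> im; apply: hol_sub_disc (Hy i im); lra.
have hy' i : (i < m)%N -> hol z1 s (y i) by move=> im; apply: hy; apply: ltnW.
pose A z := wronsk_mx m y z.
have Au z : (Cmod (Cminus z z1) < s)%coqR -> A z \in unitmx.
  by move=> Hz; rewrite unitmxE unitfE; apply/eqP/Hs.
pose rr z : 'rV[CC]_m := \row_l (Dn l (y m) z : CC).
pose b z : 'rV[CC]_m := rr z *m invmx (A z).
(* The relation holds for the orders 0 to [m], one more than the number of unknowns; the extra order
   is what the differentiation of the relation consumes. *)
have bE z l : (Cmod (Cminus z z1) < s)%coqR -> (l <= m)%N -> (Dn l (y m) z : CC) = \sum_(i < m) b z 0 i * (Dn l (y i) z : CC).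
  move=> Hz lm.
  have /eqP/det0P[v v0 vM] := W0 z (sub z Hz).
  have vl k : (k <= m)%N -> \sum_(i < m) v 0 (widen_ord (leqnSn m) i) * (Dn k (y i) z : CC) + v 0 ord_max * Dn k (y m) z = 0.
    move=> km; have := f_equal (fun w : 'rV_m.+1 => w 0 (Ordinal (km : (k < m.+1)%N))) vM.
    by rewrite /mulmx !mxE big_ord_recr /= mxE => Q0; rewrite -[RHS]Q0; apply: (f_equal2 (fun a b : CC => a + b)) => //; apply: eq_bigr => i _; rewrite mxE.
  have vmax : v 0 ord_max != 0.
    apply: contra_neq v0 => vm.
    have Z : (\row_(i < m) v 0 (widen_ord (leqnSn m) i)) *m A z = 0.
      apply/rowP => k; rewrite !mxE; have := vl k (ltnW (ltn_ord k)); rewrite vm mul0r addr0 => Q0; rewrite -[RHS]Q0.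
      by apply: eq_bigr => i _; rewrite !mxE.
    have {}Z := f_equal (mulmx^~ (invmx (A z))) Z; rewrite /= mulmxK ?Au // mul0mx in Z.
    apply/rowP => k; rewrite [RHS]mxE; case: (unliftP ord_max k) => [j ->|->//].
    have := f_equal (fun w : 'rV_m => w 0 j) Z; rewrite !mxE => Q0; rewrite -[RHS]Q0; by rewrite widen_lift.
  pose bt : 'rV[CC]_m := \row_i (- v 0 (widen_ord (leqnSn m) i) / v 0 ord_max).
  have btE k : (k <= m)%N -> (Dn k (y m) z : CC) = \sum_(i < m) bt 0 i * (Dn k (y i) z : CC).
    move=> km; apply: (mulfI vmax); have := vl k km => /eqP; rewrite addrC addr_eq0 => /eqP ->.
    rewrite mulr_sumr -sumrN; apply: eq_bigr => i _; rewrite mxE mulrA mulrCA divff // mulr1.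
    by rewrite mulNr.
  suff -> : b z = bt by apply: btE.
  rewrite /b; have -> : rr z = bt *m A z.
    apply/rowP => k; rewrite [LHS]mxE btE ?(ltnW (ltn_ord k)) // mxE.
    by apply: eq_bigr => i _; rewrite !mxE.
  by rewrite mulmxK ?Au.
have hb i : hol z1 s (fun z => b z 0 i).
  (* Cramer's formula: the coefficients are polynomials in the derivatives, divided by the
     Wronskian. *)
  have hinv : hol z1 s (fun z => (wronsk m y z)^-1 : CC).
    by apply: hol_inv => [|z Hz]; [apply: hol_wronsk|apply: Hs].
  have hh : hol z1 s (fun z => \sum_(l < m) (Dn l (y m) z : CC) * ((wronsk m y z)^-1 * \adj (A z) l i)).
    apply: hol_sum => l _; apply: hol_mul; first by apply: hol_Dn; apply: hy.
    apply: hol_mul hinv _.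
    have hc : hol z1 s (fun z => (-1) ^+ (i + l) * \det (row' i (col' l (A z)))).
      apply: hol_mul; first exact: hol_cst.
      apply: hol_det => j k.
      have := hol_Dn (lift l k) _ _ _ (hy' (lift i j) (ltn_ord _)).
      by apply: hol_ext => z _; rewrite !mxE.
    by apply: hol_ext hc => z _; rewrite !mxE.
  apply: hol_ext hh => z Hz; rewrite /b /invmx Au // !mxE; apply: eq_bigr => l _; rewrite !mxE //.
have Db z : (Cmod (Cminus z z1) < s)%coqR -> forall i, D (fun z => b z 0 i) z = RtoC 0.
  move=> Hz.
  have Z : (\row_(i < m) (D (fun z => b z 0 i) z : CC)) *m A z = 0.
    apply/rowP => l; rewrite !mxE.
    have hs : hol z1 s (fun w => \sum_(i < m) b w 0 i * (Dn l (y i) w : CC)).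
      by apply: hol_sum => i _; apply: hol_mul => //; apply: hol_Dn; apply: hy'.
    have := D_ext_disc hs (fun w Hw => esym (bE w l Hw (ltnW (ltn_ord l)))) Hz.
    rewrite -[D (Dn l (y m)) z]/(Dn l.+1 (y m) z) (bE z l.+1 Hz (ltn_ord l)).
    rewrite (D_sum (c := z1) (r := s)) //; last first.
      by move=> i _; apply: hol_mul => //; apply: hol_Dn; apply: hy'.
    under [in RHS]eq_bigr => i _ do rewrite (D_mul (hb i) (hol_Dn l _ _ _ (hy' i (ltn_ord i))) Hz).
    rewrite big_split /= => Q1; have /eqP := (Q1 : (_ : CC) = _).
    rewrite -subr_eq subrr => /eqP Q; rewrite [RHS]Q.
    by apply: eq_bigr => i _; rewrite !mxE.
  have {}Z := f_equal (mulmx^~ (invmx (A z))) Z; rewrite /= mulmxK ?Au // mul0mx in Z.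
  by move=> i; have := f_equal (fun w : 'rV_m => w 0 i) Z; rewrite !mxE.
have bc z : (Cmod (Cminus z z1) < s)%coqR -> forall i, b z 0 i = b z1 0 i.
  by move=> Hz i; apply: (D0_const (hb i) _ Hz) => w Hw; apply: Db.
pose p : 'rV[CC]_m.+1 := \row_(i < m.+1) (if unlift ord_max i is Some j then - b z1 0 j else 1).
have pE z : \sum_(i < m.+1) p 0 i * y i z = y m z - \sum_(i < m) b z1 0 i * y i z.
  rewrite big_ord_recr /= mxE unlift_none mul1r addrC; congr (_ + _).
  rewrite -sumrN; apply: eq_bigr => i _; rewrite mxE.
  by rewrite widen_lift liftK mulNr.
exists p; split.
  apply/eqP => /rowP /(_ ord_max) /eqP; by rewrite !mxE unlift_none oner_eq0.
have hp : hol c r (fun z => \sum_(i < m.+1) p 0 i * y i z).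
  by apply: hol_sum => i _; apply: hol_mul; [apply: hol_cst|apply: Hy].
apply: (identity_disc c r _ z1 s hp Hz1 s0) => z Hz.
rewrite pE (bE z 0%N Hz (leq0n m) : y m z = _).
by under eq_bigr => i _ do rewrite (bc z Hz); rewrite subrr.
Qed.
End Wronskian.

Module Curves.
Import Lra Classical all_boot all_order all_algebra all_fingroup boolp Rstruct zify Coquelicot.
Import Analysis Matroid Wronskian.
Import Order.TTheory GRing.Theory Num.Theory.
Set Implicit Arguments. Unset Strict Implicit. Unset Printing Implicit Defensive.
Delimit Scope R_scope with coqR.
Local Open Scope ring_scope.

Lemma small_step_ind (P : Complex.C -> Prop) (c0 : Complex.C) d : (0 < d)%coqR -> P c0 ->
  (forall c c', (Cmod (Cminus c' c) < d)%coqR -> P c -> P c') -> forall c, P c.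
Proof.
move=> d0 P0 PS c; have L0 := Cmod_ge_0 (Cminus c c0).
have [N HN] := INR_unbounded (Cmod (Cminus c c0) / d)%coqR.
have N0 : (0 < INR N)%coqR.
  by have := Rdiv_le_0_compat _ _ L0 d0; Lra.lra.
pose p (k : nat) := Cplus c0 (Cmult (RtoC (INR k / INR N)%coqR) (Cminus c c0)).
have pN : p N = c by rewrite /p /Rdiv Rinv_r; [ring|Lra.lra].
suff H k : P (p k) by rewrite -pN; apply: H.
elim: k => [|k IH].
  have -> : p 0%N = c0 by rewrite /p /= /Rdiv Rmult_0_l; ring.
  exact: P0.
apply: PS IH.
have -> : Cminus (p k.+1) (p k) = Cmult (RtoC (/ INR N)%coqR) (Cminus c c0).
  rewrite /p S_INR; have -> : ((INR k + 1) / INR N = INR k / INR N + / INR N)%coqR by field; Lra.lra.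
  by rewrite RtoC_plus; ring.
rewrite Cmod_mult Cmod_R Rabs_pos_eq; last by apply/Rlt_le/Rinv_0_lt_compat.
apply: (Rmult_lt_reg_l (INR N)) => //.
rewrite -Rmult_assoc Rinv_r; last Lra.lra.
have E : Cmod (Cminus c c0) = (Cmod (Cminus c c0) / d * d)%coqR by field; Lra.lra.
have := Rmult_lt_compat_r d _ _ d0 HN; Lra.lra.
Qed.

(** * The pointwise bound of the Wronskian *)

Lemma superset_card (T : finType) (A : {set T}) m : (#|A| <= m <= #|T|)%N -> exists R : {set T}, A \subset R /\ #|R| = m.
Proof.
move=> /andP[]; move: {2}(m - #|A|)%N (erefl (m - #|A|)%N) => k; elim: k A => [|k IH] A Ek Am mT.
  by exists A; split=> //; lia.
have [e eA] : exists e, e \in ~: A by apply/card_gt0P; rewrite cardsCs setCK; lia.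
rewrite inE in eA; have [|||R [AR cR]] := IH (e |: A) => //; rewrite ?cardsU1 ?eA; try lia.
by exists R; split=> //; apply: subset_trans (subsetUr _ _) AR.
Qed.

(** * The matroid of the hyperplanes *)

Section RowRank.
Variables (q K : nat) (At : 'M[CC]_(q, K)).
Definition rowspan (R : {set 'I_q}) : 'M[CC]_K := (\sum_(i in R) <<row i At>>)%MS.
Definition rowrk (R : {set 'I_q}) : nat := \rank (rowspan R).

Lemma rowspan_sub (R : {set 'I_q}) m (M : 'M_(m, K)) : reflect (forall i, i \in R -> (row i At <= M)%MS) (rowspan R <= M)%MS.
Proof.
apply: (iffP sumsmx_subP) => H i iR; first by rewrite -genmxE; apply: H.
by rewrite genmxE; apply: H.
Qed.

Lemma row_in_span (R : {set 'I_q}) i : i \in R -> (row i At <= rowspan R)%MS.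
Proof. by move=> iR; have /rowspan_sub := submx_refl (rowspan R); apply. Qed.

Lemma rowrk0 : rowrk set0 = 0%N.
Proof. by rewrite /rowrk /rowspan big_set0 mxrank0. Qed.
Lemma rowrk1 i : (rowrk [set i] <= 1)%N.
Proof. by rewrite /rowrk /rowspan big_set1 genmxE rank_rV leq_b1. Qed.
Lemma rowspanS (A B : {set 'I_q}) : A \subset B -> (rowspan A <= rowspan B)%MS.
Proof. by move=> /subsetP AB; apply/rowspan_sub => i /AB; apply: row_in_span. Qed.
Lemma rowrk_mono (A B : {set 'I_q}) : A \subset B -> (rowrk A <= rowrk B)%N.
Proof. by move=> AB; apply/mxrankS/rowspanS. Qed.
Lemma rowrk_sub (A B : {set 'I_q}) : (rowrk (A :|: B) + rowrk (A :&: B) <= rowrk A + rowrk B)%N.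
Proof.
rewrite /rowrk -(mxrank_sum_cap (rowspan A)); apply: leq_add; apply: mxrankS.
  apply/rowspan_sub => i; rewrite inE => /orP[] iR.
    by apply: submx_trans (row_in_span iR) (addsmxSl _ _).
  by apply: submx_trans (row_in_span iR) (addsmxSr _ _).
by rewrite sub_capmx !rowspanS ?subsetIl ?subsetIr.
Qed.
Lemma rowrk_max A : (rowrk A <= K)%N.
Proof. exact: rank_leq_col. Qed.
End RowRank.

Lemma rowrk_mul q m K (A : 'M[CC]_(q, m)) (B : 'M[CC]_(m, K)) R : rowrk A R = m -> rowrk (A *m B) R = \rank B.
Proof.
move=> full; have rf : row_full (rowspan A R) by rewrite /row_full -[\rank _]/(rowrk A R) full.
rewrite /rowrk -(eqmxMfull B rf); apply: eqmx_rank; apply/andP; split.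
  by apply/rowspan_sub => i iR; rewrite row_mul; apply: submxMr; apply: row_in_span.
rewrite {1}/rowspan sumsmxMr_gen; apply/sumsmx_subP => i iR; rewrite genmxE.
apply: submx_trans (_ : (row i A *m B <= _)%MS); first by apply: submxMr; rewrite genmxE.
by rewrite -row_mul; apply: row_in_span.
Qed.

(* Restricted to the span of the curve, given by [B], the hyperplanes outside [Q] contain the curve; the others
   are in [N]-subgeneral position. *)
Lemma matroid_setup n q k (a : 'M[CC]_(q, n.+1)) (B : 'M[CC]_(k.+1, n.+1)) :
  (2 * n < q)%N -> (forall R : {set 'I_q}, (n < #|R|)%N -> rowrk a R = n.+1) -> row_free B ->
  let At := a *m B^T in let Q : {set 'I_q} := [set i | row i At != 0] in
  exists N, [/\ (k <= N)%N, (N <= n)%N, (2 * N < #|Q|)%N, (#|Q| + n = q + N)%N &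
    forall R : {set 'I_q}, R \subset Q -> (N < #|R|)%N -> rowrk At R = k.+1].
Proof.
move=> nq GP fB At Q.
have full (R : {set 'I_q}) : (n < #|R|)%N -> rowrk At R = k.+1.
  by move=> cR; rewrite rowrk_mul ?GP // mxrank_tr; apply/eqP.
have loops (R : {set 'I_q}) : R \subset ~: Q -> rowrk At R = 0%N.
  move=> RQ; apply/eqP; rewrite /rowrk mxrank_eq0 -submx0; apply/rowspan_sub => i iR.
  by have := subsetP RQ i iR; rewrite !inE negbK => /eqP ->; apply: sub0mx.
have cQ : (#|Q| + #|~: Q| = q)%N by rewrite cardsC card_ord.
(* A set of [n + 1] rows containing all those outside [Q] has rank [k + 1], and as the latter are
   zero this rank comes from the remaining [n + 1 - |~: Q|] rows. *)
have s_le : (#|~: Q| + k <= n)%N.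
  have c1 : (#|~: Q| <= n)%N.
    by rewrite leqNgt; apply/negP => /full; rewrite loops.
  have [R [QR cR]] : exists R : {set 'I_q}, ~: Q \subset R /\ #|R| = n.+1.
    apply: superset_card; rewrite card_ord; apply/andP; split; first exact: leqW.
    by move: nq; clear; lia.
  have := rowrk_sub At (~: Q) (R :\: ~: Q); rewrite (loops (~: Q) (subxx _)) add0n.
  have -> : ~: Q :|: R :\: ~: Q = R.
    by apply/setP => i; have := subsetP QR i; rewrite !inE; case: (_ != 0) => //= ->.
  have := rk_card (rowrk0 At) (rowrk1 At) (rowrk_sub At) (R :\: ~: Q).
  by rewrite cardsD (setIidPr QR) cR (full R) ?cR //; move: c1; clear; lia.
exists (n - #|~: Q|)%N; split; try by move: s_le cQ nq; clear; lia.
move=> R RQ cR; apply/eqP; rewrite eqn_leq rowrk_max /=.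
have dis : R :&: ~: Q = set0.
  by apply/setP => i; have := subsetP RQ i; rewrite !inE; case: (i \in R) => // ->.
have := rowrk_sub At R (~: Q); rewrite (loops (~: Q) (subxx _)) (full (R :|: ~: Q)); first by clear; lia.
by rewrite cardsU dis cards0; move: s_le cR; clear; lia.
Qed.

(** Finitely many values of [V] of maximal rank already span all the values: a further value outside
    the span would raise the rank. A linear relation between the coordinates that holds for all
    values holds on these, which form a matrix of full column rank. *)
Lemma full_rank_span n (V : Complex.C -> 'rV[CC]_n) (P : Complex.C -> Prop) z0 : P z0 -> V z0 != 0 ->
  exists k (B : 'M[CC]_(k.+1, n)), [/\ row_free B, forall z, P z -> (V z <= B)%MS &
    forall p : 'cV[CC]_k.+1, (forall z, P z -> V z *m pinvmx B *m p = 0) -> p = 0].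
Proof.
move=> Pz0 Vz0.
pose S K := exists m (E : 'M[CC]_(m, n)), \rank E = K /\ forall s, exists2 z, P z & row s E = V z.
have S1 : exists K, `[< S K.+1 >].
  exists 0%N; apply/asboolP; exists 1%N, (V z0); rewrite rank_rV Vz0; split=> // s; exists z0 => //.
  by rewrite ord1 row_id.
have Smax K : `[< S K.+1 >] -> (K <= n)%N.
  by move=> /asboolP[m [E [<- _]]] || (move=> /asboolP[m [E [rE _]]]; have := rank_leq_col E; rewrite rE; lia).
case: (ex_maxnP S1 Smax) => k /asboolP[m [E [rE HE]]] kmax.
have : exists B : 'M[CC]_(k.+1, n), row_free B /\ (B :=: E)%MS.
  by move: (row_base E) (row_base_free E) (eq_row_base E); rewrite rE => B f e; exists B.
move=> [B [fB eB]]; exists k, B; split=> // [z Pz|p Hp].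
  rewrite eB; apply/negP => /negP nz.
  have : `[< S k.+2 >]; last by move=> /kmax; rewrite ltnn.
  apply/asboolP; exists (m + 1)%N, (col_mx E (V z)); split.
    apply/eqP; rewrite -addsmxE eqn_leq; apply/andP; split.
      by apply: leq_trans (mxrank_adds_leqif _ _) _; rewrite rE -[k.+2]addn1 leq_add2l rank_leq_row.
    rewrite -rE ltn_neqAle mxrankS ?addsmxSl // andbT.
    apply/eqP => eqr; have := mxrank_leqif_sup (addsmxSl E (V z)) => /leqifP.
    rewrite addsmx_sub submx_refl (negbTE nz) /= eqr ltnn //.
  move=> s; case: (splitP s) => [j sj|j sj].
    have [w Pw rw] := HE j; exists w => //.
    have -> : s = lshift 1 j by apply: val_inj.
    by rewrite rowKu.
  exists z => //; have -> : s = rshift m j by apply: val_inj.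
  by rewrite rowKd row_id.
pose Y := E *m pinvmx B.
have EY : E = Y *m B by rewrite /Y mulmxKpV // eB.
have fY : row_full Y.
  have : (\rank E <= \rank Y)%N by rewrite {1}EY mxrankM_maxl.
  by rewrite rE => rY; rewrite /row_full eqn_leq rank_leq_col.
have Yp : Y *m p = 0.
  apply/row_matrixP => s; rewrite row0 row_mul /Y row_mul.
  by have [z Pz ->] := HE s; apply: Hp.
by rewrite -[p]mul1mx -(mulVpmx fY) -mulmxA Yp mulmx0.
Qed.

Definition cmod (z : CC) : R := Cmod z.

Lemma cmodM (x y : CC) : cmod (x * y) = cmod x * cmod y. Proof. exact: Cmod_mult. Qed.
Lemma cmod_ge0 (x : CC) : 0 <= cmod x. Proof. exact/RleP/Cmod_ge_0. Qed.
Lemma cmodD (x y : CC) : cmod (x + y) <= cmod x + cmod y. Proof. exact/RleP/Cmod_triangle. Qed.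
Lemma cmod0 : cmod 0 = 0. Proof. exact: Cmod_0. Qed.
Lemma cmod1 : cmod 1 = 1. Proof. exact: Cmod_1. Qed.
Lemma cmodN (x : CC) : cmod (- x) = cmod x. Proof. exact: Cmod_opp. Qed.
Lemma cmod_eq0 (x : CC) : (cmod x == 0) = (x == 0).
Proof. by apply/eqP/eqP => [/Cmod_eq_0 //|->]; apply: cmod0. Qed.
Lemma cmod_gt0 (x : CC) : (0 < cmod x) = (x != 0).
Proof. by rewrite lt_def cmod_ge0 andbT cmod_eq0. Qed.
Lemma cmodX (x : CC) n : cmod (x ^+ n) = cmod x ^+ n.
Proof. by elim: n => [|n IH]; rewrite ?expr0 ?cmod1 // !exprS cmodM IH. Qed.
Lemma cmod_sum (I : Type) (s : seq I) (P : pred I) (f : I -> CC) :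
  cmod (\sum_(i <- s | P i) f i) <= \sum_(i <- s | P i) cmod (f i).
Proof.
elim/big_rec2: _ => [|i x y _ IH]; first by rewrite cmod0.
by apply: le_trans (cmodD _ _) _; rewrite lerD2l.
Qed.
Lemma cmod_prod (I : Type) (s : seq I) (P : pred I) (f : I -> CC) :
  cmod (\prod_(i <- s | P i) f i) = \prod_(i <- s | P i) cmod (f i).
Proof. by apply: (big_morph cmod cmodM cmod1). Qed.

Lemma cmod_det m (M : 'M[CC]_m) (d : 'I_m -> R) : (forall s l, cmod (M s l) <= d s) ->
  cmod (\det M) <= m`!%:R * \prod_s d s.
Proof.
move=> H; apply: le_trans (cmod_sum _ _ _) _.
have -> : m`!%:R * \prod_s d s = \sum_(s : 'S_m) \prod_s d s.
  by rewrite sumr_const card_Sn -[RHS]mulr_natl.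
apply: ler_sum => s _; rewrite cmodM cmodX cmodN cmod1 expr1n mul1r cmod_prod.
by apply: ler_prod => i _; rewrite cmod_ge0 H.
Qed.

Section Bases.
Variables (q k : nat) (At : 'M[CC]_(q, k.+1)).
Definition rowsel (b : {ffun 'I_k.+1 -> 'I_q}) : 'M[CC]_k.+1 := \matrix_(s, t) At (b s) t.

Lemma basis_rows (B : {set 'I_q}) : #|B| = k.+1 -> rowrk At B = k.+1 ->
  exists b : {ffun 'I_k.+1 -> 'I_q}, [/\ rowsel b \in unitmx, forall s, b s \in B &
    forall f : 'I_q -> R, \sum_(i in B) f i = \sum_s f (b s)].
Proof.
move=> cB rB; exists [ffun s => enum_val (cast_ord (esym cB) s)]; split.
- rewrite -row_full_unit /row_full eqn_leq rank_leq_col /= -[X in (X <= _)%N]rB.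
  apply: mxrankS; apply/rowspan_sub => i iB.
  have -> : row i At = row (cast_ord cB (enum_rank_in iB i)) (rowsel [ffun s => enum_val (cast_ord (esym cB) s)]).
    by apply/rowP => t; rewrite !mxE ffunE cast_ordK enum_rankK_in.
  exact: row_sub.
- by move=> s; rewrite ffunE; apply: enum_valP.
- move=> f; rewrite big_enum_val (reindex (cast_ord (esym cB))) /=; last first.
    by exists (cast_ord cB) => s _; rewrite ?cast_ordK ?cast_ordKV.
  by apply: eq_bigr => s _; rewrite ffunE.
Qed.

(** One constant for all selections of rows; the singular ones contribute 0, as the inverse of 0 is
    0. *)
Definition invdet_bound : R := \sum_(b : {ffun 'I_k.+1 -> 'I_q}) cmod (\det (rowsel b))^-1.
Lemma invdet_bound_ge b : cmod (\det (rowsel b))^-1 <= invdet_bound.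
Proof. by rewrite /invdet_bound (bigD1 b) //= lerDl sumr_ge0 // => i _; apply: cmod_ge0. Qed.
Lemma invdet_bound_ge0 : 0 <= invdet_bound.
Proof. by apply: sumr_ge0 => i _; apply: cmod_ge0. Qed.

Variables (y : nat -> Complex.C -> CC) (g : 'I_q -> Complex.C -> CC) (c : Complex.C) (r : R).
Hypothesis Hy : forall s, (s < k.+1)%N -> hol c r (y s).
Hypothesis Hg : forall i w, (Cmod (Cminus w c) < r)%coqR -> g i w = \sum_(s < k.+1) At i s * y s w.

Lemma wronsk_bound z (b : {ffun 'I_k.+1 -> 'I_q}) (d : 'I_k.+1 -> R) : (Cmod (Cminus z c) < r)%coqR ->
  rowsel b \in unitmx -> (forall s (l : 'I_k.+1), cmod (Dn l (g (b s)) z) <= d s) ->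
  cmod (wronsk k.+1 y z) <= invdet_bound * ((k.+1)`!%:R * \prod_s d s).
Proof.
move=> Hz Ub Hd; pose gb (s : nat) := g (b (inord s)).
have E : wronsk k.+1 gb z = \det (rowsel b) * wronsk k.+1 y z.
  apply: (wronsk_lin (c := c) (r := r)) => // i w Hw.
  by rewrite /gb inord_val Hg //; apply: eq_bigr => t _; rewrite mxE.
have nz : \det (rowsel b) != 0 by rewrite -unitfE -unitmxE.
have -> : wronsk k.+1 y z = (\det (rowsel b))^-1 * wronsk k.+1 gb z by rewrite E mulKf.
rewrite cmodM; apply: ler_pM; rewrite ?cmod_ge0 ?invdet_bound_ge //.
by apply: cmod_det => s l; rewrite mxE /gb inord_val; apply: Hd.
Qed.
End Bases.

Section SmallForms.
Variables (q k n : nat) (At : 'M[CC]_(q, k.+1)) (B : 'M[CC]_(k.+1, n)).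

Definition small_const : R := 1 + \sum_(b : {ffun 'I_k.+1 -> 'I_q}) \sum_s \sum_t \sum_j cmod (invmx (rowsel At b) t s * B t j).

Lemma small_const_ge1 : 1 <= small_const.
Proof. by rewrite lerDl; do 4 (apply: sumr_ge0 => ? _); apply: cmod_ge0. Qed.

(** If all the forms in [R] were below [small_const^-1], inverting [k + 1] independent ones among
    them would make the component of index [j] smaller than 1, whereas the normalisation makes it
    equal to 1. Hence at most [N] forms can be small at a point. *)
Lemma some_large_form (Y : 'cV[CC]_k.+1) (R : {set 'I_q}) j : rowrk At R = k.+1 ->
  (Y^T *m B) 0 j = 1 -> exists2 i, i \in R & small_const^-1 <= cmod ((At *m Y) i 0).
Proof.
move=> rR YB; apply: contrapT => H.
have small i : i \in R -> cmod ((At *m Y) i 0) < small_const^-1.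
  by move=> iR; rewrite ltNge; apply/negP => Q; apply: H; exists i.
have [B' [_ B'R cB rB]] := extend_basis (rowrk0 At) (rowrk1 At) (rowrk_mono At) (rowrk_sub At) (sub0set R) (etrans (cards0 _) (esym (rowrk0 At))).
rewrite rR in rB; rewrite rB in cB.
have [b [Ub bB _]] := basis_rows cB rB.
pose G : 'cV[CC]_k.+1 := \col_s (At *m Y) (b s) 0.
have GE : G = rowsel At b *m Y.
  by apply/colP => s; rewrite !mxE; apply: eq_bigr => t _; rewrite mxE.
have YE : Y = invmx (rowsel At b) *m G by rewrite GE mulKmx.
have : cmod ((Y^T *m B) 0 j) < 1; last by rewrite YB cmod1 ltxx.
have sc0 : 0 < small_const by apply: lt_le_trans small_const_ge1.
have E : (Y^T *m B) 0 j = \sum_s (\sum_t invmx (rowsel At b) t s * B t j) * G s 0.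
  rewrite {1}YE !mxE; under eq_bigr => t _ do rewrite !mxE mulr_suml.
  rewrite exchange_big /=; apply: eq_bigr => s _; rewrite mulr_suml; apply: eq_bigr => t _.
  by rewrite mulrAC.
rewrite E; apply: le_lt_trans (cmod_sum _ _ _) _.
apply: (@le_lt_trans _ _ (\sum_s (\sum_t \sum_j cmod (invmx (rowsel At b) t s * B t j)) * small_const^-1)).
  apply: ler_sum => s _; rewrite cmodM; apply: ler_pM; rewrite ?cmod_ge0 //; last first.
    by rewrite mxE ltW // small // (subsetP B'R).
  apply: le_trans (cmod_sum _ _ _) _; apply: ler_sum => t _.
  by rewrite (bigD1 j) //= lerDl sumr_ge0 // => ? _; apply: cmod_ge0.
rewrite -mulr_suml ltr_pdivrMr // mul1r /small_const.
apply: (@le_lt_trans _ _ (\sum_(b : {ffun 'I_k.+1 -> 'I_q}) \sum_s \sum_t \sum_j cmod (invmx (rowsel At b) t s * B t j))).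
  by rewrite [leRHS](bigD1 b) //= lerDl; do 4 (apply: sumr_ge0 => ? _); apply: cmod_ge0.
by rewrite ltrDr.
Qed.
End SmallForms.

Lemma exp_sum (I : finType) (P : pred I) (f : I -> R) : exp (\sum_(i | P i) f i) = \prod_(i | P i) exp (f i).
Proof.
apply: (big_morph exp); last exact: exp_0.
by move=> x z; rewrite exp_plus.
Qed.

Lemma exp_scale (x : R) (l : nat) : exp (l%:R * x)%R = exp x ^+ l.
Proof. by rewrite expRX mulr_natl. Qed.

(** The hypothesis makes [d] of order [g^((m - j) / m)], and since [g / Ca <= 1] the worst case is
    [j = k]. The exponential carries the fractional exponent and matches the sums in
    [weighted_basis]; the proof compares powers of exponent [m]. *)
Lemma deriv_weight (m j k : nat) (Kc Ca d g : R) : (0 < m)%N -> (j <= k)%N -> 0 <= Kc -> 1 <= Ca -> 0 < g <= Ca ->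
  0 <= d -> d ^+ m <= Kc * g ^+ (m - j) ->
  d <= (1 + Kc) * Ca * exp (- ((m - k)%N%:R / m%:R * (ln Ca - ln g)))%R.
Proof.
move=> m0 jk K0 C1 /andP[g0 gC] d0 H.
have C0 : 0 < Ca by apply: lt_le_trans C1.
have mR : (m%:R : R) != 0 by rewrite pnatr_eq0 -lt0n.
rewrite -(ler_pXn2r m0) ?nnegrE //; last first.
  by rewrite !mulr_ge0 ?addr_ge0 ?ler01 ?(ltW C0) //; apply/RleP/Rlt_le/exp_pos.
have Eg : exp (ln g - ln Ca)%R = g / Ca.
  rewrite -[ln g - ln Ca]/(Rplus (ln g) (Ropp (ln Ca))) exp_plus exp_Ropp !exp_ln //; exact/RltP.
apply: le_trans H _; rewrite !exprMn -exp_scale.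
have -> : m%:R * - ((m - k)%N%:R / m%:R * (ln Ca - ln g)) = (m - k)%N%:R * (ln g - ln Ca).
  by rewrite -[in RHS]opprB !mulrN mulrA [m%:R * _]mulrC divfK.
rewrite exp_scale Eg.
have [x [x0 x1 gE]] : exists x, [/\ 0 <= x, x <= 1 & g = x * Ca].
  exists (g / Ca); rewrite divr_ge0 ?(ltW g0) ?(ltW C0) // ler_pdivrMr // mul1r gC divfK //.
  by rewrite gt_eqF.
rewrite gE mulfK ?gt_eqF // exprMn mulrA [leRHS]mulrAC.
have X0 i : 0 <= x ^+ i by apply: exprn_ge0.
have h1 : Kc <= (1 + Kc) ^+ m.
  apply: le_trans (_ : 1 + Kc <= _); first by rewrite lerDr.
  by apply: ler_eXnr => //; rewrite lerDl.
apply: ler_pM; rewrite ?mulr_ge0 ?exprn_ge0 ?(ltW C0) //.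
  apply: ler_pM => //; apply: ler_wiXn2l => //; exact: leq_sub2l.
by apply: ler_weXn2l => //; apply: leq_subr.
Qed.

Lemma ler_exp (x y : R) : x <= y -> exp x <= exp y.
Proof. by move=> /RleP H; apply/RleP/exp_le_exp. Qed.
Lemma exp_ge0 (x : R) : 0 <= exp x.
Proof. exact/RleP/Rlt_le/exp_pos. Qed.
Lemma ler_ln (x y : R) : 0 < x -> x <= y -> ln x <= ln y.
Proof.
move=> /RltP x0 /RleP [L|->]; last exact: lexx.
exact/RleP/Rlt_le/ln_increasing.
Qed.

(** [weighted_basis] is applied to [X i = ln Ca - ln |g_i z|], with the threshold of
    [some_large_form] as [c0]. The basis depends on the point, but the exponents and the constant do
    not, and [deriv_weight] bounds the Wronskian row by row. *)
Lemma wronsk_pointwise q k n N (At : 'M[CC]_(q, k.+1)) (B : 'M[CC]_(k.+1, n)) (mu : 'I_q -> nat)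
  (Q : {set 'I_q}) (Ca Kc : R) :
  (forall i, i \in Q -> (0 < mu i)%N) -> 1 <= Ca -> 0 <= Kc ->
  (forall R : {set 'I_q}, R \subset Q -> (N < #|R|)%N -> rowrk At R = k.+1) ->
  (0 < k <= N)%N -> (2 * N < #|Q|)%N ->
  N%:R * (\sum_(i in Q) ((mu i)%:R : R)^-1) < #|Q|%:R - N%:R - 1 ->
  exists (l : 'I_q -> nat) (M : nat), (M * k.+1 < \sum_(i in Q) l i)%N /\
  exists K5 : R, 0 <= K5 /\ forall (c : Complex.C) (r : R) (y : nat -> Complex.C -> CC) (g : 'I_q -> Complex.C -> CC) z j,
    (forall s, (s < k.+1)%N -> hol c r (y s)) ->
    (forall i w, (Cmod (Cminus w c) < r)%coqR -> g i w = \sum_(s < k.+1) At i s * y s w) ->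
    (Cmod (Cminus z c) < r)%coqR -> \sum_(s < k.+1) y s z * B s j = 1 ->
    (forall i, i \in Q -> g i z != 0 /\ cmod (g i z) <= Ca) ->
    (forall i l', i \in Q -> (l' <= k)%N -> cmod (Dn l' (g i) z) ^+ mu i <= Kc * cmod (g i z) ^+ (mu i - l')) ->
    cmod (wronsk k.+1 y z) ^+ M <= K5 * \prod_(i in Q) cmod (g i z) ^+ l i.
Proof.
move=> mu0 C1 K0 full kN NQ Hsum.
have [l [M [lM [K [K00 Hw]]]]] := weighted_basis (rowrk0 At) (rowrk1 At) (rowrk_mono At) (rowrk_sub At) kN NQ full mu0 Hsum.
exists l, M; split=> //.
have C0 : 0 < Ca by apply: lt_le_trans C1.
set sc := small_const At B; have sc1 : 1 <= sc by apply: small_const_ge1.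
have sc0 : 0 < sc by apply: lt_le_trans sc1.
pose c0 := ln Ca - ln sc^-1.
have c00 : 0 <= c0.
  by rewrite subr_ge0 ler_ln ?invr_gt0 //; apply: le_trans C1; rewrite invf_le1.
pose C2 := (1 + Kc) * Ca.
have C20 : 0 <= C2 by rewrite mulr_ge0 ?addr_ge0 ?ler01 ?(ltW C0).
exists ((invdet_bound At * (k.+1`!%:R * C2 ^+ k.+1)) ^+ M * exp (K * c0)%R); split.
  rewrite mulr_ge0 ?exp_ge0 // exprn_ge0 // mulr_ge0 ?invdet_bound_ge0 // mulr_ge0 ?ler0n //.
  exact: exprn_ge0.
move=> c r y g z j Hy Hg Hz YB gQ est.
pose X i := ln Ca - ln (cmod (g i z)).
have gp i : i \in Q -> 0 < cmod (g i z) by move=> /gQ [gi _]; rewrite cmod_gt0.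
have X0 i : i \in Q -> 0 <= X i.
  by move=> iQ; rewrite subr_ge0 ler_ln ?gp //; case: (gQ i iQ).
have [|B' [BQ cB rB sB]] := Hw X c0 X0 c00.
  rewrite leqNgt; apply/negP => big.
  have sub : [set i in Q | c0 < X i] \subset Q by apply/subsetP => i; rewrite inE => /andP[].
  pose Y : 'cV[CC]_k.+1 := \col_s y s z.
  have YB' : (Y^T *m B) 0 j = 1.
    by rewrite !mxE -[RHS]YB; apply: eq_bigr => s _; rewrite !mxE.
  have [i] := some_large_form (full _ sub big) YB'.
  rewrite inE => /andP[iQ]; rewrite ltNge => /negP nX large; apply: nX.
  rewrite /X /c0 lerD2l lerN2; apply: ler_ln; first by rewrite invr_gt0.
  apply: le_trans large _; rewrite Hg // le_eqVlt; apply/orP; left; apply/eqP; congr cmod.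
  by rewrite !mxE; apply: eq_bigr => s _; rewrite !mxE.
have [b [Ub bB bsum]] := basis_rows cB rB.
pose e i : R := (mu i - k)%N%:R / (mu i)%:R.
have W : cmod (wronsk k.+1 y z) <= invdet_bound At * (k.+1`!%:R * \prod_(s < k.+1) (C2 * exp (- (e (b s) * X (b s)))%R)).
  apply: (wronsk_bound Hy Hg Hz Ub) => s l'.
  have iQ : b s \in Q by apply: (subsetP BQ); apply: bB.
  apply: (deriv_weight (j := l')) => //; rewrite ?mu0 ?cmod_ge0 //.
  - by rewrite -ltnS.
  - by rewrite gp //; case: (gQ _ iQ).
  - by apply: est => //; rewrite -ltnS.
have EX : \prod_(s < k.+1) (C2 * exp (- (e (b s) * X (b s)))%R) = C2 ^+ k.+1 * exp (- \sum_(i in B') e i * X i)%R.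
  rewrite big_split /= prodr_const card_ord -exp_sum sumrN; congr (_ * exp (- _)%R).
  by rewrite (bsum (fun i => e i * X i)).
apply: (@le_trans _ _ ((invdet_bound At * (k.+1`!%:R * (C2 ^+ k.+1 * exp (- \sum_(i in B') e i * X i)%R))) ^+ M)).
  by rewrite EX in W; apply: lerXn2r; rewrite ?nnegrE ?cmod_ge0 //; apply: le_trans W; apply: cmod_ge0.
rewrite !mulrA exprMn -!mulrA ler_wpM2l //.
  by rewrite exprn_ge0 // mulr_ge0 ?invdet_bound_ge0 // mulr_ge0 ?ler0n //; apply: exprn_ge0.
rewrite -exp_scale; apply: (@le_trans _ _ (exp (K * c0 - \sum_(i in Q) (l i)%:R * X i)%R)).
  by apply: ler_exp; rewrite mulrN lerNl opprB lerBlDr.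
rewrite -[(K * c0 - _)%R]/(Rplus (K * c0)%R (- (\sum_(i in Q) (l i)%:R * X i))%R) exp_plus.
rewrite ler_wpM2l ?exp_ge0 // -sumrN exp_sum; apply: ler_prod => i iQ; rewrite exp_ge0 /=.
rewrite -mulrN exp_scale; apply: lerXn2r; rewrite ?nnegrE ?exp_ge0 ?cmod_ge0 //.
rewrite /X opprB -[(ln _ - ln _)%R]/(Rplus (ln (cmod (g i z))) (Ropp (ln Ca))) exp_plus exp_Ropp !exp_ln; try exact/RltP/gp; try exact/RltP.
by rewrite -[leRHS]mulr1 ler_wpM2l ?cmod_ge0 // invf_le1.
Qed.

(** * The limit curve is constant *)

Lemma center_in c r : (0 < r)%coqR -> (Cmod (Cminus c c) < r)%coqR.
Proof. by rewrite Cmod_subrr. Qed.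

(* The local quotients [A c / Bf c] are the restrictions of one bounded entire function. *)
Lemma glue_liouville (A Bf : Complex.C -> Complex.C -> CC) (K : R) :
  (forall c, hol c (/ 4)%coqR (A c)) -> (forall c, hol c (/ 4)%coqR (Bf c)) ->
  (forall c, ~ (forall z, (Cmod (Cminus z c) < / 4)%coqR -> Bf c z = 0)) ->
  (forall c z, (Cmod (Cminus z c) < / 8)%coqR -> Bf c z <> 0 -> (Cmod (A c z) <= K * Cmod (Bf c z))%coqR) ->
  (forall c c' z, (Cmod (Cminus z c) < / 4)%coqR -> (Cmod (Cminus z c') < / 4)%coqR ->
    exists h : CC, [/\ h != 0, A c z = h * A c' z & Bf c z = h * Bf c' z]) ->
  exists (kap : CC) (d : R), (0 < d <= / 8)%coqR /\ forall z, (Cmod (Cminus z (RtoC 0)) < d)%coqR -> A (RtoC 0) z = kap * Bf (RtoC 0) z.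
Proof.
move=> hA hB NB bd tr.
have NB' c r : (0 < r)%coqR -> ~ (forall z, (Cmod (Cminus z c) < r)%coqR -> Bf c z = 0).
  by move=> r0 Z; apply: (NB c); apply: (identity_center c _ r).
have ex c : exists dH : R * (Complex.C -> Complex.C), (0 < dH.1 <= / 8)%coqR /\ hol c dH.1 dH.2 /\
    forall z, (Cmod (Cminus z c) < dH.1)%coqR -> A c z = (dH.2 z : CC) * Bf c z /\ (Cmod (dH.2 z) <= K)%coqR.
  have sub f : hol c (/ 4)%coqR f -> hol c (/ 8)%coqR f by move=> Hf; apply: (hol_sub _ _ _ _ _ Hf) => z; Lra.lra.
  have [||d [H HH]] := bounded_quotient c (/ 8)%coqR K (A c) (Bf c) _ (sub _ (hA c)) (sub _ (hB c)) _ (bd c).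
  - Lra.lra.
  - by apply: NB'; Lra.lra.
  - by exists (d, H).
have [f Hf] := choice ex.
pose d c := (f c).1; pose H c := (f c).2.
have Hd c : (0 < d c <= / 8)%coqR by case: (Hf c).
have hH c : hol c (d c) (H c) by case: (Hf c) => _ [].
have HE c z : (Cmod (Cminus z c) < d c)%coqR -> A c z = (H c z : CC) * Bf c z by case: (Hf c) => _ [_ /(_ z)] HH /HH [].
have HK c z : (Cmod (Cminus z c) < d c)%coqR -> (Cmod (H c z) <= K)%coqR by case: (Hf c) => _ [_ /(_ z)] HH /HH [].
(* Local quotients agree on overlaps, as numerator and denominator change by the same factor. So the
   diagonal [G z = H z z] coincides near every point with a holomorphic function. *)
have same c z : (Cmod (Cminus z c) < d c)%coqR -> H z z = H c z.
  move=> Hz; pose r := Rmin (d z) (d c - Cmod (Cminus z c)).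
  have r0 : (0 < r)%coqR by apply: Rmin_pos; have := Hd z; Lra.lra.
  have r1 : (r <= d z)%coqR by apply: Rmin_l.
  have r2 : (r <= d c - Cmod (Cminus z c))%coqR by apply: Rmin_r.
  have inc w : (Cmod (Cminus w z) < r)%coqR -> (Cmod (Cminus w c) < d c)%coqR.
    by move=> Hw; have := Cmod_sub_tri w z c; Lra.lra.
  have hdiff : hol z r (fun w => (H z w : CC) - H c w).
    apply: hol_minus; first by apply: (hol_sub _ _ _ _ _ (hH z)) => w; Lra.lra.
    exact: (hol_sub _ _ _ _ _ (hH c)).
  have hBz : hol z r (Bf z) by apply: (hol_sub _ _ _ _ _ (hB z)) => w; have := Hd z; Lra.lra.
  have prod0 w : (Cmod (Cminus w z) < r)%coqR -> ((H z w : CC) - H c w) * Bf z w = 0.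
    move=> Hw; have [||h [h0 hA' hB']] := tr c z w.
    - by have := inc w Hw; have := Hd c; Lra.lra.
    - by have := Hd z; Lra.lra.
    rewrite mulrBl -HE; last Lra.lra.
    apply/eqP; rewrite subr_eq0; apply/eqP; apply: (mulfI h0).
    by rewrite -hA' mulrCA -hB' -HE //; apply: inc.
  have [Z|Z] := mult_eq0 z r _ _ r0 hdiff hBz prod0; last by case: (NB' z r r0).
  by have /eqP := Z z (center_in _ r0); rewrite subr_eq0 => /eqP.
pose G z := H z z.
have Gd z : exists l, cder G z l.
  have [l Hl] := hH z z (center_in _ (proj1 (Hd z))).
  exists l; apply: (cder_ext_loc (H z) G z l (d z)) => //; first by case: (Hd z).
  by move=> w Hw; rewrite /G (same z w).
have GK z : (Cmod (G z) <= K)%coqR by apply: HK; apply: center_in; case: (Hd z).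
have GL := liouville K G Gd GK.
exists (G (RtoC 0)), (d (RtoC 0)); split=> // z Hz.
by rewrite HE // -(GL z) /G (same (RtoC 0)).
Qed.

Lemma prod_eq0_disc (I : eqType) (s : seq I) c r (f : I -> Complex.C -> CC) : (0 < r)%coqR -> (forall i, i \in s -> hol c r (f i)) ->
  (forall z, (Cmod (Cminus z c) < r)%coqR -> \prod_(i <- s) f i z = 0) ->
  exists2 i, i \in s & forall z, (Cmod (Cminus z c) < r)%coqR -> f i z = 0.
Proof.
move=> r0; elim: s => [|i s IH] H Z.
  by have /eqP := Z c (center_in _ r0); rewrite big_nil oner_eq0.
have hs : hol c r (fun z => \prod_(i <- s) f i z).
  elim: (s) (fun j (js : j \in s) => H j (mem_behead (s := i :: s) js)) => [|j t IHt] Ht.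
    by apply: hol_ext (hol_cst 1) => z _; rewrite big_nil.
  apply: hol_ext (hol_mul (Ht j (mem_head _ _)) (IHt (fun j' js => Ht j' (mem_behead (s := j :: t) js)))) => z _.
  by rewrite big_cons.
have [||Z1] := mult_eq0 c r (f i) (fun z => \prod_(i <- s) f i z : CC) r0 (H i (mem_head _ _)) hs.
- by move=> z Hz; have := Z z Hz; rewrite big_cons.
- by exists i => //; apply: mem_head.
have [|j js Zj] := IH _ Z1; first by move=> j js; apply: H; rewrite inE js orbT.
by exists j => //; rewrite inE js orbT.
Qed.

Lemma exp_eq0_disc c r (f : Complex.C -> CC) n : (0 < r)%coqR -> hol c r f ->
  (forall z, (Cmod (Cminus z c) < r)%coqR -> f z ^+ n = 0) -> forall z, (Cmod (Cminus z c) < r)%coqR -> f z = 0.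
Proof.
by move=> r0 _ H z Hz; have /eqP := H z Hz; rewrite expf_eq0 => /andP[_ /eqP].
Qed.

(** A failure of the inequality at one point persists nearby by continuity, which would force [Z] to
    vanish on a disc and hence everywhere. *)
Lemma bound_off_zeros c r K (A B Z : Complex.C -> CC) : hol c r A -> hol c r B -> hol c r Z ->
  ~ (forall z, (Cmod (Cminus z c) < r)%coqR -> Z z = 0) ->
  (forall z, (Cmod (Cminus z c) < r)%coqR -> Z z <> 0 -> (Cmod (A z) <= K * Cmod (B z))%coqR) ->
  forall z, (Cmod (Cminus z c) < r)%coqR -> (Cmod (A z) <= K * Cmod (B z))%coqR.
Proof.
move=> hA hB hZ NZ H z Hz; apply: Rnot_lt_le => L; apply: NZ.
set e := (Cmod (A z) - K * Cmod (B z))%coqR in L; have K0 := Rabs_pos K.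
have e0 : (0 < e)%coqR by rewrite /e; Lra.lra.
have [d1 [d10 H1]] := hol_cont _ _ _ _ hA Hz (e / 4)%coqR ltac:(Lra.lra).
have [d2 [d20 H2]] := hol_cont _ _ _ _ hB Hz (e / (4 * (Rabs K + 1)))%coqR ltac:(apply: Rdiv_lt_0_compat; Lra.lra).
pose s := Rmin (r - Cmod (Cminus z c)) (Rmin d1 d2).
have s0 : (0 < s)%coqR by repeat apply: Rmin_pos; Lra.lra.
have s1 : (s <= r - Cmod (Cminus z c))%coqR by apply: Rmin_l.
have s2 : (s <= d1)%coqR by apply: Rle_trans (Rmin_r _ _) (Rmin_l _ _).
have s3 : (s <= d2)%coqR by apply: Rle_trans (Rmin_r _ _) (Rmin_r _ _).
apply: (identity_disc c r Z z s hZ Hz s0) => w Hw; apply: NNPP => Nw.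
have Hwc : (Cmod (Cminus w c) < r)%coqR by have := Cmod_sub_tri w z c; Lra.lra.
have h := H w Hwc Nw.
have h1 := H1 w ltac:(Lra.lra); have h2 := H2 w ltac:(Lra.lra).
have t1 := Cmod_rev_triangle (A z) (A w); rewrite Cmod_sub_sym in t1.
have t2 := Cmod_rev_triangle (B w) (B z); have t3 := Cmod_rev_triangle (B z) (B w); rewrite Cmod_sub_sym in t3.
have t4 : (K * (Cmod (B w) - Cmod (B z)) <= Rabs K * (e / (4 * (Rabs K + 1))))%coqR.
  apply: Rle_trans (Rle_abs _) _; rewrite Rabs_mult; apply: Rmult_le_compat_l => //.
  by apply: Rabs_le; Lra.lra.
have t5 : (Rabs K * (e / (4 * (Rabs K + 1))) <= e / 4)%coqR.
  have -> : (e / 4 = (Rabs K + 1) * (e / (4 * (Rabs K + 1))))%coqR by field; Lra.lra.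
  by apply: Rmult_le_compat_r; [apply: Rlt_le; apply: Rdiv_lt_0_compat; Lra.lra|Lra.lra].
by rewrite /e in e0 t4 t5 h1; Lra.nra.
Qed.

Section LimitCurve.
Variables (n q : nat) (a : 'M[CC]_(q, n.+1)) (mu : 'I_q -> nat).
Variables (F : Complex.C -> 'I_n.+1 -> Complex.C -> CC) (J : Complex.C -> 'I_n.+1).
Definition form c i z : CC := \sum_j a i j * F c j z.
Hypothesis nq : (2 * n < q)%N.
Hypothesis GP : forall R : {set 'I_q}, (n < #|R|)%N -> rowrk a R = n.+1.
Hypothesis mu0 : forall i, (0 < mu i)%N.
Hypothesis Hsum : n%:R * (\sum_i ((mu i)%:R : R)^-1) < q%:R - n%:R - 1.
Hypothesis Fhol : forall c j, hol c (/ 4)%coqR (F c j).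
Hypothesis Fbd : forall c j z, (Cmod (Cminus z c) < / 4)%coqR -> cmod (F c j z) <= 2.
Hypothesis Fone : forall c z, (Cmod (Cminus z c) < / 4)%coqR -> F c (J c) z = 1.
Hypothesis Fcomp : forall c c' z j, (Cmod (Cminus z c) < / 4)%coqR -> (Cmod (Cminus z c') < / 4)%coqR ->
  F c j z = F c (J c') z * F c' j z.
Hypothesis Fest : exists2 Kc : R, 0 <= Kc & forall c i l z, (l <= n)%N -> (Cmod (Cminus z c) < / 8)%coqR ->
  cmod (Dn l (form c i) z) ^+ mu i <= Kc * cmod (form c i z) ^+ (mu i - l).

Let Fv c z : 'rV[CC]_n.+1 := \row_j F c j z.

Lemma quarter_gt0 : (0 < / 4)%coqR. Proof. Lra.lra. Qed.

(** Neighbouring representations are proportional on overlaps, so a linear relation holds on part of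
    the next disc, and by the identity theorem on all of it. *)
Lemma relation_propagates (v : 'cV[CC]_n.+1) c0 : (forall z, (Cmod (Cminus z c0) < / 4)%coqR -> Fv c0 z *m v = 0) ->
  forall c z, (Cmod (Cminus z c) < / 4)%coqR -> Fv c z *m v = 0.
Proof.
move=> H0.
apply: (small_step_ind (P := fun c => forall z, (Cmod (Cminus z c) < / 4)%coqR -> Fv c z *m v = 0) (d := (/ 8)%coqR) _ H0); first Lra.lra.
move=> c c' Hcc Hc z Hz.
have E w : (Fv c' w *m v) = (\sum_j F c' j w * v j 0)%:M.
  apply/rowP => j; rewrite !ord1 !mxE eqxx mulr1n; apply: eq_bigr => j' _; by rewrite mxE.
have hs : hol c' (/ 4)%coqR (fun w => \sum_j F c' j w * v j 0).
  by apply: hol_sum => j _; apply: hol_mul; [apply: Fhol|apply: hol_cst].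
rewrite E; suff -> : \sum_j F c' j z * v j 0 = 0 by rewrite raddf0.
apply: (identity_center c' (/ 4)%coqR (/ 8)%coqR _ _ hs _ z Hz); first Lra.lra.
move=> w Hw; have Hw' : (Cmod (Cminus w c) < / 4)%coqR by have := Cmod_sub_tri w c' c; Lra.lra.
have : (Fv c w *m v) 0 0 = 0 by rewrite Hc // mxE.
rewrite mxE => Z; under eq_bigr => j _.
  rewrite (Fcomp (c' := c)) //; [|Lra.lra]; rewrite -mulrA; over.
rewrite -mulr_sumr; have -> : \sum_j F c j w * v j 0 = 0 by rewrite -[RHS]Z; apply: eq_bigr => j _; rewrite mxE.
by rewrite mulr0.
Qed.

Lemma transition_neq0 c c' z : (Cmod (Cminus z c) < / 4)%coqR -> (Cmod (Cminus z c') < / 4)%coqR -> F c (J c') z != 0.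
Proof.
move=> Hc Hc'; apply/eqP => Z; have := Fcomp (J c) Hc Hc'; rewrite Z mul0r Fone // => /eqP.
by rewrite oner_eq0.
Qed.

Lemma limit_constant : exists p : 'rV[CC]_n.+1, p != 0 /\
  forall c z, (Cmod (Cminus z c) < / 4)%coqR -> exists lam : CC, forall j, F c j z = lam * p 0 j.
Proof.
have in0 c := center_in c quarter_gt0.
have V0 c z : (Cmod (Cminus z c) < / 4)%coqR -> Fv c z != 0.
  by move=> Hz; apply/eqP => /rowP /(_ (J c)) /eqP; rewrite !mxE Fone // oner_eq0.
have [k [B [fB spanB indB]]] := full_rank_span (P := fun z => (Cmod (Cminus z (RtoC 0)) < / 4)%coqR) (in0 (RtoC 0)) (V0 _ _ (in0 (RtoC 0))).
have {}spanB c z : (Cmod (Cminus z c) < / 4)%coqR -> (Fv c z <= B)%MS.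
  move=> Hz; rewrite submxE; apply/eqP/row_matrixP => i; rewrite ord1 row_id row0.
  apply/rowP => j; rewrite [RHS]mxE.
  have Q : Fv c z *m col j (cokermx B) = 0.
    apply: (relation_propagates (c0 := RtoC 0)) Hz => w Hw.
    by rewrite colE mulmxA; have := spanB w Hw; rewrite submxE => /eqP ->; rewrite mul0mx.
  rewrite colE mulmxA -colE in Q.
  have := f_equal (fun v : 'cV[CC]_1 => v 0 0) Q.
  by rewrite [LHS]mxE [X in _ = X -> _]mxE.
pose P := pinvmx B.
have YB c z : (Cmod (Cminus z c) < / 4)%coqR -> Fv c z *m P *m B = Fv c z.
  by move=> Hz; rewrite mulmxKpV // spanB.
(* If the span is a line, the curve is constant; the rest of the proof refutes [k > 0]. *)
case: (posnP k) => [k0|kpos].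
  subst k; exists (row 0 B); split.
    apply/eqP => Z; have := fB; rewrite /row_free.
    have -> : B = 0 by apply/row_matrixP => i; rewrite ord1 Z row0.
    by rewrite mxrank0.
  move=> c z Hz; exists ((Fv c z *m P) 0 0) => j.
  have E : (Fv c z *m P *m B) 0 j = F c j z by rewrite YB // mxE.
  by rewrite -E mxE big_ord1 [row 0 B 0 j]mxE.
exfalso.
pose y c (s : nat) z : CC := \sum_j F c j z * P j (inord s).
have yE c z (s : 'I_k.+1) : y c s z = (Fv c z *m P) 0 s.
  by rewrite /y [RHS]mxE; apply: eq_bigr => j _; rewrite [Fv c z 0 j]mxE inord_val.
have hy c s : hol c (/ 4)%coqR (y c s).
  by apply: hol_sum => j _; apply: hol_mul; [apply: Fhol|apply: hol_cst].
have ytr c c' z s : (Cmod (Cminus z c) < / 4)%coqR -> (Cmod (Cminus z c') < / 4)%coqR -> y c s z = F c (J c') z * y c' s z.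
  move=> Hc Hc'; rewrite mulr_sumr; apply: eq_bigr => j _; by rewrite (Fcomp j Hc Hc') mulrA.
have yB c z j : (Cmod (Cminus z c) < / 4)%coqR -> \sum_(s < k.+1) y c s z * B s j = F c j z.
  move=> Hz; have E : (Fv c z *m P *m B) 0 j = F c j z by rewrite YB // mxE.
  by rewrite -E mxE; apply: eq_bigr => s _; rewrite yE.
pose At := a *m B^T.
have formE c i z : (Cmod (Cminus z c) < / 4)%coqR -> form c i z = \sum_(s < k.+1) At i s * y c s z.
  move=> Hz; rewrite /form; under eq_bigr => j _ do rewrite -(yB c z j Hz) mulr_sumr.
  rewrite exchange_big /=; apply: eq_bigr => s _; rewrite mxE mulr_suml; apply: eq_bigr => j _.
  by rewrite mxE -mulrA [y _ _ _ * _]mulrC.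
have hform c i : hol c (/ 4)%coqR (form c i).
  by apply: hol_sum => j _; apply: hol_mul; [apply: hol_cst|apply: Fhol].
have ftr c c' z i : (Cmod (Cminus z c) < / 4)%coqR -> (Cmod (Cminus z c') < / 4)%coqR -> form c i z = F c (J c') z * form c' i z.
  move=> Hc Hc'; rewrite mulr_sumr; apply: eq_bigr => j _; by rewrite (Fcomp j Hc Hc') mulrCA.
have ind (p : 'rV[CC]_k.+1) : (forall z, (Cmod (Cminus z (RtoC 0)) < / 4)%coqR -> \sum_(s < k.+1) p 0 s * y (RtoC 0) s z = 0) -> p = 0.
  move=> Hp; apply: trmx_inj; rewrite trmx0; apply: indB => z Hz.
  apply/matrixP => i j; rewrite !ord1 [RHS]mxE mxE -[RHS](Hp z Hz); apply: eq_bigr => s _.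
  by rewrite yE mulrC mxE.
have [N [kN Nn NQ cQ full]] := matroid_setup nq GP fB.
set Q := [set i | _] in NQ cQ full.
rewrite -/At in Q NQ cQ full.
have [Kc Kc0 est] := Fest.
pose Ca : R := 1 + \sum_i \sum_j cmod (a i j) * 2.
have Ca1 : 1 <= Ca by rewrite lerDl; do 2 (apply: sumr_ge0 => ? _); rewrite mulr_ge0 ?cmod_ge0.
have formbd c i z : (Cmod (Cminus z c) < / 4)%coqR -> cmod (form c i z) <= Ca.
  move=> Hz; apply: le_trans (cmod_sum _ _ _) _.
  apply: (@le_trans _ _ (\sum_j cmod (a i j) * 2)).
    by apply: ler_sum => j _; rewrite cmodM ler_wpM2l ?cmod_ge0 // Fbd.
  apply: (@le_trans _ _ (\sum_i \sum_j cmod (a i j) * 2)); last by rewrite lerDr.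
  rewrite [leRHS](bigD1 i) //= lerDl; do 2 (apply: sumr_ge0 => ? _); by rewrite mulr_ge0 ?cmod_ge0.
have HsumQ : N%:R * (\sum_(i in Q) ((mu i)%:R : R)^-1) < #|Q|%:R - N%:R - 1.
  have -> : #|Q|%:R - N%:R - 1 = q%:R - n%:R - 1 :> R.
    have e : #|Q|%:R + n%:R = q%:R + N%:R :> R by rewrite -!natrD cQ.
    congr (_ - 1); rewrite (_ : #|Q|%:R = q%:R + N%:R - n%:R); last by rewrite -e addrK.
    by rewrite addrAC addrK.
  apply: le_lt_trans Hsum; apply: ler_pM; rewrite ?ler0n ?ler_nat //.
    by apply: sumr_ge0 => i _; rewrite invr_ge0.
  rewrite [leRHS](bigID (mem Q)) /= lerDl; apply: sumr_ge0 => i _; by rewrite invr_ge0.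
have kNN : (0 < k <= N)%N by rewrite kpos kN.
have [l [M [lM [K5 [K50 Hpt]]]]] := wronsk_pointwise B (fun i _ => mu0 i) Ca1 Kc0 full kNN NQ HsumQ.
(* The degree missing in [W^M] is written [p + 1]: its being at least 1 leaves room for the variable
   factor [y t]. *)
have [p pE] : exists p, (\sum_(i in Q) l i)%N = (M * k.+1 + p.+1)%N.
  exists (\sum_(i in Q) l i - M * k.+1).-1; move: lM.
  by move: (\sum_(i in Q) l i)%N (M * k.+1)%N => s t; clear; lia.
pose W c z := wronsk k.+1 (y c) z.
pose A t c z : CC := W c z ^+ M * (y c 0%N z ^+ p * y c t z).
pose Bf c z : CC := \prod_(i in Q) form c i z ^+ l i.
pose Cy : R := \sum_j \sum_(s < k.+1) 2 * cmod (P j s).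
have Cy0 : 0 <= Cy by do 2 (apply: sumr_ge0 => ? _); rewrite mulr_ge0 ?cmod_ge0.
have ybd c (s : 'I_k.+1) z : (Cmod (Cminus z c) < / 4)%coqR -> cmod (y c s z) <= Cy.
  move=> Hz; apply: le_trans (cmod_sum _ _ _) _; apply: ler_sum => j _.
  rewrite cmodM inord_val; apply: (@le_trans _ _ (2 * cmod (P j s))).
    by rewrite ler_wpM2r ?cmod_ge0 // Fbd.
  rewrite [leRHS](bigD1 s) //= lerDl; apply: sumr_ge0 => ? _; by rewrite mulr_ge0 ?cmod_ge0.
have hW c : hol c (/ 4)%coqR (W c) by apply: hol_wronsk => s _; apply: hy.
have hA t c : hol c (/ 4)%coqR (A t c).
  by apply: hol_mul; [apply: hol_exp|apply: hol_mul; [apply: hol_exp|]].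
have hB c : hol c (/ 4)%coqR (Bf c) by apply: hol_prod => i _; apply: hol_exp.
(* A form of [Q] vanishing on a disc would be a linear relation between the independent coordinates,
   forcing its row of [At] to be 0. *)
have NBf (e : 'I_q -> nat) c r : (0 < r)%coqR -> ~ (forall z, (Cmod (Cminus z c) < r)%coqR -> \prod_(i in Q) form c i z ^+ e i = 0).
  move=> r0 Zr.
  have hBe : hol c (/ 4)%coqR (fun z => \prod_(i in Q) form c i z ^+ e i) by apply: hol_prod => i _; apply: hol_exp.
  have Z := identity_center c (/ 4)%coqR r _ r0 hBe Zr.
  have [||i] := prod_eq0_disc (s := enum Q) (c := c) (f := fun i z => form c i z ^+ e i) quarter_gt0.
  - by move=> i _; apply: hol_exp.
  - by move=> z Hz; rewrite -[RHS](Z z Hz) big_enum.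
  rewrite mem_enum => iQ Zi.
  have Zf := exp_eq0_disc quarter_gt0 (hform c i) Zi.
  have Z0 z : (Cmod (Cminus z (RtoC 0)) < / 4)%coqR -> Fv (RtoC 0) z *m (\col_j a i j) = 0.
    apply: (relation_propagates (c0 := c)) => w Hw.
    apply/rowP => j; rewrite !ord1 !mxE -[RHS](Zf w Hw); apply: eq_bigr => j' _; by rewrite !mxE mulrC.
  have : row i At = 0.
    apply: ind => z Hz; have := f_equal (fun v : 'rV_1 => v 0 0) (Z0 z Hz); rewrite [X in _ = X -> _]mxE => E.
    rewrite -[RHS]E.
    have -> : (Fv (RtoC 0) z *m (\col_j a i j)) 0 0 = form (RtoC 0) i z.
      by rewrite mxE; apply: eq_bigr => j' _; rewrite !mxE mulrC.
    by rewrite formE //; apply: eq_bigr => s _; rewrite mxE.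
  by move: iQ; rewrite inE => /eqP.
(* Both functions are homogeneous of degree [M (k + 1) + p + 1] in the representation, so the same
   power of the transition function appears in each. *)
have tr t c c' z : (Cmod (Cminus z c) < / 4)%coqR -> (Cmod (Cminus z c') < / 4)%coqR ->
    exists h : CC, [/\ h != 0, A t c z = h * A t c' z & Bf c z = h * Bf c' z].
  move=> Hc Hc'; pose h := F c (J c') z; exists (h ^+ (M * k.+1 + p.+1)).
  have h0 : h != 0 by apply: transition_neq0.
  split; first by rewrite expf_neq0.
    pose r := Rmin (/ 4 - Cmod (Cminus z c)) (/ 4 - Cmod (Cminus z c')).
    have r0 : (0 < r)%coqR by apply: Rmin_pos; Lra.lra.
    have r1 : (r <= / 4 - Cmod (Cminus z c))%coqR by apply: Rmin_l.
    have r2 : (r <= / 4 - Cmod (Cminus z c'))%coqR by apply: Rmin_r.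
    have d1 w : (Cmod (Cminus w z) < r)%coqR -> (Cmod (Cminus w c) < / 4)%coqR.
      by move=> Hw; have := Cmod_sub_tri w z c; Lra.lra.
    have d2 w : (Cmod (Cminus w z) < r)%coqR -> (Cmod (Cminus w c') < / 4)%coqR.
      by move=> Hw; have := Cmod_sub_tri w z c'; Lra.lra.
    have -> : A t c z = (h ^+ k.+1 * W c' z) ^+ M * ((h * y c' 0%N z) ^+ p * (h * y c' t z)).
      rewrite /A /h -!(ytr c c') //; congr (_ ^+ _ * _); apply: (wronsk_scale (c := z) (r := r) (h := F c (J c'))).
      - exact: (hol_sub _ _ _ _ _ (@Fhol c (J c')) d1).
      - by move=> i _; apply: (hol_sub _ _ _ _ _ (hy c' i) d2).
      - by move=> i w _ Hw; apply: ytr; [apply: d1|apply: d2].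
      - exact: center_in.
    have e1 : (h ^+ k.+1) ^+ M = h ^+ (M * k.+1) by rewrite -exprM mulnC.
    rewrite /A !exprMn e1 exprD exprS.
    exact: mulr_shuffle.
  rewrite /Bf; under eq_bigr => i iQ do rewrite (ftr c c' z i Hc Hc') exprMn.
  by rewrite big_split /= prodrXr pE.
(* The pointwise bound asks for all forms of [Q] to be nonzero at the point; their product serves as
   the exceptional function. *)
have bdA t c z : (t <= 1)%N -> (Cmod (Cminus z c) < / 8)%coqR ->
    (Cmod (A t c z) <= (K5 * (Cy ^+ p * Cy))%R * Cmod (Bf c z))%coqR.
  move=> t1; have sub8 f : hol c (/ 4)%coqR f -> hol c (/ 8)%coqR f.
    by move=> Hf; apply: (hol_sub _ _ _ _ _ Hf) => w; Lra.lra.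
  apply: (bound_off_zeros (Z := fun z => \prod_(i in Q) form c i z ^+ 1)).
  - exact: sub8.
  - exact: sub8.
  - by apply: sub8; apply: hol_prod => i _; apply: hol_exp.
  - by apply: (NBf (fun=> 1%N)); Lra.lra.
  move=> {}z Hz8 nB; apply/RleP; rewrite -[Cmod (A t c z)]/(cmod (A t c z)) -[Cmod (Bf c z)]/(cmod (Bf c z)).
  have Hz : (Cmod (Cminus z c) < / 4)%coqR by Lra.lra.
  have hWp : cmod (W c z) ^+ M <= K5 * \prod_(i in Q) cmod (form c i z) ^+ l i.
    apply: (Hpt c (/ 4)%coqR (y c) (form c) z (J c)) => //.
    - by move=> i w Hw; apply: formE.
    - by rewrite yB // Fone.
    - move=> i iQ; split; last exact: formbd.
      by apply/eqP => Z; apply: nB; rewrite (bigD1 i) //= Z expr1 mul0r.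
    - move=> i l' iQ l'k; apply: est => //; apply: leq_trans l'k _; exact: leq_trans kN Nn.
  rewrite /A /Bf !cmodM !cmodX cmod_prod
    -[leRHS]/((K5 * (Cy ^+ p * Cy)) * \prod_(i in Q) cmod (form c i z ^+ l i)) [leRHS]mulrAC.
  under [\prod_(i in Q) cmod _]eq_bigr => i _ do rewrite cmodX.
  have y0 : cmod (y c 0%N z) <= Cy by apply: (ybd c ord0).
  have yt : cmod (y c t z) <= Cy.
    by apply: (ybd c (Ordinal (_ : t < k.+1)%N)) => //; apply: leq_ltn_trans t1 _; rewrite ltnS.
  apply: ler_pM; rewrite ?exprn_ge0 ?cmod_ge0 //.
    by rewrite mulr_ge0 ?exprn_ge0 ?cmod_ge0.
  apply: ler_pM; rewrite ?exprn_ge0 ?cmod_ge0 //.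
  by apply: lerXn2r; rewrite ?nnegrE ?cmod_ge0.
have fin t : (t <= 1)%N -> exists kap : CC, forall z, (Cmod (Cminus z (RtoC 0)) < / 4)%coqR ->
    A t (RtoC 0) z = kap * Bf (RtoC 0) z.
  move=> t1.
  have [|||||kap [d [Hd Hk]]] := glue_liouville (A := A t) (Bf := Bf) (K := (K5 * (Cy ^+ p * Cy))%R).
  - exact: hA.
  - exact: hB.
  - by move=> c; apply: NBf; Lra.lra.
  - by move=> c z Hz _; apply: bdA.
  - by move=> c c' z; apply: tr.
  exists kap => z Hz; apply/eqP; rewrite -subr_eq0; apply/eqP.
  apply: (identity_center (RtoC 0) (/ 4)%coqR d (fun z => A t (RtoC 0) z - kap * Bf (RtoC 0) z : CC)) Hz.
  - by case: Hd.
  - by apply: hol_minus => //; apply: hol_mul => //; apply: hol_cst.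
  - by move=> w Hw; rewrite Hk // subrr.
have [k0 Hk0] := fin 0%N isT; have [k1 Hk1] := fin 1%N isT.
have NW : ~ (forall z, (Cmod (Cminus z (RtoC 0)) < / 4)%coqR -> W (RtoC 0) z = 0).
  move=> Z; have [p' [p'0 Hp']] := wronsk_nonzero quarter_gt0 (fun s _ => hy (RtoC 0) s) Z.
  by move: p'0; rewrite (ind p' Hp') eqxx.
have Ny0 : ~ (forall z, (Cmod (Cminus z (RtoC 0)) < / 4)%coqR -> y (RtoC 0) 0%N z = 0).
  move=> Z; have : (delta_mx 0 ord0 : 'rV[CC]_k.+1) = 0.
    apply: ind => z Hz; rewrite (bigD1 ord0) //= big1 ?addr0; last first.
      by move=> s /negbTE s0; rewrite mxE s0 andbF mul0r.
    by rewrite Z // mulr0.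
  by move=> /rowP /(_ ord0) /eqP; rewrite !mxE !eqxx oner_eq0.
have cancel (u : Complex.C -> CC) : hol (RtoC 0) (/ 4)%coqR u ->
   (forall z, (Cmod (Cminus z (RtoC 0)) < / 4)%coqR -> W (RtoC 0) z ^+ M * (y (RtoC 0) 0%N z ^+ p * u z) = 0) ->
   forall z, (Cmod (Cminus z (RtoC 0)) < / 4)%coqR -> u z = 0.
  move=> hu Z.
  have h1 : hol (RtoC 0) (/ 4)%coqR (fun z => W (RtoC 0) z ^+ M) by apply: hol_exp.
  have h2 : hol (RtoC 0) (/ 4)%coqR (fun z => y (RtoC 0) 0%N z ^+ p) by apply: hol_exp.
  case: (mult_eq0 _ _ _ _ quarter_gt0 h1 (hol_mul h2 hu) Z) => [Z1|Z1].
    by case: NW; apply: exp_eq0_disc Z1; first exact: quarter_gt0.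
  case: (mult_eq0 _ _ _ _ quarter_gt0 h2 hu Z1) => [Z2|//].
  by case: Ny0; apply: exp_eq0_disc Z2; first exact: quarter_gt0.
(* The functions for [t = 0] and [t = 1] are multiples of the same product. Cancelling [W^M y_0^p]
   gives [k0 y_1 = k1 y_0], and independence of the coordinates gives [k0 = 0]; this makes
   [W^M y_0^(p + 1)] vanish, which is excluded. *)
have k00 : k0 = 0.
  have o1 : (1 < k.+1)%N by rewrite ltnS.
  have : (k0 *: delta_mx 0 (Ordinal o1) - k1 *: delta_mx 0 ord0 : 'rV[CC]_k.+1) = 0.
    apply: ind; apply: (cancel (fun z => \sum_(s < k.+1) _ 0 s * y (RtoC 0) s z)).
      by apply: hol_sum => s _; apply: hol_mul; [apply: hol_cst|].
    move=> z Hz.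
    have -> : \sum_(s < k.+1) (k0 *: delta_mx 0 (Ordinal o1) - k1 *: delta_mx 0 ord0 : 'rV[CC]_k.+1) 0 s * y (RtoC 0) s z =
       k0 * y (RtoC 0) 1%N z - k1 * y (RtoC 0) 0%N z.
      under eq_bigr => s _ do rewrite !mxE mulrBl -!mulrA.
      rewrite sumrB -!mulr_sumr (bigD1 (Ordinal o1)) //= big1 ?addr0; last first.
        by move=> s /negbTE s0; rewrite s0 ?andbF mul0r.
      rewrite (bigD1 ord0) //= big1 ?addr0; last by move=> s /negbTE s0; rewrite s0 ?andbF mul0r.
      by rewrite ?eqxx !mul1r.
    have e0 := Hk0 z Hz; have e1 := Hk1 z Hz; rewrite /A in e0 e1.
    rewrite !mulrBr.
    have -> : W (RtoC 0) z ^+ M * (y (RtoC 0) 0%N z ^+ p * (k0 * y (RtoC 0) 1%N z)) = k0 * (W (RtoC 0) z ^+ M * (y (RtoC 0) 0%N z ^+ p * y (RtoC 0) 1%N z)).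
      by rewrite !(mulrCA _ k0).
    have -> : W (RtoC 0) z ^+ M * (y (RtoC 0) 0%N z ^+ p * (k1 * y (RtoC 0) 0%N z)) = k1 * (W (RtoC 0) z ^+ M * (y (RtoC 0) 0%N z ^+ p * y (RtoC 0) 0%N z)).
      by rewrite !(mulrCA _ k1).
    by rewrite e0 e1 mulrCA subrr.
  move=> /rowP /(_ (Ordinal o1)); rewrite !mxE !eqxx /= mulr1 mulr0 subr0 //.
apply: Ny0; apply: cancel => // z Hz; rewrite -[LHS]/(A 0%N (RtoC 0) z) Hk0 // k00 mul0r //.
Qed.
End LimitCurve.

(** * Normality of orbifold discs *)

Lemma fin_min (I : finType) (d : I -> R) : (forall i, (0 < d i)%coqR) ->
  exists e, (0 < e)%coqR /\ forall i, (e <= d i)%coqR.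
Proof.
move=> d0; have [e [e0 He]] : exists e, (0 < e)%coqR /\ forall i, i \in enum I -> (e <= d i)%coqR.
  elim: (enum I) => [|i s [e [e0 IH]]]; first by exists 1%coqR; split; first Lra.lra.
  exists (Rmin e (d i)); split; first exact: Rmin_pos.
  move=> k; rewrite inE => /orP [/eqP ->|/IH L]; first exact: Rmin_r.
  by apply: Rle_trans L; apply: Rmin_l.
by exists e; split=> // i; apply: He; rewrite mem_enum.
Qed.

Lemma ultra_fin U (I : finType) (P : I -> nat -> Prop) : ultra U ->
  U (fun k => exists i, P i k) -> exists i, U (P i).
Proof.
move=> HU H; apply: NNPP => N.
have NU i : U (fun k => ~ P i k) by case: (ultra_or _ HU (P i)) => // Ui; case: N; exists i.
have A : U (fun k => forall i, i \in enum I -> ~ P i k).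
  elim: (enum I) => [|i s IH]; first by apply: (ultra_all _ HU).
  apply: (ultra_mono _ HU _ _ _ (ultra_and _ HU _ _ (NU i) IH)) => k [h1 h2] j.
  by rewrite inE => /orP [/eqP ->|/h2].
apply: (ultra_false _ HU); apply: (ultra_mono _ HU _ _ _ (ultra_and _ HU _ _ H A)) => k [[i Pi] /(_ i)].
by rewrite mem_enum; apply.
Qed.

Lemma is_ulim_sum U (I : finType) (k : I -> CC) (x : I -> nat -> CC) (l : I -> CC) : ultra U ->
  (forall i, is_ulim U (x i) (l i)) ->
  is_ulim U (fun v => \sum_i k i * x i v) (\sum_i k i * l i).
Proof.
move=> HU H; elim: (index_enum I) => [|i s IH].
  apply: (is_ulim_ext U HU (fun=> RtoC 0)); first by apply: (ultra_all U HU) => v; rewrite big_nil.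
  by rewrite big_nil; apply: is_ulim_const.
apply: (is_ulim_ext U HU (fun v => Cplus (Cmult (k i) (x i v)) (\sum_(j <- s) k j * x j v))).
  by apply: (ultra_all U HU) => v; rewrite big_cons.
by rewrite big_cons; apply: is_ulim_plus => //; apply: is_ulim_scal.
Qed.

(** * Charts and rescaling of orbifold discs *)

Section Curves.
Variables (n q : nat) (a : 'M[CC]_(q, n.+1)) (mu : 'I_q -> nat).
Implicit Types f : 'I_n.+1 -> Complex.C -> CC.

Definition lin f i z : CC := \sum_j a i j * f j z.

(** The multiplicities are finite here and the radius is a parameter, so that the class is stable
    under rescaling. *)
Record orbc (R0 : R) f : Prop := OrbC {
  orbc_hol : forall j, hol (RtoC 0) R0 (f j);
  orbc_nz : forall z, (Cmod z < R0)%coqR -> exists j, f j z <> 0;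
  orbc_mult : forall i, zeros_mult (mu i) (RtoC 0) R0 (lin f i) }.

(** A quantitative substitute for a bounded derivative: quotients by the component [j0] are bounded
    by 2, and the factor 2 rather than 1 makes every point the centre of some charted disc. *)
Definition chart f c r j0 := forall w j, (Cmod (Cminus w c) < r)%coqR -> (Cmod (f j w) <= 2 * Cmod (f j0 w))%coqR.
Definition charted f c r := exists j0, chart f c r j0.

Lemma chart_neq0 R0 f c r j0 : orbc R0 f -> chart f c r j0 ->
  (forall w, (Cmod (Cminus w c) < r)%coqR -> (Cmod w < R0)%coqR) ->
  forall w, (Cmod (Cminus w c) < r)%coqR -> f j0 w <> 0.
Proof.
move=> Hf Hc sub w Hw Z; have [j] := orbc_nz Hf (sub w Hw); apply.
apply: Cmod_eq_0; have := Hc w j Hw; rewrite Z Cmod_0; have := Cmod_ge_0 (f j w); Lra.lra.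
Qed.

Lemma orbc_rescale R0 f z s : orbc 1%coqR f -> (0 < s)%coqR -> (Cmod z + s * R0 <= 1)%coqR ->
  orbc R0 (fun j w => f j (Cplus z (Cmult (RtoC s) w))).
Proof.
move=> Hf s0 Hs.
have sub w : (Cmod w < R0)%coqR -> (Cmod (Cplus z (Cmult (RtoC s) w)) < 1)%coqR.
  move=> Hw; have := Cmod_triangle z (Cmult (RtoC s) w); rewrite Cmod_mult Cmod_R Rabs_pos_eq; last Lra.lra.
  by have := Rmult_lt_compat_l s _ _ s0 Hw; Lra.lra.
have E w : Cminus w (RtoC 0) = w by rewrite /Cminus Copp_0 Cplus_0_r.
have sub' w : (Cmod w < R0)%coqR -> (Cmod (Cminus (Cplus z (Cmult (RtoC s) w)) (RtoC 0)) < 1)%coqR by rewrite E; apply: sub.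
split.
- by move=> j; apply: (hol_affine _ _ _ _ _ _ (orbc_hol Hf j) sub').
- by move=> w /sub /(orbc_nz Hf).
- move=> i; have sC : RtoC s <> RtoC 0 by move=> /RtoC_inj; Lra.lra.
  have oC : RtoC 1 <> RtoC 0 by move=> /RtoC_inj; Lra.lra.
  have := zeros_mult_affine _ _ _ _ _ _ _ _ (@orbc_mult _ _ Hf i) sC oC sub'.
  by congr zeros_mult; apply: boolp.funext => w; rewrite Cmult_1_l.
Qed.

Lemma charted_exists R0 f z : orbc R0 f -> (Cmod z < R0)%coqR -> exists rho, (0 < rho)%coqR /\ charted f z rho.
Proof.
move=> Hf Hz; have [j1 Hj1] := orbc_nz Hf Hz.
have E : Cminus z (RtoC 0) = z by rewrite /Cminus Copp_0 Cplus_0_r.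
case: (@arg_maxP _ _ _ ord0 xpredT (fun j => cmod (f j z)) isT) => j0 _ H0.
have M0 : (0 < Cmod (f j0 z))%coqR.
  by have /RleP := H0 j1 isT; have := proj1 (Cmod_gt_0 _) Hj1; rewrite /cmod; Lra.lra.
(* A relative error of 1/3 is enough because [(1 + 1/3) / (1 - 1/3) = 2]. *)
have ex j : exists d, (0 < d)%coqR /\ forall w, (Cmod (Cminus w z) < d)%coqR ->
    (Cmod (Cminus (f j w) (f j z)) < Cmod (f j0 z) / 3)%coqR.
  have [|d [d0 Hd]] := hol_cont _ _ _ z (orbc_hol Hf j) _ (Cmod (f j0 z) / 3)%coqR ltac:(Lra.lra).
    by rewrite E.
  by exists d; split.
have [d Hd] := boolp.choice ex.
have [e [e0 He]] := @fin_min _ d (fun j => proj1 (Hd j)).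
exists e; split=> //; exists j0 => w j Hw.
have Hd' k : (Cmod (Cminus (f k w) (f k z)) < Cmod (f j0 z) / 3)%coqR.
  by apply: (proj2 (Hd k)); apply: (Rlt_le_trans _ _ _ Hw).
have := Hd' j; have := Hd' j0; have /RleP := H0 j isT; rewrite /cmod.
have := Cmod_rev_triangle (f j w) (f j z); have := Cmod_rev_triangle (f j0 z) (f j0 w).
rewrite (Cmod_sub_sym (f j0 z)); Lra.lra.
Qed.

(** [zoom_point] for the property of not being charted, followed by the change of scale by [l]: the
    radii [l / 4] and [2 l] become [1/4] and 2. *)
Lemma zoom R0 f : (1 <= R0)%coqR -> orbc 1%coqR f -> ~ charted f (RtoC 0) (2 * / (8 * R0))%coqR ->
  exists g, orbc (2 * R0)%coqR g /\ (forall c, (Cmod c < R0)%coqR -> charted g c (/ 4)%coqR) /\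
    ~ charted g (RtoC 0) 2%coqR.
Proof.
move=> R1 Hf N; have [||z [l [l0 [Hzl [B1 B2]]]]] := zoom_point (fun z r => ~ charted f z r) R0 R1 _ _ N.
- by move=> z r z' r' H sub [j0 Hj0]; apply: H; exists j0 => w j /sub; apply: Hj0.
- by move=> z Hz; have [rho [r0 Hr]] := charted_exists Hf Hz; exists rho; split=> // H; apply: H.
have lC : RtoC l <> RtoC 0 by move=> /RtoC_inj; Lra.lra.
have tr c r : charted f (Cplus z (Cmult (RtoC l) c)) (l * r)%coqR <->
    charted (fun j w => f j (Cplus z (Cmult (RtoC l) w))) c r.
  have dist w : Cmod (Cminus (Cplus z (Cmult (RtoC l) w)) (Cplus z (Cmult (RtoC l) c))) = (l * Cmod (Cminus w c))%coqR.
    have -> : Cminus (Cplus z (Cmult (RtoC l) w)) (Cplus z (Cmult (RtoC l) c)) = Cmult (RtoC l) (Cminus w c) by ring.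
    by rewrite Cmod_mult Cmod_R Rabs_pos_eq //; Lra.lra.
  split=> [] [j0 Hj0]; exists j0 => w j Hw.
    by apply: Hj0; rewrite dist; apply: Rmult_lt_compat_l.
  have E : w = Cplus z (Cmult (RtoC l) (Cmult (Cinv (RtoC l)) (Cminus w z))) by field.
  rewrite E; apply: Hj0; apply: (Rmult_lt_reg_l l) => //; by rewrite -dist -E.
exists (fun j w => f j (Cplus z (Cmult (RtoC l) w))); split.
  by apply: orbc_rescale => //; Lra.lra.
split.
  move=> c Hc; apply/tr; apply: NNPP => NB; apply: (B2 _ _ NB).
  have -> : Cminus (Cplus z (Cmult (RtoC l) c)) z = Cmult (RtoC l) c by ring.
  by rewrite Cmod_mult Cmod_R Rabs_pos_eq ?(Rmult_comm R0); [apply: Rmult_lt_compat_l|Lra.lra].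
move=> /tr; have -> : Cplus z (Cmult (RtoC l) (RtoC 0)) = z by ring.
by rewrite Rmult_comm.
Qed.
End Curves.

(** * A uniform radius for charts *)

Section Radius.
Variables (n q : nat) (a : 'M[CC]_(q, n.+1)) (mu : 'I_q -> nat).
Hypothesis nq : (2 * n < q)%N.
Hypothesis GP : forall R : {set 'I_q}, (n < #|R|)%N -> rowrk a R = n.+1.
Hypothesis mu0 : forall i, (0 < mu i)%N.
Hypothesis Hsum : n%:R * (\sum_i ((mu i)%:R : R)^-1) < q%:R - n%:R - 1.

Section Seq.
Variables (U : (nat -> Prop) -> Prop) (f : nat -> 'I_n.+1 -> Complex.C -> CC).
Hypothesis HU : ultra U.
Hypothesis Hf : forall v, orbc a mu (2 * INR (S v))%coqR (f v).
Hypothesis Hch : forall v c, (Cmod c < INR (S v))%coqR -> charted (f v) c (/ 4)%coqR.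

(** The dominating component may vary with the disc; as there are finitely many, the ultrafilter
    selects one that serves almost all discs. *)
Lemma limit_chart c : exists j, U (fun v => (Cmod c < INR (S v))%coqR /\ chart (f v) c (/ 4)%coqR j).
Proof.
apply: (ultra_fin HU); have [N HN] := INR_unbounded (Cmod c).
apply: (ultra_mono _ HU _ _ _ (ultra_tail _ HU N)) => v Nv.
have Hv : (Cmod c < INR (S v))%coqR.
  by apply: (Rlt_le_trans _ _ _ HN); apply: le_INR; lia.
by have [j Hj] := Hch Hv; exists j.
Qed.

Definition chart_index c : 'I_n.+1 := sval (cid (limit_chart c)).
Definition quot c j v z : CC := f v j z * (f v (chart_index c) z)^-1.

Definition good c v := [/\ forall w, (Cmod (Cminus w c) < / 4)%coqR -> (Cmod w < 2 * INR (S v))%coqR,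
  chart (f v) c (/ 4)%coqR (chart_index c) & forall w, (Cmod (Cminus w c) < / 4)%coqR -> f v (chart_index c) w <> 0].

Lemma good_ae c : U (good c).
Proof.
have := svalP (cid (limit_chart c)); rewrite -/(chart_index c).
apply: (ultra_mono _ HU) => v [Hc Hj].
have sub w : (Cmod (Cminus w c) < / 4)%coqR -> (Cmod w < 2 * INR (S v))%coqR.
  have := Cmod_rev_triangle w c; have := pos_INR v; rewrite S_INR; rewrite S_INR in Hc; Lra.lra.
split=> //; apply: (chart_neq0 (Hf v) Hj sub).
Qed.

Lemma quot_hol c j v : good c v -> hol c (/ 4)%coqR (quot c j v).
Proof.
move=> [h1 h2 h3].
have sub : forall w, (Cmod (Cminus w c) < / 4)%coqR -> (Cmod (Cminus w (RtoC 0)) < 2 * INR (S v))%coqR.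
  by move=> w; rewrite /Cminus Copp_0 Cplus_0_r; apply: h1.
apply: hol_mul; first exact: (hol_sub _ _ _ _ _ (@orbc_hol _ _ _ _ _ _ (Hf v) j) sub).
apply: hol_inv => //; exact: (hol_sub _ _ _ _ _ (@orbc_hol _ _ _ _ _ _ (Hf v) (chart_index c)) sub).
Qed.

Lemma quot_bd c j v z : good c v -> (Cmod (Cminus z c) < / 4)%coqR -> (Cmod (quot c j v z) <= 2)%coqR.
Proof.
move=> [h1 h2 h3] Hz; have N := h3 _ Hz; have P := proj1 (Cmod_gt_0 _) N.
have -> : (2 = 2 * Cmod (f v (chart_index c) z) * / Cmod (f v (chart_index c) z))%coqR by field; Lra.lra.
rewrite Cmod_mult Cmod_inv //; apply: Rmult_le_compat_r; first exact/Rlt_le/Rinv_0_lt_compat.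
exact: h2.
Qed.

Lemma quot_hol_ae c j : U (fun v => hol c (/ 4)%coqR (quot c j v)).
Proof. by apply: (ultra_mono _ HU _ _ _ (good_ae c)) => v; apply: quot_hol. Qed.
Lemma quot_bd_ae c j : U (fun v => forall z, (Cmod (Cminus z c) < / 4)%coqR -> (Cmod (quot c j v z) <= 2)%coqR).
Proof. by apply: (ultra_mono _ HU _ _ _ (good_ae c)) => v H z; apply: quot_bd. Qed.

Definition limit_rep c j : Complex.C -> CC := flim U (quot c j).

Lemma limit_rep_lim c j z : (Cmod (Cminus z c) < / 4)%coqR -> is_ulim U (fun v => quot c j v z) (limit_rep c j z).
Proof. by move=> Hz; apply: (flim_Dn U HU 0 _ _ _ _ _ (quot_hol_ae c j) (quot_bd_ae c j) Hz). Qed.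

Lemma limit_rep_one c z : (Cmod (Cminus z c) < / 4)%coqR -> limit_rep c (chart_index c) z = 1.
Proof.
move=> Hz; apply: (is_ulim_unique U HU _ _ _ (limit_rep_lim (chart_index c) Hz)).
apply: (is_ulim_ext U HU _ _ _ _ (is_ulim_const U HU (RtoC 1))).
apply: (ultra_mono _ HU _ _ _ (good_ae c)) => v [_ _ /(_ z Hz) N].
by rewrite /quot mulfV //; apply/eqP.
Qed.

Lemma limit_rep_comp c c' z j : (Cmod (Cminus z c) < / 4)%coqR -> (Cmod (Cminus z c') < / 4)%coqR ->
  limit_rep c j z = limit_rep c (chart_index c') z * limit_rep c' j z.
Proof.
move=> Hz Hz'; apply: (is_ulim_unique U HU _ _ _ (limit_rep_lim j Hz)).
apply: (is_ulim_ext U HU _ _ _ _ (is_ulim_mult U HU _ _ _ _ (limit_rep_lim (chart_index c') Hz) (limit_rep_lim j Hz'))).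
apply: (ultra_mono _ HU _ _ _ (good_ae c')) => v [_ _ /(_ z Hz') N].
by rewrite -CC_mulE /quot mulrC mulrA divfK //; apply/eqP.
Qed.

Definition form_bound : R := (1 + 2 * \sum_i \sum_j cmod (a i j))%R.
Lemma form_bound_gt0 : 0 < form_bound.
Proof.
rewrite /form_bound ltr_wpDr ?ltr01 // mulr_ge0 //.
by apply: sumr_ge0 => i _; apply: sumr_ge0 => j _; apply: cmod_ge0.
Qed.

Definition quot_form c i v z : CC := \sum_j a i j * quot c j v z.

Lemma quot_form_bd c i v z : good c v -> (Cmod (Cminus z c) < / 4)%coqR -> (Cmod (quot_form c i v z) <= form_bound)%coqR.
Proof.
move=> Hg Hz; apply/RleP; rewrite -/(cmod (quot_form c i v z)).
apply: (le_trans (cmod_sum _ _ _)).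
apply: (@le_trans _ _ (\sum_j 2 * cmod (a i j))).
  apply: ler_sum => j _; rewrite cmodM mulrC ler_wpM2r ?cmod_ge0 //.
  by apply/RleP; apply: quot_bd.
rewrite -mulr_sumr /form_bound (bigD1 i) //= mulrDr addrCA lerDl addr_ge0 ?ler01 // mulr_ge0 //.
by apply: sumr_ge0 => k _; apply: sumr_ge0 => j _; apply: cmod_ge0.
Qed.

Lemma quot_form_hol c i v : good c v -> hol c (/ 4)%coqR (quot_form c i v).
Proof.
move=> Hg; apply: hol_sum => j _; apply: hol_mul; [exact: hol_cst|exact: quot_hol].
Qed.

Lemma quot_form_zeros c i v : good c v -> zeros_mult (mu i) c (/ 4)%coqR (quot_form c i v).
Proof.
move=> [h1 h2 h3].
have sub : forall w, (Cmod (Cminus w c) < / 4)%coqR -> (Cmod (Cminus w (RtoC 0)) < 2 * INR (S v))%coqR.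
  by move=> w; rewrite /Cminus Copp_0 Cplus_0_r; apply: h1.
have -> : quot_form c i v = (fun z => Cmult (lin a (f v) i z) (Cinv (f v (chart_index c) z))).
  apply: boolp.funext => z; rewrite /quot_form /lin -[RHS]/((_ : CC) * (f v (chart_index c) z)^-1) mulr_suml.
  by apply: eq_bigr => j _; rewrite /quot mulrA.
apply: zeros_mult_div => //.
  exact: (zeros_mult_sub _ _ _ _ _ _ (@orbc_mult _ _ _ _ _ _ (Hf v) i) sub).
exact: (hol_sub _ _ _ _ _ (@orbc_hol _ _ _ _ _ _ (Hf v) (chart_index c)) sub).
Qed.

(** [deriv_bound] is applied to the forms before the limit, with a constant independent of the index
    and of the centre; summing over the finitely many pairs [(i, l)] leaves a single constant. *)
Lemma limit_rep_est : exists2 Kc : R, 0 <= Kc & forall c i l z, (l <= n)%N -> (Cmod (Cminus z c) < / 8)%coqR ->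
  cmod (Dn l (form a limit_rep c i) z) ^+ mu i <= Kc * cmod (form a limit_rep c i z) ^+ (mu i - l).
Proof.
have ex (p : 'I_q * 'I_n.+1) : exists K, (0 <= K)%coqR /\ forall z g,
  hol z (/ 8)%coqR g -> (forall w, (Cmod (Cminus w z) < / 8)%coqR -> (Cmod (g w) <= form_bound)%coqR) ->
  zeros_mult (mu p.1) z (/ 8)%coqR g ->
  (Cmod (Dn p.2 g z) ^ mu p.1 <= K * Cmod (g z) ^ (mu p.1 - p.2))%coqR.
  apply: deriv_bound; [exact/ssrnat.leP|Lra.lra|exact/RltP/form_bound_gt0].
have [K HK] := boolp.choice ex.
exists (\sum_p K p).
  by apply: sumr_ge0 => p _; apply/RleP; case: (HK p).
move=> c i l z ln Hz8.
have Hz : (Cmod (Cminus z c) < / 4)%coqR by Lra.lra.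
pose G := quot_form c i.
have hG : U (fun v => hol c (/ 4)%coqR (G v)).
  by apply: (ultra_mono _ HU _ _ _ (good_ae c)) => v; apply: quot_form_hol.
have bG : U (fun v => forall w, (Cmod (Cminus w c) < / 4)%coqR -> (Cmod (G v w) <= form_bound)%coqR).
  by apply: (ultra_mono _ HU _ _ _ (good_ae c)) => v Hg w; apply: quot_form_bd.
have E w : (Cmod (Cminus w c) < / 4)%coqR -> flim U G w = form a limit_rep c i w.
  by move=> Hw; apply: (ulim_eq U HU); apply: (is_ulim_sum _ HU) => j; apply: limit_rep_lim.
have LD m : is_ulim U (fun v => Dn m (G v) z) (Dn m (form a limit_rep c i) z).
  have := flim_Dn U HU m _ _ _ _ _ hG bG Hz.
  by rewrite (Dn_ext_hol m _ _ _ _ (flim_hol U HU _ _ _ _ hG bG) E _ Hz).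
have ol : (l < n.+1)%N by rewrite ltnS.
have [K0 HKK] := HK (i, Ordinal ol).
apply: (@le_trans _ _ (K (i, Ordinal ol) * cmod (form a limit_rep c i z) ^+ (mu i - l))); last first.
  apply: ler_wpM2r; first by rewrite exprn_ge0 ?cmod_ge0.
  rewrite (bigD1 (i, Ordinal ol)) //= lerDl; apply: sumr_ge0 => p _; apply/RleP; case: (HK p) => //.
rewrite -!cmodX !CC_expE; apply/RleP.
apply: (is_ulim_le U HU _ _ _ _ _ K0 (is_ulim_pow U HU _ _ (mu i) (LD l)) (is_ulim_pow U HU _ _ (mu i - l)%N (LD 0%N))).
apply: (ultra_mono _ HU _ _ _ (good_ae c)) => v Hg; rewrite !Cmod_pow; apply: HKK => /=.
- by apply: (hol_sub _ _ _ _ _ (quot_form_hol i Hg)) => w Hw; have := Cmod_sub_tri w z c; Lra.lra.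
- by move=> w Hw; apply: (quot_form_bd i Hg); have := Cmod_sub_tri w z c; Lra.lra.
- by apply: (zeros_mult_sub _ _ _ _ _ _ (@quot_form_zeros c i v Hg)) => w Hw; have := Cmod_sub_tri w z c; Lra.lra.
Qed.

Lemma limit_rep_constant : exists p : 'rV[CC]_n.+1, p != 0 /\ forall c z, (Cmod (Cminus z c) < / 4)%coqR ->
  exists lam, forall j, limit_rep c j z = lam * p 0 j.
Proof.
apply: (limit_constant (J := chart_index) nq GP mu0 Hsum) => //; last exact: limit_rep_est.
- by move=> c j; apply: (flim_hol U HU _ _ _ _ (quot_hol_ae c j) (quot_bd_ae c j)).
- move=> c j z Hz; apply/RleP; change (Cmod (limit_rep c j z) <= 2)%coqR; apply: (is_ulim_bound U HU _ _ _ _ (limit_rep_lim j Hz)); first Lra.lra.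
  by apply: (ultra_mono _ HU _ _ _ (quot_bd_ae c j)) => v; apply.
- by move=> c z; apply: limit_rep_one.
- by move=> c c' z j; apply: limit_rep_comp.
Qed.

(** The limit is a constant point; let [j0] be one of its largest components. If [j0] gave no chart
    on the disc of radius 2, the offending points would converge along the ultrafilter, and in the
    limit some component would be at least twice as large as that of [j0]. [flim_moving] evaluates
    at these points. *)
Lemma some_charted : exists v, charted (f v) (RtoC 0) 2%coqR.
Proof.
apply: NNPP => N; have {}N v : ~ charted (f v) (RtoC 0) 2%coqR by move=> H; apply: N; exists v.
have [p [pN0 Hp]] := limit_rep_constant.
case: (@arg_maxP _ _ _ (ord0 : 'I_n.+1) xpredT (fun j => cmod (p 0 j)) isT) => j0 _ Hj0.
have p0 : (0 < cmod (p 0%R j0))%coqR.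
  apply/RltP; rewrite lt_def cmod_ge0 andbT; apply: contra pN0 => /eqP Z.
  apply/eqP/rowP => j; rewrite mxE; apply/eqP; rewrite -cmod_eq0 eq_le cmod_ge0 andbT; apply: le_trans (Hj0 j isT) _; by rewrite Z.
have ex v : exists s : Complex.C * 'I_n.+1, (Cmod s.1 < 2)%coqR /\
    (2 * Cmod (f v j0 s.1) < Cmod (f v s.2 s.1))%coqR.
  apply: NNPP => N2; apply: (N v); exists j0 => w j; rewrite /Cminus Copp_0 Cplus_0_r => Hw.
  by apply: Rnot_lt_le => L; apply: N2; exists (w, j).
have [s Hs] := boolp.choice ex.
pose zt v := (s v).1.
have limz := ulimP U HU zt 2%coqR (ultra_all U HU _ (fun v => Rlt_le _ _ (proj1 (Hs v)))).
set c := ulim U zt in limz.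
have [j1 Hj1] : exists j1, U (fun v => (s v).2 = j1).
  by apply: (ultra_fin HU); apply: (ultra_all _ HU) => v; exists (s v).2.
have cc : (Cmod (Cminus c c) < / 4)%coqR by rewrite Cmod_subrr; Lra.lra.
have lim j : is_ulim U (fun v => quot c j v (zt v)) (limit_rep c j c).
  by apply: (flim_moving U HU (quot c j) c _ _ zt _ (quot_hol_ae c j) (quot_bd_ae c j) limz); Lra.lra.
have H2 : (Cmod (limit_rep c j0 c) <= / 2 * Cmod (limit_rep c j1 c))%coqR.
  apply: (is_ulim_le U HU _ _ _ _ _ _ (lim j0) (lim j1)); first Lra.lra.
  have := ultra_and _ HU _ _ Hj1 (ultra_and _ HU _ _ (good_ae c) (limz (/ 4)%coqR ltac:(Lra.lra))).
  apply: (ultra_mono _ HU) => v [e1 [[_ _ Hn] Hv]].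
  have Nz := Hn _ Hv.
  rewrite /quot !CC_mulE !Cmod_mult -Rmult_assoc; apply: Rmult_le_compat_r; first exact: Cmod_ge_0.
  by have := proj2 (Hs v); rewrite e1 -/(zt v); Lra.lra.
have [lam Hlam] := Hp c c cc.
have lam0 : (0 < Cmod lam)%coqR.
  apply/Cmod_gt_0 => L0; have := limit_rep_one cc; rewrite Hlam L0 mul0r => /esym/eqP; by rewrite oner_eq0.
move: H2; rewrite !Hlam !CC_mulE !Cmod_mult.
have /RleP := Hj0 j1 isT; rewrite /cmod in p0 * => le1 H2.
have := Rmult_lt_0_compat _ _ lam0 p0; have := Rmult_le_compat_l _ _ _ (Rlt_le _ _ lam0) le1; Lra.lra.
Qed.
End Seq.

(** If no radius works, the radii [2 / (8 R0)] with [R0 = v + 1] fail as well, and [zoom] produces a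
    sequence that [some_charted] excludes. *)
Theorem chart_radius : exists rho, (0 < rho)%coqR /\ forall f, orbc a mu 1%coqR f -> charted f (RtoC 0) rho.
Proof.
apply: NNPP => N.
have ex v : exists f, orbc a mu (2 * INR (S v))%coqR f /\
    (forall c, (Cmod c < INR (S v))%coqR -> charted f c (/ 4)%coqR) /\ ~ charted f (RtoC 0) 2%coqR.
  have R1 : (1 <= INR (S v))%coqR by rewrite S_INR; have := pos_INR v; Lra.lra.
  apply: NNPP => N2; apply: N; exists (2 * / (8 * INR (S v)))%coqR; split.
    by apply: Rmult_lt_0_compat; [Lra.lra|apply: Rinv_0_lt_compat; Lra.lra].
  by move=> f Hf; apply: NNPP => N3; apply: N2; apply: (zoom R1 Hf N3).
have [f Hf] := boolp.choice ex; have [U HU] := ultra_exists.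
have [||v Hv] := @some_charted U f HU; last by case: (Hf v) => _ [_]; apply.
- by move=> v; case: (Hf v).
- by move=> v; case: (Hf v) => _ [].
Qed.
End Radius.
End Curves.

Module Projector.
Import Lra Classical all_boot all_order all_algebra boolp Rstruct zify ring lra Coquelicot.
Import Analysis Matroid Wronskian Curves.
Import Order.TTheory GRing.Theory Num.Theory.
Set Implicit Arguments. Unset Strict Implicit. Unset Printing Implicit Defensive.
Delimit Scope R_scope with coqR.
Local Open Scope ring_scope.

Definition cj (z : CC) : CC := Complex.Cconj z.
Definition toC (r : R) : CC := RtoC r.
Arguments toC r%_R.

Lemma cjM (x y : CC) : cj (x * y) = cj x * cj y. Proof. exact: Cmult_conj. Qed.
Lemma cjB (x y : CC) : cj (x - y) = cj x - cj y. Proof. by rewrite /cj Cplus_conj Copp_conj. Qed.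
Lemma cmod_cj (x : CC) : cmod (cj x) = cmod x. Proof. exact: Cmod_conj. Qed.
Lemma cj_eq0 (x : CC) : (cj x == 0) = (x == 0). Proof. by rewrite -cmod_eq0 cmod_cj cmod_eq0. Qed.
Lemma mulcj (x : CC) : x * cj x = toC (cmod x ^+ 2).
Proof. by rewrite /toC -RpowE Cmod2_conj. Qed.
Lemma toCM (x y : R) : toC (x * y) = toC x * toC y. Proof. exact: RtoC_mult. Qed.
Lemma toCD (x y : R) : toC (x + y) = toC x + toC y. Proof. exact: RtoC_plus. Qed.
Lemma toCN (x : R) : toC (- x) = - toC x. Proof. exact: RtoC_opp. Qed.
Lemma cmod_toC (x : R) : cmod (toC x) = `|x|. Proof. exact: Cmod_R. Qed.
Lemma toC_eq0 (x : R) : (toC x == 0) = (x == 0).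
Proof. by rewrite -cmod_eq0 cmod_toC normr_eq0. Qed.

(** * The distance of projectors *)

Section Proj.
Variable n : nat.
Implicit Types x y u v : 'I_n.+1 -> CC.

Definition nrm2 x : R := \sum_j cmod (x j) ^+ 2.
Definition proj_mx x j l : CC := x j * cj (x l) * toC (nrm2 x)^-1.
Definition delta x y : R := \sum_j \sum_l cmod (proj_mx x j l - proj_mx y j l).

Lemma nrm2_ge x j : cmod (x j) ^+ 2 <= nrm2 x.
Proof. by rewrite /nrm2 (bigD1 j) //= lerDl sumr_ge0 // => i _; rewrite sqr_ge0. Qed.

Lemma nrm2_ge0 x : 0 <= nrm2 x. Proof. exact: le_trans (sqr_ge0 _) (nrm2_ge x ord0). Qed.

Lemma nrm2_gt0 x j : x j != 0 -> 0 < nrm2 x.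
Proof. by move=> N; apply: lt_le_trans (nrm2_ge x j); rewrite exprn_gt0 // cmod_gt0. Qed.

Lemma delta_ge0 x y : 0 <= delta x y.
Proof. by apply: sumr_ge0 => j _; apply: sumr_ge0 => l _; apply: cmod_ge0. Qed.
Lemma delta_xx x : delta x x = 0.
Proof. by apply: big1 => j _; apply: big1 => l _; rewrite subrr cmod0. Qed.
Lemma delta_sym x y : delta x y = delta y x.
Proof. by apply: eq_bigr => j _; apply: eq_bigr => l _; rewrite -cmodN opprB. Qed.
Lemma delta_tri x y z : delta x z <= delta x y + delta y z.
Proof.
rewrite -big_split; apply: ler_sum => j _; rewrite -big_split; apply: ler_sum => l _ /=.
by apply: le_trans (cmodD _ _); rewrite addrA subrK.
Qed.

Lemma proj_mx_scale x y (lam : CC) : lam != 0 -> (forall j, y j = lam * x j) -> forall j l, proj_mx y j l = proj_mx x j l.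
Proof.
move=> l0 E j l; rewrite /proj_mx; have -> : nrm2 y = cmod lam ^+ 2 * nrm2 x.
  by rewrite /nrm2 mulr_sumr; apply: eq_bigr => i _; rewrite E cmodM exprMn.
rewrite !E cjM invfM toCM.
have -> : lam * x j * (cj lam * cj (x l)) * (toC (cmod lam ^+ 2)^-1 * toC (nrm2 x)^-1)
  = (lam * cj lam * toC (cmod lam ^+ 2)^-1) * (x j * cj (x l) * toC (nrm2 x)^-1) by ring.
rewrite mulcj -toCM mulfV ?expf_neq0 ?cmod_eq0 //.
by rewrite -[toC 1]/(1 : CC) mul1r.
Qed.

Lemma delta_scale x x' y (lam : CC) : lam != 0 -> (forall j, x' j = lam * x j) -> delta x' y = delta x y.
Proof. by move=> l0 E; apply: eq_bigr => j _; apply: eq_bigr => l _; rewrite (proj_mx_scale l0 E). Qed.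

(** Equal projectors have equal columns, and the column of index [i] is a nonzero multiple of the
    vector itself. *)
Lemma delta_eq0 x y i : x i != 0 -> delta x y = 0 -> exists2 lam : CC, lam != 0 & forall j, y j = lam * x j.
Proof.
move=> xi /eqP; rewrite psumr_eq0; last by move=> j _; apply: sumr_ge0 => l _; apply: cmod_ge0.
move=> /allP H; have E j l : proj_mx x j l = proj_mx y j l.
  have := H j (mem_index_enum j); rewrite psumr_eq0; last by move=> k _; apply: cmod_ge0.
  by move=> /allP /(_ l (mem_index_enum l)); rewrite cmod_eq0 subr_eq0 => /eqP.
have Nx := nrm2_gt0 xi; have cxi : cj (x i) != 0 by rewrite cj_eq0.
have nx : toC (nrm2 x)^-1 != 0 by rewrite toC_eq0 invr_eq0 gt_eqF.
have Np : proj_mx y i i != 0 by rewrite -E /proj_mx !mulf_neq0.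
have cyi : cj (y i) != 0 by apply/eqP => Z; move: Np; rewrite /proj_mx Z mulr0 mul0r eqxx.
have ny : toC (nrm2 y)^-1 != 0 by apply/eqP => Z; move: Np; rewrite /proj_mx Z mulr0 eqxx.
exists (cj (x i) * toC (nrm2 x)^-1 * (cj (y i) * toC (nrm2 y)^-1)^-1).
  by apply: mulf_neq0; [apply: mulf_neq0|rewrite invr_eq0 mulf_neq0].
move=> j; have := E j i; rewrite /proj_mx => Ej.
apply: (mulIf (mulf_neq0 cyi ny)); rewrite mulrA -Ej; field.
by rewrite cyi ny.
Qed.

Lemma proj_mx_le1 x j l : cmod (proj_mx x j l) <= 1.
Proof.
rewrite !cmodM cmod_cj cmod_toC ger0_norm ?invr_ge0 ?nrm2_ge0 //.
have [->|N0] := eqVneq (nrm2 x) 0; first by rewrite invr0 mulr0 ler01.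
rewrite ler_pdivrMr ?lt_def ?N0 ?nrm2_ge0 // mul1r.
have := nrm2_ge x j; have := nrm2_ge x l; have := sqr_ge0 (cmod (x j) - cmod (x l)); nra.
Qed.

Lemma delta_bound x y : delta x y <= (n.+1%:R * n.+1%:R) * 2.
Proof.
apply: (@le_trans _ _ (\sum_(j < n.+1) \sum_(l < n.+1) (2%:R : R))).
  apply: ler_sum => j _; apply: ler_sum => l _.
  apply: le_trans (cmodD _ _) _; rewrite cmodN.
  by have := proj_mx_le1 x j l; have := proj_mx_le1 y j l; lra.
by rewrite !sumr_const !card_ord -[2%:R *+ _ *+ _]mulr_natr -[2%:R *+ n.+1]mulr_natr le_eqVlt; apply/orP; left; apply/eqP; ring.
Qed.

(** The two terms of [K0] bound the variation of the products [u_j conj(u_l)] and that of the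
    inverse of the squared norm. *)
Lemma delta_lip (b B : R) : 0 < b -> 0 < B -> exists2 K, 0 <= K & forall u v (eta : R), 0 <= eta ->
  (forall j, cmod (u j) <= B) -> (forall j, cmod (v j) <= B) -> b <= nrm2 u -> b <= nrm2 v ->
  (forall j, cmod (u j - v j) <= eta) -> delta u v <= K * eta.
Proof.
move=> b0 B0; pose K0 := B * b^-1 *+ 2 + (B ^+ 2 * (n.+1%:R * (B *+ 2)) * (b^-1 * b^-1)).
have ib : 0 < b^-1 by rewrite invr_gt0.
have K00 : 0 <= K0.
  have := ltW b0; have := ltW B0; have := ltW ib => *.
  by rewrite /K0 addr_ge0 ?mulrn_wge0 ?mulr_ge0 ?exprn_ge0 ?mulrn_wge0 ?ler0n.
exists (n.+1%:R * n.+1%:R * K0); first by rewrite !mulr_ge0 ?ler0n.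
move=> u v eta e0 Hu Hv Nu Nv Huv.
have iu : 0 <= (nrm2 u)^-1 <= b^-1 by rewrite invr_ge0 nrm2_ge0 lef_pV2 ?posrE //; apply: lt_le_trans Nu.
have iv : 0 <= (nrm2 v)^-1 <= b^-1 by rewrite invr_ge0 nrm2_ge0 lef_pV2 ?posrE //; apply: lt_le_trans Nv.
have dN : `|nrm2 v - nrm2 u| <= n.+1%:R * (B *+ 2) * eta.
  rewrite /nrm2 -sumrB; apply: le_trans (ler_norm_sum _ _ _) _.
  rewrite -mulrA mulr_natl -[X in _ <= _ *+ X](card_ord n.+1) -sumr_const; apply: ler_sum => j _.
  rewrite subr_sqr normrM mulrC; apply: ler_pM => //.
    rewrite ger0_norm ?addr_ge0 ?cmod_ge0 // mulr2n; exact: lerD.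
  apply: le_trans (Huv j); rewrite ler_norml; apply/andP; split.
    have := cmodD (v j) (u j - v j); rewrite addrC subrK; lra.
  have := cmodD (u j) (v j - u j); rewrite addrC subrK -[cmod (v j - u j)]cmodN opprB; lra.
have dC j l : cmod (u j * cj (u l) - v j * cj (v l)) <= B *+ 2 * eta.
  have -> : u j * cj (u l) - v j * cj (v l) = (u j - v j) * cj (u l) + v j * cj (u l - v l) by rewrite cjB; ring.
  apply: le_trans (cmodD _ _) _; rewrite !cmodM !cmod_cj mulr2n mulrDl.
  by apply: lerD; [rewrite mulrC|]; apply: ler_pM; rewrite ?cmod_ge0.
have main j l : cmod (proj_mx u j l - proj_mx v j l) <= K0 * eta.
  have Nu0 : nrm2 u != 0 by rewrite gt_eqF //; apply: lt_le_trans Nu.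
  have Nv0 : nrm2 v != 0 by rewrite gt_eqF //; apply: lt_le_trans Nv.
  have E : proj_mx u j l - proj_mx v j l = (u j * cj (u l) - v j * cj (v l)) * toC (nrm2 u)^-1 +
     v j * cj (v l) * toC ((nrm2 v - nrm2 u) * ((nrm2 u)^-1 * (nrm2 v)^-1)).
    have -> : (nrm2 v - nrm2 u) * ((nrm2 u)^-1 * (nrm2 v)^-1) = (nrm2 u)^-1 - (nrm2 v)^-1 by field; rewrite Nu0 Nv0.
    rewrite toCD toCN /proj_mx; ring.
  rewrite E; apply: le_trans (cmodD _ _) _; rewrite !cmodM !cmod_cj !cmod_toC !normrM.
  rewrite !(ger0_norm (andP iu).1) !(ger0_norm (andP iv).1) /K0 mulrDl.
  have m0 j' : 0 <= cmod (v j') by apply: cmod_ge0.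
  case/andP: iu => iu1 iu2; case/andP: iv => iv1 iv2.
  apply: lerD.
    have -> : (B * b^-1) *+ 2 * eta = B *+ 2 * eta * b^-1 by rewrite !mulr2n; ring.
    by apply: ler_pM; rewrite ?cmod_ge0.
  have -> : B ^+ 2 * (n.+1%:R * (B *+ 2)) * (b^-1 * b^-1) * eta = B * B * ((n.+1%:R * (B *+ 2) * eta) * (b^-1 * b^-1)).
    by rewrite !mulr2n; ring.
  apply: ler_pM; rewrite ?mulr_ge0 ?normr_ge0 //; first by apply: ler_pM.
  by apply: ler_pM; rewrite ?mulr_ge0 ?normr_ge0 //; apply: ler_pM.
apply: (@le_trans _ _ (\sum_(j < n.+1) \sum_(l < n.+1) (K0 * eta))).
  by apply: ler_sum => j _; apply: ler_sum => l _.
by rewrite !sumr_const !card_ord -[K0 * eta *+ _ *+ _]mulr_natr -[K0 * eta *+ n.+1]mulr_natr le_eqVlt; apply/orP; left; apply/eqP; ring.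
Qed.
End Proj.
End Projector.

Module Kobayashi.
Import Lra Classical all_boot all_order all_algebra boolp Rstruct zify Coquelicot.
Import Analysis Matroid Wronskian Curves Projector.
Import Order.TTheory GRing.Theory Num.Theory.
Set Implicit Arguments. Unset Strict Implicit. Unset Printing Implicit Defensive.
Delimit Scope R_scope with coqR.
Local Open Scope ring_scope.

(** * Comparison with the Kobayashi pseudo-distance *)

Section Bound.
Variables (n q : nat) (a : 'M[CC]_(q, n.+1)) (mu : 'I_q -> nat).
Hypothesis nq : (2 * n < q)%N.
Hypothesis GP : forall R : {set 'I_q}, (n < #|R|)%N -> rowrk a R = n.+1.
Hypothesis mu0 : forall i, (0 < mu i)%N.
Hypothesis Hsum : n%:R * (\sum_i ((mu i)%:R : R)^-1) < q%:R - n%:R - 1.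

Lemma orbc_mob f z : orbc a mu 1%coqR f -> (Cmod z < 1)%coqR -> orbc a mu 1%coqR (fun j w => f j (mob z w)).
Proof.
move=> Hf Hz; have E w : Cminus w (RtoC 0) = w by rewrite /Cminus Copp_0 Cplus_0_r.
split.
- move=> j; apply: (hol_comp _ _ (RtoC 0) 1%coqR (f j) (mob z) (@orbc_hol _ _ _ _ _ _ Hf j) (mob_hol _ Hz)).
  by move=> w; rewrite !E; apply: mob_lt.
- by move=> w Hw; apply: (orbc_nz Hf); apply: mob_lt.
- by move=> i; apply: (zeros_mult_mob _ _ _ Hz (@orbc_mult _ _ _ _ _ _ Hf i)).
Qed.

Lemma delta_center : exists K, (0 <= K)%coqR /\ forall f, orbc a mu 1%coqR f -> forall w, (Cmod w < 1)%coqR ->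
  (delta (f^~ (RtoC 0)) (f^~ w) <= K * Cmod w)%coqR.
Proof.
have E w : Cminus w (RtoC 0) = w by rewrite /Cminus Copp_0 Cplus_0_r.
have [r1 [r10 Hr1]] := chart_radius nq GP mu0 Hsum.
pose rho := Rmin r1 1; have rho0 : (0 < rho)%coqR by apply: Rmin_pos; Lra.lra.
have rho1 : (rho <= 1)%coqR by apply: Rmin_r.
have rhol : (rho <= r1)%coqR by apply: Rmin_l.
clearbody rho.
have [K0 /RleP K00 HK0] := @delta_lip n 1 2 ltr01 (ltr0n _ 2).
pose Dm := ((n.+1%:R * n.+1%:R) * 2)%R : R.
have Dm0 : (0 <= Dm)%coqR by apply/RleP; rewrite /Dm !mulr_ge0.
have ir : (0 < / rho)%coqR by apply: Rinv_0_lt_compat.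
exists (K0 * (16 * / rho) + Dm * (4 * / rho))%coqR; split.
  by apply: Rplus_le_le_0_compat; apply: Rmult_le_pos => //; Lra.lra.
move=> f Hf w Hw; have w0 := Cmod_ge_0 w.
have t1 : (0 <= K0 * (16 * / rho) * Cmod w)%coqR by apply: Rmult_le_pos => //; apply: Rmult_le_pos => //; Lra.lra.
have t2 : (0 <= Dm * (4 * / rho) * Cmod w)%coqR by apply: Rmult_le_pos => //; apply: Rmult_le_pos; Lra.lra.
(* Away from 0 the trivial bound on [delta] suffices. Near 0 the components are divided by the
   dominating one, which leaves [delta] unchanged and makes [taylor2] and [delta_lip] applicable. *)
case: (Rle_lt_dec (Cmod w) (rho / 4)) => Hw4; last first.
  have /RleP := delta_bound (f^~ (RtoC 0)) (f^~ w); rewrite -/Dm => H.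
  suff : (Dm <= Dm * (4 * / rho) * Cmod w)%coqR by Lra.lra.
  rewrite Rmult_assoc -{1}(Rmult_1_r Dm); apply: Rmult_le_compat_l => //.
  have := Rmult_le_compat_l (4 * / rho)%coqR _ _ ltac:(Lra.lra) (Rlt_le _ _ Hw4).
  have -> : (4 * / rho * (rho / 4) = 1)%coqR by field; Lra.lra.
  by [].
have [j0 Hj0] := Hr1 f Hf.
have ch : chart f (RtoC 0) rho j0.
  by move=> u j Hu; apply: Hj0; apply: (Rlt_le_trans _ _ _ Hu).
have sub u : (Cmod (Cminus u (RtoC 0)) < rho)%coqR -> (Cmod u < 1)%coqR by rewrite E; Lra.lra.
have Nz := chart_neq0 Hf ch sub.
have sub' u : (Cmod (Cminus u (RtoC 0)) < rho)%coqR -> (Cmod (Cminus u (RtoC 0)) < 1)%coqR by move=> /sub; rewrite E.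
pose g j u : CC := f j u * (f j0 u)^-1.
have gh j : hol (RtoC 0) rho (g j).
  apply: hol_mul; first exact: (hol_sub _ _ _ _ _ (@orbc_hol _ _ _ _ _ _ Hf j) sub').
  by apply: hol_inv => //; exact: (hol_sub _ _ _ _ _ (@orbc_hol _ _ _ _ _ _ Hf j0) sub').
have gb j u : (Cmod (Cminus u (RtoC 0)) < rho)%coqR -> (Cmod (g j u) <= 2)%coqR.
  move=> Hu; have N := Nz _ Hu; have P := proj1 (Cmod_gt_0 _) N.
  have -> : (2 = 2 * Cmod (f j0 u) * / Cmod (f j0 u))%coqR by field; Lra.lra.
  by rewrite Cmod_mult Cmod_inv //; apply: Rmult_le_compat_r; [exact/Rlt_le/Rinv_0_lt_compat|exact: ch].
have in0 : (Cmod (Cminus (RtoC 0) (RtoC 0)) < rho)%coqR by rewrite Cmod_subrr.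
have inw : (Cmod (Cminus w (RtoC 0)) < rho)%coqR by rewrite E; Lra.lra.
have tr u : (Cmod (Cminus u (RtoC 0)) < rho)%coqR -> forall j, f j u = f j0 u * g j u.
  by move=> Hu j; rewrite /g mulrCA mulfV ?mulr1 //; apply/eqP/Nz.
have nz u : (Cmod (Cminus u (RtoC 0)) < rho)%coqR -> f j0 u != 0 by move=> Hu; apply/eqP/Nz.
have N1 u : (Cmod (Cminus u (RtoC 0)) < rho)%coqR -> 1 <= nrm2 (g^~ u).
  by move=> Hu; apply: le_trans (nrm2_ge _ j0); rewrite /g mulfV ?nz // cmod1 expr1n.
rewrite (delta_scale _ (nz _ in0) (tr _ in0)) delta_sym (delta_scale _ (nz _ inw) (tr _ inw)) delta_sym.
have B2 u j : (Cmod (Cminus u (RtoC 0)) < rho)%coqR -> cmod (g j u) <= 2.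
  by move=> Hu; apply/RleP; change (Cmod (g j u) <= 2)%coqR; apply: gb.
have L j : (Cmod (Cminus (g j (RtoC 0)) (g j w)) <= 16 * / rho * Cmod w)%coqR.
  have [|h1 /(_ w) h2] := taylor2 _ rho 2 _ rho0 (gh j); first by move=> u; apply: gb.
  rewrite !E in h2; have {}h2 := h2 Hw4.
  rewrite Cmod_sub_sym.
  have -> : Cminus (g j w) (g j (RtoC 0)) = Cplus (Cminus (Cminus (g j w) (g j (RtoC 0))) (Cmult (Analysis.D (g j) (RtoC 0)) w))
     (Cmult (Analysis.D (g j) (RtoC 0)) w) by ring.
  apply: (Rle_trans _ _ _ (Cmod_triangle _ _)); rewrite (Cmod_mult (Analysis.D (g j) (RtoC 0)) w).
  have q1 : (16 * 2 / (rho * rho) * (Cmod w * Cmod w) <= 8 * / rho * Cmod w)%coqR.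
    have -> : (16 * 2 / (rho * rho) * (Cmod w * Cmod w) = 32 * / rho * / rho * Cmod w * Cmod w)%coqR by field; Lra.lra.
    apply: Rmult_le_compat_r => //.
    have -> : (8 * / rho = 32 * / rho * / rho * (rho / 4))%coqR by field; Lra.lra.
    apply: Rmult_le_compat_l => //; apply/Rlt_le; apply: Rmult_lt_0_compat; Lra.lra.
  have := Rmult_le_compat_r _ _ _ w0 h1.
  have -> : (4 * 2 / rho = 8 * / rho)%coqR by field; Lra.lra.
  Lra.lra.
have e0 : 0 <= (16 * / rho * Cmod w)%coqR by apply/RleP; apply: Rmult_le_pos => //; Lra.lra.
have /RleP := HK0 (g^~ (RtoC 0)) (g^~ w) _ e0 (fun j => B2 _ j in0) (fun j => B2 _ j inw) (N1 _ in0) (N1 _ inw) (fun j => introT RleP (L j)).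
rewrite -[(K0 * _)%R]/(Rmult K0 _) => H; Lra.lra.
Qed.

Lemma delta_disc : exists K, (0 < K)%coqR /\ forall f, orbc a mu 1%coqR f -> forall z w, (Cmod z < 1)%coqR -> (Cmod w < 1)%coqR ->
  (delta (f^~ z) (f^~ w) <= K * (Cmod (Cminus z w) / Cmod (Cminus (RtoC 1) (Cmult (Complex.Cconj w) z))))%coqR.
Proof.
have [K [K0 HK]] := delta_center; exists (K + 1)%coqR; split; first Lra.lra.
move=> f Hf z w Hz Hw.
have zo : (Cmod (Complex.Copp z) < 1)%coqR by rewrite Cmod_opp.
have := HK _ (orbc_mob Hf Hz) (mob (Complex.Copp z) w) (mob_lt _ _ zo Hw).
rewrite -(Cmod_mob_opp _ _ Hz Hw) /= mob0 mob_inv // => H.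
by have := Cmod_ge_0 (mob (Complex.Copp z) w); Lra.lra.
Qed.
End Bound.

(** * From the encoding of the statement to matrices *)

Lemma Csum_big k (f : nat -> Cplx) : Csum k f = \sum_(j < k) (f j : CC).
Proof. by elim: k => [|k IH]; rewrite ?big_ord0 // big_ord_recr /= IH. Qed.

Lemma Rsum_big k (f : nat -> R) : Defs.Rsum k f = \sum_(j < k) f j.
Proof. by elim: k => [|k IH]; rewrite ?big_ord0 // big_ord_recr /= IH. Qed.

Definition coef_mx n q (a : nat -> nat -> Cplx) : 'M[CC]_(q, n.+1) := \matrix_(i, j) (a i j : CC).

(** The first [n + 1] entries of an enumeration of [R] are distinct indices, and a vector in the
    left kernel of the corresponding rows is a relation that general position excludes. *)
Lemma general_position_rank n q a : general_position n q a ->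
  forall R : {set 'I_q}, (n < #|R|)%N -> rowrk (coef_mx n q a) R = n.+1.
Proof.
move=> gp R cR; apply/eqP; rewrite eqn_leq rowrk_max /=.
pose s := [seq val i | i in R].
have ss : size s = #|R| by rewrite size_image.
have us : uniq s by rewrite map_inj_uniq ?enum_uniq //; apply: val_inj.
have sq k : (k <= n)%N -> exists2 i : 'I_q, i \in R & val i = nth 0%N s k.
  move=> Hk; have : nth 0%N s k \in s by rewrite mem_nth // ss; lia.
  by move=> /imageP [i iR ->]; exists i.
pose sel (k : 'I_n.+1) : 'I_q := xchoose (let: ex_intro2 i _ e := sq k (ltn_ord k) in ex_intro (fun i => val i == nth 0%N s k) i (introT eqP e)).
have selE k : val (sel k) = nth 0%N s k by apply/eqP; exact: (xchooseP (let: ex_intro2 i _ e := sq k (ltn_ord k) in ex_intro (fun i => val i == nth 0%N s k) i (introT eqP e))).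
have selR k : sel k \in R.
  by have [i iR e] := sq k (ltn_ord k); suff -> : sel k = i by []; apply: val_inj; rewrite selE.
pose B : 'M[CC]_n.+1 := \matrix_(k, j) coef_mx n q a (sel k) j.
have rB : row_free B.
  apply/row_freeP; exists (invmx B); apply: mulmxV; rewrite -row_free_unit -kermx_eq0.
  apply/eqP/row_matrixP => l; rewrite row0; set c := row l (kermx B).
  have cB : c *m B = 0 by rewrite /c -row_mul mulmx_ker row0.
  apply/rowP => k; rewrite [RHS]mxE.
  (* [general_position] takes coefficients indexed by [nat]; those beyond [n] are set to 0. *)
  pose cf (i : nat) : CC := if insub i is Some k then c 0 k else 0.
  have cfE (i : 'I_n.+1) : cf i = c 0 i by rewrite /cf valK.
  rewrite -cfE; apply: (gp (nth 0%N s)).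
  - by move=> i Hi; have [|j _ <-] := sq i; [lia|apply/ssrnat.ltP/ltn_ord].
  - by move=> i j Hi Hj /eqP; rewrite nth_uniq ?ss //; [move=> /eqP|lia|lia].
  - move=> j Hj; have oj : (j < n.+1)%N by lia.
    rewrite Csum_big; have /rowP /(_ (Ordinal oj)) := cB; rewrite !mxE => Q; rewrite -[RHS]Q.
    by apply: eq_bigr => i _; rewrite cfE !mxE /= selE.
  - by have := ltn_ord k; lia.
rewrite -{1}(eqP rB : \rank B = n.+1); apply: mxrankS; apply/row_subP => k.
have -> : row k B = row (sel k) (coef_mx n q a) by apply/rowP => j; rewrite !mxE.
exact: row_in_span.
Qed.

(* An infinite multiplicity may be replaced by any finite one, here a large [M]. *)
Definition finite_mult (m : Defs.mult) M (i : nat) : nat := if m i is Some k then k else M.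

(** The inequality on the degree is strict, and its gap [g] absorbs the error, at most [n q / M], of
    giving the multiplicity [M] to the infinite ones. *)
Lemma degree_bound n q (m : Defs.mult) : (1 <= n)%coq_nat ->
  (degDelta q m > INR q - INR q / INR n + 1 + 1 / INR n)%coqR ->
  exists M, (0 < M)%N /\ n%:R * (\sum_(i < q) ((finite_mult m M i)%:R : R)^-1) < (q%:R - n%:R - 1 : R).
Proof.
move=> n1 Hd; have n0 : (1 <= INR n)%coqR by apply: (le_INR 1).
set S := Defs.Rsum q (fun i => inv_mult (m i)).
have dE k : (Defs.Rsum k (fun i => 1 - inv_mult (m i)) = INR k - Defs.Rsum k (fun i => inv_mult (m i)))%coqR.
  by elim: k => [|k IH]; rewrite ?S_INR /= ?IH; [Lra.lra|case: k {IH} => *; Lra.lra].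
have HS : (INR n * S < INR q - INR n - 1)%coqR.
  have : (S < INR q / INR n - 1 - 1 / INR n)%coqR by move: Hd; rewrite /degDelta dE -/S; Lra.lra.
  move=> /(Rmult_lt_compat_l (INR n) _ _ ltac:(Lra.lra)).
  have -> : (INR n * (INR q / INR n - 1 - 1 / INR n) = INR q - INR n - 1)%coqR by field; Lra.lra.
  by [].
set g := (INR q - INR n - 1 - INR n * S)%coqR; have g0 : (0 < g)%coqR by rewrite /g; Lra.lra.
have [M HM] := INR_unbounded (INR n * INR q / g)%coqR.
have nq0 : (0 <= INR n * INR q / g)%coqR.
  by apply: Rmult_le_pos; [apply: Rmult_le_pos; apply: pos_INR|apply/Rlt_le/Rinv_0_lt_compat].
have M0 : (0 < INR M)%coqR by Lra.lra.
have HMg : (INR n * (INR q * / INR M) < g)%coqR.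
  have := Rmult_lt_compat_r (g * / INR M)%coqR _ _ (Rmult_lt_0_compat _ _ g0 (Rinv_0_lt_compat _ M0)) HM.
  have -> : (INR n * INR q / g * (g * / INR M) = INR n * (INR q * / INR M))%coqR by field; Lra.lra.
  have -> : (INR M * (g * / INR M) = g)%coqR by field; Lra.lra.
  by [].
exists M; split; first by apply/ssrnat.ltP; apply: INR_lt.
have le : (\sum_(i < q) ((finite_mult m M i)%:R : R)^-1) <= S + q%:R * (M%:R)^-1.
  rewrite /S Rsum_big -[q in q%:R](card_ord q) mulr_natl -sumr_const -big_split; apply: ler_sum => i _ /=.
  rewrite /finite_mult /inv_mult; case: (m i) => [k|]; last by rewrite add0r.
  by rewrite -[in leRHS]RinvE INRE lerDl invr_ge0 ler0n.
apply: (@le_lt_trans _ _ (n%:R * (S + q%:R * (M%:R)^-1))).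
  by apply: ler_wpM2l => //; rewrite ler0n.
apply/RltP; rewrite -!INRE -RinvE.
change (INR n * (S + INR q * / INR M) < INR q - INR n - 1)%coqR.
by rewrite /g in HMg; Lra.lra.
Qed.

Section Bridge.
Variables (n q : nat) (a : nat -> nat -> Cplx) (m : Defs.mult).

Definition cvec (x : vec) : 'I_n.+1 -> CC := fun j => x j.

Lemma lform_big i (x : vec) : lform n a i x = \sum_(j < n.+1) (a i j : CC) * (x j : CC).
Proof. by rewrite /lform Csum_big. Qed.

Lemma orbifold_orbc M F : orbifold_morphism n q a m F ->
  orbc (coef_mx n q a) (fun i : 'I_q => finite_mult m M i) 1%coqR (fun j z => F z j).
Proof.
move=> [h1 [h2 [_ h4]]].
have lE (i : 'I_q) : lin (coef_mx n q a) (fun j z => F z j) i = (fun z => lform n a i (F z)).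
  by apply: funext => z; rewrite lform_big; apply: eq_bigr => j _; rewrite mxE.
have E (w : Complex.C) : Cminus w (RtoC 0) = w by rewrite /Cminus Copp_0 Cplus_0_r.
split.
- by move=> j; apply/holo_hol; apply: h1; have := ltn_ord j; lia.
- move=> z /inD_Cmod /h2 [j [Hj Nj]]; have oj : (j < n.+1)%N by lia.
  by exists (Ordinal oj).
(* For an infinite multiplicity the form has no zero and the condition is vacuous. *)
- move=> i; rewrite lE /finite_mult; have := h4 i; case: (m i) => [k|] h z0; rewrite E => /inD_Cmod Hz Z; last first.
    by case: (h (elimT ssrnat.ltP (ltn_ord i)) z0 Hz).
  have [u [hu Hu]] := h (elimT ssrnat.ltP (ltn_ord i)) z0 Hz Z.
  exists u; split; first exact/holo_hol.
  by move=> z; rewrite E => /inD_Cmod /Hu ->; rewrite Defs_Cpow.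
Qed.

(** With [t] the pseudo-hyperbolic distance, [exp t <= 1 / (1 - t) <= (1 + t) / (1 - t)]. *)
Lemma poincare_ge (z w : Complex.C) : inD z -> inD w ->
  (Cmod (Cminus z w) / Cmod (Cminus (RtoC 1) (Cmult (Complex.Cconj w) z)) <= poincare z w)%coqR.
Proof.
move=> /inD_Cmod Hz /inD_Cmod Hw.
have zo : (Cmod (Complex.Copp z) < 1)%coqR by rewrite Cmod_opp.
rewrite /poincare !Cnorm_Cmod.
change (Cmod (Cminus z w) / Cmod (Cminus (RtoC 1) (Cmult (Complex.Cconj w) z)) <=
  ln ((1 + Cmod (Cminus z w) / Cmod (Cminus (RtoC 1) (Cmult (Complex.Cconj w) z))) /
      (1 - Cmod (Cminus z w) / Cmod (Cminus (RtoC 1) (Cmult (Complex.Cconj w) z)))))%coqR.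
have t1 := mob_lt _ _ zo Hw; have t0 := Cmod_ge_0 (mob (Complex.Copp z) w).
rewrite -(Cmod_mob_opp _ _ Hz Hw); move: (Cmod _) t0 t1 => t t0 t1.
rewrite -{1}(ln_exp t); apply: ln_le; first exact: exp_pos.
have e1 := exp_ineq1_le (- t); rewrite exp_Ropp in e1.
have p := exp_pos t; have ip : (0 < 1 - t)%coqR by Lra.lra.
have e2 : (exp t <= / (1 - t))%coqR.
  by rewrite -[exp t]Rinv_inv; apply: Rinv_le_contravar; Lra.lra.
have i0 := Rinv_0_lt_compat _ ip.
have : (1 * / (1 - t) <= (1 + t) / (1 - t))%coqR by apply: Rmult_le_compat_r; Lra.lra.
Lra.lra.
Qed.

Lemma delta_pseudo c : (0 <= c)%coqR -> pseudo_dist n q a m (fun x y => (c * delta (cvec x) (cvec y))%coqR).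
Proof.
move=> c0; split; first by move=> x y _ _; apply: Rmult_le_pos => //; apply/RleP/delta_ge0.
split; first by move=> x _; rewrite delta_xx Rmult_0_r.
split; first by move=> x y _ _; rewrite delta_sym.
split.
  move=> x y z _ _ _; rewrite -Rmult_plus_distr_l; apply: Rmult_le_compat_l => //.
  exact/RleP/delta_tri.
move=> x x' y _ _ [lam [l0 E]]; congr (_ * _)%coqR; apply: (@delta_scale _ _ _ _ (lam : CC)); first exact/eqP.
by move=> j; apply: E; have := ltn_ord j; lia.
Qed.

Lemma delta0_proj x y : nonzero_vec n x -> delta (cvec x) (cvec y) = 0 -> proj_eq n x y.
Proof.
move=> [j [Hj xj]]; have oj : (j < n.+1)%N by lia.
have Nj : cvec x (Ordinal oj) != 0 by apply/eqP.
move=> /(delta_eq0 Nj) [lam l0 E]; exists lam; split; first by move/eqP: l0.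
move=> i Hi; have oi : (i < n.+1)%N by lia.
exact: (E (Ordinal oi)).
Qed.

Lemma proj_conv_delta xs x : nonzero_vec n x -> proj_conv n xs x ->
  forall e, (0 < e)%coqR -> exists N, forall k, (N <= k)%coq_nat -> (delta (cvec (xs k)) (cvec x) <= e)%coqR.
Proof.
move=> [j0 [Hj0 xj0]] [lam Hlam] e e0; have oj : (j0 < n.+1)%N by lia.
set o := Ordinal oj.
have p0 : (0 < cmod (cvec x o))%coqR by apply/Cmod_gt_0.
pose B := (1 + \sum_j cmod (cvec x j))%R.
have B0 : 0 < B by rewrite /B ltr_wpDr ?ltr01 // sumr_ge0 // => j _; apply: cmod_ge0.
have hp : 0 < cmod (cvec x o) / 2 by rewrite divr_gt0 //; apply/RltP.
have [K /RleP K00 HK] := @delta_lip n ((cmod (cvec x o) / 2) ^+ 2) B (exprn_gt0 _ hp) B0.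
have K0 : (0 <= K)%coqR by exact: K00.
pose eta := Rmin (Rmin 1 (cmod (cvec x o) / 2)%R) (e / (K + 1))%coqR.
have eta0 : (0 < eta)%coqR.
  apply: Rmin_pos; first by apply: Rmin_pos; [Lra.lra|apply/RltP].
  by apply: Rmult_lt_0_compat => //; apply: Rinv_0_lt_compat; Lra.lra.
have eta1 : (eta <= 1)%coqR by apply: Rle_trans (Rmin_l _ _) _; apply: Rmin_l.
have eta2 : (eta <= (cmod (cvec x o) / 2)%R)%coqR by apply: Rle_trans (Rmin_l _ _) _; apply: Rmin_r.
have eta3 : (eta <= e / (K + 1))%coqR by apply: Rmin_r.
clearbody eta.
have exN (j : 'I_n.+1) : exists N, forall k, (k >= N)%coq_nat -> (Cnorm (Csub (Cmul (lam k) (xs k j)) (x j)) < eta)%coqR.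
  by apply: Hlam => //; have := ltn_ord j; lia.
have [N HN] := boolp.choice exN.
exists (\max_j N j)%N => k Hk.
pose y (j : 'I_n.+1) : CC := (lam k : CC) * cvec (xs k) j.
have Hy j : cmod (y j - cvec x j) <= eta.
  apply/RleP/Rlt_le; have := HN j k; rewrite Cnorm_Cmod; apply.
  by apply/ssrnat.leP; apply: (leq_trans _ (introT ssrnat.leP Hk)); apply: leq_bigmax.
have bx : (cmod (cvec x o) / 2) ^+ 2 <= nrm2 (cvec x).
  apply: le_trans (nrm2_ge _ o); rewrite ler_sqr ?nnegrE ?cmod_ge0 ?(ltW hp) //.
  by rewrite ler_pdivrMr ?ltr0n // mulr_natr mulr2n lerDl cmod_ge0.
have yo : cmod (cvec x o) / 2 <= cmod (y o).
  have := cmodD (y o) (cvec x o - y o); rewrite addrC subrK -[cmod (cvec x o - y o)]cmodN opprB.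
  have h1 := Hy o; have h2 : eta <= cmod (cvec x o) / 2 by apply/RleP.
  have h3 : cmod (cvec x o) = cmod (cvec x o) / 2 + cmod (cvec x o) / 2 by rewrite -splitr.
  rewrite {1}h3 => h4; rewrite -(lerD2r (cmod (cvec x o) / 2)); apply: le_trans h4 _.
  by rewrite lerD2l; apply: le_trans h1 h2.
(* Convergence in [proj_conv] allows zero scalars a priori; for large [k] they are excluded by the
   lower bound on the component [o]. *)
have l0 : (lam k : CC) != 0.
  apply/eqP => Z; move: yo; rewrite /y Z mul0r cmod0 leNgt hp //.
rewrite -(@delta_scale _ _ y _ (lam k : CC) l0) //.
have e0' : 0 <= eta by apply/RleP/Rlt_le.
have xB j : cmod (cvec x j) <= B - 1.
  by rewrite /B addrAC subrr add0r (bigD1 j) //= lerDl sumr_ge0 // => i _; apply: cmod_ge0.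
apply: (Rle_trans _ (K * eta)%coqR).
  apply/RleP; apply: HK => //; first last.
  - apply: le_trans (nrm2_ge _ o); rewrite ler_sqr ?nnegrE ?cmod_ge0 ?(ltW hp) //.
  - by move=> j; apply: le_trans (xB j) _; rewrite lerBlDr lerDl ler01.
  - move=> j; have -> : y j = (y j - cvec x j) + cvec x j by rewrite subrK.
    apply: le_trans (cmodD _ _) _; rewrite -[B](subrK 1) addrC.
    by apply: lerD => //; apply: le_trans (Hy j) _; apply/RleP.
have := Rmult_le_compat_r (K + 1)%coqR _ _ ltac:(Lra.lra) eta3.
have -> : (e / (K + 1) * (K + 1) = e)%coqR by field; Lra.lra.
Lra.lra.
Qed.
End Bridge.

(** * Hyperbolicity and hyperbolic imbedding *)

Section Conclusion.
Variables (n q : nat) (a : nat -> nat -> Cplx) (m : Defs.mult).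
Hypothesis n1 : (1 <= n)%coq_nat.
Hypothesis nq : (2 * n < q)%coq_nat.
Hypothesis gp : general_position n q a.
Hypothesis m1 : forall i k, (i < q)%coq_nat -> m i = Some k -> (1 <= k)%coq_nat.
Hypothesis deg : (degDelta q m > INR q - INR q / INR n + 1 + 1 / INR n)%coqR.

Lemma delta_admissible : exists c, (0 < c)%coqR /\ admissible n q a m (fun x y => (c * delta (cvec (n:=n) x) (cvec y))%coqR).
Proof.
have [M [M0 Hs]] := degree_bound n1 deg.
have [||K [K0 HK]] := @delta_disc n q (coef_mx n q a) (fun i => finite_mult m M i) _ (general_position_rank gp) _ Hs.
- by move: nq; lia.
- move=> i; rewrite /finite_mult; case E : (m i) => [k|//].
  by apply/ssrnat.ltP/(m1 _ E); apply/ssrnat.ltP/ltn_ord.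
exists (/ K)%coqR; split; first exact: Rinv_0_lt_compat.
split; first exact/delta_pseudo/Rlt_le/Rinv_0_lt_compat.
move=> F HF z w Hz Hw; apply: Rle_trans (poincare_ge Hz Hw).
have := HK _ (orbifold_orbc M HF) z w (proj1 (inD_Cmod z) Hz) (proj1 (inD_Cmod w) Hw).
move=> /(Rmult_le_compat_l (/ K) _ _ (Rlt_le _ _ (Rinv_0_lt_compat _ K0))).
by rewrite -Rmult_assoc Rinv_l ?Rmult_1_l //; Lra.lra.
Qed.

Lemma orbifold_hyperbolically_imbedded : exists d : vec -> vec -> R, is_orbifold_kobayashi n q a m d /\
  hyperbolic_orb n q a m d /\ hyperbolically_imbedded n q a m d.
Proof.
have [c [c0 Ac]] := delta_admissible.
have nq' : (n < q)%coq_nat by move: nq; lia.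
have [d Kd] := kobayashi_exists _ _ _ _ nq' gp _ Ac; exists d; split=> //.
(* Maximality of [d] among the admissible pseudo-distances; both conclusions rest on this lower
   bound. *)
have low x y : in_S n q a m x -> in_S n q a m y -> (c * delta (cvec (n:=n) x) (cvec y) <= d x y)%coqR.
  by move=> Sx Sy; apply: (proj2 Kd _ Ac).
split.
  move=> x y Sx Sy N; apply: Rlt_le_trans (low x y Sx Sy); apply: Rmult_lt_0_compat => //.
  apply/RltP; rewrite lt_def delta_ge0 andbT; apply/eqP => Z; apply: N; apply: delta0_proj Z.
  by case: Sx.
move=> ps qs p p' Sp Sq Np Np' Cp Cq lim; apply: delta0_proj => //.
have D0 : (0 <= delta (cvec (n:=n) p) (cvec p'))%coqR by apply/RleP/delta_ge0.
apply: Rle_antisym => //; apply: le_epsilon => e e0; rewrite Rplus_0_l.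
have e3 : (0 < e / 3)%coqR by Lra.lra.
have [N1 H1] := proj_conv_delta Np Cp e3; have [N2 H2] := proj_conv_delta Np' Cq e3.
have [N3 H3] := lim (c * (e / 3))%coqR (Rmult_lt_0_compat _ _ c0 e3).
pose k := (N1 + N2 + N3)%N.
have h1 := H1 k ltac:(rewrite /k; lia); have h2 := H2 k ltac:(rewrite /k; lia).
have h3 : (delta (cvec (n:=n) (ps k)) (cvec (qs k)) <= e / 3)%coqR.
  apply: (Rmult_le_reg_l c) => //; apply: (Rle_trans _ _ _ (low _ _ (Sp k) (Sq k))).
  have := H3 k ltac:(rewrite /k; lia); rewrite /Rdist Rminus_0_r => H.
  by have := Rle_abs (d (ps k) (qs k)); Lra.lra.
have /RleP t1 := delta_tri (cvec (n:=n) p) (cvec (ps k)) (cvec p').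
have /RleP t2 := delta_tri (cvec (n:=n) (ps k)) (cvec (qs k)) (cvec p').
rewrite (delta_sym (cvec p) (cvec (ps k))) in t1.
apply: (Rle_trans _ _ _ t1); apply: (Rle_trans _ (e / 3 + (e / 3 + e / 3))%coqR); last Lra.lra.
apply: Rplus_le_compat => //; apply: (Rle_trans _ _ _ t2); exact: Rplus_le_compat.
Qed.
End Conclusion.
End Kobayashi.

Theorem theorem5p1 (n q : nat) (a : nat -> nat -> Cplx) (m : mult) :
  (1 <= n)%nat ->
  (2 * n < q)%nat ->
  general_position n q a ->
  (forall i k, (i < q)%nat -> m i = Some k -> (1 <= k)%nat) ->
  degDelta q m > INR q - INR q / INR n + 1 + 1 / INR n ->
  exists d : vec -> vec -> R,
    is_orbifold_kobayashi n q a m d /\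
    hyperbolic_orb n q a m d /\
    hyperbolically_imbedded n q a m d.
Proof. exact (@Kobayashi.orbifold_hyperbolically_imbedded n q a m). Qed.
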